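(* Let $H$ be a generalised Hénon map. Then for every $c>0$ $${\rm Aut}_1(U^+)={\rm Aut}_1(\Omega_c'),$$ in the sense that every element of ${\rm Aut}_1(U^+)$ maps $\Omega_c'$ onto itself and restricts to an element of ${\rm Aut}_1(\Omega_c')$, and every element of ${\rm Aut}_1(\Omega_c')$ extends to an element of ${\rm Aut}_1(U^+)$.
   Context: A generalised Hénon map is $H=H_m\circ\cdots\circ H_1$, $m\ge1$, with $H_i(x,y)=(y,p_i(y)-a_ix)$, $p_i$ a complex polynomial in one variable of degree $d_i\ge2$ and $a_i\ne0$. Put $d=d_m\cdots d_1$. $K^+=\{z\in\mathbb{C}^2:(H^n(z))_{n\ge0}\text{ is bounded}\}$, $U^+=\mathbb{C}^2\setminus K^+$, and $G_H^+(z)=\lim_{n\to\infty}d^{-n}\log^+\|H^n(z)\|$. For $c>0$, $\Omega_c=\{z\in\mathbb{C}^2:G_H^+(z)<c\}$ and $\Omega_c'=\Omega_c\setminus K^+$. For $X=U^+$ or $X=\Omega_c'$, ${\rm Aut}_1(X)$ is the group of holomorphic automorphisms of $X$ that induce the identity map on the fundamental group $\pi_1(X)$ (this group is abelian, isomorphic to $\mathbb{Z}[1/d]$, so the induced map does not depend on base points). *)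

(* Defs.v *)
From HB Require Import structures.
From mathcomp Require Import all_boot all_order all_algebra.
From mathcomp Require Import complex.
From mathcomp Require Import all_classical all_reals all_analysis.

Set Implicit Arguments.
Unset Strict Implicit.
Unset Printing Implicit Defensive.

Import Order.TTheory GRing.Theory Num.Theory.
Import numFieldNormedType.Exports.

Local Open Scope classical_set_scope.
Local Open Scope ring_scope.

(* The complex numbers R[i] carry no canonical topology; packing them as a
   numClosedFieldType gives access to the normed space structure that
   MathComp-Analysis puts on every such field. *)
Definition Cx (R : realType) : numClosedFieldType := complex R.

(* Its norm is the sup norm of the moduli of the coordinates. *)
Definition Cx2 (R : realType) : normedModType (Cx R) := (Cx R * Cx R)%type.

Section Henon.
Context {R : realType}.

Definition henon_factor (h : {poly Cx R} * Cx R) (z : Cx2 R) : Cx2 R :=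
  (z.2, h.1.[z.2] - h.2 * z.1).

(* The list [:: (p_1, a_1); ...; (p_m, a_m)] encodes H_m \o ... \o H_1. *)
Definition henon (hs : seq ({poly Cx R} * Cx R)) (z : Cx2 R) : Cx2 R :=
  foldl (fun w h => henon_factor h w) z hs.

(* deg p_i >= 2 reads 2 < size p_i. *)
Definition henon_data (hs : seq ({poly Cx R} * Cx R)) : bool :=
  (0 < size hs)%N &&
  all (fun h : {poly Cx R} * Cx R => (2 < size h.1)%N && (h.2 != 0)) hs.

Definition henon_degree (hs : seq ({poly Cx R} * Cx R)) : nat :=
  (\prod_(h <- hs) (size h.1).-1)%N.

Definition Kplus (hs : seq ({poly Cx R} * Cx R)) : set (Cx2 R) :=
  [set z | bounded_fun (fun n : nat => iter n (henon hs) z)].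

Definition Uplus (hs : seq ({poly Cx R} * Cx R)) : set (Cx2 R) :=
  ~` Kplus hs.

Definition norm2 (z : Cx2 R) : R := complex.Re `|z|.

Definition lnplus (t : R) : R := Num.max 0 (ln t).

Definition Gplus (hs : seq ({poly Cx R} * Cx R)) (z : Cx2 R) : R :=
  lim ((fun n : nat => ((henon_degree hs)%:R ^+ n)^-1
                       * lnplus (norm2 (iter n (henon hs) z))) @ \oo).

Definition Omega (hs : seq ({poly Cx R} * Cx R)) (c : R) : set (Cx2 R) :=
  [set z | Gplus hs z < c].

Definition Omega' (hs : seq ({poly Cx R} * Cx R)) (c : R) : set (Cx2 R) :=
  Omega hs c `\` Kplus hs.

End Henon.

Section FundamentalGroup.
Context {R : realType} {T : topologicalType}.
Implicit Types (X : set T) (g : R -> T).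

(* Paths are total functions on R of which only the values on [0, 1] matter. *)
Definition is_path X (x y : T) g : Prop :=
  [/\ {within `[0, 1], continuous g},
      forall t, 0 <= t <= 1 -> X (g t), g 0 = x & g 1 = y].

(* Homotopy in X relative to the endpoints. *)
Definition path_homotopic X g0 g1 : Prop :=
  exists h : R * R -> T,
    [/\ {within `[0, 1] `*` `[0, 1], continuous h},
        forall s t, 0 <= s <= 1 -> 0 <= t <= 1 -> X (h (s, t)),
        forall t, 0 <= t <= 1 -> h (0, t) = g0 t /\ h (1, t) = g1 t
      & forall s, 0 <= s <= 1 -> h (s, 0) = g0 0 /\ h (s, 1) = g0 1].

Definition path_class X g : set (R -> T) :=
  [set g' | path_homotopic X g g'].

Definition path_rev g : R -> T := fun t => g (1 - t).

Definition path_cat g g' : R -> T :=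
  fun t => if t <= 2^-1 then g (2 * t) else g' (2 * t - 1).

(* The elements of pi_1(X, x): homotopy classes of loops based at x. *)
Definition pi1 X (x : T) : set (set (R -> T)) :=
  [set path_class X g | g in is_path X x x].

(* The induced map pi_1(X, x) -> pi_1(X, f x). *)
Definition pi1_map X (f : T -> T) (a : set (R -> T)) : set (R -> T) :=
  \bigcup_(g in a) path_class X (f \o g).

(* The change of base point pi_1(X, y) -> pi_1(X, x) along a path d from x
   to y. *)
Definition pi1_transport X (d : R -> T) (a : set (R -> T)) : set (R -> T) :=
  \bigcup_(g in a) path_class X (path_cat d (path_cat g (path_rev d))).

(* For X path connected with abelian fundamental group, the groups pi_1(X, x)
   and pi_1(X, f x) are identified by transport along any path. *)
Definition acts_trivially_on_pi1 X (f : T -> T) : Prop :=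
  forall (x : T) (d : R -> T) (a : set (R -> T)),
    is_path X x (f x) d -> pi1 X x a -> pi1_transport X d (pi1_map X f a) = a.

End FundamentalGroup.

Section Automorphisms.
Context {R : realType}.
Implicit Types (X : set (Cx2 R)) (f : Cx2 R -> Cx2 R).

(* 'differentiable' is Frechet differentiability over the scalars Cx R, i.e.
   complex differentiability. Intended for open X, where it depends only on
   the restriction of f to X. *)
Definition holomorphic_on X f : Prop := forall z, X z -> differentiable f z.

(* A holomorphic automorphism of X is represented by any total function
   extending it; the values outside X are irrelevant. *)
Definition holo_aut X f : Prop :=
  [/\ set_bij X X f, holomorphic_on X f
    & exists g, [/\ holomorphic_on X g, {homo g : z / X z}
                  & forall z, X z -> g (f z) = z]].

Definition Aut1 X f : Prop := holo_aut X f /\ acts_trivially_on_pi1 (R := R) X f.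

End Automorphisms.

(* Main.v *)
(* Near infinity H is conjugate to F(z, zeta) = (alpha z + Q(zeta), zeta^d) on
   {|zeta| > rho, |z| < |zeta|^2}, with Q(zeta) ~ q zeta^(d+e), 0 < e < d: zeta
   is the Boettcher coordinate and z a coordinate on the leaves zeta = const.
   Hence U+ is covered by {Re s > 0} x C with deck group 2 pi i Z[1/d] acting on
   s, G = Re s, and every leaf carries an affine structure, so that C acts on
   U+ by translations T_b along the leaves.
   Let f be an automorphism of U+ or of Omega'_c acting trivially on pi_1. By
   Liouville f maps leaves to leaves, and since f commutes with the deck group
   it acts on s by a translation s + kappa; Re kappa = 0 as G takes arbitrarily
   small values, so f preserves G. On leaves f is affine with a factor A, and
   comparing f at s and at s + 2 pi i / d^(l+1) gives
   exp((d+e) d^l kappa) -> A. Being the orbit of a point of the unit circle under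
   u -> u^d, this sequence is eventually constant, so kappa is a rational multiple
   of 2 pi i. If kappa lies in 2 pi i Z[1/d] then A = 1 and f = T_b.
   In general (d^k - 1) kappa lies in 2 pi i Z[1/d] for some k >= 1, so
   H^k f H^-k = f T_b on Omega'_c. Solved for f, this relation extends f from
   {G < c} to {G < d^k c}, and so, inductively, to U+. *)
Require Import Defs.
From HB Require Import structures.
From mathcomp Require Import all_boot all_order all_algebra.
From mathcomp Require Import complex ring lra.
From mathcomp Require Import all_classical all_reals all_analysis.
Import Order.TTheory GRing.Theory Num.Theory.
Import numFieldNormedType.Exports.

Set Implicit Arguments.
Unset Strict Implicit.
Unset Printing Implicit Defensive.

Local Open Scope classical_set_scope.
Local Open Scope ring_scope.
Local Notation Re := complex.Re.
Local Notation Im := complex.Im.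

(** * One complex variable *)

Section Modulus.
Context {R : realType}.
Local Notation C := (Cx R).

(** The conjugation of H to its normal form holds on |z| < |zeta|^2, a region that translations do
    not preserve. Therefore points are read at a level N, through the chart coordinates of H^N p,
    the inverse chart is completed to all |zeta| > rho, and the logarithm s of the Boettcher
    coordinate is a relation rather than a map on a covering space. Trivial action on pi_1 is used
    in the form that f preserves the increment of s along loops. As Z[1/d] is dense in R, this fixes
    the derivative of s along vertical segments and produces kappa. The limit of exp((d+e) d^l
    kappa) arises as follows. The points over s and s + 2 pi i/d^(l+1) lie on one leaf, and their
    displacement, measured at level l+1, is dominated by its last term q (omega - 1) zeta_l^(d+e),
    where zeta_l = exp(d^l s) and omega = exp(2 pi i (d+e)/d) is not 1 because 0 < e < d. The map f
    multiplies the displacement by A up to an error alpha^(l+1) O(1), while passing from s to s +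
    kappa multiplies zeta_l^(d+e) by exp((d+e) d^l kappa). *)

Definition rc (x : R) : C := Complex x 0.
Definition mkc (x y : R) : C := Complex x y.

Lemma cx_ind (P : C -> Prop) : (forall x y, P (mkc x y)) -> forall z, P z.
Proof. by move=> H z; exact: (match z as z' return P z' with Complex x y => H x y end). Qed.

(* The norm of a normed module over C is an element of C; this is its real value. *)
Definition nrm {V : normedModType C} (v : V) : R := Re `|v|.

Lemma rc_le x y : (rc x <= rc y) = (x <= y).
Proof. exact: lecR. Qed.

Lemma rc_lt x y : (rc x < rc y) = (x < y).
Proof. exact: ltcR. Qed.

Lemma rcM x y : rc (x * y) = rc x * rc y.
Proof. exact: (rmorphM (real_complex R)). Qed.

Lemma rcD x y : rc (x + y) = rc x + rc y.
Proof. exact: (rmorphD (real_complex R)). Qed.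

Lemma rcN x : rc (- x) = - rc x.
Proof. exact: (rmorphN (real_complex R)). Qed.

Lemma rcB x y : rc (x - y) = rc x - rc y.
Proof. exact: (rmorphB (real_complex R)). Qed.

Lemma rcV x : rc x^-1 = (rc x)^-1.
Proof. exact: (fmorphV (real_complex R)). Qed.

Lemma rcX x n : rc (x ^+ n) = rc x ^+ n.
Proof. exact: (rmorphXn (real_complex R)). Qed.

Lemma rc_nat n : rc n%:R = n%:R.
Proof. exact: (rmorph_nat (real_complex R)). Qed.

Lemma rc_int (k : int) : rc k%:~R = k%:~R.
Proof. exact: (rmorph_int (real_complex R)). Qed.

Lemma rc_inj : injective rc. Proof. by move=> x y []. Qed.
Lemma rc0 : rc 0 = 0. Proof. by []. Qed.
Lemma rc1 : rc 1 = 1. Proof. by []. Qed.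

Lemma rc_eq0 x : (rc x == 0) = (x == 0).
Proof. by rewrite eq_complex /= eqxx andbT. Qed.

Lemma rc_gt0E (e : C) : 0 < e -> exists2 x : R, 0 < x & e = rc x.
Proof.
move: e; apply: cx_ind => x y; rewrite ltcE => /andP[/eqP y0 x0].
by exists x; rewrite ?[y]y0.
Qed.

Section Normed.
Context {V : normedModType C}.
Implicit Types (v w : V).

Lemma nrmE v : `|v| = rc (nrm v).
Proof.
have := normr_ge0 v; rewrite lecE => /andP[/eqP/= H _].
by rewrite /nrm; move: `|v| H; apply: cx_ind => a b /= ->.
Qed.

Lemma nrm_ge0 v : 0 <= nrm v.
Proof. by rewrite -rc_le -nrmE; exact: normr_ge0. Qed.

Lemma nrm0 : nrm (0 : V) = 0.
Proof. by rewrite /nrm normr0. Qed.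

Lemma nrm_eq0 v : (nrm v == 0) = (v == 0).
Proof. by rewrite -rc_eq0 -nrmE normr_eq0. Qed.

Lemma nrm_gt0 v : (0 < nrm v) = (v != 0).
Proof. by rewrite lt_def nrm_ge0 andbT nrm_eq0. Qed.

Lemma nrmD v w : nrm (v + w) <= nrm v + nrm w.
Proof. by rewrite -rc_le rcD -!nrmE; exact: ler_normD. Qed.

Lemma nrmN v : nrm (- v) = nrm v.
Proof. by rewrite /nrm normrN. Qed.

Lemma nrmBC v w : nrm (v - w) = nrm (w - v).
Proof. by rewrite -nrmN opprB. Qed.

Lemma nrmB v w : nrm (v - w) <= nrm v + nrm w.
Proof. by rewrite -(nrmN w) nrmD. Qed.

Lemma nrm_triangle u v w : nrm (v - w) <= nrm (v - u) + nrm (u - w).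
Proof. by rewrite (le_trans _ (nrmD _ _)) // addrA subrK. Qed.

Lemma nrm_subD v w : nrm v <= nrm (v - w) + nrm w.
Proof. by have := nrmD (v - w) w; rewrite subrK. Qed.

Lemma nbhs_nrmP v (P : set V) :
  nbhs v P <-> exists2 e : R, 0 < e & forall w, nrm (w - v) < e -> P w.
Proof.
rewrite nbhs_ballP; split.
  case=> e /= /rc_gt0E[x x0 ->] H; exists x => // w wx; apply: H.
  by rewrite -ball_normE /ball_ /= distrC nrmE rc_lt.
case=> e e0 H; exists (rc e) => /=; first by rewrite -rc0 rc_lt.
by move=> w; rewrite -ball_normE /ball_ /= distrC nrmE rc_lt; exact: H.
Qed.

Lemma near_nrm v (e : R) : 0 < e -> \forall w \near v, nrm (w - v) < e.
Proof. by move=> e0; apply/nbhs_nrmP; exists e. Qed.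

Lemma cvg_nrmP {T} (F : set_system T) (FF : Filter F) (f : T -> V) (l : V) :
  f @ F --> l <-> forall e : R, 0 < e -> \forall x \near F, nrm (f x - l) < e.
Proof.
split=> [fl e e0|H].
  exact: (fl _ (near_nrm l e0)).
move=> P /nbhs_nrmP[e e0 eP].
by apply: filterS (H e e0) => x /eP.
Qed.

End Normed.

Lemma nrmZ {V : normedModType C} (a : C) (v : V) : nrm (a *: v) = nrm a * nrm v.
Proof. by apply: rc_inj; rewrite rcM -!nrmE normrZ. Qed.

Lemma nrmM (a b : C) : nrm (a * b) = nrm a * nrm b.
Proof. exact: (@nrmZ C). Qed.

Lemma nrm1 : nrm (1 : C) = 1.
Proof. by rewrite /nrm normr1. Qed.

Lemma nrmX (a : C) n : nrm (a ^+ n) = nrm a ^+ n.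
Proof. by apply: rc_inj; rewrite rcX -!nrmE normrX. Qed.

Lemma nrmV (a : C) : nrm (a^-1) = (nrm a)^-1.
Proof. by apply: rc_inj; rewrite rcV -!nrmE normfV. Qed.

Lemma nrm_rc x : nrm (rc x) = `|x|.
Proof. by rewrite /nrm normc_def /= expr0n /= addr0 sqrtr_sqr. Qed.

Lemma nrm_nat n : nrm (n%:R : C) = n%:R.
Proof. by rewrite -rc_nat nrm_rc normr_nat. Qed.

Lemma nrm_pair {V W : normedModType C} (v : V) (w : W) :
  nrm ((v, w) : V * W) = Num.max (nrm v) (nrm w).
Proof.
rewrite /nrm prod_normE /= [`|v|]nrmE [`|w|]nrmE.
by rewrite /Order.max /= rc_lt; case: ifP.
Qed.

Lemma nrm_fst {V W : normedModType C} (p : V * W) : nrm p.1 <= nrm p.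
Proof. by case: p => v w; rewrite nrm_pair le_max lexx. Qed.

Lemma nrm_snd {V W : normedModType C} (p : V * W) : nrm p.2 <= nrm p.
Proof. by case: p => v w; rewrite nrm_pair le_max lexx orbT. Qed.

Lemma nrm_pair_lt {V W : normedModType C} (p : V * W) e :
  nrm p.1 < e -> nrm p.2 < e -> nrm p < e.
Proof. by case: p => v w /= H1 H2; rewrite nrm_pair gt_max H1. Qed.

Lemma nrm_pair_le {V W : normedModType C} (p : V * W) e :
  nrm p.1 <= e -> nrm p.2 <= e -> nrm p <= e.
Proof. by case: p => v w /= H1 H2; rewrite nrm_pair ge_max H1. Qed.

Lemma nrm_def (z : C) : nrm z = Num.sqrt (Re z ^+ 2 + Im z ^+ 2).
Proof. by rewrite /nrm normc_def. Qed.

Lemma nrm_sqr (z : C) : nrm z ^+ 2 = Re z ^+ 2 + Im z ^+ 2.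
Proof. by rewrite nrm_def sqr_sqrtr // addr_ge0 ?sqr_ge0. Qed.

Lemma Re_le_nrm (z : C) : `|Re z| <= nrm z.
Proof. by rewrite nrm_def -sqrtr_sqr ler_wsqrtr // lerDl sqr_ge0. Qed.

Lemma Im_le_nrm (z : C) : `|Im z| <= nrm z.
Proof. by rewrite nrm_def -sqrtr_sqr ler_wsqrtr // lerDr sqr_ge0. Qed.

Lemma mkcE (x y : R) : mkc x y = rc x + 'i%C * rc y.
Proof. exact: complexE. Qed.

Lemma nrm_i : nrm ('i%C : C) = 1.
Proof. by rewrite nrm_def /= expr0n expr1n add0r sqrtr1. Qed.

Lemma nrm_le_ReIm (z : C) : nrm z <= `|Re z| + `|Im z|.
Proof.
move: z; apply: cx_ind => x y; rewrite [in leLHS]mkcE (le_trans (nrmD _ _)) //.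
by rewrite nrmM nrm_i mul1r !nrm_rc.
Qed.

Lemma ReD (z w : C) : Re (z + w) = Re z + Re w. Proof. by move: z w; apply: cx_ind => a b; apply: cx_ind. Qed.
Lemma ImD (z w : C) : Im (z + w) = Im z + Im w. Proof. by move: z w; apply: cx_ind => a b; apply: cx_ind. Qed.
Lemma ReN (z : C) : Re (- z) = - Re z. Proof. by move: z; apply: cx_ind. Qed.
Lemma ReB (z w : C) : Re (z - w) = Re z - Re w. Proof. by move: z w; apply: cx_ind => a b; apply: cx_ind. Qed.
Lemma ImB (z w : C) : Im (z - w) = Im z - Im w. Proof. by move: z w; apply: cx_ind => a b; apply: cx_ind. Qed.
Lemma ReM (z w : C) : Re (z * w) = Re z * Re w - Im z * Im w.
Proof. by move: z w; apply: cx_ind => a b; apply: cx_ind. Qed.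
Lemma ImM (z w : C) : Im (z * w) = Re z * Im w + Im z * Re w.
Proof. by move: z w; apply: cx_ind => a b; apply: cx_ind. Qed.

Lemma cx_ext (z w : C) : Re z = Re w -> Im z = Im w -> z = w.
Proof. by move: z w; apply: cx_ind => a b; apply: cx_ind => c d /= -> ->. Qed.

Lemma continuous_nrm_real {V : normedModType C} (g : V -> R) (v : V) :
  (forall e, 0 < e -> exists2 d, 0 < d &
     forall w, nrm (w - v) < d -> `|g w - g v| < e) -> {for v, continuous g}.
Proof.
move=> H; apply: (@cvgrPdist_lt R _ V (nbhs v) _ g (g v)).2 => e e0.
have [d d0 hd] := H e e0; apply: filterS (near_nrm v d0) => w.
by rewrite distrC; exact: hd.
Qed.

Lemma continuous_nrm {V W : normedModType C} (g : V -> W) (v : V) :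
  (forall e : R, 0 < e -> exists2 d : R, 0 < d &
     forall w, nrm (w - v) < d -> nrm (g w - g v) < e) -> {for v, continuous g}.
Proof.
move=> H; apply: (@cvg_nrmP W V (nbhs v) _ g (g v)).2 => e e0.
by have [d d0 hd] := H e e0; apply: filterS (near_nrm v d0) => w; exact: hd.
Qed.

Lemma Re_continuous : continuous (@complex.Re R : C -> R).
Proof.
move=> z; apply: continuous_nrm_real => e e0; exists e => // w wz.
by rewrite -ReB (le_lt_trans (Re_le_nrm _)).
Qed.

Lemma Im_continuous : continuous (@complex.Im R : C -> R).
Proof.
move=> z; apply: continuous_nrm_real => e e0; exists e => // w wz.
by rewrite -ImB (le_lt_trans (Im_le_nrm _)).
Qed.

Lemma nrm_continuous {V : normedModType C} : continuous (nrm : V -> R).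
Proof.
move=> v; apply: continuous_nrm_real => e e0; exists e => // w wv; rewrite ltr_norml; apply/andP; split.
  by have := nrm_subD v w; rewrite (nrmBC v w); lra.
by have := nrm_subD w v; lra.
Qed.

Lemma cvg_ReIm {T} (F : set_system T) (FF : Filter F) (f : T -> C) (l : C) :
  Re (f x) @[x --> F] --> Re l -> Im (f x) @[x --> F] --> Im l -> f @ F --> l.
Proof.
move=> /cvgrPdist_lt H1 /cvgrPdist_lt H2; apply/cvg_nrmP => e e0.
have e2 : 0 < e / 2 by rewrite divr_gt0.
near=> x.
rewrite (le_lt_trans (nrm_le_ReIm _)) // ReB ImB distrC (distrC (Im _)).
by rewrite [e]splitr ltrD //; near: x; [exact: H1|exact: H2].
Unshelve. all: by end_near. Qed.

Lemma rc_continuous : continuous rc.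
Proof.
move=> x; apply: cvg_ReIm => /=; [exact: cvg_id|exact: cvg_cst].
Qed.

Lemma mkc_comp_continuous {T : topologicalType} (f g : T -> R) (x : T) :
  {for x, continuous f} -> {for x, continuous g} ->
  {for x, continuous (fun t => mkc (f t) (g t))}.
Proof.
by move=> H1 H2; apply: cvg_ReIm => /=; [exact: H1|exact: H2].
Qed.

Lemma mkc_continuous : continuous (fun p : R * R => mkc p.1 p.2).
Proof. by move=> x; apply: cvg_ReIm => /=; [exact: cvg_fst|exact: cvg_snd]. Qed.

Lemma Re_comp_continuous {T : topologicalType} (f : T -> C) (x : T) :
  {for x, continuous f} -> {for x, continuous (fun t => Re (f t))}.
Proof. by move=> H; exact: (cvg_comp _ _ H (@Re_continuous (f x))). Qed.

Lemma Im_comp_continuous {T : topologicalType} (f : T -> C) (x : T) :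
  {for x, continuous f} -> {for x, continuous (fun t => Im (f t))}.
Proof. by move=> H; exact: (cvg_comp _ _ H (@Im_continuous (f x))). Qed.

(** Composition with this retraction onto [a, b] turns functions continuous on the interval into
    globally continuous ones, so that subspace topologies can be avoided. *)
Definition clamp (a b x : R) := Num.max a (Num.min x b).

Lemma clamp_continuous a b : continuous (clamp a b).
Proof.
move=> x; apply/(@cvgrPdist_lt R R R (nbhs x)) => e e0.
apply/nbhs_ballP; exists e => // y; rewrite /ball /= => xy.
apply: le_lt_trans xy; rewrite /clamp /Order.max /Order.min.
case: (ltP x b) => xb; [case: (ltP a x) => ax|case: (ltP a b) => ax];
  (case: (ltP y b) => yb; [case: (ltP a y) => ay|case: (ltP a b) => ay]);
  have := ler_norm (x - y); have := ler_norm (- (x - y)); rewrite normrN;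
  by rewrite ler_norml => ? ?; apply/andP; split; lra.
Qed.

Lemma clamp_id a b x : a <= x <= b -> clamp a b x = x.
Proof. by move=> /andP[ax xb]; rewrite /clamp (min_idPl xb) (max_idPr ax). Qed.

Lemma clamp_in a b x : a <= b -> a <= clamp a b x <= b.
Proof. by move=> ab; rewrite /clamp le_max lexx /= ge_max ab ge_min lexx orbT. Qed.

Lemma cx_cauchy (u : nat -> C) :
  (forall e, 0 < e -> exists N, forall n m, (N <= n)%N -> (N <= m)%N ->
     nrm (u n - u m) < e) -> exists l : C, u n @[n --> \oo] --> l.
Proof.
move=> H.
have cv (g : C -> R) : (forall z w, g (z - w) = g z - g w) ->
    (forall z, `|g z| <= nrm z) -> cvgn (g \o u).
  move=> gB gle; apply: cauchy_cvg; apply: cauchy_exP => e e0.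
  have [N HN] := H e e0; exists (g (u N)); exists N => // n /= Nn.
  by rewrite -ball_normE /ball_ /= -gB (le_lt_trans (gle _)) // HN.
have /cvg_ex[l1 H1] := cv (@complex.Re R) ReB Re_le_nrm.
have /cvg_ex[l2 H2] := cv (@complex.Im R) ImB Im_le_nrm.
by exists (mkc l1 l2); apply: cvg_ReIm.
Qed.

End Modulus.

(* [lra] and [nra] fail or diverge on contexts containing equations, or local
   definitions, in complex types. *)
Ltac drop_complex :=
  repeat match goal with
  | H : @eq ?T _ _ |- _ =>
      lazymatch T with
      | Num.ClosedField.sort _ => clear H
      | NormedModule.sort _ => clear H
      | prod _ _ => clear H
      end
  | H := _ : ?T |- _ =>
      lazymatch T with
      | Num.ClosedField.sort _ => clearbody H
      | NormedModule.sort _ => clearbody H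
      | prod _ _ => clearbody H
      end
  end.
Ltac rlra := drop_complex; lra.
Ltac rnra := drop_complex; nra.

(** * Differentials and complex derivatives as epsilon-delta estimates *)

Section Differentials.
Context {R : realType}.
Local Notation C := (Cx R).

Section General.
Context {V W : normedModType C}.
Implicit Types (f : V -> W) (x : V).

Lemma diff_nrm f x : differentiable f x -> forall e : R, 0 < e ->
  exists2 d : R, 0 < d & forall h, nrm h < d ->
    nrm (f (x + h) - f x - 'd f x h) <= e * nrm h.
Proof.
move=> /diff_locallyP[_ H] e e0.
have /eqaddoP /(_ (rc e)) := H; rewrite -rc0 rc_lt => /(_ e0) /nbhs_nrmP[d d0 dH].
exists d => // h hd; have := dH h; rewrite subr0 => /(_ hd).
by rewrite [x + h]addrC -addrA -opprD !nrmE -rcM rc_le.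
Qed.

Lemma diff_nrmI f x (L : {linear V -> W}) (M : R) :
  (forall v, nrm (L v) <= M * nrm v) ->
  (forall e : R, 0 < e -> exists2 d : R, 0 < d & forall h, nrm h < d ->
    nrm (f (x + h) - f x - L h) <= e * nrm h) ->
  differentiable f x /\ 'd f x = L :> (V -> W).
Proof.
move=> LM H.
have Lc : continuous L.
  move=> v; apply/cvg_nrmP => e e0.
  have M1 : 0 < `|M| + 1 by have := normr_ge0 M; lra.
  apply: filterS (near_nrm v (divr_gt0 e0 M1)) => w wv.
  rewrite -linearB (le_lt_trans (LM _)) //.
  rewrite ltr_pdivlMr // in wv; apply: le_lt_trans wv.
  rewrite mulrC ler_wpM2l ?nrm_ge0 //.
  by have := ler_norm M; lra.
have Lo : f \o shift x = cst (f x) + L +o_ 0 id.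
  apply/eqaddoP => e /rc_gt0E[r r0 ->].
  have [d d0 dH] := H r r0; apply/nbhs_nrmP; exists d => // h; rewrite subr0 => hd.
  have := dH h hd; rewrite [x + h]addrC -addrA -opprD => H'.
  by rewrite !nrmE -rcM rc_le.
have dE := diff_unique Lc Lo; split => //.
by apply/diff_locallyP; rewrite dE.
Qed.

Lemma diff_continuous_nrm f x : differentiable f x -> f @ x --> f x.
Proof. exact: differentiable_continuous. Qed.

End General.

Section OneVariable.
Context {W : normedModType C}.
Implicit Types (f : C -> W) (z : C) (l : W).

Lemma is_derive_nrm f z l : is_derive z 1 f l -> forall e : R, 0 < e ->
  exists2 d : R, 0 < d & forall h, nrm h < d ->
    nrm (f (z + h) - f z - h *: l) <= e * nrm h.
Proof.
move=> [df <-] e e0; have df' := (derivable1_diffP f z).1 df.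
have [d d0 dH] := diff_nrm df' e0; exists d => // h hd.
by have := dH h hd; rewrite diff1E // derive1E.
Qed.

Lemma nrm_is_derive f z l : (forall e : R, 0 < e ->
  exists2 d : R, 0 < d & forall h, nrm h < d ->
    nrm (f (z + h) - f z - h *: l) <= e * nrm h) -> is_derive z 1 f l.
Proof.
move=> H; pose L (h : C) := h *: l.
have linL : linear L by move=> ? ? ?; rewrite /L scalerDl scalerA.
pose Lm := GRing.isLinear.Build _ _ _ _ _ linL.
pose LL : {linear _ -> _} := HB.pack L Lm.
have [|df dE] := @diff_nrmI _ _ f z LL (nrm l) _ H.
  by move=> v; rewrite /= /L nrmZ mulrC.
by apply: DeriveDef; [exact/derivable1_diffP|rewrite deriveE // dE /= /L scale1r].
Qed.

Lemma is_derive_diff f z l : is_derive z 1 f l -> differentiable f z.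
Proof. by move=> [/derivable1_diffP]. Qed.

Lemma diff_is_derive f z : differentiable f z -> is_derive z 1 f ('d f z 1).
Proof. by move=> df; split; [exact/derivable1_diffP|rewrite deriveE]. Qed.

Lemma is_derive_uniq f z l1 l2 : is_derive z 1 f l1 -> is_derive z 1 f l2 -> l1 = l2.
Proof. by case=> _ <- [_ <-]. Qed.

Lemma is_derive_near f g z l : (\forall w \near z, f w = g w) ->
  is_derive z 1 f l -> is_derive z 1 g l.
Proof.
move=> /nbhs_nrmP[d1 d10 fg] /is_derive_nrm H; apply: nrm_is_derive => e e0.
have [d d0 dH] := H e e0; exists (Num.min d d1); first by rewrite lt_min d0.
move=> h; rewrite lt_min => /andP[hd hd1].
rewrite -!fg ?subrr ?nrm0 //; first exact: dH.
by rewrite addrC addKr.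
Qed.

End OneVariable.

Lemma is_derive_comp {V W : normedModType C} (f : V -> W) (g : C -> V) z l :
  differentiable f (g z) -> is_derive z 1 g l ->
  is_derive z 1 (f \o g) ('d f (g z) l).
Proof.
move=> df dg; have dg' := is_derive_diff dg.
have dfg : differentiable (f \o g) z by exact: differentiable_comp.
split; first exact/derivable1_diffP.
rewrite deriveE // diff_comp //=; congr ('d f _ _).
by rewrite -deriveE //; case: dg.
Qed.

Lemma is_derive_compC {W : normedModType C} (f : C -> W) (g : C -> C) z l m :
  is_derive (g z) 1 f m -> is_derive z 1 g l -> is_derive z 1 (f \o g) (l *: m).
Proof.
move=> df dg; have := is_derive_comp (is_derive_diff df) dg.
rewrite (diff1E (is_derive_diff df)) => H.
by have <- : f^`()%classic (g z) = m by rewrite derive1E; case: df.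
Qed.

Definition lin2 (a b : C) (h : Cx2 R) : C := h.1 * a + h.2 * b.

Lemma lin2_is_linear a b : linear (lin2 a b).
Proof. by move=> k u v; rewrite /lin2 /= /GRing.scale /=; ring. Qed.

HB.instance Definition _ a b :=
  GRing.isLinear.Build C (Cx2 R) C _ (lin2 a b) (lin2_is_linear a b).

Lemma lin2_le a b h : nrm (lin2 a b h) <= (nrm a + nrm b) * nrm h.
Proof.
rewrite (le_trans (nrmD _ _)) // !nrmM mulrDl.
by rewrite lerD // mulrC ler_wpM2l ?nrm_ge0 ?nrm_fst ?nrm_snd.
Qed.

Lemma nrm_diff2 (f : Cx2 R -> C) (p : Cx2 R) a b : (forall e : R, 0 < e ->
  exists2 d : R, 0 < d & forall h : Cx2 R, nrm h < d ->
    nrm (f (p + h) - f p - lin2 a b h) <= e * nrm h) ->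
  differentiable f p /\ 'd f p = lin2 a b :> (_ -> _).
Proof. by move=> H; exact: (diff_nrmI (@lin2_le a b) H). Qed.

Lemma diff2E (f : Cx2 R -> C) (p h : Cx2 R) : differentiable f p ->
  'd f p h = lin2 ('d f p ((1, 0) : Cx2 R)) ('d f p ((0, 1) : Cx2 R)) h.
Proof.
move=> df; rewrite /lin2 -[_ * _]/(_ *: _) -[X in _ + X]/(_ *: _) -!linearZ -linearD.
by congr ('d f p _); case: h => a b; congr pair => /=; rewrite /GRing.scale /=; ring.
Qed.

End Differentials.

(** * The complex exponential and its logarithms *)

Section ComplexExp.
Context {R : realType}.
Local Notation C := (Cx R).

Lemma diff_near {V W : normedModType C} (f g : V -> W) (x : V) :
  (\forall y \near x, f y = g y) -> differentiable f x -> differentiable g x.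
Proof.
move=> /nbhs_nrmP[d1 d10 fg] df.
have [k k0 kE] := linear_lipschitz (diff_continuous df).
have [r r0 rE] := rc_gt0E k0.
have Lle v : nrm ('d f x v) <= r * nrm v by rewrite -rc_le rcM -!nrmE -rE kE.
have [|//] := @diff_nrmI _ _ _ g x ('d f x) r Lle.
move=> e e0; have [d d0 dH] := diff_nrm df e0.
exists (Num.min d d1); first by rewrite lt_min d0.
move=> h; rewrite lt_min => /andP[hd hd1].
rewrite -!fg ?subrr ?nrm0 //; first exact: dH.
by rewrite addrC addKr.
Qed.

Lemma is_derive_real (f : R -> R) (x l : R) : is_derive x 1 f l -> forall e : R, 0 < e ->
  exists2 d : R, 0 < d & forall h, `|h| < d ->
    `|f (x + h) - f x - h * l| <= e * `|h|.
Proof.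
move=> [/derivable_nbhsP/eqaddoP H <-] e e0.
have /nbhs_ballP[d /= d0 dH] := H e e0.
exists d => // h hd; have := dH h; rewrite -ball_normE /ball_ /= sub0r normrN.
move=> /(_ hd).
rewrite -[(_ - _ : R -> R) h]/(f (h * 1 + x) - (f x + h * 'D_1 f x)).
by rewrite mulr1 [h + x]addrC opprD addrA.
Qed.

Definition cexp (z : C) : C :=
  mkc (expR (Re z) * cos (Im z)) (expR (Re z) * sin (Im z)).

Lemma cexp0 : cexp 0 = 1.
Proof. by rewrite /cexp /= expR0 cos0 sin0 !mul1r. Qed.

Lemma cexpD z w : cexp (z + w) = cexp z * cexp w.
Proof.
by apply: cx_ext; rewrite ?ReM ?ImM /= ReD ImD expRD ?cosD ?sinD; ring.
Qed.

Lemma nrm_cexp z : nrm (cexp z) = expR (Re z).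
Proof.
rewrite nrm_def /= !exprMn -mulrDr cos2Dsin2 mulr1 sqrtr_sqr ger0_norm //.
Qed.

Lemma cexp_neq0 z : cexp z != 0.
Proof. by rewrite -nrm_eq0 nrm_cexp expR_eq0. Qed.

Lemma cexpN z : cexp (- z) = (cexp z)^-1.
Proof.
apply: (mulfI (cexp_neq0 z)); rewrite -cexpD subrr cexp0 divff //.
exact: cexp_neq0.
Qed.

Lemma cexpB z w : cexp (z - w) = cexp z / cexp w.
Proof. by rewrite cexpD cexpN. Qed.

Lemma cexpMn n z : cexp (n%:R * z) = cexp z ^+ n.
Proof.
elim: n => [|n IH]; first by rewrite mul0r cexp0.
by rewrite -natr1 mulrDl mul1r cexpD IH exprSr.
Qed.

Lemma cexp_2pi : cexp (mkc 0 (2 * pi)) = 1.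
Proof. by rewrite /cexp /= expR0 !mul1r mulr_natl cos2pi sin2pi. Qed.

Lemma cexp_2pi_int (k : int) : cexp (k%:~R * mkc 0 (2 * pi)) = 1.
Proof.
case: k => n.
  by rewrite -pmulrn cexpMn cexp_2pi expr1n.
by rewrite NegzE mulrNz mulNr cexpN -pmulrn cexpMn cexp_2pi expr1n invr1.
Qed.

(** The addition law transports this expansion at 0 to every point. It also shows that an increment
    h is comparable to exp h - 1, which is how logarithms are differentiated. *)
Lemma cexp_near0 (e : R) : 0 < e -> exists2 d : R, 0 < d &
  forall h : C, nrm h < d -> nrm (cexp h - 1 - h) <= e * nrm h.
Proof.
move=> e0.
pose e' := Num.min (e / 16) 1.
have e'0 : 0 < e' by rewrite lt_min divr_gt0 //= ltr01.
have e'1 : e' <= 1 by rewrite ge_min lexx orbT.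
have e'e : e' <= e / 16 by rewrite ge_min lexx.
have [d1 d10 H1] := is_derive_real (is_derive_expR (0 : R)) e'0.
have [d2 d20 H2] := is_derive_real (is_derive_cos (0 : R)) e'0.
have [d3 d30 H3] := is_derive_real (is_derive_sin (0 : R)) e'0.
exists (Num.min (Num.min d1 d2) (Num.min d3 (Num.min (e / 16) 1))).
  by rewrite !lt_min d10 d20 d30 divr_gt0 //= ltr01.
move=> h; rewrite !lt_min => /andP[/andP[hd1 hd2] /and3P[hd3 he h1]].
have := Re_le_nrm h; have := Im_le_nrm h.
set a := Re h; set b := Im h => bh ah.
have {}H1 := H1 _ (le_lt_trans ah hd1).
have {}H2 := H2 _ (le_lt_trans bh hd2).
have {}H3 := H3 _ (le_lt_trans bh hd3).
rewrite !add0r expR0 mulr1 in H1; rewrite !add0r cos0 sin0 oppr0 mulr0 subr0 in H2.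
rewrite !add0r cos0 sin0 subr0 mulr1 in H3.
have nh := nrm_ge0 h; have na := normr_ge0 a; have nb := normr_ge0 b.
have E1 : `|expR a - 1| <= 2 * `|a|.
  have -> : expR a - 1 = (expR a - 1 - a) + a by ring.
  by rewrite (le_trans (ler_normD _ _)) //; nra.
have E2 : `|expR a| <= 3.
  have -> : expR a = (expR a - 1) + 1 by ring.
  by rewrite (le_trans (ler_normD _ _)) // normr1; lra.
rewrite (le_trans (nrm_le_ReIm _)) //.
have -> : Re (cexp h - 1 - h) = (expR a - 1 - a) + expR a * (cos b - 1).
  by rewrite !ReB /= -/a -/b; ring.
have -> : Im (cexp h - 1 - h) = expR a * (sin b - b) + b * (expR a - 1).
  by rewrite !ImB /= -/a -/b subr0; ring.
apply: (@le_trans _ _ ((e' * `|a| + 3 * (e' * `|b|)) + (3 * (e' * `|b|) + `|b| * (2 * `|a|)))).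
  apply: lerD; rewrite (le_trans (ler_normD _ _)) // lerD ?normrM //.
  - by rewrite ler_pM.
  - by rewrite ler_pM.
  - by rewrite ler_pM.
have : e' * `|a| <= e / 16 * nrm h by rewrite ler_pM // ltW.
have : e' * `|b| <= e / 16 * nrm h by rewrite ler_pM // ltW.
have := mulr_ge0 (ltW e0) nh.
have : `|b| * `|a| <= nrm h * (e / 16) by rewrite ler_pM // (le_trans ah) // ltW.
by lra.
Qed.

Global Instance is_derive_cexp (z : C) : is_derive z 1 cexp (cexp z).
Proof.
apply: nrm_is_derive => e e0.
have e'0 : 0 < e / expR (Re z) by rewrite divr_gt0 // expR_gt0.
have [d d0 H] := cexp_near0 e'0; exists d => // h hd.
have -> : cexp (z + h) - cexp z - h *: cexp z = cexp z * (cexp h - 1 - h).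
  by rewrite cexpD /GRing.scale /=; ring.
rewrite nrmM nrm_cexp -ler_pdivlMl ?expR_gt0 // mulrA.
by rewrite [_^-1 * e]mulrC; exact: H.
Qed.

Lemma cexp_differentiable z : differentiable cexp z.
Proof. exact: is_derive_diff (is_derive_cexp z). Qed.

Lemma cexp_continuous : continuous cexp.
Proof. by move=> z; exact: differentiable_continuous (cexp_differentiable z). Qed.

Lemma cexp_surj (w : C) : w != 0 -> exists z, cexp z = w.
Proof.
move=> w0; have n0 : 0 < nrm w by rewrite nrm_gt0.
have n1 : nrm w != 0 by rewrite gt_eqF.
pose c := Re w / nrm w.
have c2 : c ^+ 2 + (Im w / nrm w) ^+ 2 = 1.
  by rewrite !exprMn -mulrDl -nrm_sqr -exprMn divff // expr1n.
have cle : -1 <= c <= 1.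
  by rewrite -ler_norml -(@ler_pXn2r _ 2) ?nnegrE // expr1n real_normK ?num_real // -c2 lerDl sqr_ge0.
pose t := acos c.
have ct : cos t = c by rewrite acosK // in_itv.
have st : `|sin t| = `|Im w / nrm w|.
  rewrite -[LHS]sqrtr_sqr -[RHS]sqrtr_sqr sin2cos2 ct; congr Num.sqrt.
  by rewrite -c2; ring.
have [t' [ct' st']] : exists t', cos t' = c /\ sin t' = Im w / nrm w.
  have /eqP := st; rewrite eqr_norm2 => /orP[/eqP E|/eqP E].
    by exists t.
  by exists (- t); rewrite cosN sinN E opprK.
exists (mkc (ln (nrm w)) t').
by apply: cx_ext; rewrite /= lnK ?posrE // (ct', st') mulrC divfK.
Qed.

Lemma cexp_eq1 (z : C) : cexp z = 1 -> exists k : int, z = k%:~R * mkc 0 (2 * pi).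
Proof.
move=> ez; have Rz : Re z = 0.
  by apply: expR_inj; rewrite -nrm_cexp ez nrm1 expR0.
have cz : cos (Im z) = 1.
  by have := congr1 (@complex.Re R) ez; rewrite /= Rz expR0 mul1r.
have p0 := @pi_gt0 R.
(* This k brings Im z - 2 pi k into [-pi, pi), where the cosine equals 1 only at 0. *)
pose k := Num.floor ((Im z + pi) / (2 * pi)).
pose t := Im z - k%:~R * (2 * pi).
have /andP[t1 t2] : - pi <= t < pi.
  have /andP[k1 k2] : k%:~R <= (Im z + pi) / (2 * pi) < k%:~R + 1.
    rewrite -[1]/(1%:~R) -intrD; apply/andP; split; [exact: floor_le|exact: floorD1_gt].
  rewrite ler_pdivlMr ?mulr_gt0 // in k1; rewrite ltr_pdivrMr ?mulr_gt0 // in k2.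
  by rewrite /t; apply/andP; split; lra.
have ct : cos t = 1.
  have : cexp z * cexp ((- k)%:~R * mkc 0 (2 * pi)) = 1.
    by rewrite cexp_2pi_int mulr1.
  rewrite -cexpD => /(congr1 (@complex.Re R)).
  have -> : z + (- k)%:~R * mkc 0 (2 * pi) = mkc 0 t.
    have -> : ((- k)%:~R : C) = rc (- k%:~R).
      by rewrite rcN mulrNz rc_int.
    by apply: cx_ext; rewrite ?ReD ?ImD ?ReM ?ImM /= ?Rz /t; ring.
  by rewrite /= expR0 mul1r.
have t0 : t = 0.
  have [t0|t0] := leP 0 t.
    by apply: (@cos_inj R); rewrite ?in_itv /= ?t0 ?lexx ?(ltW t2) ?ltW // ct cos0.
  apply/eqP; rewrite -oppr_eq0; apply/eqP.
  clear ez; apply: (@cos_inj R); rewrite ?in_itv /= ?lexx ?cosN ?ct ?cos0 //; apply/andP; split; lra.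
exists k.
have -> : (k%:~R : C) = rc k%:~R by rewrite rc_int.
apply: cx_ext; rewrite ?ReM ?ImM /= ?Rz; first by ring.
by move: t0; rewrite /t; lra.
Qed.

(** A logarithm only on Re w > 0. It is applied to ratios at distance less than 1 from 1. *)
Definition Log (w : C) : C := mkc (ln (nrm w)) (atan (Im w / Re w)).

Lemma LogK (w : C) : 0 < Re w -> cexp (Log w) = w.
Proof.
move=> w0; pose t := Im w / Re w.
have nw : nrm w = Re w * Num.sqrt (1 + t ^+ 2).
  rewrite nrm_def -{2}[Re w]ger0_norm ?ltW // -sqrtr_sqr -sqrtrM ?sqr_ge0 //.
  by congr Num.sqrt; rewrite /t; field; rewrite gt_eqF.
have s0 : 0 < Num.sqrt (1 + t ^+ 2).
  by rewrite sqrtr_gt0 ltr_pwDl // sqr_ge0.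
have n0 : 0 < nrm w by rewrite nw mulr_gt0.
have ca := cos_atan t.
have sa : sin (atan t) = t * cos (atan t).
  by rewrite -[X in X * _](atanK t) /tan divfK // ca invr_eq0 gt_eqF.
apply: cx_ext => /=; rewrite lnK ?posrE // -/t ?sa ca nw.
  by rewrite mulfK // gt_eqF.
by rewrite /t; field; rewrite !gt_eqF.
Qed.

Lemma Log1 : Log 1 = 0.
Proof. by rewrite /Log nrm1 ln1 /= mul0r atan0. Qed.

Lemma Log_continuous (w : C) : 0 < Re w -> {for w, continuous Log}.
Proof.
move=> w0; have n0 : 0 < nrm w by apply: lt_le_trans (Re_le_nrm w); rewrite gtr0_norm.
have H1 : {for w, continuous (fun z : C => ln (nrm z))}.
  by apply: continuous_comp; [exact: nrm_continuous|exact: continuous_ln].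
have H2 : {for w, continuous (fun z : C => atan (Im z / Re z))}.
  apply: continuous_comp; last exact: continuous_atan.
  apply: (@cvgM R C (nbhs w) _ (@complex.Im R) (fun z => (Re z)^-1) (Im w) (Re w)^-1).
    exact: Im_continuous.
  by apply: (@cvgV R C (nbhs w) _ (@complex.Re R)); [rewrite gt_eqF|exact: Re_continuous].
exact: (@cvg_ReIm R C (nbhs w) _ Log (Log w) H1 H2).
Qed.

(** Continuity of a logarithm already forces holomorphy: its increment k is small, hence comparable
    to exp k - 1, which is the relative increment of psi. *)
Lemma lift_is_derive (L psi : C -> C) z l : L @ z --> L z ->
  (\forall w \near z, cexp (L w) = psi w) -> is_derive z 1 psi l ->
  is_derive z 1 L (l / psi z).
Proof.
move=> Lc Lpsi dpsi; apply: nrm_is_derive => e e0.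
have Lz : cexp (L z) = psi z := nbhs_singleton Lpsi.
have p0 : psi z != 0 by rewrite -Lz cexp_neq0.
have n0 : 0 < nrm (psi z) by rewrite nrm_gt0.
pose M := nrm (l / psi z) + 1.
have M0 : 0 < M by have := nrm_ge0 (l / psi z); rewrite /M; lra.
(* The bound 1/2 gives |k| <= 2 M |h| for the increment k of L, and then e / (4 M) makes the error
   e1 |k| at most (e / 2) |h|. *)
pose e1 := Num.min (2^-1) (e / 4 / M).
have e10 : 0 < e1 by rewrite lt_min invr_gt0 ltr0n /= !divr_gt0.
pose e2 := Num.min (e / 2) 1.
have e20 : 0 < e2 by rewrite lt_min divr_gt0 //= ltr01.
have [d1 d10 H1] := cexp_near0 e10.
have [d2 d20 H2] := is_derive_nrm dpsi (mulr_gt0 e20 n0).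
have [d3 d30 H3] := (nbhs_nrmP _ _).1 Lpsi.
have [d4 d40 H4] := (nbhs_nrmP _ _).1 ((cvg_nrmP _ _ _).1 Lc d1 d10).
exists (Num.min d2 (Num.min d3 d4)); first by rewrite !lt_min d20 d30.
move=> h; rewrite !lt_min => /and3P[hd2 hd3 hd4].
have zh : z + h - z = h by rewrite addrC addKr.
have {}H4 : nrm (L (z + h) - L z) < d1 by apply: H4; rewrite zh.
have {}H3 : cexp (L (z + h)) = psi (z + h) by apply: H3; rewrite zh.
have {}H2 := H2 h hd2; have {H1 H4} := H1 _ H4.
set k := L (z + h) - L z.
have -> : cexp k = psi (z + h) / psi z by rewrite cexpB H3 Lz.
set q := psi (z + h) / psi z => H1.
have qE : q - 1 - h * (l / psi z) = (psi (z + h) - psi z - h * l) / psi z.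
  by rewrite /q; field.
have Hq : nrm (q - 1 - h * (l / psi z)) <= e2 * nrm h.
  by rewrite qE nrmM nrmV ler_pdivrMr // mulrAC.
have nh := nrm_ge0 h; have nk := nrm_ge0 k.
have Hq1 : nrm (q - 1) <= M * nrm h.
  rewrite (le_trans (nrm_subD _ (h * (l / psi z)))) // /M nrmM.
  have : e2 <= 1 by rewrite ge_min lexx orbT.
  by nra.
have Hk : nrm k <= 2 * (M * nrm h).
  have : nrm k <= nrm (q - 1 - k) + nrm (q - 1).
    by rewrite -(nrmN (_ - k)) (le_trans _ (nrmD _ _)) // opprB subrK.
  have : e1 <= 2^-1 by rewrite ge_min lexx.
  by nra.
rewrite -[h *: _]/(h * _).
have -> : k - h * (l / psi z) = - (q - 1 - k) + (q - 1 - h * (l / psi z)) by ring.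
rewrite (le_trans (nrmD _ _)) // nrmN.
have E1 : e1 * nrm k <= e / 2 * nrm h.
  apply: (@le_trans _ _ (e / 4 / M * (2 * (M * nrm h)))).
    by apply: ler_pM => //; [exact: ltW|rewrite ge_min lexx orbT].
  by rewrite le_eqVlt; apply/orP; left; apply/eqP; field; rewrite gt_eqF.
have : e2 * nrm h <= e / 2 * nrm h by rewrite ler_wpM2r // ge_min lexx.
by lra.
Qed.

Lemma is_derive_Log (w : C) : 0 < Re w -> is_derive w 1 Log (w^-1).
Proof.
move=> w0; rewrite -[w^-1]mul1r.
apply: (lift_is_derive (Log_continuous w0) _ (is_derive_id w 1)).
apply/nbhs_nrmP; exists (Re w) => // v vw; apply: LogK.
have := Re_le_nrm (v - w); rewrite ReB => H.
have := ler_norm (- (Re v - Re w)); rewrite normrN; lra.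
Qed.

End ComplexExp.

(** * Primitives of continuous real functions *)

Section Primitives.
Context {R : realType}.

Lemma primitive_exists (A : R) (f : R -> R) : exists F : R -> R,
  continuous f -> forall x, A < x -> is_derive x 1 F (f x).
Proof.
exists (fun x => \int[lebesgue_measure]_(t in `[A, x]) f t)%R => fc x Ax.
have xu : x < x + 1 by rewrite ltrDl.
have [||d e] := continuous_FTC1 (a := BLeft A) xu _ _ (fc x).
- apply: continuous_compact_integrable; first exact: segment_compact.
  exact: continuous_subspaceT.
- by rewrite /= lte_fin.
by apply: DeriveDef; [exact: d|rewrite -derive1E; exact: e].
Qed.

(* A derivative of prim A f is f only on ]A, +oo[, and for continuous f. *)
Definition prim (A : R) (f : R -> R) : R -> R := projT1 (cid (primitive_exists A f)).

Lemma primP (A : R) (f : R -> R) (x : R) : continuous f -> A < x -> is_derive x 1 (prim A f) (f x).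
Proof. by move=> fc; exact: (projT2 (cid (primitive_exists A f)) fc x). Qed.

Lemma prim_affine_bound (A : R) (f : R -> R) (c d k0 k1 M : R) : continuous f -> A < c -> c <= d ->
  (forall x, c <= x <= d -> `|f x - (k0 + k1 * x)| <= M) ->
  `|prim A f d - prim A f c - (k0 * (d - c) + k1 * (d ^+ 2 - c ^+ 2) / 2)|
    <= M * (d - c).
Proof.
move=> fc Ac cd fM.
pose F x := prim A f x - (k0 * x + k1 / 2 * x ^+ 2).
have dF x : A < x -> is_derive x 1 F (f x - (k0 + k1 * x)).
  move=> Ax; have dp := primP fc Ax.
  have -> : F = prim A f - (k0 *: id + (k1 / 2) *: (id ^+ 2 : R -> R)).
    by apply/funext => y; rewrite /F -[RHS]/(_ - (_ * _ + _ * _)).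
  refine (is_derive_eq (is_deriveB dp (is_deriveD (is_deriveZ k0 (is_derive_id x 1))
    (is_deriveZ (k1 / 2) (is_deriveX 2 (is_derive_id x 1))))) _).
  rewrite /GRing.scale /=; by field.
have -> : prim A f d - prim A f c - (k0 * (d - c) + k1 * (d ^+ 2 - c ^+ 2) / 2)
    = F d - F c by rewrite /F; field.
have [x xcd||x xcd ->] := @MVT_segment R F (fun x => f x - (k0 + k1 * x)) c d cd.
- apply: dF; rewrite in_itv /= in xcd.
  by apply: lt_trans Ac _; case/andP: xcd.
- apply: continuous_in_subspaceT => x; rewrite inE /= in_itv /= => /andP[cx _].
  have [dFx _] := dF x (lt_le_trans Ac cx).
  exact/differentiable_continuous/derivable1_diffP.
rewrite normrM (ger0_norm (_ : 0 <= d - c)) ?subr_ge0 // ler_wpM2r ?subr_ge0 //.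
by apply: fM; rewrite in_itv /= in xcd.
Qed.

End Primitives.

(** * Goursat's theorem for rectangles *)

Section Goursat.
Context {R : realType}.
Variables (A : R) (u v : R -> R -> R).
Hypothesis uc : forall x, continuous (u x).
Hypothesis vc : forall y, continuous (v ^~ y).

Let U x := prim A (u x).
Let V y := prim A (v ^~ y).

(* The integral of u dy + v dx along the boundary of [a, b] x [c, d]. *)
Definition rect_int a b c d : R :=
  (U b d - U b c) - (U a d - U a c) - (V d b - V d a) + (V c b - V c a).

(** The Cauchy-Riemann linearisation of u + i v with derivative alpha + i beta, with a uniform error
    e on the rectangle. *)
Definition cr_at (a b c d x0 y0 alpha beta e : R) : Prop :=
  forall x y, a <= x <= b -> c <= y <= d ->
  `|u x y - (u x0 y0 + alpha * (x - x0) - beta * (y - y0))| <= e /\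
  `|v x y - (v x0 y0 + beta * (x - x0) + alpha * (y - y0))| <= e.

(** The affine Cauchy-Riemann part integrates to 0 along the boundary, so that only the error times
    the perimeter remains. *)
Lemma rect_int_bound a b c d x0 y0 alpha beta e :
  A < a -> A < c -> a <= b -> c <= d -> cr_at a b c d x0 y0 alpha beta e ->
  `|rect_int a b c d| <= 2 * e * ((b - a) + (d - c)).
Proof.
move=> Aa Ac ab cd H.
have HU x : a <= x <= b ->
  `|U x d - U x c - ((u x0 y0 + alpha * (x - x0) + beta * y0) * (d - c)
     + (- beta) * (d ^+ 2 - c ^+ 2) / 2)| <= e * (d - c).
  move=> xab; apply: prim_affine_bound => // y ycd.
  have [E _] := H x y xab ycd; apply: etrans E; congr (`|_| <= _); ring.
have HV y : c <= y <= d ->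
  `|V y b - V y a - ((v x0 y0 - beta * x0 + alpha * (y - y0)) * (b - a)
     + beta * (b ^+ 2 - a ^+ 2) / 2)| <= e * (b - a).
  move=> ycd; apply: prim_affine_bound => // x xab.
  have [_ E] := H x y xab ycd; apply: etrans E; congr (`|_| <= _); ring.
have := HU a; have := HU b; have := HV c; have := HV d.
rewrite !lexx !ab !cd => /(_ isT) + /(_ isT) + /(_ isT) + /(_ isT).
rewrite !ler_norml /rect_int => /andP[? ?] /andP[? ?] /andP[? ?] /andP[? ?].
by apply/andP; split; lra.
Qed.

Lemma rect_int_split a b c d x y :
  rect_int a b c d = rect_int a x c y + rect_int x b c y
                   + rect_int a x y d + rect_int x b y d.
Proof. by rewrite /rect_int; ring. Qed.

Variables (a0 c0 w h : R).
Hypotheses (Aa : A < a0) (Ac : A < c0) (w0 : 0 <= w) (h0 : 0 <= h).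
Hypothesis CR : forall x0 y0, a0 <= x0 <= a0 + w -> c0 <= y0 <= c0 + h ->
  exists alpha beta, forall e : R, 0 < e -> exists2 d : R, 0 < d &
  forall x y, a0 <= x <= a0 + w -> c0 <= y <= c0 + h ->
  `|x - x0| < d -> `|y - y0| < d ->
  `|u x y - (u x0 y0 + alpha * (x - x0) - beta * (y - y0))|
     <= e * (`|x - x0| + `|y - y0|) /\
  `|v x y - (v x0 y0 + beta * (x - x0) + alpha * (y - y0))|
     <= e * (`|x - x0| + `|y - y0|).

Let Jn n (p : R * R) :=
  rect_int p.1 (p.1 + w / 2 ^+ n) p.2 (p.2 + h / 2 ^+ n).

Let child n (p q : R * R) : Prop :=
  [/\ p.1 <= q.1, q.1 + w / 2 ^+ n.+1 <= p.1 + w / 2 ^+ n,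
      p.2 <= q.2, q.2 + h / 2 ^+ n.+1 <= p.2 + h / 2 ^+ n
    & `|Jn n p| <= 4 * `|Jn n.+1 q|].

(** By additivity one of the four quarters carries at least a fourth of the integral. *)
Let child_ex n p : exists q, child n p q.
Proof.
pose w' := w / 2 ^+ n.+1; pose h' := h / 2 ^+ n.+1.
have wE : w / 2 ^+ n = w' + w' by rewrite /w' exprS; field; rewrite expf_neq0.
have hE : h / 2 ^+ n = h' + h' by rewrite /h' exprS; field; rewrite expf_neq0.
have w'0 : 0 <= w' by rewrite divr_ge0 // exprn_ge0.
have h'0 : 0 <= h' by rewrite divr_ge0 // exprn_ge0.
apply: contrapT => /forallNP H.
have E : Jn n p = Jn n.+1 p + Jn n.+1 (p.1 + w', p.2)
     + Jn n.+1 (p.1, p.2 + h') + Jn n.+1 (p.1 + w', p.2 + h').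
  by rewrite /Jn wE hE (rect_int_split _ _ _ _ (p.1 + w') (p.2 + h')) -/w' -/h' !addrA.
have sm q : p.1 <= q.1 -> q.1 + w' <= p.1 + (w' + w') -> p.2 <= q.2 ->
    q.2 + h' <= p.2 + (h' + h') -> 4 * `|Jn n.+1 q| < `|Jn n p|.
  move=> q1 q2 q3 q4; rewrite ltNge; apply/negP => q5; apply: (H q).
  by split; rewrite -/w' -/h' ?wE ?hE.
have := sm p; have := sm (p.1 + w', p.2); have := sm (p.1, p.2 + h').
have := sm (p.1 + w', p.2 + h').
rewrite /= => S1 S2 S3 S4.
have {}S1 : 4 * `|Jn n.+1 (p.1 + w', p.2 + h')| < `|Jn n p| by apply: S1; rewrite ?addrA ?lerDl.
have {}S2 : 4 * `|Jn n.+1 (p.1, p.2 + h')| < `|Jn n p| by apply: S2; rewrite ?addrA ?lerDl.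
have {}S3 : 4 * `|Jn n.+1 (p.1 + w', p.2)| < `|Jn n p| by apply: S3; rewrite ?addrA ?lerDl.
have {}S4 : 4 * `|Jn n.+1 p| < `|Jn n p| by apply: S4; rewrite ?addrA ?lerDl.
have : `|Jn n p| <= `|Jn n.+1 p| + `|Jn n.+1 (p.1 + w', p.2)|
     + `|Jn n.+1 (p.1, p.2 + h')| + `|Jn n.+1 (p.1 + w', p.2 + h')|.
  rewrite {1}E; do 3!(apply: le_trans (ler_normD _ _) _; apply: lerD => //).
by lra.
Qed.

Let next n p := projT1 (cid (child_ex n p)).
Let nextP n p : child n p (next n p) := projT2 (cid (child_ex n p)).

Fixpoint goursat_seq n := if n is m.+1 then next m (goursat_seq m) else (a0, c0).
Let q := goursat_seq.

Let q_bounds n m : (n <= m)%N ->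
  [/\ (q n).1 <= (q m).1, (q m).1 + w / 2 ^+ m <= (q n).1 + w / 2 ^+ n,
      (q n).2 <= (q m).2 & (q m).2 + h / 2 ^+ m <= (q n).2 + h / 2 ^+ n].
Proof.
elim: m => [|m IH]; first by rewrite leqn0 => /eqP ->.
rewrite leq_eqVlt => /orP[/eqP <- //|/IH[b1 b2 b3 b4]].
have [c1 c2 c3 c4 _] := nextP m (q m).
by split; [exact: le_trans b1 c1|exact: le_trans c2 b2|
           exact: le_trans b3 c3|exact: le_trans c4 b4].
Qed.

Let q_int n : `|Jn 0 (a0, c0)| <= 4 ^+ n * `|Jn n (q n)|.
Proof.
elim: n => [|n IH]; first by rewrite mul1r.
have [_ _ _ _ c5] := nextP n (q n).
rewrite (le_trans IH) // exprSr -mulrA ler_wpM2l // exprn_ge0 //.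
Qed.

Let nested_limit (g : nat -> R) (l : R) : 0 <= l ->
  (forall n m, (n <= m)%N -> g n <= g m /\ g m + l / 2 ^+ m <= g n + l / 2 ^+ n) ->
  exists x, forall n, g n <= x <= g n + l / 2 ^+ n.
Proof.
move=> l0 H; exists (sup (range g)) => n.
have up m : g m <= g n + l / 2 ^+ n.
  have [nm|/ltnW mn] := leqP n m.
    have [_] := H n m nm; apply: le_trans.
    by rewrite lerDl divr_ge0 // exprn_ge0.
  have [+ _] := H m n mn; move/le_trans; apply.
  by rewrite lerDl divr_ge0 // exprn_ge0.
apply/andP; split.
  apply: ub_le_sup; last by exists n.
  by exists (g n + l / 2 ^+ n) => _ [m _ <-].
by apply: ge_sup; [exists (g 0), 0|move=> _ [m _ <-]].
Qed.

(** Nested quarters shrink to a point (x0, y0). The linearisation there makes the n-th integral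
    o(4^-n), whereas the choice of the quarters keeps it at least 4^-n times the first one.
    Pointwise differentiability suffices for this. *)
Theorem goursat_rect : rect_int a0 (a0 + w) c0 (c0 + h) = 0.
Proof.
have [x0 Hx] : exists x, forall n, (q n).1 <= x <= (q n).1 + w / 2 ^+ n.
  by apply: (nested_limit (g := fun n => (q n).1)) => // n m /q_bounds[].
have [y0 Hy] : exists y, forall n, (q n).2 <= y <= (q n).2 + h / 2 ^+ n.
  by apply: (nested_limit (g := fun n => (q n).2)) => // n m /q_bounds[].
have x0r : a0 <= x0 <= a0 + w by have := Hx 0; rewrite /= expr0 divr1.
have y0r : c0 <= y0 <= c0 + h by have := Hy 0; rewrite /= expr0 divr1.
have [al [be H]] := CR x0r y0r.
have J0E : Jn 0 (a0, c0) = rect_int a0 (a0 + w) c0 (c0 + h).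
  by rewrite /Jn /= expr0 !divr1.
apply/eqP; rewrite -normr_eq0 eq_le normr_ge0 andbT -J0E.
apply/ler_addgt0Pr => e e0; rewrite add0r.
pose s := w + h + 1; have s0 : 0 < s by rewrite /s; lra.
(* The factor 4^n 2 (wn + hn)^2 equals 2 (w + h)^2 for every n, and w + h < s. *)
have e1 : 0 < e / (2 * s ^+ 2) by rewrite divr_gt0 // mulr_gt0 // exprn_gt0.
have [d d0 dH] := H _ e1.
have [n nd] : exists n, (w + h) / 2 ^+ n < d.
  have [n nn] : exists n : nat, (w + h) / d < n%:R.
    by exists (Num.truncn ((w + h) / d)).+1; exact: truncnS_gt.
  exists n; rewrite ltr_pdivrMr ?exprn_gt0 //.
  rewrite ltr_pdivrMr // in nn; apply: (lt_le_trans nn).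
  by rewrite mulrC ler_pM2l // -natrX ler_nat ltnW // ltn_expl.
have [b1 b2 b3 b4] := q_bounds (leq0n n).
have /andP[x1 x2] := Hx n; have /andP[y1 y2] := Hy n.
rewrite /= !expr0 !divr1 in b1 b2 b3 b4.
have t0 : (0 : R) < 2 ^+ n by rewrite exprn_gt0.
set wn := w / 2 ^+ n in b2 x2; set hn := h / 2 ^+ n in b4 y2.
have wn0 : 0 <= wn by rewrite divr_ge0 // ltW.
have hn0 : 0 <= hn by rewrite divr_ge0 // ltW.
rewrite mulrDl -/wn -/hn in nd.
have bd : cr_at (q n).1 ((q n).1 + wn) (q n).2 ((q n).2 + hn) x0 y0 al be
    (e / (2 * s ^+ 2) * (wn + hn)).
  move=> x y /andP[xa xb] /andP[ya yb].
  have xx : `|x - x0| <= wn by rewrite ler_norml; apply/andP; split; lra.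
  have yy : `|y - y0| <= hn by rewrite ler_norml; apply/andP; split; lra.
  have xr : a0 <= x <= a0 + w by rewrite (le_trans b1 xa) (le_trans xb b2).
  have yr : c0 <= y <= c0 + h by rewrite (le_trans b3 ya) (le_trans yb b4).
  have xd : `|x - x0| < d by apply: le_lt_trans xx _; apply: le_lt_trans nd; rewrite lerDl.
  have yd : `|y - y0| < d by apply: le_lt_trans yy _; apply: le_lt_trans nd; rewrite lerDr.
  have [E1 E2] := dH x y xr yr xd yd.
  by split; [apply: le_trans E1 _|apply: le_trans E2 _];
    rewrite ler_wpM2l ?lerD // ltW.
have := rect_int_bound _ _ _ _ bd.
move=> /(_ (lt_le_trans Aa b1)) /(_ (lt_le_trans Ac b3)).
rewrite !lerDl => /(_ wn0) /(_ hn0).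
rewrite [_ + wn - _]addrAC subrr add0r [_ + hn - _]addrAC subrr add0r => B.
have B' : `|Jn n (q n)| <= 2 * (e / (2 * s ^+ 2) * (wn + hn)) * (wn + hn) by exact: B.
apply: le_trans (q_int n) _.
have t4 : (4 : R) ^+ n = 2 ^+ n * 2 ^+ n by rewrite -exprMn; congr (_ ^+ _); ring.
apply: le_trans (ler_wpM2l _ B') _; first by rewrite exprn_ge0.
have -> : 4 ^+ n * (2 * (e / (2 * s ^+ 2) * (wn + hn)) * (wn + hn))
   = e * ((w + h) / s) ^+ 2.
  by rewrite t4 /wn /hn; field; rewrite !gt_eqF.
rewrite -[leRHS]mulr1 ler_pM2l // -[leRHS](expr1n _ 2).
have sw : 0 <= w + h by lra.
rewrite ler_pXn2r ?nnegrE ?ler01 //; last by rewrite divr_ge0 // ltW.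
by rewrite ler_pdivrMr // mul1r /s; lra.
Qed.

End Goursat.

(** * Mean value property, Cauchy estimates and Taylor's formula *)

Section MeanValue.
Context {R : realType}.
Local Notation C := (Cx R).

Lemma prim_mvt (A : R) (f : R -> R) (c d : R) : continuous f -> A < c -> c <= d ->
  exists2 x, c <= x <= d & prim A f d - prim A f c = f x * (d - c).
Proof.
move=> fc Ac cd.
have [x xcd||x xcd ->] := @MVT_segment R (prim A f) f c d cd.
- apply: primP => //; rewrite in_itv /= in xcd.
  by apply: lt_trans Ac _; case/andP: xcd.
- apply: continuous_in_subspaceT => x; rewrite inE /= in_itv /= => /andP[cx _].
  have [dFx _] := primP fc (lt_le_trans Ac cx).
  exact/differentiable_continuous/derivable1_diffP.
by exists x => //; rewrite in_itv /= in xcd.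
Qed.

(** Pull f back by exp to the rectangle [ln s, ln t] x [0, 2 pi]. The horizontal sides cancel by
    periodicity, so that Re f has equal means over the circles of radius s and t, and s tends to 0.
    At 0 itself f need only be continuous; this replaces the theorem on removable singularities. *)
Lemma mvp_le (f : C -> C) (r t m : R) : 0 < t < r ->
  (forall z, 0 < nrm z < r -> differentiable f z) -> {for 0, continuous f} ->
  (forall z, nrm z = t -> Re (f z) <= m) -> Re (f 0) <= m.
Proof.
move=> /andP[t0 tr] df fc0 fm; apply/ler_addgt0Pr => e e0.
have [d d0 dH] := (nbhs_nrmP _ _).1 ((cvg_nrmP _ _ _).1 fc0 e e0).
pose s := Num.min (d / 2) (t / 2).
have s0 : 0 < s by rewrite lt_min !divr_gt0.
have sd : s < d by rewrite gt_min; apply/orP; left; lra.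
have st : s < t by rewrite gt_min; apply/orP; right; lra.
pose a := ln s; pose b := ln t.
have ab : a < b by rewrite ltr_ln ?posrE.
have ea : expR a = s by rewrite lnK ?posrE.
have eb : expR b = t by rewrite lnK ?posrE.
pose cl := clamp a b.
have cl_id x : a <= x <= b -> cl x = x by exact: clamp_id.
have cl_in x : a <= cl x <= b by exact: clamp_in (ltW ab).
have clc : continuous cl by exact: clamp_continuous.
pose g (z : C) := f (cexp z).
have dg (z : C) : a <= Re z <= b -> differentiable g z.
  move=> /andP[az zb]; apply: differentiable_comp; first exact: cexp_differentiable.
  by apply: df; rewrite nrm_cexp expR_gt0 (le_lt_trans _ tr) // -eb ler_expR.
have gc (z : C) : a <= Re z <= b -> {for z, continuous g}.
  by move=> /dg/differentiable_continuous.
(* Clamping x keeps the argument in the closed annulus where f is differentiable, which yields the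
   global continuity that [goursat_rect] asks for. *)
pose G x y := g (mkc (cl x) y).
have Gc1 x : continuous (G x).
  move=> y; apply: (continuous_comp (f := fun y => mkc (cl x) y) (g := g)).
    by apply: mkc_comp_continuous; [exact: cvg_cst|exact: cvg_id].
  by apply: gc; exact: cl_in.
have Gc2 y : continuous (G ^~ y).
  move=> x; apply: (continuous_comp (f := fun x => mkc (cl x) y) (g := g)).
    by apply: mkc_comp_continuous; [exact: clc|exact: cvg_cst].
  by apply: gc; exact: cl_in.
pose u x y := Re (G x y); pose v x y := Im (G x y).
have uc x : continuous (u x).
  by move=> y; exact: Re_comp_continuous (Gc1 x y).
have vc y : continuous (v ^~ y).
  by move=> x; exact: Im_comp_continuous (Gc2 y x).
(* [prim A] is a primitive only to the right of A, hence A lies below the left side a and the bottom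
   0. *)
pose A := Num.min a 0 - 1.
have Aa : A < a by rewrite /A; have : Num.min a 0 <= a; [rewrite ge_min lexx|lra].
have A0 : A < 0 by rewrite /A; have : Num.min a 0 <= 0; [rewrite ge_min lexx orbT|lra].
have w0 : 0 <= b - a by lra.
have p0 := @pi_gt0 R.
have h0 : 0 <= 2 * @pi R by lra.
have : rect_int A u v a (a + (b - a)) 0 (0 + 2 * pi) = 0.
  apply: goursat_rect => // x0 y0; rewrite [a + _]addrC subrK add0r => x0r _.
  have dl := diff_is_derive (dg (mkc x0 y0) x0r).
  set l := 'd g _ _ in dl.
  exists (Re l), (Im l) => e1 e10.
  have [d1 d10 H] := is_derive_nrm dl e10.
  exists (d1 / 2); first by rewrite divr_gt0.
  move=> x y xr _ xd yd.
  pose h := mkc (x - x0) (y - y0).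
  have nh : nrm h <= `|x - x0| + `|y - y0| by exact: nrm_le_ReIm.
  have hd : nrm h < d1 by apply: le_lt_trans nh _; lra.
  have E : mkc x0 y0 + h = mkc x y by apply: cx_ext; rewrite ?ReD ?ImD /=; lra.
  have {}H : nrm (g (mkc x y) - g (mkc x0 y0) - h * l) <= e1 * (`|x - x0| + `|y - y0|).
    by rewrite -E; apply: le_trans (H h hd) _; rewrite ler_wpM2l // ltW.
  rewrite /u /v /G !cl_id //; split.
    apply: le_trans _ (le_trans (Re_le_nrm _) H).
    by rewrite !ReB ReM /= le_eqVlt; apply/orP; left; apply/eqP; congr `|_|; ring.
  apply: le_trans _ (le_trans (Im_le_nrm _) H).
  by rewrite !ImB ImM /= le_eqVlt; apply/orP; left; apply/eqP; congr `|_|; ring.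
rewrite [a + _]addrC subrK add0r /rect_int.
have -> : v ^~ (2 * pi) = v ^~ 0.
  apply/funext => x; rewrite /v /G /g.
  have -> // : cexp (mkc (cl x) (2 * pi)) = cexp (mkc (cl x) 0).
  have -> : mkc (cl x) (2 * pi) = mkc (cl x) 0 + mkc 0 (2 * pi) :> C.
    by apply: cx_ext; rewrite ?ReD ?ImD /=; lra.
  by rewrite cexpD cexp_2pi mulr1.
have [y1 y1r ->] := prim_mvt (uc b) A0 h0.
have [y2 y2r ->] := prim_mvt (uc a) A0 h0.
have ub : u b y1 <= m.
  by apply: fm; rewrite cl_id ?lexx ?(ltW ab) // nrm_cexp /= eb.
have ua : Re (f 0) - e <= u a y2.
  have : nrm (G a y2 - f 0) < e.
    by apply: dH; rewrite subr0 cl_id ?lexx ?(ltW ab) // nrm_cexp /= ea.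
  move=> /(le_lt_trans (Re_le_nrm _)); rewrite ReB => H.
  by have := ler_norm (- (Re (G a y2) - Re (f 0))); rewrite normrN /u; lra.
rewrite subr0; nra.
Qed.

Lemma unimodular (z : C) : exists2 c : C, nrm c = 1 & c * z = rc (nrm z).
Proof.
have [->|z0] := eqVneq z 0; first by exists 1; rewrite ?nrm1 // nrm0 mulr0.
have n0 : nrm z != 0 by rewrite nrm_eq0.
exists (rc (nrm z) / z); last by rewrite divfK.
by rewrite nrmM nrmV nrm_rc ger0_norm ?nrm_ge0 // divff.
Qed.

(** Apply [mvp_le] to the difference quotient (f(a + z) - f(a)) / z, extended by the derivative at 0
    and rotated so that this derivative is real and nonnegative. The factor 2 bounds the
    numerator. *)
Lemma cauchy_estimate (f : C -> C) a (r M : R) l : 0 < r ->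
  (forall z, nrm (z - a) < r -> differentiable f z) ->
  (forall z, nrm (z - a) < r -> nrm (f z) <= M) ->
  is_derive a 1 f l -> nrm l <= 2 * M / r.
Proof.
move=> r0 df fM dl.
have M0 : 0 <= M by apply: le_trans (nrm_ge0 (f a)) (fM _ _); rewrite subrr nrm0.
have key t : 0 < t < r -> nrm l * t <= 2 * M.
  move=> tr; have /andP[t0 t1] := tr.
  have [c c1 cl] := unimodular l.
  pose h z := if z == 0 then c * l else c * ((f (a + z) - f a) / z).
  have h0 : h 0 = rc (nrm l) by rewrite /h eqxx.
  have : Re (h 0) <= 2 * M / t.
    apply: (mvp_le tr) => [z /andP[z0 zr]||z zt].
    - rewrite nrm_gt0 in z0.
      apply: (@diff_near _ _ _ (fun z => c * ((f (a + z) - f a) / z))).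
        apply/nbhs_nrmP; exists (nrm z); first by rewrite nrm_gt0.
        move=> w wz; rewrite /h ifF //; apply/eqP => w0.
        by rewrite w0 sub0r nrmN ltxx in wz.
      have D1 : differentiable (fun z => f (a + z)) z.
        apply: (@differentiable_comp _ _ _ _ (fun z => a + z) f).
          by apply: differentiableD; [exact: differentiable_cst|exact: ex_diff].
        by apply: df; rewrite addrC addKr.
      apply: (@differentiableM _ _ (cst c) (fun z => (f (a + z) - f a) / z)).
        exact: differentiable_cst.
      apply: (@differentiableM _ _ (fun z => f (a + z) - f a) (fun z => z^-1)).
        by apply: (differentiableB D1); exact: differentiable_cst.
      exact: differentiable_Rinv.
    - apply: continuous_nrm => e e0; rewrite h0.
      have [d d0 dH] := is_derive_nrm dl (divr_gt0 e0 (ltr0Sn R 1)).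
      exists d => // w; rewrite subr0 => wd.
      rewrite /h; case: eqVneq => [w0|w0]; first by rewrite cl subrr nrm0.
      rewrite -cl -mulrBr nrmM c1 mul1r.
      have -> : (f (a + w) - f a) / w - l = (f (a + w) - f a - w * l) / w by field.
      have nw : 0 < nrm w by rewrite nrm_gt0.
      rewrite nrmM nrmV ltr_pdivrMr // (le_lt_trans (dH w wd)) //.
      by rewrite ltr_pM2r //; lra.
    - have z0 : z != 0 by rewrite -nrm_gt0 zt.
      rewrite /h (negbTE z0) (le_trans (ler_norm _)) // (le_trans (Re_le_nrm _)) //.
      rewrite nrmM c1 mul1r nrmM nrmV zt ler_pM2r ?invr_gt0 //.
      rewrite (le_trans (nrmB _ _)) // mulr_natl mulr2n lerD // fM //.
        by rewrite addrC addKr zt.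
      by rewrite subrr nrm0.
  by rewrite h0 /= ler_pdivlMr.
(* [key] covers only t < r; if it failed in the limit, the midpoint of 2 M / |l| and r would
   contradict it. *)
rewrite ler_pdivlMr // leNgt; apply/negP => H.
have l0 : 0 < nrm l.
  by rewrite lt_def nrm_ge0 andbT; apply/eqP => l0; rewrite l0 in H; lra.
have q1 : 2 * M / nrm l < r by rewrite ltr_pdivrMr // [r * _]mulrC.
have q0 : 0 <= 2 * M / nrm l by rewrite divr_ge0 ?nrm_ge0 //; lra.
have := key ((2 * M / nrm l + r) / 2).
have -> : 0 < (2 * M / nrm l + r) / 2 < r by apply/andP; split; lra.
move=> /(_ isT).
have -> : nrm l * ((2 * M / nrm l + r) / 2) = (2 * M + nrm l * r) / 2.
  by field; rewrite gt_eqF.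
by lra.
Qed.

Lemma real_is_derive (f : R -> R) (x l : R) : (forall e : R, 0 < e ->
  exists2 d : R, 0 < d & forall h, `|h| < d ->
    `|f (x + h) - f x - h * l| <= e * `|h|) -> is_derive x 1 f l.
Proof.
move=> H; have cv : h^-1 *: ((f \o shift x) (h *: (1 : R)) - f x) @[h --> 0^'] --> l.
  apply/cvgrPdist_le => e e0; have [d d0 dH] := H e e0.
  apply/nbhs_ballP; exists d => // h; rewrite /ball /= sub0r normrN => hd h0.
  have hn : 0 < `|h| by rewrite normr_gt0.
  rewrite -(ler_pM2r hn) distrC -normrM; apply: le_trans _ (dH h hd).
  rewrite le_eqVlt; apply/orP; left; apply/eqP; congr `|_|.
  by rewrite /GRing.scale /= mulr1 [h + x]addrC; field.
by split; [apply/cvg_ex; exists l|exact: cvg_lim].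
Qed.

(** A rotation makes f z - f w real, and the real mean value theorem applies to the real part along
    the segment. *)
Lemma mean_value_inequality (f : C -> C) (w z : C) (K : R) :
  (forall t : R, 0 <= t <= 1 ->
    exists2 l, is_derive (w + rc t * (z - w)) 1 f l & nrm l <= K) ->
  nrm (f z - f w) <= K * nrm (z - w).
Proof.
move=> H; have [c c1 cl] := unimodular (f z - f w).
pose g t := Re (c * f (w + rc t * (z - w))).
have dg (t : R) : 0 <= t <= 1 ->
    exists2 m, is_derive t 1 g m & m <= K * nrm (z - w).
  move=> /H[l dl lK]; exists (Re (c * ((z - w) * l))).
    apply: real_is_derive => e e0.
    have nz := nrm_ge0 (z - w).
    have e1 : 0 < e / (nrm (z - w) + 1) by rewrite divr_gt0 //; lra.
    have [d d0 dH] := is_derive_nrm dl e1.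
    exists (d / (nrm (z - w) + 1)); first by rewrite divr_gt0 //; lra.
    move=> h hd; rewrite ltr_pdivlMr in hd; last by lra.
    pose k := rc h * (z - w).
    have nk : nrm k = `|h| * nrm (z - w) by rewrite nrmM nrm_rc.
    have kd : nrm k < d by have := normr_ge0 h; rewrite nk; nra.
    have E : w + rc (t + h) * (z - w) = w + rc t * (z - w) + k.
      by rewrite rcD mulrDl addrA.
    have -> : g (t + h) - g t - h * Re (c * ((z - w) * l)) =
        Re (c * (f (w + rc t * (z - w) + k) - f (w + rc t * (z - w)) - k * l)).
      rewrite /g E !mulrBr !ReB; congr (_ - _ - _).
      have -> : c * (k * l) = rc h * (c * ((z - w) * l)) by rewrite /k; ring.
      by rewrite [in RHS]ReM /= mul0r subr0.
    apply: le_trans (Re_le_nrm _) _; rewrite nrmM c1 mul1r.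
    apply: le_trans (dH k kd) _; rewrite nk mulrAC ler_pdivrMr; last by lra.
    by have := mulr_ge0 (ltW e0) (normr_ge0 h); clear -nz; nra.
  apply: le_trans (ler_norm _) _; apply: le_trans (Re_le_nrm _) _.
  by rewrite !nrmM c1 mul1r mulrC ler_wpM2r ?nrm_ge0.
have dg' (t : R) : exists m, 0 <= t <= 1 -> is_derive t 1 g m /\ m <= K * nrm (z - w).
  have [/dg[m]|] := boolP (0 <= t <= 1); first by exists m.
  by move=> _; exists 0.
pose g' t := projT1 (cid (dg' t)).
have g'P (t : R) : 0 <= t <= 1 -> is_derive t 1 g (g' t) /\ g' t <= K * nrm (z - w).
  exact: projT2 (cid (dg' t)).
have [t||t] := @MVT_segment R g g' 0 1 ler01.
- by rewrite in_itv /= => /andP[t0 t1]; have [] := g'P t _; rewrite ?(ltW t0) ?(ltW t1).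
- apply: continuous_in_subspaceT => t; rewrite inE /= in_itv /= => /g'P[[dgt _] _].
  exact/differentiable_continuous/derivable1_diffP.
rewrite in_itv /= => /g'P[_ le1]; rewrite subr0 mulr1 => E.
have : g 1 - g 0 = nrm (f z - f w).
  rewrite /g rc1 mul1r mul0r addr0 [w + (z - w)]addrC subrK -ReB -mulrBr cl.
  by [].
by rewrite E => <-.
Qed.

Lemma derive_eq0_const (f : C -> C) (w z : C) :
  (forall t : R, 0 <= t <= 1 -> is_derive (w + rc t * (z - w)) 1 f 0) -> f z = f w.
Proof.
move=> H; apply/eqP; rewrite -subr_eq0 -nrm_eq0 eq_le nrm_ge0 andbT.
rewrite -(mul0r (nrm (z - w))); apply: mean_value_inequality => t /H ?.
by exists 0; rewrite ?nrm0.
Qed.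

Lemma segment_in_ball (a w z : C) (r t : R) : 0 <= t <= 1 ->
  nrm (w - a) < r -> nrm (z - a) < r -> nrm (w + rc t * (z - w) - a) < r.
Proof.
move=> /andP[t0 t1] wr zr.
have -> : w + rc t * (z - w) - a = rc (1 - t) * (w - a) + rc t * (z - a).
  by rewrite rcB rc1; ring.
apply: le_lt_trans (nrmD _ _) _; rewrite !nrmM !nrm_rc (ger0_norm t0) ger0_norm; last by lra.
have [->|tn0] := eqVneq t 0; first by rewrite mul0r addr0 subr0 mul1r.
have {}t0 : 0 < t by rewrite lt_def tn0.
have := nrm_ge0 (w - a); nra.
Qed.

(** Two Cauchy estimates: the derivative is at most 4 M / r on the half disc, so f(z + (b - a)) -
    f(z) is at most (4 M / r) |b - a|, and the Cauchy estimate for this difference bounds f'(b) -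
    f'(a). Thus f' is Lipschitz at a without being known to be differentiable. *)
Lemma taylor2 (f : C -> C) a (r M : R) l h : 0 < r ->
  (forall z, nrm (z - a) < r -> differentiable f z) ->
  (forall z, nrm (z - a) < r -> nrm (f z) <= M) ->
  is_derive a 1 f l -> nrm h < r / 4 ->
  nrm (f (a + h) - f a - h * l) <= 32 * M / r ^+ 2 * nrm h ^+ 2.
Proof.
move=> r0 df fM dl hr.
have M0 : 0 <= M by apply: le_trans (nrm_ge0 (f a)) (fM _ _); rewrite subrr nrm0.
have f'le z m : nrm (z - a) < r / 2 -> is_derive z 1 f m -> nrm m <= 4 * M / r.
  move=> za dm; have -> : 4 * M / r = 2 * M / (r / 2) by field; rewrite gt_eqF.
  have sub v : nrm (v - z) < r / 2 -> nrm (v - a) < r.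
    by move=> vz; apply: le_lt_trans (nrm_triangle z _ _) _; lra.
  apply: (@cauchy_estimate f z) => //; first by rewrite divr_gt0.
  - by move=> v /sub/df.
  - by move=> v /sub/fM.
have flip z w : nrm (z - a) < r / 2 -> nrm (w - a) < r / 2 ->
    nrm (f z - f w) <= 4 * M / r * nrm (z - w).
  move=> za wa; apply: mean_value_inequality => t t01.
  have ta := segment_in_ball t01 wa za.
  have dt : differentiable f (w + rc t * (z - w)) by apply: df; lra.
  by exists ('d f (w + rc t * (z - w)) 1); [exact: diff_is_derive|
     apply: f'le ta _; exact: diff_is_derive].
have shiftE z v : z + v - (a + v) = z - a by rewrite opprD addrACA subrr addr0.
have lipd b m : nrm (b - a) < r / 4 -> is_derive b 1 f m ->
    nrm (m - l) <= 32 * M / r ^+ 2 * nrm (b - a).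
  move=> ba dm.
  pose k z := f (z + (b - a)) - f z.
  have -> : 32 * M / r ^+ 2 * nrm (b - a) =
     2 * (4 * M / r * nrm (b - a)) / (r / 4) by field; rewrite gt_eqF.
  have r40 : 0 < r / 4 by rewrite divr_gt0.
  have nb z : nrm (z - a) < r / 4 -> nrm (z + (b - a) - a) < r / 2.
    move=> za; have -> : z + (b - a) - a = (z - a) + (b - a) by ring.
    by apply: le_lt_trans (nrmD _ _) _; lra.
  apply: (cauchy_estimate (f := k) (a := a) r40).
  - move=> z za; apply: differentiableB; last by apply: df; lra.
    apply: (@differentiable_comp _ _ _ _ (fun z => z + (b - a)) f).
      by apply: differentiableD; [exact: ex_diff|exact: differentiable_cst].
    by apply: df; have := nb z za; lra.
  - move=> z za; have -> : nrm (b - a) = nrm (z + (b - a) - z) by congr nrm; ring.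
    by apply: flip; [exact: nb|lra].
  - have E : a + (b - a) = b by ring.
    apply: is_deriveB.
    have := @is_derive_compC _ C f (fun z => z + (b - a)) a 1 m.
    rewrite E => /(_ dm); rewrite scale1r; apply.
    by apply: is_derive_eq; rewrite addr0.
have -> : f (a + h) - f a - h * l = (f (a + h) - (a + h) * l) - (f a - a * l) by ring.
apply: le_trans (@mean_value_inequality (fun z => f z - z * l) a (a + h)
  (32 * M / r ^+ 2 * nrm h) _) _; last first.
  by rewrite [a + h]addrC addrK expr2 mulrA.
move=> t /andP[t0 t1].
rewrite [a + h - a]addrC addKr; set b := a + rc t * h.
have bE : b - a = rc t * h by rewrite /b addrC addKr.
have bh : nrm (b - a) <= nrm h.
  by rewrite bE nrmM nrm_rc ger0_norm // ler_piMl // nrm_ge0.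
have db : differentiable f b by apply: df; lra.
exists ('d f b 1 - l).
  apply: is_deriveB; first exact: diff_is_derive.
  have := @is_deriveM _ _ id (cst l) b 1 1 0 _ _.
  by rewrite scaler0 add0r /= [l *: 1]mulr1; apply.
apply: le_trans (lipd b _ _ (diff_is_derive db)) _; first by lra.
by rewrite ler_wpM2l // divr_ge0 ?exprn_ge0 ?mulr_ge0 // ltW.
Qed.

End MeanValue.

(** * Compactness of squares and uniform thresholds *)

Section Compactness.
Context {R : realType}.
Local Notation C := (Cx R).

Lemma compact_nat {T : topologicalType} (K : set T) (P : nat -> T -> Prop) :
  compact K ->
  (forall x, K x -> exists N, \forall y \near x, forall n, (N <= n)%N -> P n y) ->
  exists N, forall n, (N <= n)%N -> forall x, K x -> P n x.
Proof.
move=> /compact_near_coveringP cK H.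
have [|N _ HN] := cK nat \oo P _; last by exists N => n Nn x Kx; exact: HN n Nn x Kx.
move=> x Kx; have [N HN] := H x Kx.
exists ([set y | forall n, (N <= n)%N -> P n y], [set n | (N <= n)%N]) => /=.
  by split => //; exists N.
by move=> [y n] /= [Hy Nn]; exact: Hy.
Qed.

Definition csquare (r : R) : set C := [set z | `|Re z| <= r /\ `|Im z| <= r].

Lemma csquare_compact r : compact (csquare r).
Proof.
have -> : csquare r = (fun p : R * R => mkc p.1 p.2) @` (`[- r, r] `*` `[- r, r]).
  apply/seteqP; split => [z|_ [[x y] /= [+ +] <-]].
    rewrite /csquare /= !ler_norml => -[zr zi].
    exists (Re z, Im z); first by rewrite /= !in_itv.
    by apply: cx_ext.
  by rewrite /csquare /= !ler_norml !in_itv.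
apply: continuous_compact; last by apply: compact_setX; exact: segment_compact.
by apply: continuous_subspaceT; exact: mkc_continuous.
Qed.

Lemma csquare_bounded (f : C -> C) r : (forall z, {for z, continuous f}) ->
  exists K : R, forall z, csquare r z -> nrm (f z) <= K.
Proof.
move=> fc.
have [N HN] : exists N : nat, forall n, (N <= n)%N -> forall z, csquare r z ->
    nrm (f z) <= n%:R.
  apply: compact_nat; first exact: csquare_compact.
  move=> z _; exists (Num.truncn (nrm (f z) + 1)).+1.
  have [d d0 dH] := (nbhs_nrmP _ _).1 ((cvg_nrmP _ _ _).1 (fc z) 1 ltr01).
  apply/nbhs_nrmP; exists d => // w /dH wz n Nn.
  have := truncnS_gt (nrm (f z) + 1); move: Nn; rewrite -(ler_nat R).
  by have := nrm_subD (f w) (f z); lra.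
by exists N%:R => z; exact: HN.
Qed.

Lemma nrm_lim_le {V : normedModType C} (u : nat -> V) (l : V) (K : R) :
  u n @[n --> \oo] --> l -> (forall n, nrm (u n) <= K) -> nrm l <= K.
Proof.
move=> ul uK; apply/ler_addgt0Pr => e e0.
have [n _ /(_ n (leqnn n)) H] := (cvg_nrmP _ _ _).1 ul e e0.
by have := nrm_subD l (u n); have := uK n; rewrite nrmBC in H; move: H => /=; lra.
Qed.

End Compactness.

Lemma pair_continuous {T U V : topologicalType} (f : T -> U) (g : T -> V) (x : T) :
  {for x, continuous f} -> {for x, continuous g} ->
  {for x, continuous (fun t => (f t, g t))}.
Proof. by move=> H1 H2; exact: (cvg_pair H1 H2). Qed.

(** * Continuous logarithms on intervals and squares *)

Section LogLift.
Context {R : realType}.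
Local Notation C := (Cx R).

Lemma sum_continuous {T : topologicalType} n (g : nat -> T -> C) (x : T) :
  (forall i, (i < n)%N -> {for x, continuous (g i)}) ->
  {for x, continuous (fun t => \sum_(i < n) g i t)}.
Proof.
elim: n => [|n IH] H.
  rewrite (_ : (fun t => _) = cst 0); first exact: cvg_cst.
  by apply/funext => t; rewrite big_ord0.
rewrite (_ : (fun t => _) = (fun t => \sum_(i < n) g i t + g n t)); last first.
  by apply/funext => t; rewrite big_ord_recr.
apply: cvgD; last exact: H.
by apply: IH => i ni; apply: H; rewrite ltnS ltnW.
Qed.

Lemma Re_near1 (z : C) : nrm (z - 1) < 1 -> 0 < Re z.
Proof.
move=> /(le_lt_trans (Re_le_nrm _)); rewrite ReB /=.
by have := ler_norm (- (Re z - 1)); rewrite normrN; lra.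
Qed.

(* Subdivide [0, 1] so finely that consecutive values of the path Xi(., p) have
   ratio close to 1, uniformly in p, and add up principal logarithms. *)
Lemma log_lift_homotopy {T : topologicalType} (K : set T) (Xi : R -> T -> C) :
  compact K ->
  (forall t p, 0 <= t <= 1 -> K p ->
     {for (t, p), continuous (fun q : R * T => Xi q.1 q.2)}) ->
  (forall t p, 0 <= t <= 1 -> K p -> Xi t p != 0) ->
  exists L : T -> C, forall p, K p ->
    {for p, continuous L} /\ cexp (L p) = Xi 1 p / Xi 0 p.
Proof.
move=> cK Xc X0.
have [N HN] : exists N, forall n, (N <= n)%N -> forall q : R * T,
    (`[0%R, 1%R] `*` K) q -> forall t, 0 <= t <= 1 -> `|t - q.1| <= n.+1%:R^-1 ->
    nrm (Xi t q.2 / Xi q.1 q.2 - 1) < 1.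
  apply: (compact_nat (P := fun n (q : R * T) => forall t, 0 <= t <= 1 ->
    `|t - q.1| <= n.+1%:R^-1 -> nrm (Xi t q.2 / Xi q.1 q.2 - 1) < 1)).
    by apply: compact_setX => //; exact: segment_compact.
  move=> [t0 p0] [/= t0r Kp0]; rewrite in_itv /= in t0r.
  have n0 : 0 < nrm (Xi t0 p0) by rewrite nrm_gt0 X0.
  have e0 : 0 < nrm (Xi t0 p0) / 4 by rewrite divr_gt0.
  have [[U V] /= [/nbhs_ballP[d /= d0 dU] V0] UV] :=
    (cvg_nrmP _ _ _).1 (Xc t0 p0 t0r Kp0) _ e0.
  exists (Num.truncn (2 / d)).
  exists (ball t0 (d / 2), V) => /=; first by split=> //; apply: nbhsx_ballx; rewrite divr_gt0.
  move=> [t p] /= [td Vp] n Nn t' t'r t't.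
  have nd : n.+1%:R^-1 < d / 2.
    rewrite invf_plt ?posrE ?divr_gt0 // invf_div.
    by apply: lt_le_trans (truncnS_gt _) _; rewrite ler_nat ltnS.
  rewrite /ball /= in td; rewrite /= in t't.
  have tU : U t by apply: dU; rewrite /ball /=; lra.
  have t'U : U t'.
    apply: dU; rewrite /ball /= (_ : t0 - t' = (t0 - t) - (t' - t)); last by ring.
    rewrite (le_lt_trans (ler_normB _ _)) // [d]splitr; apply: ltrD => //.
    exact: le_lt_trans t't nd.
  have H1 : nrm (Xi t p - Xi t0 p0) < nrm (Xi t0 p0) / 4 by exact: (UV (t, p)).
  have H2 : nrm (Xi t' p - Xi t0 p0) < nrm (Xi t0 p0) / 4 by exact: (UV (t', p)).
  have H3 := nrm_subD (Xi t0 p0) (Xi t p); rewrite nrmBC in H3.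
  have X1 : Xi t p != 0 by rewrite -nrm_gt0; lra.
  have -> : Xi t' p / Xi t p - 1 = (Xi t' p - Xi t p) / Xi t p by field.
  rewrite nrmM nrmV ltr_pdivrMr ?nrm_gt0 // mul1r.
  have := nrm_triangle (Xi t0 p0) (Xi t' p) (Xi t p); rewrite (nrmBC (Xi t0 p0)).
  by lra.
pose n := N.+1; pose tt i : R := i%:R / n%:R.
have n0 : (0 : R) < n%:R by rewrite ltr0n.
have ttr i : (i <= n)%N -> 0 <= tt i <= 1.
  by move=> ni; rewrite divr_ge0 //= ler_pdivrMr // mul1r ler_nat.
have ttS i : `|tt i.+1 - tt i| <= n%:R^-1.
  by rewrite /tt -mulrBl -natr1 addrC addKr mul1r ger0_norm // invr_ge0 ltW.
have rat p i : K p -> (i < n)%N -> nrm (Xi (tt i.+1) p / Xi (tt i) p - 1) < 1.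
  move=> Kp ni; apply: (HN N (leqnn N) (tt i, p)) => //=.
    by split => //=; rewrite in_itv /= ttr // ltnW.
  exact: ttr.
have Xtc p i : K p -> (i <= n)%N -> {for p, continuous (Xi (tt i))}.
  move=> Kp ni; have := Xc (tt i) p (ttr i ni) Kp => H.
  apply: (@cvg_comp _ _ _ (fun p => (tt i, p)) (fun q : R * T => Xi q.1 q.2)
    (nbhs p) (nbhs (tt i, p))) H.
  by apply: (cvg_pair (G := nbhs (tt i))); [exact: cvg_cst|exact: cvg_id].
exists (fun p => \sum_(i < n) Log (Xi (tt i.+1) p / Xi (tt i) p)) => p Kp.
split.
  apply: (sum_continuous (g := fun i p => Log (Xi (tt i.+1) p / Xi (tt i) p))) => i ni.
  apply: (continuous_comp (f := fun p => Xi (tt i.+1) p / Xi (tt i) p)).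
    apply: cvgM; first exact: Xtc.
    by apply: cvgV; [apply: X0 => //; exact: ttr (ltnW ni)|apply: Xtc => //; exact: ltnW].
  by apply: Log_continuous; apply: Re_near1; exact: rat.
have part k : (k <= n)%N ->
    cexp (\sum_(i < k) Log (Xi (tt i.+1) p / Xi (tt i) p)) = Xi (tt k) p / Xi 0 p.
  elim: k => [|k IH] kn.
    by rewrite big_ord0 cexp0 /tt mul0r divff // X0 // lexx ler01.
  rewrite big_ord_recr /= cexpD IH ?(ltnW kn) // LogK; last first.
    by apply: Re_near1; exact: rat.
  by rewrite mulrC mulrA divfK // X0 //; exact: ttr (ltnW kn).
by rewrite part // /tt divff // gt_eqF.
Qed.

(** The parameter domain is star-shaped about 0, so the family p |-> psi(t p) is the homotopy to a
    constant; the next two lemmas repeat this on squares. *)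
Lemma log_lift_path (psi : R -> C) : continuous psi ->
  (forall t, 0 <= t <= 1 -> psi t != 0) ->
  exists L : R -> C, forall t, 0 <= t <= 1 ->
    {for t, continuous L} /\ cexp (L t) = psi t.
Proof.
move=> pc p0; have [z0 z0E] := cexp_surj (p0 0 (introT andP (conj (lexx 0) ler01))).
have [|||L HL] := @log_lift_homotopy R `[0%R, 1%R] (fun t p => psi (t * p)) _ _ _.
- exact: segment_compact.
- move=> t p _ _; apply: (continuous_comp (f := fun q : R * R => q.1 * q.2)).
    by apply: cvgM; [exact: cvg_fst|exact: cvg_snd].
  exact: pc.
- move=> t p /andP[t0 t1]; rewrite /= in_itv /= => /andP[q0 q1]; apply: p0.
  by rewrite mulr_ge0 //= mulr_ile1.
exists (fun t => L t + z0) => t t01.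
have [|Lc Le] := HL t; first by rewrite /= in_itv.
split; first exact: (cvgD Lc (cvg_cst z0)).
by rewrite cexpD Le mul1r mul0r z0E divfK // p0 // lexx ler01.
Qed.

Lemma log_lift_square (psi : R * R -> C) : continuous psi ->
  (forall s t, 0 <= s <= 1 -> 0 <= t <= 1 -> psi (s, t) != 0) ->
  exists L : R * R -> C, forall s t, 0 <= s <= 1 -> 0 <= t <= 1 ->
    {for (s, t), continuous L} /\ cexp (L (s, t)) = psi (s, t).
Proof.
move=> pc p0; have i0 : 0 <= (0 : R) <= 1 by apply/andP; split; [exact: lexx|exact: ler01].
have [z0 z0E] := cexp_surj (p0 0 0 i0 i0).
have [|||L HL] := @log_lift_homotopy (R * R)%type (`[0%R, 1%R] `*` `[0%R, 1%R])
  (fun t p => psi (t * p.1, t * p.2)) _ _ _.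
- by apply: compact_setX; exact: segment_compact.
- move=> t p _ _; apply: (continuous_comp
    (f := fun q : R * (R * R) => (q.1 * q.2.1, q.1 * q.2.2))); last exact: pc.
  have c1 : {for (t, p), continuous (fun q : R * (R * R) => q.2.1)}.
    by apply: (continuous_comp (f := snd) (g := fst)); [exact: cvg_snd|exact: cvg_fst].
  have c2 : {for (t, p), continuous (fun q : R * (R * R) => q.2.2)}.
    by apply: (continuous_comp (f := snd) (g := snd)); [exact: cvg_snd|exact: cvg_snd].
  have c0 : {for (t, p), continuous (@fst R (R * R)%type)} by exact: cvg_fst.
  exact: (pair_continuous (cvgM c0 c1) (cvgM c0 c2)).
- move=> t [p q] /andP[t0 t1] /=; rewrite !in_itv /= => -[/andP[p1 p2] /andP[q1 q2]].
  by apply: p0; rewrite mulr_ge0 //= mulr_ile1.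
exists (fun t => L t + z0) => s t s01 t01.
have [|Lc Le] := HL (s, t); first by rewrite /= !in_itv.
split; first exact: (cvgD Lc (cvg_cst z0)).
by rewrite cexpD Le /= !mul1r !mul0r z0E divfK // p0.
Qed.

Lemma log_lift_csquare (psi : C -> C) r : 0 <= r ->
  (forall z, csquare r z -> {for z, continuous psi}) ->
  (forall z, csquare r z -> psi z != 0) ->
  exists L : C -> C, forall z, csquare r z ->
    {for z, continuous L} /\ cexp (L z) = psi z.
Proof.
move=> r0 pc p0; have s0 : csquare r 0 by rewrite /csquare /= normr0.
have scl t z : 0 <= t <= 1 -> csquare r z -> csquare r (rc t * z).
  move=> /andP[t0 t1] [zr zi]; rewrite /csquare /= ReM ImM /= !mul0r subr0 addr0.
  by rewrite !normrM ger0_norm //; split; apply: le_trans (ler_piMl _ t1) _.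
have [z0 z0E] := cexp_surj (p0 0 s0).
have [|||L HL] := @log_lift_homotopy C (csquare r) (fun t z => psi (rc t * z)) _ _ _.
- exact: csquare_compact.
- move=> t z t01 zr; apply: (continuous_comp (f := fun q : R * C => rc q.1 * q.2)).
    apply: (@cvgM C (R * C)%type (nbhs (t, z)) _ (fun q => rc q.1) snd); last exact: cvg_snd.
    by apply: (continuous_comp (f := fst) (g := rc)); [exact: cvg_fst|exact: rc_continuous].
  by apply: pc; exact: scl.
- by move=> t z t01 zr; apply: p0; exact: scl.
exists (fun z => L z + z0) => z zr.
have [Lc Le] := HL z zr.
split; first exact: (cvgD Lc (cvg_cst z0)).
by rewrite cexpD Le rc1 mul1r rc0 mul0r z0E divfK // p0.
Qed.

End LogLift.

(** * Limits of holomorphic functions and implicit functions *)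

Section Limits.
Context {R : realType}.
Local Notation C := (Cx R).

(* The differential of a scalar function, kept folded: comparing the various
   module structures on C is expensive. *)
Definition dif {V : normedModType C} (f : V -> C) (p v : V) : C := 'd f p v.

Section Dif.
Context {V : normedModType C}.
Implicit Types (f : V -> C) (p v : V).

Lemma difD f p v w : dif f p (v + w) = dif f p v + dif f p w.
Proof. exact: linearD. Qed.

Lemma difZ f p (a : C) v : dif f p (a *: v) = a * dif f p v.
Proof. exact: linearZ. Qed.

Lemma dif0 f p : dif f p 0 = 0.
Proof. exact: linear0. Qed.

Lemma dif_nrm f p : differentiable f p -> forall e : R, 0 < e ->
  exists2 d : R, 0 < d & forall h, nrm h < d ->
    nrm (f (p + h) - f p - dif f p h) <= e * nrm h.
Proof. exact: diff_nrm. Qed.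

Lemma dif_bounded f p :
  differentiable f p -> exists2 K : R, 0 < K & forall v, nrm (dif f p v) <= K * nrm v.
Proof.
move=> df; have [k k0 kE] := linear_lipschitz (diff_continuous df).
have [r r0 rE] := rc_gt0E k0; exists r => // v.
by rewrite -rc_le rcM -!nrmE -rE kE.
Qed.

Lemma is_derive_dif f (g : C -> V) (z : C) (l : V) : differentiable f (g z) ->
  is_derive z 1 g l -> is_derive z 1 (fun t => f (g t)) (dif f (g z) l).
Proof. exact: is_derive_comp. Qed.

End Dif.

Lemma dif2E (f : Cx2 R -> C) (p h : Cx2 R) : differentiable f p ->
  dif f p h = h.1 * dif f p ((1, 0) : Cx2 R) + h.2 * dif f p ((0, 1) : Cx2 R).
Proof. exact: diff2E. Qed.

Lemma line_is_derive {V : normedModType C} (p h : V) (t : C) :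
  is_derive t 1 (fun t : C => p + t *: h) h.
Proof.
apply: nrm_is_derive => e e0; exists 1 => // k _.
have -> : p + (t + k) *: h - (p + t *: h) - k *: h = 0.
  by rewrite scalerDl addrA [p + _ + _]addrC addrK subrr.
by rewrite nrm0 mulr_ge0 ?nrm_ge0 // ltW.
Qed.

Lemma taylor_along {V : normedModType C} (f : V -> C) (p h : V) (r M : R) : 0 < r ->
  (forall q, nrm (q - p) < r -> differentiable f q /\ nrm (f q) <= M) ->
  nrm h < r / 4 ->
  nrm (f (p + h) - f p - dif f p h) <= 32 * M / r ^+ 2 * nrm h ^+ 2.
Proof.
move=> r0 H hr.
have [->|h0] := eqVneq h 0.
  by rewrite addr0 subrr dif0 subr0 !nrm0 expr0n /= mulr0.
have n0 : 0 < nrm h by rewrite nrm_gt0.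
have inb t : nrm (t - 0 : C) < r / nrm h -> nrm (p + t *: h - p) < r.
  by rewrite subr0 addrC addKr nrmZ ltr_pdivlMr.
have dk (t : C) l : is_derive t 1 (fun t : C => p + t *: h) l ->
    differentiable f (p + t *: h) -> is_derive t 1 (fun t : C => f (p + t *: h)) (dif f (p + t *: h) l).
  by move=> dl df; exact: (is_derive_dif (g := fun t : C => p + t *: h) df dl).
have := @taylor2 R (fun t => f (p + t *: h)) 0 (r / nrm h) M (dif f p h) 1.
rewrite add0r scale1r scale0r addr0 mul1r nrm1 expr1n mulr1.
have -> : 32 * M / (r / nrm h) ^+ 2 = 32 * M / r ^+ 2 * nrm h ^+ 2.
  by field; rewrite !gt_eqF.
apply; first by rewrite divr_gt0.
- move=> t /inb tr; have [df _] := H _ tr.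
  exact: is_derive_diff (dk t h (line_is_derive p h t) df).
- by move=> t /inb tr; have [] := H _ tr.
- have [|df _] := H p; first by rewrite subrr nrm0.
  have := dk 0 h (line_is_derive p h 0); rewrite scale0r addr0; exact.
- by rewrite ltr_pdivlMr // ltr_pdivlMr //; clear -hr; lra.
Qed.

(* Weierstrass: pointwise convergence of a bounded sequence suffices, since
   Cauchy estimates make the difference quotients converge. *)
Lemma limit_diff2 (F : nat -> Cx2 R -> C) (G : Cx2 R -> C) (p : Cx2 R) (r M : R) :
  0 < r ->
  (forall n q, nrm (q - p) < r -> differentiable (F n) q /\ nrm (F n q) <= M) ->
  (forall q, nrm (q - p) < r -> F n q @[n --> \oo] --> G q) ->
  differentiable G p.
Proof.
move=> r0 H lim.
have pp : nrm (p - p) < r by rewrite subrr nrm0.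
have M0 : 0 <= M by apply: le_trans (nrm_ge0 _) (proj2 (H 0 p pp)).
pose B := 32 * M / r ^+ 2.
have B0 : 0 <= B by rewrite divr_ge0 ?exprn_ge0 ?mulr_ge0 // ltW.
have T n h : nrm h < r / 4 -> nrm (F n (p + h) - F n p - dif (F n) p h) <= B * nrm h ^+ 2.
  by apply: taylor_along => // q; exact: H.
have cvD v : nrm v <= 1 -> exists l : C, dif (F n) p v @[n --> \oo] --> l.
  move=> v1; apply: cx_cauchy => e e0.
  (* For |h| <= t each Taylor error is at most B t^2 <= t e / 8, and division by t leaves e / 8. *)
  have [t [t0 tr tB]] : exists t, [/\ 0 < t, t <= r / 8 & t * B <= e / 8].
    exists (Num.min (r / 8) (e / (8 * (B + 1)))); split.
    - by rewrite lt_min !divr_gt0 // mulr_gt0 //; clear -B0; lra.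
    - by rewrite ge_min lexx.
    - apply: (@le_trans _ _ (e / (8 * (B + 1)) * (B + 1))).
        have BB : 0 <= 8 * (B + 1) by clear -B0; lra.
        apply: ler_pM => //; [|by rewrite ge_min lexx orbT|clear -B0; lra].
        by rewrite le_min !divr_ge0 // ltW.
      by rewrite le_eqVlt; apply/orP; left; apply/eqP; field; rewrite gt_eqF //; clear -B0; lra.
  have [h hE] : exists h, h = rc t *: v by exists (rc t *: v).
  have ht : nrm h <= t by rewrite hE nrmZ nrm_rc gtr0_norm // ler_piMr // ltW.
  have hr : nrm h < r / 4 by clear -ht tr r0; lra.
  have phr : nrm (p + h - p) < r by rewrite addrC addKr; clear -hr r0; lra.
  have te : 0 < t * e / 16 by rewrite divr_gt0 // mulr_gt0.
  have [N1 _ HN1] := (cvg_nrmP _ _ _).1 (lim _ phr) _ te.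
  have [N2 _ HN2] := (cvg_nrmP _ _ _).1 (lim _ pp) _ te.
  exists (maxn N1 N2) => n m; rewrite !geq_max => /andP[n1 n2] /andP[m1 m2].
  have Tn := T n h hr; have Tm := T m h hr.
  have {}HN1 : nrm (F n (p + h) - F m (p + h)) < t * e / 8.
    have := nrm_triangle (G (p + h)) (F n (p + h)) (F m (p + h)).
    rewrite [nrm (G _ - _)]nrmBC => T1; apply: le_lt_trans T1 _.
    rewrite [t * e / 8](_ : _ = t * e / 16 + t * e / 16); last by clear; field.
    by apply: ltrD; [exact: HN1|exact: HN1].
  have {}HN2 : nrm (F n p - F m p) < t * e / 8.
    have := nrm_triangle (G p) (F n p) (F m p).
    rewrite [nrm (G _ - _)]nrmBC => T1; apply: le_lt_trans T1 _.
    rewrite [t * e / 8](_ : _ = t * e / 16 + t * e / 16); last by clear; field.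
    by apply: ltrD; [exact: HN2|exact: HN2].
  have E : rc t * (dif (F n) p v - dif (F m) p v) =
     (F n (p + h) - F m (p + h)) - (F n p - F m p)
     - (F n (p + h) - F n p - dif (F n) p h) + (F m (p + h) - F m p - dif (F m) p h).
    have dE k : dif (F k) p h = rc t * dif (F k) p v by rewrite hE difZ.
    have aux (a b c d x y w : C) :
        w * (x - y) = a - b - (c - d) - (a - c - w * x) + (b - d - w * y) by ring.
    by rewrite !dE; exact: aux.
  rewrite -(ltr_pM2l t0).
  have -> : t * nrm (dif (F n) p v - dif (F m) p v) = nrm (rc t * (dif (F n) p v - dif (F m) p v)).
    by rewrite nrmM nrm_rc gtr0_norm.
  rewrite E.
  have h2 : B * nrm h ^+ 2 <= t * e / 8.
    apply: (@le_trans _ _ (B * t ^+ 2)).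
      by rewrite ler_wpM2l // ler_pXn2r ?nnegrE ?nrm_ge0 // ltW.
    by clear -B0 t0 tB; rewrite expr2; nra.
  have te0 : 0 < t * e by rewrite mulr_gt0.
  have fin (y1 y2 y3 y4 y5 y6 y7 w : R) : 0 < w -> y1 < w / 8 -> y2 < w / 8 ->
      y3 <= w / 8 -> y4 <= w / 8 -> y5 <= y1 + y2 -> y6 <= y5 + y3 -> y7 <= y6 + y4 -> y7 < w.
    by clear; lra.
  exact: (fin _ _ _ _ _ _ _ _ te0 HN1 HN2 (le_trans Tn h2) (le_trans Tm h2)
    (nrmB _ _) (nrmB _ _) (nrmD _ _)).
have [a Ha] : exists a : C, dif (F n) p ((1, 0) : Cx2 R) @[n --> \oo] --> a.
  by apply: cvD; rewrite nrm_pair nrm1 nrm0 ge_max lexx ler01.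
have [b Hb] : exists b : C, dif (F n) p ((0, 1) : Cx2 R) @[n --> \oo] --> b.
  by apply: cvD; rewrite nrm_pair nrm1 nrm0 ge_max lexx ler01.
have [|//] := @nrm_diff2 R G p a b => e e0.
have B1 : 0 < B + 1 by clear -B0; lra.
exists (Num.min (r / 4) (e / (B + 1))); first by rewrite lt_min !divr_gt0.
move=> h; rewrite lt_min => /andP[hr he].
have : nrm (G (p + h) - G p - lin2 a b h) <= B * nrm h ^+ 2.
  apply: (@nrm_lim_le R C (fun n => F n (p + h) - F n p - dif (F n) p h)); last first.
    by move=> n; exact: T.
  have phr : nrm (p + h - p) < r by rewrite addrC addKr; clear -hr r0; lra.
  apply: cvgB; first exact: (cvgB (lim _ phr) (lim _ pp)).
  have -> : (fun n => dif (F n) p h) =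
      (fun n => h.1 * dif (F n) p ((1, 0) : Cx2 R) + h.2 * dif (F n) p ((0, 1) : Cx2 R)).
    by apply/funext => n; exact: (dif2E h (proj1 (H n p pp))).
  exact: (cvgD (cvgM (cvg_cst h.1) Ha) (cvgM (cvg_cst h.2) Hb)).
move=> /le_trans; apply; rewrite expr2 mulrA ler_wpM2r ?nrm_ge0 //.
rewrite ltr_pdivlMr // in he; have := nrm_ge0 h; move: (nrm h) he; clear -B0 => y ? ?; nra.
Qed.

(** Y(t) is a fixed point of a contraction of ratio 1/2. The contraction makes Y Lipschitz at t0,
    and linearising Y = g(t, Y) gives the differential (1 - g_y)^-1 g_t. *)
Lemma implicit_diff (g : Cx2 R * C -> C) (Y : Cx2 R -> C) (t0 : Cx2 R) (d0 : R) :
  0 < d0 -> differentiable g (t0, Y t0) ->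
  (forall t, nrm (t - t0) < d0 -> Y t = g (t, Y t) /\
     nrm (g (t, Y t) - g (t, Y t0)) <= 2^-1 * nrm (Y t - Y t0)) ->
  (forall y, nrm (y - Y t0) < d0 ->
     nrm (g (t0, y) - g (t0, Y t0)) <= 2^-1 * nrm (y - Y t0)) ->
  differentiable Y t0.
Proof.
move=> d00 dg H1 H2; pose D := dif g (t0, Y t0).
have [K K0 DK] := dif_bounded dg.
pose gy := D ((0, 1) : Cx2 R * C).
have DE (h : Cx2 R) (k : C) : D (h, k) = D (h, 0) + k * gy.
  have -> : (h, k) = (h, 0) + k *: ((0, 1) : Cx2 R * C) :> (Cx2 R * C).
    by congr pair => /=; rewrite ?scaler0 ?addr0 ?add0r // /GRing.scale /= mulr1.
  by rewrite /D difD difZ.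
(* If g_y were 1, a small real displacement x of y would move g by at least (3/4) x, against the
   ratio 1/2. *)
have gy1 : 1 - gy != 0.
  apply/eqP => /eqP; rewrite subr_eq0 => /eqP gyE.
  have [d d1 dH] := dif_nrm dg (divr_gt0 (ltr01 : 0 < (1 : R)) (ltr0Sn R 3)).
  pose x := Num.min d d0 / 2.
  have x2 : 0 < Num.min d d0 by rewrite lt_min d1.
  have x0 : 0 < x by rewrite divr_gt0.
  have xd : x < d by have : Num.min d d0 <= d; [rewrite ge_min lexx|rewrite /x; move: (Num.min d d0) x2; clear => *; lra].
  have xd0 : x < d0 by have : Num.min d d0 <= d0; [rewrite ge_min lexx orbT|rewrite /x; move: (Num.min d d0) x2; clear => *; lra].
  have nx : nrm ((0, rc x) : Cx2 R * C) = x.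
    by rewrite nrm_pair nrm0 nrm_rc gtr0_norm // max_r // ltW.
  have := dH (0, rc x); rewrite nx => /(_ xd).
  have -> : (t0, Y t0) + (0, rc x) = (t0, Y t0 + rc x) :> (Cx2 R * C).
    by congr pair => /=; rewrite addr0.
  rewrite -/D DE -gyE mulr1.
  have -> : D (0, 0) = 0 by exact: dif0.
  have := H2 (Y t0 + rc x); rewrite addrAC subrr add0r nrm_rc gtr0_norm // => /(_ xd0).
  have := nrm_subD (rc x) (g (t0, Y t0 + rc x) - g (t0, Y t0)).
  rewrite [nrm (rc x - _)]nrmBC nrm_rc gtr0_norm // => T1 T2 T3.
  have fin (y1 y2 : R) : x <= y1 + y2 -> y2 <= 2^-1 * x -> y1 <= 1 / 4 * x -> False.
    by clear -x0; lra.
  exact: fin T1 T2 T3.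
have lip : exists2 d : R, 0 < d & forall h, nrm h < d ->
    nrm (Y (t0 + h) - Y t0) <= 2 * (K + 1) * nrm h.
  have [d d1 dH] := dif_nrm dg (ltr01 : 0 < (1 : R)).
  exists (Num.min d d0); first by rewrite lt_min d1.
  move=> h; rewrite lt_min => /andP[hd hd0].
  have [|E1 E2] := H1 (t0 + h); first by rewrite addrC addKr.
  have nh : nrm ((h, 0) : Cx2 R * C) = nrm h.
    by rewrite nrm_pair nrm0 max_l // nrm_ge0.
  have := dH (h, 0); rewrite -/D nh => /(_ hd).
  have -> : (t0, Y t0) + (h, 0) = (t0 + h, Y t0) :> (Cx2 R * C).
    by congr pair => /=; rewrite addr0.
  have := DK (h, 0); rewrite -/D nh => D1 D2.
  have [|E3 _] := H1 t0; first by rewrite subrr nrm0.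
  have N1 := nrm_subD (g (t0 + h, Y t0) - g (t0, Y t0)) (D (h, 0)).
  have N2 := nrm_triangle (g (t0 + h, Y t0)) (Y (t0 + h)) (Y t0).
  have N3 : nrm (Y (t0 + h) - g (t0 + h, Y t0)) <= 2^-1 * nrm (Y (t0 + h) - Y t0).
    by rewrite {1}E1.
  have N4 : nrm (g (t0 + h, Y t0) - Y t0) = nrm (g (t0 + h, Y t0) - g (t0, Y t0)).
    by rewrite -E3.
  rewrite N4 in N2.
  have fin (y1 y2 y3 y4 y5 y6 : R) : y3 <= y5 + y4 -> y1 <= y2 + y3 ->
      y2 <= 2^-1 * y1 -> y4 <= K * y6 -> y5 <= 1 * y6 -> y1 <= 2 * (K + 1) * y6.
    by clear; lra.
  exact: fin N1 N2 N3 D1 D2.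
pose c := (1 - gy)^-1.
pose L1 := c * D ((1, 0) : Cx2 R, 0); pose L2 := c * D ((0, 1) : Cx2 R, 0).
have LE (h : Cx2 R) : lin2 L1 L2 h = c * D (h, 0).
  have -> : (h, 0) = h.1 *: (((1, 0) : Cx2 R, 0) : Cx2 R * C)
               + h.2 *: (((0, 1) : Cx2 R, 0) : Cx2 R * C).
    case: h => h1 h2; congr pair => /=; last by rewrite !scaler0 addr0.
    by congr pair => /=; rewrite /GRing.scale /= ?mulr0 ?mulr1 ?addr0 ?add0r.
  have aux (x y k u1 u2 : C) : u1 * (k * x) + u2 * (k * y) = k * (u1 * x + u2 * y) by ring.
  by rewrite /L1 /L2 /lin2 /D difD !difZ; exact: aux.
have [|//] := @nrm_diff2 R Y t0 L1 L2 => e e0.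
have [d1 d10 lipH] := lip.
pose A := 2 * (K + 1).
have A1 : 1 <= A by rewrite /A; clear -K0; lra.
have cn : 0 < nrm c by rewrite nrm_gt0 invr_eq0.
have e1 : 0 < e / (A * nrm c) by rewrite divr_gt0 // mulr_gt0 //; clear -A1; lra.
have [d d2 dH] := dif_nrm dg e1.
exists (Num.min (Num.min d0 d1) (d / A)).
  by rewrite !lt_min d00 d10 divr_gt0 //; clear -A1; lra.
move=> h; rewrite !lt_min => /andP[/andP[hd0 hd1] hd].
rewrite ltr_pdivlMr in hd; last by clear -A1; lra.
set k := Y (t0 + h) - Y t0.
have kh : nrm k <= A * nrm h by exact: lipH.
have nh0 := nrm_ge0 h.
have hk : nrm ((h, k) : Cx2 R * C) <= A * nrm h.
  apply: nrm_pair_le => //=; move: (nrm h) nh0 => y; clear -A1 => ?; nra.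
have := dH (h, k); rewrite -/D.
have -> : (t0, Y t0) + (h, k) = (t0 + h, Y (t0 + h)) :> (Cx2 R * C).
  by congr pair => /=; rewrite /k addrC subrK.
have [|<- _] := H1 (t0 + h); first by rewrite addrC addKr.
have [|<- _] := H1 t0; first by rewrite subrr nrm0.
rewrite -/k DE LE => /(_ (le_lt_trans hk _)); rewrite mulrC => /(_ hd) B.
have -> : k - c * D (h, 0) = c * (k - (D (h, 0) + k * gy)).
  rewrite /c; move: (D (h, 0)) (k) (gy) gy1; clear => x y z z1; by field.
rewrite nrmM.
apply: (@le_trans _ _ (nrm c * (e / (A * nrm c) * (A * nrm h)))).
  rewrite ler_pM2l //; apply: le_trans B _.
  by rewrite ler_wpM2l // ltW.
rewrite le_eqVlt; apply/orP; left; apply/eqP; field.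
by rewrite !gt_eqF //; clear -A1; lra.
Qed.

End Limits.

(** * Entire functions of polynomial growth *)

Section Entire.
Context {R : realType}.
Local Notation C := (Cx R).

Lemma differentiable_pow {V : normedModType C} (f : V -> C) (p : V) n :
  differentiable f p -> differentiable (fun q => f q ^+ n) p.
Proof.
move=> df; elim: n => [|n IH].
  rewrite (_ : (fun q => _) = cst 1); first exact: differentiable_cst.
  by apply/funext => q; rewrite expr0.
rewrite (_ : (fun q => _) = (fun q => f q * f q ^+ n)); first exact: differentiableM.
by apply/funext => q; rewrite exprS.
Qed.

Lemma differentiable_idC (z : C) : differentiable (fun z : C => z) z.
Proof. exact: ex_diff. Qed.

Lemma is_derive_shiftr (f : C -> C) (a b l : C) :
  is_derive (a + b) 1 f l -> is_derive a 1 (fun z => f (z + b)) l.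
Proof.
move=> df; have db : is_derive a 1 (fun z : C => z + b) (1 + 0).
  exact: is_deriveD (is_derive_id a 1) (is_derive_cst b a 1).
have := is_derive_compC (f := f) (g := fun z => z + b) df db.
by rewrite addr0 scale1r.
Qed.

Lemma is_derive_lin (l z : C) : is_derive z 1 (fun w : C => w * l) l.
Proof.
apply: nrm_is_derive => e e0; exists 1 => // h _.
rewrite -[h *: l]/(h * l) (_ : _ - _ = 0); last by ring.
by rewrite nrm0 mulr_ge0 ?nrm_ge0 // ltW.
Qed.

(** On the disc of radius r the Taylor error is O((1 + r) / r^2), which tends to 0 with growing
    r. *)
Lemma entire_linear_growth (u : C -> C) (K : R) : (forall z, differentiable u z) ->
  (forall z, nrm (u z) <= K * (1 + nrm z)) -> exists l, forall z, u z = u 0 + z * l.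
Proof.
move=> du uK; exists (dif u 0 1) => z.
have K0 : 0 <= K.
  have := le_trans (nrm_ge0 (u 0)) (uK 0); rewrite nrm0; clear; lra.
suff : nrm (u z - u 0 - z * dif u 0 1) = 0.
  move=> /eqP; rewrite nrm_eq0 subr_eq0 subr_eq => /eqP ->; exact: addrC.
apply/eqP; rewrite eq_le nrm_ge0 andbT; apply/ler_addgt0Pr => e e0; rewrite add0r.
have n0 := nrm_ge0 z.
pose c := 64 * K * nrm z ^+ 2.
have c0 : 0 <= c by rewrite !mulr_ge0 // exprn_ge0.
have [r [r0 r1 rz re]] : exists r : R, [/\ 0 < r, 1 <= r, nrm z < r / 4 & c <= e * r].
  exists (1 + 4 * nrm z + c / e + 1); have ce : 0 <= c / e by rewrite divr_ge0 // ltW.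
  have E : c = e * (c / e) by field; rewrite gt_eqF.
  split; [by clear -n0 ce; lra|by clear -n0 ce; lra|by clear -n0 ce; lra|].
  by rewrite {1}E ler_pM2l //; clear -n0 ce; lra.
have := @taylor2 R u 0 r (K * (1 + r)) (dif u 0 1) z r0.
rewrite add0r => /(_ _ _ (diff_is_derive (du 0)) rz) H.
apply: le_trans (H _ _) _; first by move=> ? _; exact: du.
  move=> w; rewrite subr0 => wr; apply: le_trans (uK w) _.
  by apply: ler_wpM2l => //; clear -wr; lra.
have r20 : 0 < r ^+ 2 by rewrite exprn_gt0.
rewrite mulrAC ler_pdivrMr //.
have : c * r <= e * r ^+ 2 by rewrite expr2 mulrA ler_pM2r.
apply: le_trans; rewrite /c.
have -> : 32 * (K * (1 + r)) * nrm z ^+ 2 = 32 * K * nrm z ^+ 2 * (1 + r) by ring.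
have : 0 <= 32 * K * nrm z ^+ 2 by rewrite !mulr_ge0 // exprn_ge0.
by move: (nrm z ^+ 2) => y; clear -r1; nra.
Qed.

(** The differences u(z + h) - u(z) grow linearly, hence are affine in z with some slope be(h).
    Symmetry in z and h makes be linear, and after removal of the quadratic term u is additive up to
    a constant. *)
Lemma entire_quadratic_growth (u : C -> C) (K : R) : (forall z, differentiable u z) ->
  (forall z, nrm (u z) <= K * (1 + nrm z ^+ 2)) ->
  exists b c, forall z, u z = u 0 + z * b + c * z ^+ 2.
Proof.
move=> du uK.
have K0 : 0 <= K.
  have := le_trans (nrm_ge0 (u 0)) (uK 0); rewrite nrm0 expr0n /=; clear; lra.
have u'K a : nrm (dif u a 1) <= 10 * K * (1 + nrm a).
  have n0 := nrm_ge0 a; have r0 : 0 < 1 + nrm a by clear -n0; lra.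
  have -> : 10 * K * (1 + nrm a) = 2 * (5 * K * (1 + nrm a) ^+ 2) / (1 + nrm a).
    by field; rewrite gt_eqF.
  apply: (cauchy_estimate (f := u) (a := a) r0); last exact: diff_is_derive.
    by move=> z _; exact: du.
  move=> z za; apply: le_trans (uK z) _.
  rewrite [5 * K]mulrC -mulrA ler_wpM2l //.
  have := nrm_subD z a; have := nrm_ge0 z; move: (nrm z) (nrm a) (nrm (z - a)) za n0.
  by clear => x y w; nra.
have lin h : exists l, forall z, u (z + h) - u z = u h - u 0 + z * l.
  have nh := nrm_ge0 h.
  have [||l Hl] := @entire_linear_growth (fun z => u (z + h) - u z)
      (10 * K * (1 + nrm h) * nrm h).
  - move=> z; apply: is_derive_diff.
    exact: (is_deriveB (is_derive_shiftr (diff_is_derive (du (z + h)))) (diff_is_derive (du z))).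
  - move=> z; have nz := nrm_ge0 z.
    have := @mean_value_inequality R u z (z + h) (10 * K * (1 + nrm z + nrm h)).
    rewrite [z + h - z]addrC addKr => /(_ _) H; apply: le_trans (H _) _.
      move=> t /andP[t0 t1]; exists (dif u (z + rc t * h) 1); first exact: diff_is_derive.
      apply: le_trans (u'K _) _; rewrite ler_wpM2l ?mulr_ge0 // -addrA lerD2l.
      apply: le_trans (nrmD _ _) _; rewrite lerD2l nrmM nrm_rc ger0_norm //.
      by rewrite ler_piMl.
    rewrite -!mulrA ler_wpM2l // ler_wpM2l //.
    by move: (nrm h) (nrm z) nh nz; clear => x y; nra.
  by exists l => z; rewrite Hl add0r.
pose be h := projT1 (cid (lin h)).
have beE h z : u (z + h) - u z = u h - u 0 + z * be h by exact: projT2 (cid (lin h)) z.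
have sym h z : z * be h = h * be z.
  have E1 := beE h z; have E2 := beE z h; rewrite [h + z]addrC in E2.
  have -> : z * be h = u (z + h) - u z - (u h - u 0) by rewrite E1; ring.
  have -> : h * be z = u (z + h) - u h - (u z - u 0) by rewrite E2; ring.
  by ring.
have be1 h : be h = h * be 1 by rewrite -sym mul1r.
(* The mixed difference u(z + h) - u(z) - u(h) + u(0) is z h be(1), and that of c z^2 is 2 c z h. *)
pose c := be 1 / 2.
pose w (z : C) : C := u z - u 0 - c * z ^+ 2.
have two : (2 : C) != 0 by rewrite pnatr_eq0.
have wadd (z h : C) : w (z + h) - w z = w h.
  have E : u (z + h) = u z + (u h - u 0 + z * (h * be 1)).
    by rewrite -be1 -beE [RHS]addrC subrK.
  by rewrite /w E /c; field.
have w0 : w 0 = 0 by rewrite /w expr0n /= mulr0 subrr subr0.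
have dw (z : C) : differentiable w z.
  apply: differentiableB; first by apply: differentiableB; [exact: du|exact: differentiable_cst].
  apply: differentiableM; first exact: differentiable_cst.
  exact: differentiable_pow (differentiable_idC z).
pose l := dif w 0 1.
have dwl (z : C) : is_derive z 1 w l.
  apply: nrm_is_derive => e e0.
  have [d d0 dH] := is_derive_nrm (diff_is_derive (dw 0)) e0.
  exists d => // h hd; rewrite wadd.
  by have := dH h hd; rewrite add0r w0 subr0.
exists l, c => z.
have : w z - z * l = w 0 - 0 * l.
  apply: (@derive_eq0_const R (fun z => w z - z * l)) => t _.
  have := is_deriveB (dwl (0 + rc t * (z - 0))) (is_derive_lin l (0 + rc t * (z - 0))).
  by rewrite subrr.
rewrite w0 mul0r subr0 => /eqP; rewrite subr_eq0 => /eqP wz.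
have -> : u z = u 0 + w z + c * z ^+ 2 by rewrite /w; ring.
by rewrite wz.
Qed.

(* z^2 / (tau z - tau 0) is entire of quadratic growth since tau is proper. *)
Lemma entire_affine (tau k : C -> C) : (forall z, differentiable tau z) ->
  (forall z, differentiable k z) -> (forall z, k (tau z) = z) ->
  exists2 A, A != 0 & forall z, tau z = A * z + tau 0.
Proof.
move=> dtau dk ktau.
pose T (z : C) : C := tau z - tau 0.
have T0 (z : C) : z != 0 -> T z != 0.
  by rewrite subr_eq0; apply: contra => /eqP E; rewrite -(ktau z) E ktau.
pose u (z : C) : C := if z == 0 then 0 else z ^+ 2 / T z.
have uE (z : C) : z != 0 -> u z = z ^+ 2 / T z by rewrite /u => /negPf ->.
have u0 : u 0 = 0 by rewrite /u eqxx.
pose l := dif tau 0 1.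
have dl : is_derive (0 : C) 1 tau l := diff_is_derive (dtau 0).
have l0 : l != 0.
  apply/eqP => l0.
  have := is_derive_compC (diff_is_derive (dk (tau 0))) dl.
  rewrite (_ : k \o tau = id); last by apply/funext => z /=; rewrite ktau.
  move=> /(is_derive_uniq (is_derive_id (0 : C) 1)); rewrite l0 scale0r => /eqP.
  by rewrite oner_eq0.
have du (z : C) : differentiable u z.
  have [->|z0] := eqVneq z 0.
    (* The extension by the value 0 has derivative 1 / tau'(0) at 0, directly from the difference
       quotients of tau. *)
    apply: (@is_derive_diff R C u 0 (l^-1)); apply: nrm_is_derive => e e0.
    have nl : 0 < nrm l by rewrite nrm_gt0.
    have e1 : 0 < Num.min (nrm l / 2) (e * nrm l ^+ 2 / 2).
      by rewrite lt_min !divr_gt0 // mulr_gt0 // exprn_gt0.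
    have [d d0 dH] := is_derive_nrm dl e1; exists d => // h hd.
    rewrite add0r u0 subr0.
    have [->|h0] := eqVneq h 0; first by rewrite u0 scale0r subrr nrm0 mulr0.
    have nh : 0 < nrm h by rewrite nrm_gt0.
    have := dH h hd; rewrite add0r -/(T h) -[h *: l]/(h * l) => B.
    have B1 : nrm (T h - h * l) <= nrm l / 2 * nrm h.
      by apply: le_trans B _; rewrite ler_wpM2r ?(ltW nh) // ge_min lexx.
    have B2 : nrm (T h - h * l) <= e * nrm l ^+ 2 / 2 * nrm h.
      by apply: le_trans B _; rewrite ler_wpM2r ?(ltW nh) // ge_min lexx orbT.
    have B3 : nrm l / 2 * nrm h <= nrm (T h).
      have := nrm_subD (h * l) (T h); rewrite nrmBC nrmM [nrm h * _]mulrC.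
      by move: B1; move: (nrm l) (nrm h) (nrm (T h)) (nrm (T h - h * l)); clear => *; nra.
    rewrite uE // -[h *: l^-1]/(h * l^-1).
    have -> : h ^+ 2 / T h - h / l = - (h * (T h - h * l)) / (T h * l).
      by field; rewrite T0 // l0.
    rewrite nrmM nrmV nrmN !nrmM ler_pdivrMr; last by rewrite mulr_gt0 // nrm_gt0 T0.
    have -> : e * nrm h * (nrm (T h) * nrm l) = nrm h * (e * nrm l * nrm (T h)) by ring.
    rewrite ler_pM2l //; apply: le_trans B2 _.
    have -> : e * nrm l ^+ 2 / 2 * nrm h = e * nrm l * (nrm l / 2 * nrm h) by field.
    by rewrite ler_pM2l // mulr_gt0.
  have D : differentiable (fun z : C => z ^+ 2 / T z) z.
    apply: differentiableM; first exact: differentiable_pow (differentiable_idC z).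
    apply: differentiableV; last exact: T0.
    by apply: differentiableB; [exact: dtau|exact: differentiable_cst].
  apply: diff_near D; apply/nbhs_nrmP; exists (nrm z); first by rewrite nrm_gt0.
  move=> y yz; rewrite uE //; apply/eqP => y0.
  by rewrite y0 sub0r nrmN ltxx in yz.
(* The square of half-side S contains the unit disc about tau 0. The left inverse k is bounded on
   it, so |T z| > 1 for large z. *)
pose S := `|Re (tau 0)| + `|Im (tau 0)| + 1.
have [r0 Hr0] := @csquare_bounded R k S (fun z => differentiable_continuous (dk z)).
have big (z : C) : r0 < nrm z -> 1 < nrm (T z).
  move=> rz; rewrite ltNge; apply/negP => T1.
  have : nrm (k (tau z)) <= r0.
    apply: Hr0; have -> : tau z = tau 0 + T z by rewrite /T addrC subrK.
    have := le_trans (Re_le_nrm _) T1; have := le_trans (Im_le_nrm _) T1.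
    have := normr_ge0 (Re (tau 0)); have := normr_ge0 (Im (tau 0)).
    split; rewrite (ReD, ImD) /S; apply: le_trans (ler_normD _ _) _.
      by move: H H0 H1 H2; clear; lra.
    by move: H H0 H1 H2; clear; lra.
  by rewrite ktau leNgt rz.
have [K1 HK1] := @csquare_bounded R u r0 (fun z => differentiable_continuous (du z)).
have uK (z : C) : nrm (u z) <= (`|K1| + 1) * (1 + nrm z ^+ 2).
  have n2 : 0 <= nrm z ^+ 2 by rewrite exprn_ge0 // nrm_ge0.
  have [zr|rz] := leP (nrm z) r0.
    have : nrm (u z) <= K1.
      by apply: HK1; split; [apply: le_trans (Re_le_nrm z) zr|apply: le_trans (Im_le_nrm z) zr].
    move=> /le_trans; apply; apply: le_trans (ler_norm K1) _.
    by have := normr_ge0 K1; move: (nrm z ^+ 2) `|K1| n2; clear => *; nra.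
  have T1 := big z rz.
  have z0 : z != 0.
    by apply/eqP => z0; move: T1; rewrite z0 /T subrr nrm0 ltr10.
  rewrite uE // nrmM nrmV nrmX ler_pdivrMr; last by apply: lt_trans T1.
  have := normr_ge0 K1; move: (nrm z ^+ 2) `|K1| (nrm (T z)) T1 n2; clear => x y w *.
  have : 0 <= (y + 1) * (1 + x) - x by nra.
  by nra.
have [b [c E]] := entire_quadratic_growth du uK.
have TE (z : C) : z != 0 -> z = T z * (b + c * z).
  move=> z0; have := E z; rewrite uE // u0 add0r => Ez.
  apply: (mulfI z0); rewrite -expr2.
  have -> : z * (T z * (b + c * z)) = T z * (z * b + c * z ^+ 2) by ring.
  by rewrite -Ez mulrC divfK // T0.
have one0 : (1 : C) != 0 by rewrite oner_eq0.
have two0 : (2 : C) != 0 by rewrite pnatr_eq0.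
(* In z = T(z) (b + c z), b = 0 would make T constant off 0, against injectivity of tau, and c != 0
   would make the right side vanish at z = -b/c. *)
have [b0|b0] := eqVneq b 0.
  have c1 (z : C) : z != 0 -> T z = c^-1.
    move=> z0; have H : 1 = T z * c.
      by apply: (mulIf z0); rewrite mul1r {1}(TE z z0) b0 add0r; ring.
    have c0 : c != 0.
      by apply/eqP => c0; move/eqP: H; rewrite c0 mulr0 oner_eq0.
    by apply: (mulIf c0); rewrite -H mulVf.
  have : tau 1 = tau 2.
    have : T 1 = T 2 by rewrite !c1.
    by rewrite /T => /(congr1 (+%R^~ (tau 0))); rewrite !subrK.
  move=> /(congr1 k); rewrite !ktau => /eqP; rewrite -subr_eq0.
  by rewrite (_ : (1 : C) - 2 = -1) ?oppr_eq0 ?oner_eq0 //; ring.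
have c0 : c = 0.
  apply/eqP; apply: contraT => c0.
  have z0 : - b / c != 0 by rewrite mulf_neq0 ?oppr_eq0 ?invr_eq0.
  have := TE _ z0; rewrite (_ : b + c * (- b / c) = 0); last by field.
  by rewrite mulr0 => /eqP; rewrite (negPf z0).
exists b^-1; first by rewrite invr_eq0.
move=> z; have [->|z0] := eqVneq z 0; first by rewrite mulr0 add0r.
have E1 : z = T z * b by rewrite {1}(TE z z0) c0 mul0r addr0.
have -> : b^-1 * z = T z by rewrite {1}E1 mulrC mulfK.
by rewrite /T subrK.
Qed.

End Entire.

(** * The Böttcher coordinate *)

Section Cones.
Context {R : realType}.
Local Notation C := (Cx R).
Local Notation C2 := (Cx2 R).

Definition cone (r : R) : set C2 := [set p | r < nrm p.2 /\ nrm p.1 < nrm p.2].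

(** Limits along this filter are limits for |y| tending to infinity, uniform over |x| < |y|. *)
Definition cone_infty : set_system C2 := filter_from [set r : R | 0 < r] cone.

Lemma cone_sub r s p : r <= s -> cone s p -> cone r p.
Proof. by move=> rs [p1 p2]; split => //; apply: le_lt_trans p1. Qed.

Global Instance cone_infty_filter : Filter cone_infty.
Proof.
apply: filter_from_filter; first by exists 1; exact: ltr01.
move=> r s /= r0 s0; exists (Num.max r s) => /=; first by rewrite lt_max r0.
by move=> p pm; split; apply: cone_sub pm; rewrite le_max lexx ?orbT.
Qed.

Lemma near_cone (P : C2 -> Prop) : (\forall p \near cone_infty, P p) ->
  exists2 r, 0 < r & forall p, cone r p -> P p.
Proof. by case=> r /= r0 rP; exists r. Qed.

Lemma cone_near (P : C2 -> Prop) r : 0 < r -> (forall p, cone r p -> P p) ->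
  \forall p \near cone_infty, P p.
Proof. by move=> r0 rP; exists r. Qed.

Lemma cone_open r p : cone r p -> \forall q \near p, cone r q.
Proof.
move=> [p1 p2].
pose e := Num.min (nrm p.2 - r) ((nrm p.2 - nrm p.1) / 2).
have e0 : 0 < e by rewrite lt_min subr_gt0 p1 divr_gt0 // subr_gt0.
have e1 : e <= nrm p.2 - r by rewrite ge_min lexx.
have e2 : e <= (nrm p.2 - nrm p.1) / 2 by rewrite ge_min lexx orbT.
apply/nbhs_nrmP; exists e => // q qp.
have S1 : nrm (q.1 - p.1) < e := le_lt_trans (nrm_fst (q - p)) qp.
have S2 : nrm (q.2 - p.2) < e := le_lt_trans (nrm_snd (q - p)) qp.
have T1 := nrm_subD p.2 q.2; have T2 := nrm_subD q.1 p.1.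
rewrite [nrm (p.2 - _)]nrmBC in T1; rewrite /cone /=.
clearbody e; move: (nrm (q.1 - p.1)) (nrm (q.2 - p.2)) (nrm p.1) (nrm p.2) (nrm q.1) (nrm q.2) S1 S2 T1 T2 e1 e2.
by clear -e0 => *; split; lra.
Qed.

Lemma cone_eq_cvg (f g : C2 -> C) (l : C) (r : R) : 0 < r ->
  (forall p, cone r p -> f p = g p) ->
  f p @[p --> cone_infty] --> l -> g p @[p --> cone_infty] --> l.
Proof.
move=> r0 fg /cvg_nrmP H; apply/cvg_nrmP => e /H/near_cone[s s0 sH].
apply: (@cone_near _ (Num.max r s)); first by rewrite lt_max r0.
move=> p pm; rewrite -fg; last by apply: cone_sub pm; rewrite le_max lexx.
by apply: sH; apply: cone_sub pm; rewrite le_max lexx orbT.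
Qed.

Lemma inv_snd_cvg : p.2^-1 @[p --> cone_infty] --> (0 : C).
Proof.
apply/cvg_nrmP => e e0; apply: (@cone_near _ e^-1); first by rewrite invr_gt0.
move=> p [pe _]; rewrite subr0 nrmV invf_plt ?posrE //.
by apply: lt_trans pe; rewrite invr_gt0.
Qed.

Lemma horner_differentiable (q : {poly C}) (z : C) : differentiable (horner q) z.
Proof.
elim/poly_ind: q => [|q c IH].
  rewrite (_ : horner 0 = cst 0); first exact: differentiable_cst.
  by apply/funext => w; rewrite horner0.
rewrite (_ : horner _ = (fun w => q.[w] * w + c)); last first.
  by apply/funext => w; rewrite !hornerE.
apply: differentiableD; last exact: differentiable_cst.
by apply: differentiableM => //; exact: differentiable_idC.
Qed.

Lemma horner_inverse (q : {poly C}) k (y : C) : (size q <= k.+1)%N -> y != 0 ->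
  q.[y] / y ^+ k = (\poly_(i < k.+1) q`_(k - i)).[y^-1].
Proof.
move=> qk y0; rewrite horner_poly (horner_coef_wide y qk) mulr_suml.
rewrite (reindex_inj rev_ord_inj) /=; apply: eq_bigr => i _.
rewrite subSS -mulrA; congr (_ * _).
have ik : (i <= k)%N by rewrite -ltnS.
have -> : y ^+ k = y ^+ (k - i) * y ^+ i by rewrite -exprD subnK.
by rewrite invfM mulrA divff ?mul1r ?exprVn // expf_neq0.
Qed.

Lemma henon_factor_asymp (h : {poly C} * C) : (2 < size h.1)%N ->
  (henon_factor h p).2 / p.2 ^+ (size h.1).-1 @[p --> cone_infty] --> lead_coef h.1.
Proof.
case: h => q a /= q2; set k := (size q).-1.
have kS : size q = k.+1 by rewrite /k prednK // (leq_trans _ q2).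
have k1 : (0 < k.-1)%N by rewrite /k; move: q2; case: (size q) => [|[|[|n]]].
have cv1 : (\poly_(i < k.+1) q`_(k - i)).[p.2^-1] @[p --> cone_infty] --> lead_coef q.
  have : horner (\poly_(i < k.+1) q`_(k - i)) @ (0 : C) --> lead_coef q.
    have -> : lead_coef q = (\poly_(i < k.+1) q`_(k - i)).[0].
      by rewrite horner_coef0 coef_poly /= subn0 lead_coefE.
    exact: differentiable_continuous (horner_differentiable _ 0).
  by move=> H; exact: cvg_comp inv_snd_cvg H.
have cv2 : a * p.1 / p.2 ^+ k @[p --> cone_infty] --> (0 : C).
  apply/cvg_nrmP => e e0.
  have H : a * p.2^-1 @[p --> cone_infty] --> (0 : C).
    by rewrite -(mulr0 a); apply: cvgM; [exact: cvg_cst|exact: inv_snd_cvg].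
  have [r r0 rH] := near_cone ((cvg_nrmP _ _ _).1 H e e0).
  apply: (@cone_near _ (Num.max r 1)); first by rewrite lt_max r0.
  move=> p; move=> /[dup] pc [+ p12]; rewrite gt_max => /andP[pr p1].
  have := rH p (conj pr p12); rewrite !subr0; apply: le_lt_trans.
  have y0 : 0 < nrm p.2 by apply: lt_trans p1; exact: ltr01.
  have [k' ->] : exists k', k = k'.+2.
    by move: k1; case: (k) => [|[|n]] // _; exists n.
  rewrite !nrmM !nrmV nrmX exprS invfM -mulrA ler_wpM2l ?nrm_ge0 //.
  rewrite mulrA -[leRHS]mul1r; apply: ler_pM; rewrite ?mulr_ge0 ?invr_ge0 ?exprn_ge0 ?nrm_ge0 //.
    by rewrite ler_pdivrMr // mul1r ltW.
  rewrite exprS invfM; apply: ler_piMr; first by rewrite invr_ge0 ltW.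
  by rewrite invf_le1 ?exprn_gt0 // exprn_ege1 // ltW.
have cv3 : (\poly_(i < k.+1) q`_(k - i)).[p.2^-1] - a * p.1 / p.2 ^+ k @[p --> cone_infty]
    --> lead_coef q by rewrite -[lead_coef q]subr0; exact: (cvgB cv1 cv2).
apply: (cone_eq_cvg ltr01 _ cv3) => p [p1 _].
have y0 : p.2 != 0 by rewrite -nrm_gt0; apply: lt_trans p1; exact: ltr01.
by rewrite -horner_inverse ?kS // /henon_factor /= mulrBl.
Qed.

Lemma henon_factor_cone (h : {poly C} * C) : (2 < size h.1)%N ->
  exists2 r0, 0 < r0 & forall r, r0 <= r -> forall p, cone r p -> cone r (henon_factor h p).
Proof.
move=> h2; have l0 : 0 < nrm (lead_coef h.1).
  by rewrite nrm_gt0 lead_coef_eq0 -size_poly_gt0 (leq_trans _ h2).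
have l2 : 0 < nrm (lead_coef h.1) / 2 by rewrite divr_gt0.
have [r1 r10 H] := near_cone ((cvg_nrmP _ _ _).1 (henon_factor_asymp h2) _ l2).
exists (Num.max (Num.max r1 1) (2 / nrm (lead_coef h.1))); first by rewrite !lt_max r10.
move=> r; rewrite !ge_max => /andP[/andP[r1r r1'] rl] p /[dup] pc [pr p12].
have y1 : 1 < nrm p.2 by apply: le_lt_trans pr.
have y0 : 0 < nrm p.2 by apply: lt_trans y1; exact: ltr01.
have {}H := H p (cone_sub r1r pc).
set y' := (henon_factor h p).2 in H *.
have k2 : exists k, (size h.1).-1 = k.+2.
  by move: h2; case: (size h.1) => [|[|[|n]]] // _; exists n.
have [k kE] := k2; rewrite kE in H.
have B : nrm (lead_coef h.1) / 2 < nrm (y' / p.2 ^+ k.+2).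
  have := nrm_subD (lead_coef h.1) (y' / p.2 ^+ k.+2); rewrite nrmBC.
  by move: H; clear; lra.
rewrite nrmM nrmV nrmX ltr_pdivlMr ?exprn_gt0 // in B.
have yy : nrm p.2 < nrm y'.
  apply: le_lt_trans B; set L := nrm (lead_coef h.1) / 2 in l2 *.
  have L1 : 1 <= L * nrm p.2.
    have := le_lt_trans rl pr; rewrite ltr_pdivrMr // /L => H1.
    by move: H1; clear; lra.
  have -> : L * nrm p.2 ^+ k.+2 = (L * nrm p.2) * (nrm p.2 * nrm p.2 ^+ k).
    by rewrite !exprS; ring.
  rewrite -{1}[nrm p.2]mul1r; apply: ler_pM => //; try exact: ltW.
  by apply: ler_peMr; rewrite ?(ltW y0) // exprn_ege1 // ltW.
by split => //=; apply: lt_trans yy.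
Qed.

Lemma henon_rcons hs (h : {poly C} * C) z : henon (rcons hs h) z = henon_factor h (henon hs z).
Proof. by rewrite /henon foldl_rcons. Qed.

Definition factors_ok (hs : seq ({poly C} * C)) : bool :=
  all (fun h : {poly C} * C => (2 < size h.1)%N && (h.2 != 0)) hs.

Lemma factors_ok_rcons hs h :
  factors_ok (rcons hs h) = ((2 < size h.1)%N && (h.2 != 0)) && factors_ok hs.
Proof. exact: all_rcons. Qed.

Lemma henon_degree_rcons hs (h : {poly C} * C) :
  henon_degree (rcons hs h) = (henon_degree hs * (size h.1).-1)%N.
Proof. by rewrite /henon_degree -cats1 big_cat big_seq1. Qed.

(** The second half says that the norm does not grow beyond M as long as images stay outside the
    cone. Consequently an unbounded forward orbit must enter it. *)
Lemma henon_cone hs : factors_ok hs -> exists2 r0, 0 < r0 & forall r, r0 <= r ->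
  (forall p, cone r p -> cone r (henon hs p)) /\
  (forall p, ~ cone r (henon hs p) -> forall M, r <= M -> nrm p.1 <= M -> nrm p.2 <= M ->
     nrm (henon hs p).1 <= M /\ nrm (henon hs p).2 <= M).
Proof.
elim/last_ind: hs => [_|hs h IH]; first by exists 1.
rewrite factors_ok_rcons => /andP[/andP[h2 _] /IH[r1 r10 H1]].
have [r2 r20 H2] := henon_factor_cone h2.
exists (Num.max r1 r2); first by rewrite lt_max r10.
move=> r; rewrite ge_max => /andP[r1r r2r]; have [H1a H1b] := H1 r r1r.
have {}H2 := H2 r r2r.
split=> p; rewrite henon_rcons; first by move=> /H1a/H2.
move=> nc M rM pM1 pM2.
have nc' : ~ cone r (henon hs p) by move=> /H2.
have [M1 M2] := H1b p nc' M rM pM1 pM2.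
split => //=; move: nc; rewrite /cone /= => nc.
rewrite leNgt; apply/negP => MM; apply: nc.
by split; [apply: le_lt_trans MM|apply: le_lt_trans MM].
Qed.

Lemma henon_asymp hs : factors_ok hs -> exists2 l, l != 0 &
  (henon hs p).2 / p.2 ^+ henon_degree hs @[p --> cone_infty] --> l /\
  henon hs @ cone_infty `=>` cone_infty.
Proof.
elim/last_ind: hs => [_|hs h IH].
  exists 1; rewrite ?oner_eq0 // /henon_degree big_nil; split; last exact: cvg_id.
  apply: (@cone_eq_cvg (cst 1) _ _ 1) => //; last exact: cvg_cst.
  move=> p [p1 _] /=.
  by rewrite expr1 divff // -nrm_gt0; apply: lt_trans p1; exact: ltr01.
rewrite factors_ok_rcons => /andP[/andP[h2 _] /IH[l l0 [cvl cvF]]].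
have [r2 r20 H2] := henon_factor_cone h2.
have fF : henon_factor h @ cone_infty `=>` cone_infty.
  move=> P [r /= r0 rP]; exists (Num.max r r2); first by rewrite /= lt_max r0.
  move=> p pm; apply: rP; apply: (@cone_sub _ (Num.max r r2)); first by rewrite le_max lexx.
  by apply: H2 => //; rewrite le_max lexx orbT.
exists (lead_coef h.1 * l ^+ (size h.1).-1).
  by rewrite mulf_neq0 ?expf_neq0 // lead_coef_eq0 -size_poly_gt0 (leq_trans _ h2).
split; last first.
  rewrite (_ : henon _ = henon_factor h \o henon hs); last by apply/funext => p /=; rewrite henon_rcons.
  exact: cvg_comp cvF fF.
have powcv n : ((henon hs p).2 / p.2 ^+ henon_degree hs) ^+ n @[p --> cone_infty] --> l ^+ n.
  elim: n => [|n IHn]; first exact: cvg_cst.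
  under eq_fun do rewrite exprS.
  by rewrite exprS; exact: cvgM cvl IHn.
have [r1 r10 r1P] := near_cone (cvF _ (ex_intro2 _ _ (1 : R) ltr01 (fun p pc => pc))).
have r0 : 0 < Num.max 1 r1 by rewrite lt_max ltr01.
apply: (cone_eq_cvg r0 _ (cvgM (cvg_comp _ _ cvF (henon_factor_asymp h2)) (powcv (size h.1).-1))).
move=> p pm; have [p1 _] : cone 1 p by apply: cone_sub pm; rewrite le_max lexx.
have [q1 _] : cone 1 (henon hs p) by apply: r1P; apply: cone_sub pm; rewrite le_max lexx orbT.
have y0 : p.2 != 0 by rewrite -nrm_gt0; apply: lt_trans p1; exact: ltr01.
have y1 : (henon hs p).2 != 0 by rewrite -nrm_gt0; apply: lt_trans q1; exact: ltr01.
rewrite /= henon_rcons henon_degree_rcons expr_div_n -exprM.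
by rewrite mulrA divfK // expf_neq0.
Qed.

End Cones.

(** * Inverse and Jacobian of a Hénon map *)

Section HenonAlgebra.
Context {R : realType}.
Local Notation C := (Cx R).
Local Notation C2 := (Cx2 R).
Implicit Types (hs : seq ({poly C} * C)) (h : {poly C} * C) (p : C2).

Lemma fst_differentiable p : differentiable (fun p : C2 => p.1) p.
Proof. by apply: (@linear_differentiable _ _ _ (fst : {linear C2 -> C})) => //; move=> q; apply: cvg_fst. Qed.

Lemma snd_differentiable p : differentiable (fun p : C2 => p.2) p.
Proof. by apply: (@linear_differentiable _ _ _ (snd : {linear C2 -> C})) => //; move=> q; apply: cvg_snd. Qed.

Lemma henon_factor_differentiable h p : differentiable (henon_factor h) p.
Proof.
apply: differentiable_pair; first exact: snd_differentiable.
apply: differentiableB.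
  apply: (@differentiable_comp _ _ _ _ (fun p : C2 => p.2) (horner h.1)).
    exact: snd_differentiable.
  exact: horner_differentiable.
apply: differentiableM; first exact: differentiable_cst.
exact: fst_differentiable.
Qed.

Lemma henon_differentiable hs p : differentiable (henon hs) p.
Proof.
elim/last_ind: hs => [|hs h IH].
  by have [] := @is_diff_id (Cx R) (Cx2 R) p.
rewrite (_ : henon _ = henon_factor h \o henon hs); last by apply/funext => q /=; rewrite henon_rcons.
by apply: differentiable_comp; [exact: IH|exact: henon_factor_differentiable].
Qed.

Definition henon_factor_inv h p : C2 := ((h.1.[p.1] - p.2) / h.2, p.1).

Definition henon_inv hs p : C2 := foldr henon_factor_inv p hs.

Lemma henonK hs : factors_ok hs -> cancel (henon hs) (henon_inv hs).
Proof.
elim: hs => [|h hs IH] //= /andP[/andP[_ h2] /IH H] p /=.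
rewrite /henon /= -/(henon hs _) H; case: p => x y; rewrite /henon_factor_inv /=.
by congr (_, _); rewrite opprB addrCA subrr addr0 mulrC mulKf.
Qed.

Lemma henon_invK hs : factors_ok hs -> cancel (henon_inv hs) (henon hs).
Proof.
elim: hs => [|h hs IH] //= /andP[/andP[_ h2] /IH H] p /=.
rewrite /henon /= -/(henon hs _) -[RHS]H; congr (henon hs _).
case: (henon_inv hs p) => x y; rewrite /henon_factor /=.
by congr (_, _); rewrite mulrC divfK // opprB addrCA subrr addr0.
Qed.

Lemma henon_inv_differentiable hs p : differentiable (henon_inv hs) p.
Proof.
elim: hs => [|h hs IH].
  by have [] := @is_diff_id (Cx R) (Cx2 R) p.
apply: (@differentiable_comp _ _ _ _ (henon_inv hs) (henon_factor_inv h)); first exact: IH.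
apply: differentiable_pair; last exact: fst_differentiable.
apply: differentiableM; last exact: differentiable_cst.
apply: differentiableB; last exact: snd_differentiable.
apply: (@differentiable_comp _ _ _ _ (fun p : C2 => p.1) (horner h.1)).
  exact: fst_differentiable.
exact: horner_differentiable.
Qed.

Lemma dif_comp {V W : normedModType C} (g : V -> W) (f : W -> C) (x v : V) :
  differentiable g x -> differentiable f (g x) ->
  dif (fun y => f (g y)) x v = dif f (g x) ('d g x v).
Proof. by move=> gx fx; rewrite /dif (@diff_comp _ _ _ _ g f). Qed.

Lemma dif_fst (p v : C2) : dif (fun p : C2 => p.1) p v = v.1.
Proof. by rewrite /dif (@diff_lin _ _ _ (fst : {linear C2 -> C})) //; move=> q; apply: cvg_fst. Qed.

Lemma dif_snd (p v : C2) : dif (fun p : C2 => p.2) p v = v.2.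
Proof. by rewrite /dif (@diff_lin _ _ _ (snd : {linear C2 -> C})) //; move=> q; apply: cvg_snd. Qed.

Lemma diff_pairE (g : C2 -> C2) p v : differentiable g p ->
  'd g p v = (dif (fun q => (g q).1) p v, dif (fun q => (g q).2) p v).
Proof.
move=> gp; have E1 := dif_comp v gp (fst_differentiable (g p)).
have E2 := dif_comp v gp (snd_differentiable (g p)).
rewrite dif_fst in E1; rewrite dif_snd in E2; rewrite E1 E2.
by case: ('d g p v).
Qed.

Lemma dif_is_derive (V : normedModType C) (f : V -> C) (p v : V) (l : C) :
  differentiable f p -> is_derive (0 : C) 1 (fun t : C => f (p + t *: v)) l -> dif f p v = l.
Proof.
move=> fp; apply: is_derive_uniq.
have := @is_derive_dif _ _ f (fun t : C => p + t *: v) 0 v.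
by rewrite scale0r addr0; apply => //; exact: line_is_derive.
Qed.

(** The constant is the product of the [h.2]. A constant Jacobian determines how H stretches the
    leaves, see [push_leafvec]. *)
Lemma henon_jacobian hs : factors_ok hs -> exists2 a, a != 0 & forall p v w,
  dif (fun q => (henon hs q).1) p v * dif (fun q => (henon hs q).2) p w -
  dif (fun q => (henon hs q).1) p w * dif (fun q => (henon hs q).2) p v =
  a * (v.1 * w.2 - v.2 * w.1).
Proof.
elim/last_ind: hs => [_|hs h IH].
  exists 1; rewrite ?oner_eq0 // => p v w.
  by rewrite /henon /= !dif_fst !dif_snd mul1r [v.2 * _]mulrC.
rewrite factors_ok_rcons => /andP[/andP[_ h2] /IH[a a0 H]].
exists (h.2 * a); rewrite ?mulf_neq0 // => p v w.
have -> : (fun q => (henon (rcons hs h) q).1) = (fun q => (henon hs q).2).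
  by apply/funext => q; rewrite henon_rcons.
pose G (z : C2) : C := (henon_factor h z).2.
have -> : (fun q => (henon (rcons hs h) q).2) = (fun q => G (henon hs q)).
  by apply/funext => q; rewrite henon_rcons.
have Gd z : differentiable G z.
  apply: (@differentiable_comp _ _ _ _ (henon_factor h) (fun p : C2 => p.2)).
    exact: henon_factor_differentiable.
  exact: snd_differentiable.
have Gx z : dif G z ((1, 0) : C2) = - h.2.
  apply: dif_is_derive; first exact: Gd.
  rewrite (_ : (fun t : C => _) = (fun t : C => t * (- h.2) + (h.1.[z.2] - h.2 * z.1))).
    rewrite -[X in is_derive _ _ _ X]addr0; apply: is_deriveD; exact: is_derive_lin.
  apply/funext => t; rewrite /G /henon_factor /=.
  rewrite ![_ *: _]mulr0 addr0 [t *: _]mulr1; ring.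
have E u : dif (fun q => G (henon hs q)) p u = dif (fun q => (henon hs q).1) p u * (- h.2)
   + dif (fun q => (henon hs q).2) p u * dif G (henon hs p) ((0, 1) : C2).
  rewrite (dif_comp _ (henon_differentiable hs p) (Gd _)) (dif2E _ (Gd _)) Gx.
  by rewrite (diff_pairE _ (henon_differentiable hs p)).
rewrite !E; have {H} := H p v w; move: (dif _ p v) (dif _ p w) (dif _ p v) (dif _ p w) (dif G _ _).
by move=> x1 x2 y1 y2 g Hxy; rewrite -mulrA -Hxy; ring.
Qed.

End HenonAlgebra.

(** * Growth exponents of the two coordinates *)

Section Growth.
Context {R : realType}.
Local Notation C := (Cx R).

Lemma henon_data_rcons (hs : seq ({poly C} * C)) : henon_data hs ->
  exists hs' h, [/\ hs = rcons hs' h, factors_ok hs', (2 < size h.1)%N & factors_ok hs].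
Proof.
move=> /andP[hs0 hsok]; move: hs0 hsok; case/lastP: hs => // hs h _ ok.
exists hs, h; have ok1 : factors_ok (rcons hs h) := ok.
by move: (ok1); rewrite {1}factors_ok_rcons => /andP[/andP[h2 _] ok'].
Qed.

Lemma henon_degree_gt0 (hs : seq ({poly C} * C)) : factors_ok hs -> (0 < henon_degree hs)%N.
Proof.
elim/last_ind: hs => [_|hs h IH]; first by rewrite /henon_degree big_nil.
rewrite factors_ok_rcons henon_degree_rcons muln_gt0 => /andP[/andP[h2 _] /IH ->] /=.
by move: h2; case: (size h.1) => [|[|]].
Qed.

(** The first coordinate of H is the second coordinate of the composition of all factors but the
    last; e is the degree of that composition, and e < d since the last factor has degree at least
    2. *)
Lemma henon_growth (hs : seq ({poly C} * C)) : henon_data hs -> exists e l l',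
  [/\ (0 < e < henon_degree hs)%N, l != 0 /\ l' != 0,
      (henon hs p).2 / p.2 ^+ henon_degree hs @[p --> cone_infty] --> l,
      (henon hs p).1 / p.2 ^+ e @[p --> cone_infty] --> l'
    & (henon hs p).1 / (henon hs p).2 @[p --> cone_infty] --> (0 : C)].
Proof.
move=> /henon_data_rcons[hs' [h [hsE ok' h2 ok]]].
have [l' l'0 [H1 _]] := henon_asymp ok'; have [l l0 [H2 HF]] := henon_asymp ok.
have PE p : (henon hs p).1 = (henon hs' p).2 by rewrite hsE henon_rcons.
have e0 := henon_degree_gt0 ok'; set e := henon_degree hs' in H1 e0.
have eD : (e < henon_degree hs)%N.
  rewrite hsE henon_degree_rcons -/e -[X in (X < _)%N]muln1 ltn_pmul2l //.
  by move: h2; case: (size h.1) => [|[|[|]]].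
have H1' : (henon hs p).1 / p.2 ^+ e @[p --> cone_infty] --> l'.
  by under eq_fun do rewrite PE.
exists e, l, l'; split; [by rewrite e0|by split|exact: H2|exact: H1'|].
have I : (p.2^-1) ^+ (henon_degree hs - e) @[p --> cone_infty] --> (0 : C).
  have [n ->] : exists n, (henon_degree hs - e)%N = n.+1.
    by move: eD; rewrite -subn_gt0; case: (_ - _)%N => // n _; exists n.
  elim: n => [|n IH]; first exact: inv_snd_cvg.
  under eq_fun do rewrite exprS.
  rewrite -(mulr0 0); exact: (cvgM inv_snd_cvg IH).
have H2' : ((henon hs p).2 / p.2 ^+ henon_degree hs)^-1 @[p --> cone_infty] --> l^-1.
  exact: (cvgV l0 H2).
have H : (henon hs p).1 / p.2 ^+ e * ((henon hs p).2 / p.2 ^+ henon_degree hs)^-1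
    * (p.2^-1) ^+ (henon_degree hs - e) @[p --> cone_infty] --> (0 : C).
  by rewrite -[X in _ --> X](mulr0 (l' * l^-1)); exact: (cvgM (cvgM H1' H2') I).
apply: (cone_eq_cvg ltr01 _ H) => p [p1 _] /=.
have y0 : p.2 != 0 by rewrite -nrm_gt0; apply: lt_trans p1; exact: ltr01.
rewrite invfM invrK exprVn.
have -> : p.2 ^+ henon_degree hs = p.2 ^+ e * p.2 ^+ (henon_degree hs - e).
  by rewrite -exprD subnKC // ltnW.
have := expf_neq0 e y0; have := expf_neq0 (henon_degree hs - e) y0.
move: (p.2 ^+ e) (p.2 ^+ _) ((henon hs p).1) ((henon hs p).2^-1) => A B x y B0 A0.
by field; rewrite A0 B0.
Qed.

End Growth.

(** * Elementary inequalities for the Böttcher estimates *)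

Section RealAux.
Context {R : realType}.
Implicit Types a b c d e : R.

Lemma half_close a b c : c <= a + b -> a < c / 2 -> c / 2 <= b.
Proof. lra. Qed.

Lemma cone_step_aux s a b p : 2 * a <= b -> p <= b / 100 -> s < a -> 0 < a ->
  2 * s < b /\ p < b.
Proof. by move=> *; split; lra. Qed.

Lemma two_close a b c d e : c < e / 2 -> a <= c -> b <= c -> d <= a + b -> d < e.
Proof. lra. Qed.

Lemma half_split_le a b c d e : a <= e * (c - d) -> b <= e * (2^-1 * d) ->
  a + b <= e * (c - 2^-1 * d).
Proof.
move=> H1 H2; have -> : e * (c - 2^-1 * d) = e * (c - d) + e * (2^-1 * d) by field.
exact: lerD.
Qed.

Lemma cone_ball_aux (s x y z w : R) : 2 * s < y -> x < y / 2 -> z < y / 2 -> y <= z + w ->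
  s < w /\ x < w.
Proof. by move=> *; split; lra. Qed.

Lemma quarter_div (g y : R) : y != 0 -> 2 * g / (y / 2) = 4 * g / y.
Proof. by move=> y0; field. Qed.

Lemma ring_aux1 (a b c : Cx R) : a + b * (c * a) - 1 = (a - 1) + a * (c * b).
Proof. ring. Qed.

Lemma add_half_le a b d e : d <= a + b -> a <= 2^-1 * e -> b <= e / 2 -> d <= e.
Proof. lra. Qed.

Lemma comparable_close (d y f : R) : 0 <= f -> d <= y / 20 -> y <= d + f -> d <= f / 4.
Proof. lra. Qed.

Lemma E_close (S b x y g e : R) : x <= 2 * S -> S <= g -> y <= 4 * g -> b <= 1 + x ->
  0 <= y -> 0 <= b -> 0 <= g -> g <= 2^-1 -> g <= e / 10 -> x + b * y <= e.
Proof.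
move=> H1 H2 H3 H4 y0 b0 g0 g1 g2.
have Hby : b * y <= 2 * (4 * g) by apply: ler_pM; lra.
lra.
Qed.

End RealAux.

(** * The contraction principle on discs *)

Section ContractionPrinciple.
Context {R : realType}.
Local Notation C := (Cx R).

Lemma half_small (e : R) : 0 < e -> exists n : nat, 2^-1 ^+ n < e.
Proof.
move=> e0; have : (2^-1 : R) ^+ n @[n --> \oo] --> (0 : R).
  by apply: cvg_expr; rewrite ger0_norm ?invr_ge0 // invf_lt1 // ltr1n.
move=> /cvgrPdist_lt/(_ e e0)[N _ HNN]; exists N.
by have := HNN N (leqnn N); rewrite /= sub0r normrN ger0_norm ?exprn_ge0 // invr_ge0.
Qed.

Lemma contraction_fixpoint (g : C -> C) (c : C) (s : R) : 0 <= s ->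
  (forall y y', nrm (y - c) <= s -> nrm (y' - c) <= s ->
     nrm (g y - g y') <= 2^-1 * nrm (y - y')) ->
  nrm (g c - c) <= s / 2 -> exists2 y, nrm (y - c) <= s & g y = y.
Proof.
move=> s0 gL gc; pose u n := iter n g c.
have uB n : nrm (u n - c) <= s.
  elim: n => [|n IH]; first by rewrite /u /= subrr nrm0.
  have H1 := gL _ _ IH (_ : nrm (c - c) <= s).
  apply: add_half_le (nrm_triangle (g c) _ _) _ gc.
  apply: le_trans (H1 _) _; first by rewrite subrr nrm0.
  by rewrite ler_wpM2l // invr_ge0.
have uS n : nrm (u n.+1 - u n) <= s * 2^-1 ^+ n.+1.
  elim: n => [|n IH]; first by rewrite expr1; exact: gc.
  apply: (le_trans (gL _ _ (uB n.+1) (uB n))).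
  by rewrite exprS mulrCA ler_wpM2l // invr_ge0.
have uC n m : nrm (u (n + m)%N - u n) <= s * (2^-1 ^+ n - 2^-1 ^+ (n + m)).
  elim: m => [|m IH]; first by rewrite addn0 !subrr nrm0 mulr0.
  have := uS (n + m)%N; rewrite addnS [_ ^+ (n + m).+1]exprS => H1.
  apply: le_trans (nrm_triangle (u (n + m)%N) _ _) _.
  by rewrite addrC; exact: half_split_le IH H1.
have uC' n m : nrm (u (n + m)%N - u n) <= s * 2^-1 ^+ n.
  by apply: (le_trans (uC n m)); rewrite ler_wpM2l // gerBl exprn_ge0.
have [y yP] : exists y : C, u n @[n --> \oo] --> y.
  apply: cx_cauchy => e e0.
  have s1 : 0 < e / 2 / (s + 1) by rewrite !divr_gt0 // ltr_wpDl.
  have [N NP] := half_small s1; exists N => n m Nn Nm.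
  have NP' : s * 2^-1 ^+ N < e / 2.
    rewrite ltr_pdivlMr ?ltr_wpDl // in NP; apply: le_lt_trans NP.
    by rewrite mulrC ler_wpM2l ?exprn_ge0 // lerDl.
  have := nrm_triangle (u N) (u n) (u m); rewrite [nrm (u N - _)]nrmBC.
  have B k : (N <= k)%N -> nrm (u k - u N) <= s * 2^-1 ^+ N.
    by move=> Nk; rewrite -(subnKC Nk).
  exact: two_close NP' (B n Nn) (B m Nm).
have yB n : nrm (y - u n) <= s * 2^-1 ^+ n.
  have cv : u (m + n)%N - u n @[m --> \oo] --> y - u n.
    apply: cvgB; last exact: cvg_cst.
    by have := yP; rewrite -(cvg_shiftn n).
  by apply: (nrm_lim_le cv) => m; rewrite addnC.
have yc : nrm (y - c) <= s by have := yB 0%N; rewrite expr0 mulr1.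
exists y => //; apply/eqP; rewrite -subr_eq0 -nrm_eq0 eq_le nrm_ge0 andbT leNgt.
apply/negP => p0; have s1 : 0 < nrm (g y - y) / (s + 1) by rewrite !divr_gt0 // ltr_wpDl.
have [n nP] := half_small s1; rewrite ltr_pdivlMr ?ltr_wpDl // in nP.
have B1 := nrm_triangle (u n.+1) (g y) y.
have B2 : nrm (g y - u n.+1) <= 2^-1 * (s * 2^-1 ^+ n).
  apply: (le_trans (gL _ _ yc (uB n))); rewrite ler_wpM2l ?invr_ge0 //.
have B3 : nrm (u n.+1 - y) <= s * 2^-1 ^+ n / 2.
  by rewrite nrmBC; apply: (le_trans (yB n.+1)); rewrite exprS mulrCA mulrC.
have := add_half_le B1 B2 B3; apply/negP; rewrite -ltNge; apply: le_lt_trans nP.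
by rewrite mulrC ler_wpM2l ?exprn_ge0 // lerDl.
Qed.

End ContractionPrinciple.

(** * Construction and asymptotics of the Böttcher coordinate *)

Section Boettcher.
Context {R : realType}.
Local Notation C := (Cx R).
Local Notation C2 := (Cx2 R).

Lemma cvg_seq_uniq (u : nat -> C) (l m : C) :
  u n @[n --> \oo] --> l -> u n @[n --> \oo] --> m -> l = m.
Proof. by apply: cvg_unique; exact: norm_hausdorff. Qed.

Variables (H : C2 -> C2) (D : nat) (l : C).
Hypotheses (D1 : (1 < D)%N) (l0 : l != 0) (Hd : forall p, differentiable H p).
Hypothesis HN : (H p).2 / p.2 ^+ D @[p --> cone_infty] --> l.
Hypothesis HP : (H p).1 / (H p).2 @[p --> cone_infty] --> (0 : C).

Definition quo (p : C2) : C := (H p).2 / p.2 ^+ D / l.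

Lemma quo_cvg : quo @ cone_infty --> (1 : C).
Proof.
rewrite (_ : 1 = l / l); last by rewrite divff.
by apply: (cvgM HN); exact: cvg_cst.
Qed.

(* The Boettcher coordinate is y exp(sum_n D^-(n+1) psi(H^n p)), the limit of
   the D^n-th roots of the second coordinate of H^n p. *)
Definition psi (p : C2) : C := Log (quo p).

Lemma psi_cvg : psi @ cone_infty --> (0 : C).
Proof.
rewrite -(@Log1 R); apply: (cvg_comp _ _ quo_cvg).
by apply: Log_continuous; rewrite -rc1 /= ltr01.
Qed.

(** The factor 100 is a margin: it places images under H so close to the y-axis that they fall into
    the image of the chart, see [chart_set_of]. *)
Definition escape_radius (r : R) : Prop :=
  1 <= r /\ forall p, cone r p ->
    [/\ nrm (quo p - 1) < 1, nrm (psi p) <= 1, 2 * nrm p.2 <= nrm (H p).2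
      & nrm (H p).1 <= nrm (H p).2 / 100].

Lemma escape_radius_exists (r0 : R) : exists2 r, r0 <= r & escape_radius r.
Proof.
have [r1 r10 E1] := near_cone ((cvg_nrmP _ _ _).1 quo_cvg 1 ltr01).
have [r2 r20 E2] := near_cone ((cvg_nrmP _ _ _).1 psi_cvg 1 ltr01).
have lp : 0 < nrm l by rewrite nrm_gt0.
have lp2 : 0 < nrm l / 2 by rewrite divr_gt0.
have [r3 r30 E3] := near_cone ((cvg_nrmP _ _ _).1 HN _ lp2).
have e100 : (0 : R) < 100^-1 by rewrite invr_gt0.
have [r4 r40 E4] := near_cone ((cvg_nrmP _ _ _).1 HP _ e100).
exists (Num.max (Num.max (Num.max r0 1) (Num.max r1 r2)) (Num.max (Num.max r3 r4) (4 / nrm l))).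
  by rewrite !le_max lexx.
split; first by rewrite !le_max lexx !orbT.
move=> p pm.
have p1 : cone r1 p by apply: cone_sub pm; rewrite !le_max lexx !orbT.
have p2 : cone r2 p by apply: cone_sub pm; rewrite !le_max lexx !orbT.
have p3 : cone r3 p by apply: cone_sub pm; rewrite !le_max lexx !orbT.
have p4 : cone r4 p by apply: cone_sub pm; rewrite !le_max lexx !orbT.
have [p5 _] : cone 1 p by apply: cone_sub pm; rewrite !le_max lexx !orbT.
have [p6 _] : cone (4 / nrm l) p by apply: cone_sub pm; rewrite !le_max lexx !orbT.
have y0 : 0 < nrm p.2 by apply: lt_trans p5; exact: ltr01.
have N2 : 2 * nrm p.2 <= nrm (H p).2.
  have := nrm_subD l ((H p).2 / p.2 ^+ D); rewrite nrmBC => T.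
  have := half_close T (E3 p p3).
  rewrite nrmM nrmV nrmX ler_pdivlMr ?exprn_gt0 //; apply: le_trans.
  have [k DE] : exists k, D = k.+2 by move: D1; case: (D) => [|[|k]] // _; exists k.
  have Y1 : 1 <= nrm p.2 ^+ k by rewrite exprn_ege1 // ltW.
  have Y2 : 4 <= nrm l * nrm p.2 by rewrite mulrC -ler_pdivrMr // ltW.
  rewrite DE !exprS.
  have -> : nrm l / 2 * (nrm p.2 * (nrm p.2 * nrm p.2 ^+ k)) =
    (nrm l * nrm p.2) / 2 * (nrm p.2 * nrm p.2 ^+ k) by ring.
  apply: ler_pM; rewrite ?(ltW y0) //; first by rewrite ler_pdivlMr // -natrM.
  by rewrite ler_peMr // ltW.
split=> //; first exact: E1.
  by have := E2 p p2; rewrite subr0 => /ltW.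
have := E4 p p4; rewrite subr0 nrmM nrmV.
have N0 : 0 < nrm (H p).2 by apply: lt_le_trans N2; rewrite mulr_gt0.
by rewrite ltr_pdivrMr // mulrC => /ltW.
Qed.

Variable r : R.
Hypothesis rP : escape_radius r.

Let r1 : 1 <= r := rP.1.
Let r0 : 0 < r := lt_le_trans ltr01 r1.

Lemma cone_gt0 s p : r <= s -> cone s p -> 0 < nrm p.2.
Proof. by move=> rs [ps _]; apply: lt_trans ps; apply: lt_le_trans rs. Qed.

Lemma cone_neq0 s p : r <= s -> cone s p -> p.2 != 0.
Proof. by move=> rs ps; rewrite -nrm_gt0 (cone_gt0 rs ps). Qed.

Lemma cone_step s p : r <= s -> cone s p -> cone (2 * s) (H p).
Proof.
move=> rs /[dup] ps [ps1 ps2]; have [_ _ N2 P1] := rP.2 p (cone_sub rs ps).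
have y0 := cone_gt0 rs ps.
exact: cone_step_aux N2 P1 ps1 y0.
Qed.

Lemma cone_iter s n p : r <= s -> cone s p -> cone (2 ^+ n * s) (iter n H p).
Proof.
move=> rs ps; have s0 : 0 <= s by apply: ltW; apply: lt_le_trans rs.
elim: n => [|n IH]; first by rewrite expr0 mul1r.
rewrite iterS exprS -mulrA; apply: cone_step => //.
by apply: (le_trans rs); rewrite ler_peMl // exprn_ege1 // ler1n.
Qed.

Lemma cone_iter_sub s n p : r <= s -> cone s p -> cone s (iter n H p).
Proof.
move=> rs ps; apply: cone_sub (cone_iter n rs ps).
rewrite ler_peMl //; last by rewrite exprn_ege1 // ler1n.
by apply: le_trans rs; exact: ltW.
Qed.

Lemma psi_small (e : R) : 0 < e -> exists2 s, r <= s & forall p, cone s p -> nrm (psi p) <= e.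
Proof.
move=> e0; have [s s0 E] := near_cone ((cvg_nrmP _ _ _).1 psi_cvg e e0).
exists (Num.max r s); first by rewrite le_max lexx.
move=> p pm; have := E p; rewrite subr0 => H1; apply: ltW; apply: H1.
by apply: cone_sub pm; rewrite le_max lexx orbT.
Qed.

Lemma quo_Re p : cone r p -> 0 < Re (quo p).
Proof. by move=> pr; apply: Re_near1; have [] := rP.2 p pr. Qed.

Lemma cexp_psi p : cone r p -> cexp (psi p) = quo p.
Proof. by move=> pr; apply: LogK; exact: quo_Re. Qed.

Lemma iter_differentiable n p : differentiable (iter n H) p.
Proof.
elim: n => [|n IH]; first by have [] := @is_diff_id (Cx R) (Cx2 R) p.
by rewrite (_ : iter n.+1 H = H \o iter n H) //; apply: differentiable_comp; [exact: IH|exact: Hd].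
Qed.

Lemma snd_H_differentiable p : differentiable (fun q => (H q).2) p.
Proof.
apply: (@differentiable_comp _ _ _ _ H (fun p : C2 => p.2)); first exact: Hd.
exact: snd_differentiable.
Qed.

Lemma psi_differentiable p : cone r p -> differentiable psi p.
Proof.
move=> pr; apply: (@differentiable_comp _ _ _ _ quo (@Log R)).
  apply: differentiableM; last exact: differentiable_cst.
  apply: differentiableM; first exact: snd_H_differentiable.
  apply: differentiableV; first by apply: differentiable_pow; exact: snd_differentiable.
  by rewrite expf_neq0 // (cone_neq0 (lexx r) pr).
exact: is_derive_diff (is_derive_Log (quo_Re pr)).
Qed.

Definition Spart (n : nat) (p : C2) : C :=
  \sum_(k < n) (D%:R ^- k.+1) * psi (iter k H p).

Lemma Spart_cauchy s e p n m : r <= s -> (forall q, cone s q -> nrm (psi q) <= e) ->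
  cone s p -> nrm (Spart (n + m) p - Spart n p) <= e * (2^-1 ^+ n).
Proof.
move=> rs es ps.
suff B : nrm (Spart (n + m) p - Spart n p) <= e * (2^-1 ^+ n - 2^-1 ^+ (n + m)).
  apply: le_trans B _; have e0 : 0 <= e by apply: le_trans (es p ps); exact: nrm_ge0.
  by rewrite ler_wpM2l // gerBl exprn_ge0.
elim: m => [|m IH]; first by rewrite addn0 !subrr nrm0 mulr0.
rewrite addnS /Spart big_ord_recr /= -/(Spart (n + m) p) -/(Spart n p) addrAC.
apply: le_trans (nrmD _ _) _.
have : nrm (D%:R ^- (n + m).+1 * psi (iter (n + m) H p)) <= e * 2^-1 ^+ (n + m).+1.
  rewrite nrmM nrmV nrmX nrm_nat mulrC; apply: ler_pM; rewrite ?nrm_ge0 ?invr_ge0 ?exprn_ge0 //.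
  - by apply: es; apply: cone_iter_sub.
  rewrite exprVn lef_pV2 ?posrE ?exprn_gt0 ?ltr0n ?(ltn_trans _ D1) //.
  by apply: lerXn2r; rewrite ?nnegrE ?ler_nat.
rewrite [2^-1 ^+ (n + m).+1]exprS; exact: half_split_le IH.
Qed.

Definition Slim (p : C2) : C := xget 0 [set z | Spart n p @[n --> \oo] --> z].

Lemma psi_le1 p : cone r p -> nrm (psi p) <= 1.
Proof. by move=> pr; have [] := rP.2 p pr. Qed.

Lemma Slim_cvg p : cone r p -> Spart n p @[n --> \oo] --> Slim p.
Proof.
move=> pr; suff [z zP] : exists z : C, Spart n p @[n --> \oo] --> z.
  exact: (@xgetPex _ 0 [set z | Spart n p @[n --> \oo] --> z] (ex_intro _ z zP)).
apply: cx_cauchy => e e0; have e20 : 0 < e / 2 by rewrite divr_gt0.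
have [N NP] := half_small e20; exists N => n m Nn Nm.
have B k : (N <= k)%N -> nrm (Spart k p - Spart N p) <= 2^-1 ^+ N.
  move=> Nk; rewrite -(subnKC Nk) -[leRHS]mul1r.
  by apply: Spart_cauchy (lexx r) _ pr; exact: psi_le1.
have := nrm_triangle (Spart N p) (Spart n p) (Spart m p).
rewrite [nrm (Spart N p - _)]nrmBC; exact: two_close NP (B n Nn) (B m Nm).
Qed.

Lemma Slim_le s e p : r <= s -> (forall q, cone s q -> nrm (psi q) <= e) ->
  cone s p -> nrm (Slim p) <= e.
Proof.
move=> rs es ps; apply: nrm_lim_le (Slim_cvg (cone_sub rs ps)) _ => n.
have := Spart_cauchy 0 n rs es ps; rewrite add0n expr0 mulr1.
by rewrite [X in _ - X]/Spart big_ord0 subr0.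
Qed.

Lemma Slim_differentiable p : cone r p -> differentiable Slim p.
Proof.
move=> /cone_open/nbhs_nrmP[e e0 eP]; apply: (@limit_diff2 R Spart Slim p e 1 e0); last first.
  by move=> q /eP qr; exact: Slim_cvg.
move=> n q /eP qr; split; last first.
  have := Spart_cauchy 0 n (lexx r) psi_le1 qr; rewrite add0n expr0 mulr1.
  by rewrite [X in _ - X]/Spart big_ord0 subr0.
rewrite (_ : Spart n = \sum_(k < n) (fun p => (D%:R ^- k.+1) * psi (iter k H p))); last first.
  by apply/funext => z; rewrite fct_sumE.
apply: differentiable_sum => k.
apply: differentiableM; first exact: differentiable_cst.
apply: (@differentiable_comp _ _ _ _ (iter k H) psi); first exact: iter_differentiable.
by apply: psi_differentiable; apply: cone_iter_sub.
Qed.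

Lemma Slim_H p : cone r p -> D%:R * Slim p = psi p + Slim (H p).
Proof.
move=> pr; have Hr := cone_iter_sub 1 (lexx r) pr.
have E n : D%:R * Spart n.+1 p = psi p + Spart n (H p).
  rewrite /Spart big_ord_recl /= mulrDr mulrA expr1 mulfV ?mul1r; last first.
    by rewrite pnatr_eq0 -lt0n (ltn_trans _ D1).
  congr (_ + _); rewrite mulr_sumr; apply: eq_bigr => k _.
  rewrite /bump /= add1n -iterS iterSr mulrA exprS invfM mulrA mulfV ?mul1r //.
  by rewrite pnatr_eq0 -lt0n (ltn_trans _ D1).
have c1 : D%:R * Spart n.+1 p @[n --> \oo] --> D%:R * Slim p.
  apply: cvgM; first exact: cvg_cst.
  by have := Slim_cvg pr; rewrite -cvg_shiftS.
apply: (cvg_seq_uniq c1); under eq_fun do rewrite E.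
by apply: cvgD; [exact: cvg_cst|exact: (Slim_cvg Hr)].
Qed.

Definition bphi (p : C2) : C := p.2 * cexp (Slim p).

Lemma bphi_differentiable p : cone r p -> differentiable bphi p.
Proof.
move=> pr; apply: differentiableM; first exact: snd_differentiable.
apply: (@differentiable_comp _ _ _ _ Slim (@cexp R)); first exact: Slim_differentiable.
exact: cexp_differentiable.
Qed.

Lemma bphi_H p : cone r p -> bphi (H p) = l * bphi p ^+ D.
Proof.
move=> pr; have y0 := cone_neq0 (lexx r) pr.
have -> : bphi (H p) = (H p).2 * (cexp (D%:R * Slim p) / cexp (psi p)).
  by rewrite /bphi -cexpB (Slim_H pr) addrC addKr.
rewrite cexpMn cexp_psi // /bphi exprMn /quo.
have N0 : (H p).2 != 0 := cone_neq0 (lexx r) (cone_iter_sub 1 (lexx r) pr).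
move: (cexp _ ^+ _) (expf_neq0 D y0) N0; move: (p.2 ^+ D) (H p).2 => A B Z A0 B0.
by field; rewrite A0 B0 l0.
Qed.

(** In this narrower cone the vertical disc of radius |y|/2 about a point stays inside [cone], up to
    halving the radius s, as the Cauchy estimate in the y-direction requires. *)
Definition ncone (s : R) : set C2 := [set p | s < nrm p.2 /\ nrm p.1 < nrm p.2 / 2].

Lemma ncone_cone s p : 0 <= s -> ncone s p -> cone s p.
Proof.
move=> s0 [p1 p2]; split => //; apply: lt_le_trans p2 _.
by rewrite ler_pdivrMr // ler_peMr ?nrm_ge0 // ler1n.
Qed.

Lemma ncone_sub s s' p : s <= s' -> ncone s' p -> ncone s p.
Proof. by move=> ss [p1 p2]; split => //; apply: le_lt_trans p1. Qed.

(** The exponent [Slim] is small near infinity. By Cauchy on a disc of radius |y|/2 its y-derivative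
    is small compared with 1/|y|, which compensates for the factor y in y exp([Slim]). *)
Lemma bphi_estimates (e : R) : 0 < e -> exists2 s, r <= s & forall p, ncone s p ->
  nrm (bphi p - p.2) <= e * nrm p.2 /\ nrm (dif bphi p ((0, 1) : C2) - 1) <= e.
Proof.
move=> e0; have [d d0 dP] := @cexp_near0 R 1 ltr01.
(* With |[Slim]| <= g the derivative error is at most 2 g + (1 + 2 g) 4 g <= 10 g, using g <=
   1/2. *)
pose g := Num.min (d / 2) (Num.min (e / 10) 2^-1).
have g0 : 0 < g by rewrite /g !lt_min; apply/and3P; split; rewrite ?divr_gt0 ?invr_gt0.
have gd : g < d by apply: (@le_lt_trans _ _ (d / 2)); [rewrite ge_min lexx|rewrite ltr_pdivrMr // ltr_pMr // ltr1n].
have ge : g <= e / 10 by rewrite !ge_min lexx orbT.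
have g2 : g <= 2^-1 by rewrite !ge_min lexx !orbT.
clearbody g; have [s rs sP] := psi_small g0.
have s0 : 0 < s := lt_le_trans r0 rs.
exists (2 * s) => [|p pn]; first by apply: le_trans rs _; rewrite ler_peMl ?ler1n // ltW.
have ps : cone s p.
  apply: ncone_cone (ltW s0) _; apply: ncone_sub pn; rewrite ler_peMl ?ler1n //; exact: ltW.
have y0 := cone_gt0 rs ps.
have Sg : nrm (Slim p) <= g := Slim_le rs sP ps.
have eS : nrm (cexp (Slim p) - 1) <= 2 * nrm (Slim p).
  have T := nrm_subD (cexp (Slim p) - 1) (Slim p); have := dP _ (le_lt_trans Sg gd).
  rewrite mul1r => T2; apply: (le_trans T).
  by rewrite (_ : 2 = 1 + 1) // mulrDl mul1r lerD2r.
split.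
  rewrite /bphi -{2}[p.2]mulr1 -mulrBr nrmM mulrC ler_wpM2r ?nrm_ge0 //.
  apply: (le_trans eS); apply: (@le_trans _ _ (2 * (e / 10))); last first.
    by rewrite mulrCA ler_piMr ?(ltW e0) // ler_pdivrMr // mul1r ler_nat.
  by rewrite ler_wpM2l // (le_trans Sg).
have Sd := Slim_differentiable (cone_sub rs ps).
have L1 : is_derive (0 : C) 1 (fun t : C => p + t *: ((0, 1) : C2)) ((0, 1) : C2).
  exact: line_is_derive.
set v : C2 := (0, 1) in L1 *; set sg := dif Slim p v.
have D1' : is_derive (0 : C) 1 (fun t : C => Slim (p + t *: v)) sg.
  have B : differentiable Slim (p + 0 *: v) by rewrite scale0r addr0.
  have := is_derive_dif B L1; rewrite scale0r addr0; exact.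
have D2 : is_derive (0 : C) 1 (fun t : C => cexp (Slim (p + t *: v))) (sg * cexp (Slim p)).
  have B : is_derive (Slim (p + 0 *: v)) 1 (@cexp R) (cexp (Slim p)).
    by rewrite scale0r addr0; exact: is_derive_cexp.
  exact: (is_derive_compC B D1').
have D3 : dif bphi p v = cexp (Slim p) + p.2 * (sg * cexp (Slim p)).
  apply: dif_is_derive; first exact: bphi_differentiable (cone_sub rs ps).
  have D4 : is_derive (0 : C) 1 (fun t : C => p.2 + t * 1) 1.
    rewrite -[X in is_derive _ _ _ X]add0r; apply: is_deriveD; exact: is_derive_lin.
  have := is_deriveM D4 D2.
  rewrite /= scale0r addr0 mul0r addr0 [_ *: 1]mulr1 addrC.
  by congr is_derive; apply/funext => t; rewrite /bphi /v /= [t *: 1]mulr1 mulr1.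
have lineE (z : C) : p + z *: v = (p.1, p.2 + z) :> C2.
  by case: (p) => x y; rewrite /v; congr (_, _); [rewrite /= scaler0 addr0|rewrite /= [_ *: _]mulr1].
have vcone (z : C) : nrm z < nrm p.2 / 2 -> cone s (p + z *: v).
  case: pn => pn1 pn2 zy; rewrite lineE; have := nrm_subD p.2 (p.2 + z).
  rewrite opprD addNKr nrmN; exact: cone_ball_aux.
have sgB : nrm sg <= 2 * g / (nrm p.2 / 2).
  apply: (@cauchy_estimate R (fun t : C => Slim (p + t *: v)) 0 _ _ _ _ _ _ D1').
  - by rewrite divr_gt0.
  - move=> z; rewrite subr0 => zy.
    apply: (@differentiable_comp _ _ _ _ (fun t : C => p + t *: v) Slim).
      exact: is_derive_diff (line_is_derive _ _ _).
    by apply: Slim_differentiable; apply: cone_sub rs _; exact: vcone.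
  by move=> z; rewrite subr0 => zy; apply: Slim_le rs sP _; exact: vcone.
rewrite D3 (ring_aux1 (cexp (Slim p)) p.2 sg); apply: (le_trans (nrmD _ _)); rewrite nrmM.
have bx : nrm (cexp (Slim p)) <= 1 + nrm (cexp (Slim p) - 1).
  by have := nrm_subD (cexp (Slim p)) 1; rewrite nrm1 addrC.
have yB : nrm (sg * p.2) <= 4 * g.
  rewrite nrmM -ler_pdivlMr //; apply: (le_trans sgB).
  by rewrite quarter_div // gt_eqF.
apply: E_close eS Sg yB bx _ _ (ltW g0) g2 ge; exact: nrm_ge0.
Qed.

End Boettcher.

(** * Leaves and the chart at infinity *)

Section Leaves.
Context {R : realType}.
Local Notation C := (Cx R).
Local Notation C2 := (Cx2 R).

Lemma pr1_differentiable {V W : normedModType C} (p : V * W) :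
  differentiable (fun p : V * W => p.1) p.
Proof.
pose L : {linear (V * W)%type -> V} := fst.
have [] // := @diff_nrmI R (V * W)%type V fst p L 1; first by move=> v; rewrite mul1r nrm_fst.
move=> e e0; exists 1 => [|h _]; first exact: ltr01.
rewrite (_ : _ - _ = 0) ?nrm0 ?mulr_ge0 ?nrm_ge0 // ?ltW //.
by rewrite /L [fst (p + h)](_ : _ = fst p + fst h) // [fst p + _]addrC addrK subrr.
Qed.

Lemma pr2_differentiable {V W : normedModType C} (p : V * W) :
  differentiable (fun p : V * W => p.2) p.
Proof.
pose L : {linear (V * W)%type -> W} := snd.
have [] // := @diff_nrmI R (V * W)%type W snd p L 1; first by move=> v; rewrite mul1r nrm_snd.
move=> e e0; exists 1 => [|h _]; first exact: ltr01.
rewrite (_ : _ - _ = 0) ?nrm0 ?mulr_ge0 ?nrm_ge0 // ?ltW //.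
by rewrite /L [snd (p + h)](_ : _ = snd p + snd h) // [snd p + _]addrC addrK subrr.
Qed.

Lemma vertical_is_derive (x y : C) :
  is_derive y 1 (fun y : C => ((x, y) : C2)) ((0, 1) : C2).
Proof.
have := @line_is_derive R (Cx2 R) ((x, 0) : C2) ((0, 1) : C2) y.
congr is_derive; apply/funext => z.
by congr (_, _); [rewrite /= scaler0 addr0|rewrite /= add0r [_ *: _]mulr1].
Qed.

Lemma ball_cone_aux (s n x d y : R) : 0 <= s -> 2 * s < n -> x < n / 4 -> d <= n / 4 -> n <= d + y ->
  s < y /\ x < y / 2.
Proof. by move=> *; split; lra. Qed.

Lemma close_aux1 (d y f : R) : 0 <= f -> d <= y / 20 -> y <= d + f -> d <= f / 10.
Proof. lra. Qed.

Lemma close_aux2 (a b c n m : R) : 0 <= n -> c <= a + b -> a <= n / 10 -> b <= n / 20 -> n <= b + m ->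
  c <= m / 4.
Proof. lra. Qed.

Lemma close_aux3 (a b c n : R) : 0 <= n -> c <= a + b -> b <= n / 10 -> a <= n / 20 -> c <= n / 4.
Proof. lra. Qed.

Variables (phi : C2 -> C) (r s : R).
Hypotheses (r0 : 0 < r) (rs : r <= s).
Hypothesis phi_diff : forall p, cone r p -> differentiable phi p.
Hypothesis phi_est : forall p, ncone s p ->
  nrm (phi p - p.2) <= 20^-1 * nrm p.2 /\ nrm (dif phi p ((0, 1) : C2) - 1) <= 20^-1.

Let s0 : 0 <= s := ltW (lt_le_trans r0 rs).

Lemma ncone_r p : ncone s p -> cone r p.
Proof. by move=> /(ncone_cone s0); exact: cone_sub. Qed.

(** Here t = (x, zeta). The constants ensure that every y with |y - zeta| <= |zeta|/4 gives a point
    (x, y) of [ncone s]. *)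
Definition leaf_dom : set C2 := [set t | 2 * s < nrm t.2 /\ nrm t.1 < nrm t.2 / 4].

Definition leaf_ball (t : C2) : set C := [set y | nrm (y - t.2) <= nrm t.2 / 4].

Lemma leaf_ball_ncone t y : leaf_dom t -> leaf_ball t y -> ncone s ((t.1, y) : C2).
Proof.
move=> [t2 t1] yb; have := nrm_subD t.2 y; rewrite nrmBC.
exact: ball_cone_aux s0 t2 t1 yb.
Qed.

(* A contraction whose fixed point is the y with phi (x, y) = zeta, t = (x, zeta). *)
Definition leaf_map (t : C2) (y : C) : C := y - phi (t.1, y) + t.2.

Lemma leaf_ball_segment t w z (u : R) : 0 <= u <= 1 -> leaf_ball t w -> leaf_ball t z ->
  leaf_ball t (w + rc u * (z - w)).
Proof.
move=> /andP[u0 u1]; rewrite /leaf_ball /= => wb zb.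
have -> : w + rc u * (z - w) - t.2 = rc (1 - u) * (w - t.2) + rc u * (z - t.2).
  by rewrite rcB rc1; move: (t.2) => c; ring.
apply: le_trans (nrmD _ _) _; rewrite !nrmM !nrm_rc !ger0_norm ?subr_ge0 //.
have -> : nrm t.2 / 4 = (1 - u) * (nrm t.2 / 4) + u * (nrm t.2 / 4) by rewrite -mulrDl subrK mul1r.
by apply: lerD; rewrite ler_wpM2l ?subr_ge0.
Qed.

Lemma phi_vertical_is_derive x y : cone r ((x, y) : C2) ->
  is_derive y 1 (fun y : C => phi (x, y)) (dif phi ((x, y) : C2) ((0, 1) : C2)).
Proof.
by move=> /phi_diff pd; exact: (@is_derive_dif R (Cx2 R) phi _ _ _ pd (vertical_is_derive x y)).
Qed.

Lemma leaf_map_lip t w z : leaf_dom t -> leaf_ball t w -> leaf_ball t z ->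
  nrm (leaf_map t z - leaf_map t w) <= 2^-1 * nrm (z - w).
Proof.
move=> td wb zb; apply: mean_value_inequality => u u01.
have yb := leaf_ball_segment u01 wb zb; move: (w + _) yb => y yb.
have yn := leaf_ball_ncone td yb.
exists (1 - dif phi ((t.1, y) : C2) ((0, 1) : C2)).
  rewrite -[X in is_derive _ _ _ X]addr0.
  apply: is_deriveD; apply: is_deriveB; exact: phi_vertical_is_derive (ncone_r yn).
rewrite nrmBC; apply: (le_trans (phi_est yn).2); rewrite lef_pV2 ?posrE ?ltr0n //.
by rewrite ler_nat.
Qed.

Lemma leaf_solution t : leaf_dom t ->
  exists y, leaf_ball t y /\ phi (t.1, y) = t.2.
Proof.
move=> td; have cb : leaf_ball t t.2 by rewrite /leaf_ball /= subrr nrm0 divr_ge0 ?nrm_ge0.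
have [|||y yb yfix] := @contraction_fixpoint R (leaf_map t) t.2 (nrm t.2 / 4).
- by rewrite divr_ge0 ?nrm_ge0.
- by move=> y y' yb yb'; exact: leaf_map_lip.
- rewrite /leaf_map addrK nrmBC; apply: (le_trans (phi_est (leaf_ball_ncone td cb)).1) => /=.
  by rewrite mulrC -mulrA ler_wpM2l ?nrm_ge0 // -invfM lef_pV2 ?posrE -?natrM ?ler_nat.
exists y; split => //; apply/eqP; move/eqP: yfix.
by rewrite /leaf_map -addrA -subr_eq0 addrAC subrr add0r addrC subr_eq0 eq_sym.
Qed.

Lemma leaf_unique t y y' : leaf_dom t -> leaf_ball t y -> leaf_ball t y' ->
  phi (t.1, y) = t.2 -> phi (t.1, y') = t.2 -> y = y'.
Proof.
move=> td yb yb' e e'; have := leaf_map_lip td yb yb'; rewrite /leaf_map e e' !subrK.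
move=> H; apply/esym/eqP; rewrite -subr_eq0 -nrm_eq0 eq_le nrm_ge0 andbT.
by have := nrm_ge0 (y' - y); move: H; move: (nrm _) => d; lra.
Qed.

Definition leafY (t : C2) : C := xget 0 [set y | leaf_ball t y /\ phi (t.1, y) = t.2].

Lemma leafY_spec t : leaf_dom t -> leaf_ball t (leafY t) /\ phi (t.1, leafY t) = t.2.
Proof.
move=> /leaf_solution[y yP].
exact: (@xgetPex _ 0 [set y | leaf_ball t y /\ phi (t.1, y) = t.2] (ex_intro _ y yP)).
Qed.

Definition leaf (t : C2) : C2 := (t.1, leafY t).

Lemma leaf_ncone t : leaf_dom t -> ncone s (leaf t).
Proof. by move=> td; apply: leaf_ball_ncone => //; exact: (leafY_spec td).1. Qed.

Lemma phi_leaf t : leaf_dom t -> phi (leaf t) = t.2.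
Proof. by move=> td; exact: (leafY_spec td).2. Qed.

Lemma leaf_phi p : ncone s p -> leaf_dom (p.1, phi p) -> leaf (p.1, phi p) = p.
Proof.
move=> pn td; case: p pn td => x y pn td; congr (_, _).
have [Yb Ye] := leafY_spec td; apply: leaf_unique td Yb _ Ye _ => //.
rewrite /leaf_ball /=; have [e1 _] := phi_est pn; rewrite nrmBC.
apply: comparable_close (nrm_ge0 _) _ (_ : nrm y <= _); first by rewrite [leRHS]mulrC; exact: e1.
by rewrite nrmBC; exact: nrm_subD.
Qed.

Lemma leaf_dom_open t : leaf_dom t -> \forall u \near t, leaf_dom u.
Proof.
move=> [t2 t1].
pose e := Num.min (nrm t.2 - 2 * s) ((nrm t.2 / 4 - nrm t.1) / 2).
have e0 : 0 < e by rewrite lt_min subr_gt0 t2 divr_gt0 // subr_gt0.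
have e1 : e <= nrm t.2 - 2 * s by rewrite ge_min lexx.
have e2 : e <= (nrm t.2 / 4 - nrm t.1) / 2 by rewrite ge_min lexx orbT.
apply/nbhs_nrmP; exists e => // q qp.
have S1 : nrm (q.1 - t.1) < e := le_lt_trans (nrm_fst (q - t)) qp.
have S2 : nrm (q.2 - t.2) < e := le_lt_trans (nrm_snd (q - t)) qp.
have T1 := nrm_subD t.2 q.2; have T2 := nrm_subD q.1 t.1.
rewrite [nrm (t.2 - _)]nrmBC in T1; rewrite /leaf_dom /=.
clearbody e.
move: (nrm (q.1 - t.1)) (nrm (q.2 - t.2)) (nrm t.1) (nrm t.2) (nrm q.1) (nrm q.2) S1 S2 T1 T2 e1 e2 e0.
move=> a b c d f g *; split; lra.
Qed.

Lemma leafY_differentiable t : leaf_dom t -> differentiable leafY t.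
Proof.
move=> td; have /nbhs_nrmP[d d0 dP] := leaf_dom_open td.
have [Yb Ye] := leafY_spec td.
have n0 : 0 < nrm t.2 by have [t2 _] := td; apply: le_lt_trans t2; rewrite mulr_ge0.
(* The solution lies well inside its ball of radius |zeta|/4, so it also lies in the ball of every
   nearby parameter, where the contraction of the latter applies to it. *)
have Yc : nrm (leafY t - t.2) <= nrm t.2 / 10.
  have [e1 _] := phi_est (leaf_ball_ncone td Yb); rewrite Ye nrmBC mulrC in e1.
  by apply: close_aux1 (nrm_ge0 _) e1 _; exact: nrm_subD.
pose d1 := Num.min d (nrm t.2 / 20).
have d10 : 0 < d1 by rewrite lt_min d0 divr_gt0.
have d1d : d1 <= d by rewrite ge_min lexx.
have d1n : d1 <= nrm t.2 / 20 by rewrite ge_min lexx orbT.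
clearbody d1.
pose g (q : C2 * C) : C := q.2 - phi (q.1.1, q.2) + q.1.2.
apply: (@implicit_diff R g leafY t d1 d10).
- apply: differentiableD; last first.
    apply: (@differentiable_comp _ _ _ _ (fun q : C2 * C => q.1) (fun q : C2 => q.2)).
      exact: pr1_differentiable.
    exact: snd_differentiable.
  apply: differentiableB; first exact: pr2_differentiable.
  apply: (@differentiable_comp _ _ _ _ (fun q : C2 * C => (q.1.1, q.2) : C2) phi); last first.
    exact: phi_diff (ncone_r (leaf_ncone td)).
  apply: differentiable_pair; last exact: pr2_differentiable.
  apply: (@differentiable_comp _ _ _ _ (fun q : C2 * C => q.1) (fun q : C2 => q.1)).
    exact: pr1_differentiable.
  exact: fst_differentiable.
- move=> u ut; have ud := dP u (lt_le_trans ut d1d); have [Yu Yue] := leafY_spec ud.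
  split; first by rewrite /g /= Yue subrK.
  apply: leaf_map_lip => //; have tu := le_trans (ltW (le_lt_trans (nrm_snd _) ut)) d1n.
  rewrite [nrm _]nrmBC /= in tu; apply: close_aux2 (ltW n0) _ Yc tu _.
    exact: nrm_triangle.
  exact: nrm_subD.
move=> y yt; apply: leaf_map_lip => //.
apply: close_aux3 (ltW n0) (nrm_triangle (leafY t) _ _) Yc _.
exact: le_trans (ltW yt) d1n.
Qed.

Lemma leaf_differentiable t : leaf_dom t -> differentiable leaf t.
Proof.
move=> td; apply: differentiable_pair; first exact: fst_differentiable.
exact: leafY_differentiable.
Qed.

End Leaves.

(** * The affine coordinate along the leaves *)

Section Transversal.
Context {R : realType}.
Local Notation C := (Cx R).
Local Notation C2 := (Cx2 R).

Lemma horizontal_is_derive (x y : C) :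
  is_derive x 1 (fun x : C => ((x, y) : C2)) ((1, 0) : C2).
Proof.
have := @line_is_derive R (Cx2 R) ((0, y) : C2) ((1, 0) : C2) x.
congr is_derive; apply/funext => z.
by congr (_, _); [rewrite /= add0r [_ *: _]mulr1|rewrite /= scaler0 addr0].
Qed.

Lemma push_aux (a E E' A' u1 u2 w1 w2 k : C) : k != 0 -> E != 0 -> E' != 0 ->
  A' * u1 + E' * u2 = 0 -> A' * w1 + E' * w2 = k * E -> u1 * w2 - w1 * u2 = a * E ->
  u1 = a / k * E' /\ u2 = a / k * (- A').
Proof.
move=> k0 E0 E'0 H1 H2 H3.
have e1 : u1 = a / k * E'.
  apply: (mulIf (mulf_neq0 k0 E0)).
  have -> : a / k * E' * (k * E) = E' * (a * E) by field.
  rewrite -H3 -H2; have -> : u1 * (A' * w1 + E' * w2) = E' * (u1 * w2 - w1 * u2) + w1 * (A' * u1 + E' * u2) by ring.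
  by rewrite H1 mulr0 addr0.
split=> //; apply: (mulfI E'0).
have -> : E' * u2 = (A' * u1 + E' * u2) - A' * u1 by ring.
by rewrite H1 e1; ring.
Qed.

Lemma ring_aux2 (p q x y z : C) : p - x * z - (q - y * z) = p - q - z * (x - y).
Proof. ring. Qed.

Lemma field_aux2 (a d x z A B B' : C) : a != 0 -> d != 0 ->
  x * (z * (A - B')) = a / d * (d / a * x * (z * (A - B))) + x * (z * (B - B')).
Proof. by move=> a0 d0; field; rewrite a0 d0. Qed.

Lemma image_dom_aux (f n p d s : R) : 0 < s -> d <= 20^-1 * n -> n <= d + f -> p <= n / 100 ->
  2 * (3 / 2 * s) < n -> 2 * s < f /\ p < f / 4.
Proof. by move=> *; split; lra. Qed.

Lemma ratio_close (E E' : C) (e : R) : e <= 20^-1 -> nrm (E - 1) <= e -> nrm (E' - 1) <= e ->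
  nrm (E' / E - 1) <= 3 * e.
Proof.
move=> e1 H1 H2; have E2 : 19 / 20 <= nrm E.
  have := nrm_subD (1 : C) E; rewrite nrm1 nrmBC; move: H1 e1; move: (nrm _) (nrm _) => u v; lra.
have E0 : 0 < nrm E by apply: lt_le_trans E2; rewrite divr_gt0.
have -> : E' / E - 1 = (E' - E) / E by rewrite mulrBl divff // -nrm_gt0.
rewrite nrmM nrmV ler_pdivrMr //; have := nrm_triangle (1 : C) E' E; rewrite [nrm (1 - E)]nrmBC => T.
have e0 : 0 <= e by apply: le_trans H1; exact: nrm_ge0.
apply: le_trans T _; apply: (@le_trans _ _ (3 * e * (19 / 20))); last by rewrite ler_wpM2l // mulr_ge0.
by move: H1 H2 e0; move: (nrm _) (nrm _) => u v; lra.
Qed.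

Lemma ratio_close2 (E E1 E2 : C) (e : R) : nrm (E - 1) <= 20^-1 -> nrm (E1 - 1) <= e -> nrm (E2 - 1) <= e ->
  nrm (E1 / E - E2 / E) <= 3 * e.
Proof.
move=> H H1 H2; have E19 : 19 / 20 <= nrm E.
  have := nrm_subD (1 : C) E; rewrite nrm1 nrmBC; move: H; move: (nrm _) (nrm _) => u v; lra.
have E0 : 0 < nrm E by apply: lt_le_trans E19; rewrite divr_gt0.
rewrite -mulrBl nrmM nrmV ler_pdivrMr //; have := nrm_triangle (1 : C) E1 E2; rewrite [nrm (1 - E2)]nrmBC => T.
have e0 : 0 <= e by apply: le_trans H1; exact: nrm_ge0.
apply: le_trans T _; apply: (@le_trans _ _ (3 * e * (19 / 20))); last by rewrite ler_wpM2l // mulr_ge0.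
by move: H1 H2 e0; move: (nrm _) (nrm _) => u v; lra.
Qed.

Lemma three_halves (u v : R) (z x w : C) : nrm (z - w * x) <= v -> v <= u * (nrm w * nrm x) ->
  nrm z <= (1 + u) * (nrm w * nrm x).
Proof.
move=> H1 H2; apply: (le_trans (nrm_subD z (w * x))); rewrite mulrDl mul1r addrC nrmM lerD2l.
exact: le_trans H1 H2.
Qed.

Variables (H : C2 -> C2) (D : nat) (l a : C) (phi : C2 -> C) (r s : R).
Hypotheses (D1 : (1 < D)%N) (l0 : l != 0) (a0 : a != 0) (r0 : 0 < r) (rs : r <= s).
Hypothesis Hd : forall p, differentiable H p.
Hypothesis jac : forall p v w,
  dif (fun q => (H q).1) p v * dif (fun q => (H q).2) p w -
  dif (fun q => (H q).1) p w * dif (fun q => (H q).2) p v = a * (v.1 * w.2 - v.2 * w.1).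
Hypothesis phi_diff : forall p, cone r p -> differentiable phi p.
Hypothesis phi_est : forall p, ncone s p ->
  nrm (phi p - p.2) <= 20^-1 * nrm p.2 /\ nrm (dif phi p ((0, 1) : C2) - 1) <= 20^-1.
Hypothesis phi_lim : forall e : R, 0 < e -> exists2 s', s <= s' & forall p, ncone s' p ->
  nrm (phi p - p.2) <= e * nrm p.2 /\ nrm (dif phi p ((0, 1) : C2) - 1) <= e.
Hypothesis phi_H : forall p, cone r p -> phi (H p) = l * phi p ^+ D.
Hypothesis H_step : forall s' p, s <= s' -> ncone s' p ->
  ncone (2 * s') (H p) /\ nrm (H p).1 <= nrm (H p).2 / 100.

Let s0 : 0 < s := lt_le_trans r0 rs.
Let D0 : (D%:R : C) != 0.
Proof. by rewrite pnatr_eq0 -lt0n (ltn_trans _ D1). Qed.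

Definition phy (p : C2) : C := dif phi p ((0, 1) : C2).
Definition phx (p : C2) : C := dif phi p ((1, 0) : C2).
(** The vector spanning the kernel of d phi, tangent to the leaf phi = const. *)
Definition leafvec (p : C2) : C2 := (phy p, - phx p).

Let nc p : ncone s p -> cone r p.
Proof. exact: ncone_r. Qed.

Lemma phy_neq0 p : ncone s p -> phy p != 0.
Proof.
move=> /phi_est[_ e1]; apply/eqP => e2; move: e1; rewrite -/(phy p) e2 sub0r nrmN nrm1.
by apply/negP; rewrite -ltNge invf_lt1 // ltr1n.
Qed.

Lemma phi_neq0 p : ncone s p -> phi p != 0.
Proof.
move=> pn; have [e1 _] := phi_est pn; apply/eqP => e2; move: e1; rewrite e2 sub0r nrmN.
apply/negP; rewrite -ltNge; have [p2 _] := pn.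
have y0 : 0 < nrm p.2 by apply: lt_trans p2.
by rewrite gtr_pMl // invf_lt1 // ltr1n.
Qed.

Lemma dif_phi_H p v : ncone s p ->
  dif phi (H p) ('d H p v) = l * D%:R * phi p ^+ D.-1 * dif phi p v.
Proof.
move=> pn; have [Hn _] := H_step (lexx s) pn.
have s2 : s <= 2 * s by rewrite ler_peMl ?ler1n // ltW.
have Hc : cone r (H p) := nc (ncone_sub s2 Hn).
have L : is_derive (0 : C) 1 (fun t : C => p + t *: v) v by exact: line_is_derive.
have p0E : p + (0 : C) *: v = p by rewrite scale0r addr0.
have B0 : differentiable H (p + (0 : C) *: v) by exact: Hd.
have L1 := is_derive_comp B0 L; rewrite p0E in L1.
have B1 : differentiable phi (H (p + (0 : C) *: v)) by rewrite p0E; exact: phi_diff.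
have L2 := is_derive_dif B1 L1; rewrite /= p0E in L2.
have B2 : differentiable phi (p + (0 : C) *: v) by rewrite p0E; exact: phi_diff (nc pn).
have L3 := is_derive_dif B2 L; rewrite p0E in L3.
have L4 := is_deriveX D L3; rewrite p0E in L4.
have L5 := is_deriveZ l L4.
have LN : \forall t \near (0 : C), phi (H (p + t *: v)) = l * phi (p + t *: v) ^+ D.
  have : (fun t : C => p + t *: v) @ (0 : C) --> p.
    have := diff_continuous_nrm (is_derive_diff L); by rewrite p0E.
  move=> /(_ _ (cone_open (nc pn)))/nbhs_nrmP[d d0 dP].
  by apply/nbhs_nrmP; exists d => // t /dP; exact: phi_H.
have {}L5 : is_derive (0 : C) 1 (fun t : C => l * phi (p + t *: v) ^+ D)
  (l *: ((D%:R * phi p ^+ D.-1) *: dif phi p v)).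
  move: L5; congr is_derive; apply/funext => t; rewrite /GRing.scale_fun /=.
  by congr (_ * _); elim: (D) => [|k IHk]; rewrite ?expr0 // !exprS -IHk.
have -> := is_derive_uniq (is_derive_near LN L2) L5.
 rewrite /GRing.scale /= -mulr_natr; ring.
Qed.

(** Since phi(H p) = l phi(p)^D, dH maps the kernel of d phi at p to that at H p. The factor follows
    from the Jacobian applied to [leafvec p] and (0, 1): it is a / (l D phi(p)^(D-1)). *)
Lemma push_leafvec p : ncone s p ->
  'd H p (leafvec p) = (a / D%:R * (phi p / phi (H p))) *: leafvec (H p).
Proof.
move=> pn; have [Hn _] := H_step (lexx s) pn.
have s2 : s <= 2 * s by rewrite ler_peMl ?ler1n // ltW.
have Hns : ncone s (H p) := ncone_sub s2 Hn.
have E1 := dif_phi_H (leafvec p) pn; have E2 := dif_phi_H ((0, 1) : C2) pn.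
have J := jac p (leafvec p) ((0, 1) : C2).
rewrite (dif2E _ (phi_diff (nc Hns))) (diff_pairE _ (Hd p)) in E1.
rewrite (dif2E _ (phi_diff (nc Hns))) (diff_pairE _ (Hd p)) in E2.
rewrite (dif2E _ (phi_diff (nc pn))) in E1.
rewrite (diff_pairE _ (Hd p)).
set u1 := dif (fun q : C2 => (H q).1) p (leafvec p) in J E1 *.
set u2 := dif (fun q : C2 => (H q).2) p (leafvec p) in J E1 *.
set w1 := dif (fun q : C2 => (H q).1) p ((0, 1) : C2) in J E2.
set w2 := dif (fun q : C2 => (H q).2) p ((0, 1) : C2) in J E2.
have {}J : u1 * w2 - w1 * u2 = a * (phy p * 1 - (- phx p) * 0) := J.
have {}E1 : u1 * phx (H p) + u2 * phy (H p) =
  l * D%:R * phi p ^+ D.-1 * (phy p * phx p + (- phx p) * phy p) := E1.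
have {}E2 : w1 * phx (H p) + w2 * phy (H p) = l * D%:R * phi p ^+ D.-1 * phy p := E2.
clearbody u1 u2 w1 w2.
rewrite mulr1 mulr0 subr0 in J.
rewrite [phy p * phx p]mulrC mulNr subrr mulr0 in E1.
have ph0 := phi_neq0 pn.
have k0 : l * D%:R * phi p ^+ D.-1 != 0 by rewrite !mulf_neq0 // expf_neq0.
have X1 : phx (H p) * u1 + phy (H p) * u2 = 0 by rewrite mulrC [phy _ * _]mulrC; exact: E1.
have X2 : phx (H p) * w1 + phy (H p) * w2 = l * D%:R * phi p ^+ D.-1 * phy p.
  by rewrite mulrC [phy _ * _]mulrC; exact: E2.
have [-> ->] := push_aux k0 (phy_neq0 pn) (phy_neq0 Hns) X1 X2 J.
have -> : a / D%:R * (phi p / phi (H p)) = a / (l * D%:R * phi p ^+ D.-1).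
  rewrite (phi_H (nc pn)).
  have -> : phi p ^+ D = phi p ^+ D.-1 * phi p by rewrite -exprSr prednK // (ltn_trans _ D1).
  move: (expf_neq0 D.-1 ph0); move: (_ ^+ D.-1) => x x0; by field; rewrite ph0 x0 l0 D0.
by [].
Qed.

Definition orb (n : nat) (t : C2) : C2 := iter n H (leaf phi t).
Definition zn (n : nat) (z : C) : C := iter n (fun w => l * w ^+ D) z.

Let ld := leaf_dom s.

Lemma leaf_lower (t : C2) k : ld t -> s <= k -> 4 / 3 * k < nrm t.2 -> ncone k (leaf phi t).
Proof.
move=> td sk tk; have [_ q2] := leaf_ncone r0 rs phi_diff phi_est td; split => //.
have [Yb _] := leafY_spec r0 rs phi_diff phi_est td; rewrite /leaf_ball /= in Yb.
have := nrm_subD t.2 (leafY phi t); rewrite nrmBC.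
by move: Yb tk; rewrite /leaf /=; move: (nrm _) (nrm _) (nrm _) => u v w; lra.
Qed.

Lemma iter_ncone k n p : s <= k -> ncone k p -> ncone (2 ^+ n * k) (iter n H p).
Proof.
move=> sk pk; elim: n => [|n IH]; first by rewrite expr0 mul1r.
rewrite iterS exprS -mulrA; apply: (proj1 (H_step _ IH)).
apply: (le_trans sk); rewrite ler_peMl // ?exprn_ege1 ?ler1n //.
by apply: (le_trans (ltW s0)).
Qed.

Lemma orb_ncone n t : ld t -> ncone (2 ^+ n * s) (orb n t).
Proof. by move=> td; apply: iter_ncone => //; exact: (leaf_ncone r0 rs phi_diff phi_est td). Qed.

Lemma orb_ncone_s n t : ld t -> ncone s (orb n t).
Proof.
move=> td; apply: ncone_sub (orb_ncone n td).
by rewrite ler_peMl ?(ltW s0) // exprn_ege1 // ler1n.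
Qed.

Lemma phi_orb n t : ld t -> phi (orb n t) = zn n t.2.
Proof.
move=> td; elim: n => [|n IH]; first exact: phi_leaf r0 rs phi_diff phi_est _ td.
by rewrite /orb iterS -/(orb n t) phi_H ?IH //; apply: nc; exact: orb_ncone_s.
Qed.

Lemma zn_neq0 n t : ld t -> zn n t.2 != 0.
Proof. by move=> td; rewrite -phi_orb //; apply: phi_neq0; exact: orb_ncone_s. Qed.

Lemma zn_differentiable n z : differentiable (zn n) z.
Proof.
elim: n => [|n IH]; first exact: differentiable_idC.
rewrite (_ : zn n.+1 = fun z => l * zn n z ^+ D) //.
by apply: differentiableM; [exact: differentiable_cst|exact: differentiable_pow].
Qed.

Lemma leaf_is_derive t : ld t ->
  is_derive t.1 1 (fun x => leaf phi (x, t.2)) ((phy (leaf phi t))^-1 *: leafvec (leaf phi t)).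
Proof.
move=> td; have tE : ((t.1, t.2) : C2) = t by case: t {td}.
have Yd : differentiable (leaf phi) ((t.1, t.2) : C2).
  by rewrite tE; exact: leaf_differentiable r0 rs phi_diff phi_est _ td.
have L := is_derive_comp Yd (horizontal_is_derive t.1 t.2); rewrite tE in L.
have ln := leaf_ncone r0 rs phi_diff phi_est td.
set m := 'd _ _ _ in L.
have m1 : m.1 = 1.
  have B : is_derive t.1 1 (fun x : C => x) (1 : C) by exact: is_derive_id.
  by have := is_derive_uniq B (is_derive_dif (fst_differentiable _) L); rewrite dif_fst => <-.
have m2 : m.1 * phx (leaf phi t) + m.2 * phy (leaf phi t) = 0.
  have B : differentiable phi ((leaf phi \o (fun x : C => (x, t.2) : C2)) t.1).
    by rewrite /= tE; exact: phi_diff (nc ln).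
  have L2 := is_derive_dif B L.
  rewrite /= tE dif2E in L2; last exact: phi_diff (nc ln).
  have /nbhs_nrmP[d d0 dP] := leaf_dom_open td.
  suff N : \forall x \near t.1, phi ((leaf phi \o (fun x : C => (x, t.2) : C2)) x) = cst t.2 x.
    exact: (is_derive_uniq (is_derive_near N L2) (is_derive_cst t.2 t.1 (1 : C))).
  apply/nbhs_nrmP; exists d => // x xt; apply: phi_leaf r0 rs phi_diff phi_est _ _.
  by apply: dP; apply: nrm_pair_lt; rewrite //= subrr nrm0.
have -> : (phy (leaf phi t))^-1 *: leafvec (leaf phi t) = m; last exact: L.
have E0 := phy_neq0 ln; move: m1 m2 E0; case: (m) => x y /= ->; rewrite mul1r.
rewrite /leafvec; move: (phx _) (phy _) => A B AB B0; congr (_, _) => /=.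
  by rewrite [_ *: _]mulVf.
rewrite [_ *: _]mulrN; apply: (mulfI B0); rewrite mulrN mulrA divff // mul1r.
by apply/eqP; rewrite eq_sym -addr_eq0 mulrC addrC AB.
Qed.

(** The ratios phi(H^k p) / phi(H^(k+1) p) contributed by [push_leafvec] telescope to zeta /
    zeta_n. *)
Lemma orb_is_derive n t : ld t ->
  is_derive t.1 1 (fun x => orb n (x, t.2))
   ((phy (leaf phi t))^-1 *: (((a / D%:R) ^+ n * (t.2 / zn n t.2)) *: leafvec (orb n t))).
Proof.
move=> td; have tE : ((t.1, t.2) : C2) = t by case: t {td}.
elim: n => [|n IH].
  rewrite expr0 mul1r divff ?scale1r; first exact: leaf_is_derive.
  by have [t2 _] := td; rewrite -nrm_gt0; apply: lt_trans t2; rewrite mulr_gt0.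
have B : differentiable H (orb n (t.1, t.2)) by exact: Hd.
have L := is_derive_comp B IH; rewrite tE in L.
set v := (X in is_derive _ _ _ X).
suff -> : v = 'd H (orb n t) ((phy (leaf phi t))^-1 *:
    (((a / D%:R) ^+ n * (t.2 / zn n t.2)) *: leafvec (orb n t))) by exact: L.
rewrite linearZ /= linearZ /= push_leafvec; last exact: orb_ncone_s.
rewrite /v; congr (_ *: _); rewrite scalerA.
have -> : phi (H (orb n t)) = zn n.+1 t.2 by rewrite -(phi_orb n.+1 td).
rewrite (phi_orb n td); congr (_ *: _); rewrite exprS.
move: (zn_neq0 n.+1 td) (zn_neq0 n td) (_ ^+ n) => z0 p0 x.
by field; rewrite z0 p0 D0.
Qed.

(* Along a leaf d(x_n)/dx equals (a/D)^n / zeta_n up to a convergent factor, so that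
   this converges; the limit vanishes at x = 0. *)
Definition Fn (n : nat) (t : C2) : C :=
  (D%:R / a) ^+ n * (zn n t.2 * ((orb n t).1 - (orb n (0, t.2)).1)).

Lemma ld0 t : ld t -> ld (0, t.2).
Proof. by move=> [t2 t1]; split => //=; rewrite nrm0; apply: le_lt_trans t1; exact: nrm_ge0. Qed.

Lemma Fn_is_derive n t : ld t ->
  is_derive t.1 1 (fun x => Fn n (x, t.2)) (t.2 * (phy (orb n t) / phy (leaf phi t))).
Proof.
move=> td; have tE : ((t.1, t.2) : C2) = t by case: t {td}.
have L := is_derive_dif (fst_differentiable _) (orb_is_derive n td); rewrite /= dif_fst in L.
have L2 := is_deriveB L (is_derive_cst (orb n (0, t.2)).1 t.1 (1 : C)); rewrite subr0 in L2.
have L3 := is_deriveZ ((D%:R / a) ^+ n * zn n t.2) L2.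
have -> : (fun x => Fn n (x, t.2)) =
    (fun x => ((D%:R / a) ^+ n * zn n t.2) * ((orb n (x, t.2)).1 - (orb n (0, t.2)).1)).
  by apply/funext => x; rewrite /Fn /= mulrA.
move: L3; congr is_derive.
rewrite /leafvec /GRing.scale /= /GRing.scale /=.
have -> : (a / D%:R) ^+ n = ((D%:R / a) ^+ n)^-1 by rewrite -exprVn invf_div.
have E0 : (D%:R / a) ^+ n != 0 by rewrite expf_neq0 // mulf_neq0 ?invr_eq0.
move: (zn_neq0 n td) (phy_neq0 (leaf_ncone r0 rs phi_diff phi_est td)) E0.
move: (zn n t.2) (phy (leaf phi t)) ((D%:R / a) ^+ n) (phy _) (t.2) => z p x q w z0 p0 x0.
by field; rewrite z0 p0 x0.
Qed.

Lemma Fn_differentiable n t : ld t -> differentiable (Fn n) t.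
Proof.
move=> td.
have od u : ld u -> differentiable (fun t => (orb n t).1) u.
  move=> ud; apply: (@differentiable_comp _ _ _ _ (orb n) (fun p : C2 => p.1)); last exact: fst_differentiable.
  apply: (@differentiable_comp _ _ _ _ (leaf phi) (iter n H)).
    exact: leaf_differentiable r0 rs phi_diff phi_est _ ud.
  elim: (n) => [|m IH]; first by have [] := @is_diff_id (Cx R) (Cx2 R) (leaf phi u).
  by rewrite (_ : iter m.+1 H = H \o iter m H) //; apply: differentiable_comp; [exact: IH|exact: Hd].
apply: differentiableM; first exact: differentiable_cst.
apply: differentiableM.
  apply: (@differentiable_comp _ _ _ _ (fun p : C2 => p.2) (zn n)); first exact: snd_differentiable.
  exact: zn_differentiable.
apply: differentiableB; first exact: od.
apply: (@differentiable_comp _ _ _ _ (fun p : C2 => (0, p.2) : C2) (fun t => (orb n t).1)).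
  by apply: differentiable_pair; [exact: differentiable_cst|exact: snd_differentiable].
by apply: od; exact: ld0.
Qed.

Lemma ld_segment t x (u : R) : 0 <= u <= 1 -> ld t -> ld (x, t.2) ->
  ld (t.1 + rc u * (x - t.1), t.2).
Proof.
move=> u01 [t2 t1] [_ x1]; split=> //=; have := @segment_in_ball R 0 t.1 x (nrm t.2 / 4) u u01.
by rewrite !subr0 => /(_ t1 x1).
Qed.

Lemma Fn0 n (z : C) : Fn n (0, z) = 0.
Proof. by rewrite /Fn /= subrr !mulr0. Qed.

Lemma Fn_lip n t x (e : R) : ld t -> ld (x, t.2) -> e <= 20^-1 ->
  (forall u, ld u -> u.2 = t.2 -> nrm (phy (orb n u) - 1) <= e /\ nrm (phy (leaf phi u) - 1) <= e) ->
  nrm (Fn n (x, t.2) - Fn n t - t.2 * (x - t.1)) <= 3 * e * (nrm t.2 * nrm (x - t.1)).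
Proof.
move=> td xd e1 eP.
have := @mean_value_inequality R (fun y : C => Fn n (y, t.2) - y * t.2) t.1 x (3 * e * nrm t.2).
have -> : ((t.1, t.2) : C2) = t by case: (t).
rewrite -[3 * e * _ * _]mulrA ring_aux2.
apply=> u u01; have yd := ld_segment u01 td xd.
move: (t.1 + _) yd => y yd; have [E1 E2] := eP _ yd erefl.
exists (t.2 * (phy (orb n (y, t.2)) / phy (leaf phi (y, t.2))) - t.2).
  by apply: is_deriveB; [exact: (Fn_is_derive n yd)|exact: is_derive_lin].
rewrite -[X in _ - X]mulr1 -mulrBr nrmM mulrC ler_wpM2r ?nrm_ge0 //.
exact: ratio_close.
Qed.

Lemma Fn_cauchy n m t (e : R) : ld t ->
  (forall u, ld u -> u.2 = t.2 -> nrm (phy (orb n u) - 1) <= e /\ nrm (phy (orb m u) - 1) <= e) ->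
  nrm (Fn n t - Fn m t) <= 3 * e * (nrm t.2 * nrm t.1).
Proof.
move=> td eP; have zd := ld0 td.
have := @mean_value_inequality R (fun y : C => Fn n (y, t.2) - Fn m (y, t.2)) 0 t.1 (3 * e * nrm t.2).
have -> : ((t.1, t.2) : C2) = t by case: (t).
rewrite !Fn0 !subr0 -[3 * e * _ * _]mulrA; apply=> u u01.
have yd : ld (0 + rc u * (t.1 - 0), t.2) by apply: (ld_segment u01 zd); case: (t) td.
rewrite subr0 in yd; move: (0 + _) yd => y yd; have [E1 E2] := eP _ yd erefl.
exists (t.2 * (phy (orb n (y, t.2)) / phy (leaf phi (y, t.2)))
  - t.2 * (phy (orb m (y, t.2)) / phy (leaf phi (y, t.2)))).
  by apply: is_deriveB; [exact: (Fn_is_derive n yd)|exact: (Fn_is_derive m yd)].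
rewrite -mulrBr nrmM mulrC ler_wpM2r ?nrm_ge0 //; apply: ratio_close2 => //.
by have [] := phi_est (leaf_ncone r0 rs phi_diff phi_est yd).
Qed.

Definition Zl (t : C2) : C := xget 0 [set z | Fn n t @[n --> \oo] --> z].

Lemma pow2_large (k : R) : exists N, forall n, (N <= n)%N -> k <= 2 ^+ n * s.
Proof.
have [k0|k0] := leP k 0.
  by exists 0%N => n _; apply: le_trans k0 _; rewrite mulr_ge0 ?exprn_ge0 // ltW.
have [N NP] := half_small (divr_gt0 s0 k0); exists N => n Nn.
apply: (@le_trans _ _ (2 ^+ N * s)); last first.
  by rewrite ler_wpM2r ?(ltW s0) // ler_weXn2l // ler1n.
by move: NP; rewrite exprVn ltr_pdivlMr // ltr_pdivrMl ?exprn_gt0 // => /ltW.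
Qed.

Lemma Zl_cvg t : ld t -> Fn n t @[n --> \oo] --> Zl t.
Proof.
move=> td; suff [z zP] : exists z : C, Fn n t @[n --> \oo] --> z.
  exact: (@xgetPex _ 0 [set z | Fn n t @[n --> \oo] --> z] (ex_intro _ z zP)).
apply: cx_cauchy => e e0.
pose B := 3 * (nrm t.2 * nrm t.1) + 1.
have B0 : 0 < B by rewrite ltr_wpDl // !mulr_ge0 // nrm_ge0.
have [s' ss' s'P] := phi_lim (divr_gt0 e0 B0).
have [N NP] := pow2_large s'; exists N => n m Nn Nm.
apply: le_lt_trans (Fn_cauchy (e := e / B) td _) _.
  move=> u ud _; split.
    by apply: (proj2 (s'P _ _)); apply: ncone_sub (orb_ncone n ud); exact: NP.
  by apply: (proj2 (s'P _ _)); apply: ncone_sub (orb_ncone m ud); exact: NP.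
rewrite mulrAC mulrA ltr_pdivrMr // mulrC ltr_pM2l // /B mulrA.
by rewrite ltrDl.
Qed.

Lemma Zl0 z : Zl (0, z) = 0.
Proof.
have cv : Fn n (0, z) @[n --> \oo] --> (0 : C).
  by under eq_fun do rewrite Fn0; exact: cvg_cst.
apply: (cvg_seq_uniq _ cv).
exact: (@xgetPex _ 0 [set w | Fn n (0, z) @[n --> \oo] --> w] (ex_intro _ (0 : C) cv)).
Qed.

Lemma Zl_lip t x (e : R) : ld t -> ld (x, t.2) -> e <= 20^-1 ->
  (forall u n, ld u -> u.2 = t.2 -> nrm (phy (orb n u) - 1) <= e) ->
  nrm (Zl (x, t.2) - Zl t - t.2 * (x - t.1)) <= 3 * e * (nrm t.2 * nrm (x - t.1)).
Proof.
move=> td xd e1 eP; have cv : Fn n (x, t.2) - Fn n t - t.2 * (x - t.1) @[n --> \oo] -->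
    Zl (x, t.2) - Zl t - t.2 * (x - t.1).
  by apply: cvgB; [apply: cvgB; exact: Zl_cvg|exact: cvg_cst].
apply: (nrm_lim_le cv) => n; apply: Fn_lip => // u ud ut.
by split; [exact: eP|exact: (eP u 0%N)].
Qed.

(** Along a leaf the limit stays so close to zeta x that it is injective there and can be inverted
    by a contraction of ratio 1/2. *)
Lemma Zl_half t x : ld t -> ld (x, t.2) ->
  nrm (Zl (x, t.2) - Zl t - t.2 * (x - t.1)) <= 2^-1 * (nrm t.2 * nrm (x - t.1)).
Proof.
move=> td xd; apply: le_trans (Zl_lip (e := 20^-1) td xd (lexx _) _) _.
  by move=> u n ud _; have [] := phi_est (orb_ncone_s n ud).
rewrite ler_wpM2r ?mulr_ge0 ?nrm_ge0 // ler_pdivrMr //.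
by rewrite mulrC ler_pdivlMr // -natrM ler_nat.
Qed.

Lemma Zl_asymp (e : R) : 0 < e -> exists k, forall t, ld t -> k < nrm t.2 ->
  nrm (Zl t - t.2 * t.1) <= e * (nrm t.2 * nrm t.1).
Proof.
move=> e0; pose d := Num.min (e / 3) 20^-1.
have d0 : 0 < d by rewrite lt_min divr_gt0 //= invr_gt0.
have d1 : d <= 20^-1 by rewrite ge_min lexx orbT.
have d2 : d <= e / 3 by rewrite ge_min lexx.
have [s' ss' s'P] := phi_lim d0; exists (4 / 3 * s') => t td tk.
have zd := ld0 td; have tE : ((t.1, t.2) : C2) = t by case: (t).
have td' : ld (t.1, ((0, t.2) : C2).2) by case: (t) td.
have := Zl_lip (e := d) zd td' d1; rewrite /= tE Zl0 !subr0 => K.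
apply: le_trans (K _) _; last by rewrite ler_wpM2r ?mulr_ge0 ?nrm_ge0 // mulrC -ler_pdivlMr.
move=> u n ud ut; apply: (proj2 (s'P _ _)).
have us : ncone s' (leaf phi u) by apply: leaf_lower => //; rewrite ut.
apply: ncone_sub (iter_ncone n ss' us).
by rewrite ler_peMl ?exprn_ege1 ?ler1n // (le_trans (ltW s0)).
Qed.

Lemma Zl_differentiable t : ld t -> differentiable Zl t.
Proof.
move=> td; have /nbhs_nrmP[d d0 dP] := leaf_dom_open td.
pose B := nrm t + d.
apply: (@limit_diff2 R Fn Zl t d ((1 + 2^-1) * (B * B)) d0); last by move=> q /dP; exact: Zl_cvg.
move=> n q qt; have qd := dP q qt; split; first exact: Fn_differentiable.
have zd := ld0 qd; have qE : ((q.1, q.2) : C2) = q by case: (q).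
have qd' : ld (q.1, ((0, q.2) : C2).2) by case: (q) qd.
have K : nrm (Fn n q - q.2 * q.1) <= 2^-1 * (nrm q.2 * nrm q.1).
  have := @Fn_lip n (0, q.2) q.1 20^-1 zd qd' (lexx _); rewrite /= qE Fn0 !subr0 => K.
  apply: le_trans (K _) _.
    move=> u ud _; split; first by have [] := phi_est (orb_ncone_s n ud).
    by have [] := phi_est (orb_ncone_s 0 ud).
  rewrite ler_wpM2r ?mulr_ge0 ?nrm_ge0 // ler_pdivrMr //.
  by rewrite mulrC ler_pdivlMr // -natrM ler_nat.
apply: (le_trans (three_halves K (lexx _))).
rewrite ler_wpM2l ?addr_ge0 ?invr_ge0 //.
have qB : nrm q <= B.
  by apply: (le_trans (nrm_subD q t)); rewrite /B addrC lerD2l ltW.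
apply: ler_pM; rewrite ?nrm_ge0 //; first exact: le_trans (nrm_snd q) qB.
exact: le_trans (nrm_fst q) qB.
Qed.

Lemma leaf_H t : ld t -> ld ((H (leaf phi t)).1, l * t.2 ^+ D) /\
  leaf phi ((H (leaf phi t)).1, l * t.2 ^+ D) = H (leaf phi t).
Proof.
move=> td; have [t2 t1] := td.
have ln := orb_ncone_s 0 td; have [Hn2 HP] := H_step (lexx s) ln.
have pE : phi (H (leaf phi t)) = l * t.2 ^+ D by exact: (phi_orb 1 td).
have ln' : ncone (3 / 2 * s) (leaf phi t).
  apply: leaf_lower => //; first by rewrite ler_peMl ?(ltW s0) // ler_pdivlMr // mul1r ler_nat.
  by rewrite mulrA (_ : 4 / 3 * (3 / 2) = 2) //; field.
have s32 : s <= 3 / 2 * s by rewrite ler_peMl ?(ltW s0) // ler_pdivlMr // mul1r ler_nat.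
have [Hn3 _] := H_step s32 ln'.
have Hns : ncone s (H (leaf phi t)) by apply: ncone_sub Hn2; rewrite ler_peMl ?(ltW s0) // ler1n.
have [e1 _] := phi_est Hns.
have dom : ld ((H (leaf phi t)).1, phi (H (leaf phi t))).
  have := nrm_subD (H (leaf phi t)).2 (phi (H (leaf phi t))); rewrite nrmBC => T.
  by case: Hn3 => Hn3 _; exact: image_dom_aux s0 e1 T HP Hn3.
by rewrite -pE; split => //; exact: (leaf_phi r0 rs phi_diff phi_est Hns dom).
Qed.

(** Since n iterations after H are n + 1 iterations, [Fn n] at the image is a/D times [Fn n.+1],
    corrected by the image of the base point x = 0 of the leaf. This is the origin of alpha = a/D
    and of Q. *)
Lemma Zl_H t : ld t ->
  Zl ((H (leaf phi t)).1, l * t.2 ^+ D) = a / D%:R * Zl t +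
    Zl ((H (leaf phi (0, t.2))).1, l * t.2 ^+ D).
Proof.
move=> td; have zd := ld0 td; have [hd hE] := leaf_H td; have [zhd zhE] := leaf_H zd.
have E n : Fn n ((H (leaf phi t)).1, l * t.2 ^+ D) = a / D%:R * Fn n.+1 t +
    Fn n ((H (leaf phi (0, t.2))).1, l * t.2 ^+ D).
  rewrite /Fn /= /orb hE /= zhE /zn -!(iterSr n) exprS.
  exact: field_aux2.
have c1 := Zl_cvg hd; have c2 : Fn n.+1 t @[n --> \oo] --> Zl t.
  by have := Zl_cvg td; rewrite -cvg_shiftS.
apply: (cvg_seq_uniq c1); under eq_fun do rewrite E.
by apply: cvgD; [apply: cvgM; [exact: cvg_cst|exact: c2]|exact: (Zl_cvg zhd)].
Qed.

End Transversal.

(** * Limits at infinity in the complex plane *)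

Section ComplexInfinity.
Context {R : realType}.
Local Notation C := (Cx R).

Definition cx_infty : set_system C := filter_from [set r : R | 0 < r] (fun r => [set z | r < nrm z]).

Global Instance cx_infty_filter : Filter cx_infty.
Proof.
apply: filter_from_filter; first by exists 1; exact: ltr01.
move=> r s /= r0 s0; exists (Num.max r s) => /=; first by rewrite lt_max r0.
by move=> z /=; rewrite gt_max => /andP[].
Qed.

Lemma near_cx_infty (P : C -> Prop) : (\forall z \near cx_infty, P z) ->
  exists2 r, 0 < r & forall z, r < nrm z -> P z.
Proof. by case=> r /= r0 rP; exists r. Qed.

Lemma cx_infty_near (P : C -> Prop) (r : R) : (forall z, r < nrm z -> P z) ->
  \forall z \near cx_infty, P z.
Proof.
move=> rP; exists (Num.max r 1) => /=; first by rewrite lt_max ltr01 orbT.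
by move=> z /=; rewrite gt_max => /andP[+ _]; exact: rP.
Qed.

Lemma cx_infty_eq_cvg (f g : C -> C) (l : C) (r : R) : (forall z, r < nrm z -> f z = g z) ->
  f z @[z --> cx_infty] --> l -> g z @[z --> cx_infty] --> l.
Proof.
move=> fg /cvg_nrmP H; apply/cvg_nrmP => e /H/near_cx_infty[s s0 sH].
apply: (@cx_infty_near _ (Num.max r s)) => z; rewrite gt_max => /andP[rz sz].
by rewrite -fg //; exact: sH.
Qed.

End ComplexInfinity.

(** * The chart at infinity and its conjugation to the normal form *)

Section Chart.
Context {R : realType}.
Local Notation C := (Cx R).
Local Notation C2 := (Cx2 R).

Lemma sixteenth (u : R) : u ^+ 2 / 16 <= u / 8 / 2 * u.
Proof. by rewrite le_eqVlt; apply/orP; left; apply/eqP; field. Qed.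

Lemma ring_aux3 (x x' A A' z w : C) : w != 0 ->
  x - A / w + z / w - (x' - A' / w + z / w) = - ((A - A' - w * (x - x')) / w).
Proof. by move=> w0; field. Qed.

Lemma image_dom_aux2 (f n p d s z : R) : 0 < s -> d <= 20^-1 * n -> n <= d + f -> p <= n / 100 ->
  3 * s < n -> z <= (1 + 2^-1) * (f * p) -> [/\ 2 * s < f, p < f / 4 & z < f ^+ 2 / 16].
Proof.
move=> s0 H1 H2 H3 H4 H5; have f0 : 0 < f by lra.
split; [lra|lra|apply: (le_lt_trans H5)].
have : p <= f / 50 by lra.
rewrite -(ler_pM2l f0) => H6; have ff : 0 < f * f by rewrite mulr_gt0.
rewrite expr2; move: (f * p) H6 => u; rewrite mulrA; move: (f * f) ff => v; lra.
Qed.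

Variables (H : C2 -> C2) (D : nat) (l a : C) (phi : C2 -> C) (r s : R).
Hypotheses (D1 : (1 < D)%N) (l0 : l != 0) (a0 : a != 0) (r0 : 0 < r) (rs : r <= s).
Hypothesis Hd : forall p, differentiable H p.
Hypothesis jac : forall p v w,
  dif (fun q => (H q).1) p v * dif (fun q => (H q).2) p w -
  dif (fun q => (H q).1) p w * dif (fun q => (H q).2) p v = a * (v.1 * w.2 - v.2 * w.1).
Hypothesis phi_diff : forall p, cone r p -> differentiable phi p.
Hypothesis phi_est : forall p, ncone s p ->
  nrm (phi p - p.2) <= 20^-1 * nrm p.2 /\ nrm (dif phi p ((0, 1) : C2) - 1) <= 20^-1.
Hypothesis phi_lim : forall e : R, 0 < e -> exists2 s', s <= s' & forall p, ncone s' p ->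
  nrm (phi p - p.2) <= e * nrm p.2 /\ nrm (dif phi p ((0, 1) : C2) - 1) <= e.
Hypothesis phi_H : forall p, cone r p -> phi (H p) = l * phi p ^+ D.
Hypothesis H_step : forall s' p, s <= s' -> ncone s' p ->
  ncone (2 * s') (H p) /\ nrm (H p).1 <= nrm (H p).2 / 100.

Let s0 : 0 < s := lt_le_trans r0 rs.

Local Notation Z := (Zl H D l a phi).
Local Notation ld := (leaf_dom s).

Let Zhalf := Zl_half D1 l0 a0 r0 rs Hd jac phi_diff phi_est phi_lim phi_H H_step.
Let Zdiff := Zl_differentiable D1 l0 a0 r0 rs Hd jac phi_diff phi_est phi_lim phi_H H_step.
Let ZH := Zl_H D1 l0 a0 r0 rs Hd jac phi_diff phi_est phi_lim phi_H H_step.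
Let Zasymp := Zl_asymp D1 l0 a0 r0 rs Hd jac phi_diff phi_est phi_lim phi_H H_step.
Let lnc := leaf_ncone r0 rs phi_diff phi_est.
Let philf := phi_leaf r0 rs phi_diff phi_est.
Let lfphi := leaf_phi r0 rs phi_diff phi_est.
Let lfdiff := leaf_differentiable r0 rs phi_diff phi_est.

Lemma Z0 z : Z ((0, z) : C2) = 0.
Proof. exact: Zl0. Qed.

Lemma ld_neq0 t : ld t -> t.2 != 0.
Proof. by move=> [t2 _]; rewrite -nrm_gt0; apply: lt_trans t2; rewrite mulr_gt0. Qed.

Lemma Z_bound t : ld t -> nrm (Z t) <= (1 + 2^-1) * (nrm t.2 * nrm t.1).
Proof.
move=> td; have zd : ld ((0, t.2) : C2).
  by case: td => t2 t1; split => //=; rewrite nrm0; apply: le_lt_trans t1; exact: nrm_ge0.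
have td' : ld (t.1, ((0, t.2) : C2).2) by case: (t) td.
have tE : ((t.1, t.2) : C2) = t by case: (t).
have := Zhalf zd td'; rewrite /= tE Z0 !subr0 => K.
exact: three_halves K (lexx _).
Qed.

(** [leafX_map] moves its centre 0 by |z / zeta|, which must not exceed half of the radius |zeta|/8;
    hence the 16. *)
Definition chart_dom : set C2 := [set w | 2 * s < nrm w.2 /\ nrm w.1 < nrm w.2 ^+ 2 / 16].

(** Newton's iteration for Z(x, zeta) = z, with zeta in place of the derivative of Z. *)
Definition leafX_map (w : C2) (x : C) : C := x - Z (x, w.2) / w.2 + w.1 / w.2.

Lemma leafX_map_lip w x x' : ld ((x, w.2) : C2) -> ld ((x', w.2) : C2) ->
  nrm (leafX_map w x - leafX_map w x') <= 2^-1 * nrm (x - x').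
Proof.
move=> xd xd'; have w0 : w.2 != 0 := ld_neq0 xd.
rewrite /leafX_map ring_aux3 // nrmN nrmM nrmV ler_pdivrMr ?nrm_gt0 //.
by have := Zhalf xd' xd; rewrite /= [X in _ <= _ * X]mulrC mulrA.
Qed.

Lemma small_ld (w : C2) (x : C) : chart_dom w -> nrm x <= nrm w.2 / 8 -> ld ((x, w.2) : C2).
Proof.
move=> [w2 _] x8; split => //=; apply: (le_lt_trans x8).
have w0 : 0 < nrm w.2 by apply: lt_trans w2; rewrite mulr_gt0.
by rewrite ltr_pM2l // ltf_pV2 ?posrE // ltr_nat.
Qed.

Lemma leafX_fix w x : w.2 != 0 -> leafX_map w x = x <-> Z (x, w.2) = w.1.
Proof.
move=> w0; rewrite /leafX_map; split => [|->]; last by rewrite subrK.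
move/eqP; rewrite -addrA -[X in _ == X]addr0 (inj_eq (addrI x)) addrC subr_eq0.
by move=> /eqP/(mulIf (_ : w.2^-1 != 0)) ->; rewrite ?invr_eq0.
Qed.

Lemma leafX_exists w : chart_dom w -> exists x, nrm x <= nrm w.2 / 8 /\ Z (x, w.2) = w.1.
Proof.
move=> wd; have [w2 w1] := wd.
have w0 : 0 < nrm w.2 by apply: lt_trans w2; rewrite mulr_gt0.
have [|||x xb xfix] := @contraction_fixpoint R (leafX_map w) 0 (nrm w.2 / 8).
- by rewrite divr_ge0 ?nrm_ge0.
- move=> x x'; rewrite !subr0 => xb xb'; apply: leafX_map_lip; exact: small_ld.
- rewrite /leafX_map Z0 mul0r !subr0 add0r nrmM nrmV ler_pdivrMr //; apply: ltW.
  by apply: (lt_le_trans w1); rewrite sixteenth.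
rewrite subr0 in xb; exists x; split => //; apply/leafX_fix => //.
by rewrite -nrm_gt0.
Qed.

Lemma Z_inj t x : ld t -> ld ((x, t.2) : C2) -> Z (x, t.2) = Z t -> x = t.1.
Proof.
move=> td xd E; have t0 : 0 < nrm t.2 by rewrite nrm_gt0; exact: ld_neq0 td.
have := Zhalf td xd; rewrite E subrr sub0r nrmN nrmM.
rewrite mulrCA ler_pM2l // => K; apply/eqP; rewrite -subr_eq0 -nrm_eq0 eq_le nrm_ge0 andbT.
by have := nrm_ge0 (x - t.1); move: K; move: (nrm _) => u; lra.
Qed.

Definition leafX (w : C2) : C := xget 0 [set x | nrm x <= nrm w.2 / 8 /\ Z (x, w.2) = w.1].

Lemma leafX_spec w : chart_dom w -> nrm (leafX w) <= nrm w.2 / 8 /\ Z (leafX w, w.2) = w.1.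
Proof.
move=> /leafX_exists[x xP].
exact: (@xgetPex _ 0 [set x | nrm x <= nrm w.2 / 8 /\ Z (x, w.2) = w.1] (ex_intro _ x xP)).
Qed.

Lemma leafX_ld w : chart_dom w -> ld ((leafX w, w.2) : C2).
Proof. by move=> wd; apply: small_ld => //; exact: (leafX_spec wd).1. Qed.

Lemma chart_dom_open w : chart_dom w -> \forall v \near w, chart_dom v.
Proof.
move=> [w2 w1].
have c1 : (fun v : C2 => nrm v.2) @ w --> nrm w.2.
  by apply: (@cvg_comp _ _ _ (fun v : C2 => v.2) (@nrm R C)); [exact: (diff_continuous_nrm (snd_differentiable w))|exact: nrm_continuous].
have c2 : (fun v : C2 => nrm v.1) @ w --> nrm w.1.
  by apply: (@cvg_comp _ _ _ (fun v : C2 => v.1) (@nrm R C)); [exact: (diff_continuous_nrm (fst_differentiable w))|exact: nrm_continuous].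
have c3 : (fun v : C2 => nrm v.2 ^+ 2 / 16 - nrm v.1) @ w --> nrm w.2 ^+ 2 / 16 - nrm w.1.
  apply: cvgB; last exact: c2.
  apply: cvgM; last exact: cvg_cst.
  exact: (cvgM c1 c1).
have n1 : \forall v \near w, 2 * s < nrm v.2 by exact: (cvgr_gt _ c1).
have n2 : \forall v \near w, 0 < nrm v.2 ^+ 2 / 16 - nrm v.1.
  by apply: (cvgr_gt _ c3); rewrite subr_gt0.
by near=> v; split; [near: v|rewrite -subr_gt0; near: v].
Unshelve. all: by end_near.
Qed.

Lemma leafX_differentiable w : chart_dom w -> differentiable leafX w.
Proof.
move=> wd; have /nbhs_nrmP[d d0 dP] := chart_dom_open wd.
have [X8 XZ] := leafX_spec wd; have w0 := ld_neq0 (leafX_ld wd).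
have n0 : 0 < nrm w.2 by rewrite nrm_gt0.
pose d1 := Num.min d (nrm w.2 / 20).
have d10 : 0 < d1 by rewrite lt_min d0 divr_gt0.
have d1d : d1 <= d by rewrite ge_min lexx.
have d1n : d1 <= nrm w.2 / 20 by rewrite ge_min lexx orbT.
clearbody d1.
pose g (q : C2 * C) : C := q.2 - Z (q.2, q.1.2) / q.1.2 + q.1.1 / q.1.2.
have q12 (q : C2 * C) : differentiable (fun q : C2 * C => q.1.2) q.
  apply: (@differentiable_comp _ _ _ _ (fun q : C2 * C => q.1) (fun q : C2 => q.2)).
    exact: pr1_differentiable.
  exact: snd_differentiable.
have q11 (q : C2 * C) : differentiable (fun q : C2 * C => q.1.1) q.
  apply: (@differentiable_comp _ _ _ _ (fun q : C2 * C => q.1) (fun q : C2 => q.1)).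
    exact: pr1_differentiable.
  exact: fst_differentiable.
have q12V : differentiable (fun q : C2 * C => q.1.2^-1) (w, leafX w).
  by apply: differentiableV; [exact: q12|].
apply: (@implicit_diff R g leafX w d1 d10).
- apply: differentiableD; last by apply: differentiableM; [exact: q11|exact: q12V].
  apply: differentiableB; first exact: pr2_differentiable.
  apply: differentiableM; last exact: q12V.
  apply: (@differentiable_comp _ _ _ _ (fun q : C2 * C => (q.2, q.1.2) : C2) Z); last first.
    exact: Zdiff (leafX_ld wd).
  apply: differentiable_pair; [exact: pr2_differentiable|exact: q12].
- move=> u ut; have ud := dP u (lt_le_trans ut d1d); have [Xu XuZ] := leafX_spec ud.
  split.
    by rewrite /g /= XuZ subrK.
  apply: leafX_map_lip; first exact: leafX_ld.
  have [u2 _] := ud; split => //=.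
  have := nrm_subD w.2 u.2; rewrite nrmBC => T.
  have := le_trans (ltW (le_lt_trans (nrm_snd (u - w)) ut)) d1n.
  move: T X8 n0; rewrite /=; move: (nrm _) (nrm _) (nrm _) (nrm _) => *; lra.
move=> y yt; apply: leafX_map_lip; last exact: leafX_ld.
have [w2 _] := wd; split => //=; have := nrm_subD y (leafX w).
have := lt_le_trans yt d1n; move: X8 n0; move: (nrm _) (nrm _) (nrm _) (nrm _) => *; lra.
Qed.

Definition psi0 (w : C2) : C2 := leaf phi (leafX w, w.2).
Definition phi0 (p : C2) : C2 := (Z (p.1, phi p), phi p).
Definition chart_set : set C2 :=
  [set p | [/\ ncone s p, ld ((p.1, phi p) : C2) & chart_dom (phi0 p)]].

Lemma psi0_differentiable w : chart_dom w -> differentiable psi0 w.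
Proof.
move=> wd; apply: (@differentiable_comp _ _ _ _ (fun w : C2 => (leafX w, w.2) : C2) (leaf phi)).
  by apply: differentiable_pair; [exact: leafX_differentiable|exact: snd_differentiable].
exact: lfdiff (leafX_ld wd).
Qed.

Lemma psi0K w : chart_dom w -> chart_set (psi0 w) /\ phi0 (psi0 w) = w.
Proof.
move=> wd; have xd := leafX_ld wd; have [_ XZ] := leafX_spec wd.
have E : phi (psi0 w) = w.2 by exact: philf xd.
have E2 : phi0 (psi0 w) = w by rewrite /phi0 E [(psi0 w).1]/= XZ; case: (w).
by split=> //; split; [exact: lnc xd|rewrite E; exact: xd|rewrite E2].
Qed.

Lemma phi0K p : chart_set p -> psi0 (phi0 p) = p.
Proof.
move=> [pn pd wd]; have [X8 XZ] := leafX_spec wd.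
have XE : leafX (phi0 p) = p.1.
  exact: (@Z_inj ((p.1, phi p) : C2) (leafX (phi0 p)) pd (leafX_ld wd) XZ).
by rewrite /psi0 XE; exact: lfphi.
Qed.

Lemma phi0_differentiable p : chart_set p -> differentiable phi0 p.
Proof.
move=> [pn pd wd]; have fd := phi_diff (ncone_r r0 rs pn).
apply: differentiable_pair; last exact: fd.
apply: (@differentiable_comp _ _ _ _ (fun p : C2 => (p.1, phi p) : C2) Z).
  by apply: differentiable_pair; [exact: fst_differentiable|exact: fd].
exact: Zdiff.
Qed.

Lemma ncone_open (k : R) (p : C2) : ncone k p -> \forall q \near p, ncone k q.
Proof.
move=> [p2 p1]; pose e := Num.min (nrm p.2 - k) ((nrm p.2 / 2 - nrm p.1) / 2).
have e0 : 0 < e by rewrite lt_min subr_gt0 p2 divr_gt0 // subr_gt0.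
have e1 : e <= nrm p.2 - k by rewrite ge_min lexx.
have e2 : e <= (nrm p.2 / 2 - nrm p.1) / 2 by rewrite ge_min lexx orbT.
apply/nbhs_nrmP; exists e => // q qp.
have S1 : nrm (q.1 - p.1) < e := le_lt_trans (nrm_fst (q - p)) qp.
have S2 : nrm (q.2 - p.2) < e := le_lt_trans (nrm_snd (q - p)) qp.
have T1 := nrm_subD p.2 q.2; have T2 := nrm_subD q.1 p.1.
rewrite [nrm (p.2 - _)]nrmBC in T1; rewrite /ncone /=.
clearbody e.
move: (nrm (q.1 - p.1)) (nrm (q.2 - p.2)) (nrm p.1) (nrm p.2) (nrm q.1) (nrm q.2) S1 S2 T1 T2 e1 e2 e0.
move=> u v b c d f *; split; lra.
Qed.

Lemma chart_set_open : open chart_set.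
Proof.
rewrite openE => p ps; rewrite /interior; have [pn pd wd] := ps.
have c1 : (fun p : C2 => (p.1, phi p) : C2) @ p --> ((p.1, phi p) : C2).
  apply: diff_continuous_nrm; apply: differentiable_pair; first exact: fst_differentiable.
  exact: phi_diff (ncone_r r0 rs pn).
have c2 := diff_continuous_nrm (phi0_differentiable ps).
have n1 := ncone_open pn.
have n2 := c1 _ (leaf_dom_open pd).
have n3 := c2 _ (chart_dom_open wd).
by near=> q; split; near: q.
Unshelve. all: by end_near.
Qed.

Definition Qf (z : C) : C := Z ((H (leaf phi (0, z))).1, l * z ^+ D).
Definition Ff (w : C2) : C2 := (a / D%:R * w.1 + Qf w.2, l * w.2 ^+ D).

(** From |x| <= |y|/100 one gets |x| <= |zeta|/50, and |Z| <= (3/2) |zeta| |x| is then below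
    |zeta|^2/16. *)
Lemma chart_set_of p : ncone (3 * s) p -> nrm p.1 <= nrm p.2 / 100 -> chart_set p.
Proof.
move=> pn p1; have pns : ncone s p by apply: ncone_sub pn; rewrite ler_peMl ?ler1n // ltW.
have [e1 _] := phi_est pns; have T := nrm_subD p.2 (phi p); rewrite nrmBC in T.
have s3 := pn.1.
have [A1 A2 _] := image_dom_aux2 s0 e1 T p1 s3 (lexx _).
have pd : ld ((p.1, phi p) : C2) by split.
split => //; have [_ _ A3] := image_dom_aux2 s0 e1 T p1 s3 (Z_bound pd).
by split.
Qed.

Lemma psi0_conj w : chart_dom w -> chart_dom (Ff w) /\ H (psi0 w) = psi0 (Ff w).
Proof.
move=> wd; have xd := leafX_ld wd; have [_ XZ] := leafX_spec wd.
have [ld' lE] := leaf_H r0 rs phi_diff phi_est phi_H H_step xd.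
have ZE := ZH xd; rewrite XZ in ZE.
have phE : phi (H (psi0 w)) = l * w.2 ^+ D by rewrite phi_H ?(philf xd) //; exact: (ncone_r r0 rs (lnc xd)).
have p0E : phi0 (H (psi0 w)) = Ff w by rewrite /phi0 phE /Ff -ZE.
have [P1 P2] := H_step (lexx s) (lnc xd).
suff cs : chart_set (H (psi0 w)) by split; [rewrite -p0E; case: cs|rewrite -p0E phi0K].
apply: chart_set_of => //.
have lns : ncone (3 / 2 * s) (leaf phi (leafX w, w.2)).
  apply: (leaf_lower r0 rs phi_diff phi_est xd).
    by rewrite ler_peMl ?(ltW s0) // ler_pdivlMr // mul1r ler_nat.
  by rewrite mulrA (_ : 4 / 3 * (3 / 2) = 2); [case: wd|field].
have [] := H_step _ lns; first by rewrite ler_peMl ?(ltW s0) // ler_pdivlMr // mul1r ler_nat.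
by rewrite mulrA mulrCA divff ?mulr1.
Qed.

Variables (e : nat) (l' : C).
Hypothesis HPe : (H p).1 / p.2 ^+ e @[p --> cone_infty] --> l'.

Lemma ld_axis z : 2 * s < nrm z -> ld ((0, z) : C2).
Proof.
move=> zs; split => //=; rewrite nrm0 divr_gt0 //; apply: lt_trans zs; by rewrite mulr_gt0.
Qed.

Lemma leaf_axis_infty : leaf phi (0, z) @[z --> cx_infty] --> cone_infty.
Proof.
move=> P [k /= k0 kP]; pose m := Num.max k s.
apply: (@cx_infty_near _ _ (2 * m)) => z zm.
have mk : k <= m by rewrite le_max lexx.
have ms : s <= m by rewrite le_max lexx orbT.
have m0 : 0 < m := lt_le_trans k0 mk.
have zd : ld ((0, z) : C2) by apply: ld_axis; apply: le_lt_trans zm; rewrite ler_pM2l.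
apply: kP; apply: (cone_sub mk); apply: ncone_cone (ltW m0) _.
apply: (leaf_lower r0 rs phi_diff phi_est zd ms); apply: le_lt_trans zm.
by rewrite ler_pM2r // ler_pdivrMr // -natrM ler_nat.
Qed.

Lemma leafY_axis_cvg : leafY phi (0, z) / z @[z --> cx_infty] --> (1 : C).
Proof.
have K : z / leafY phi (0, z) @[z --> cx_infty] --> (1 : C).
  apply/cvg_nrmP => d d0; have [s' ss' s'P] := phi_lim (divr_gt0 d0 (ltr0n R 2)).
  apply: (@cx_infty_near _ _ (2 * s')) => z zs.
  have s'0 : 0 < s' := lt_le_trans s0 ss'.
  have zd : ld ((0, z) : C2) by apply: ld_axis; apply: le_lt_trans zs; rewrite ler_pM2l.
  have yn : ncone s' (leaf phi (0, z)).
    apply: (leaf_lower r0 rs phi_diff phi_est zd ss'); apply: le_lt_trans zs.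
    by rewrite ler_pM2r // ler_pdivrMr // -natrM ler_nat.
  have [e1 _] := s'P _ yn; rewrite (philf zd) /= in e1.
  have y0 : 0 < nrm (leafY phi (0, z)) by apply: lt_trans yn.1.
  have -> : z / leafY phi (0, z) - 1 = (z - leafY phi (0, z)) / leafY phi (0, z).
    by rewrite mulrBl divff // -nrm_gt0.
  rewrite nrmM nrmV ltr_pdivrMr //; apply: (le_lt_trans e1).
  by rewrite ltr_pM2r // ltr_pdivrMr // ltr_pMr // ltr1n.
have K2 : (z / leafY phi (0, z))^-1 @[z --> cx_infty] --> (1 : C).
  by rewrite -(invr1 C); exact: (cvgV (oner_neq0 C) K).
by apply: (@cx_infty_eq_cvg _ _ _ _ 0 _ K2) => z _; rewrite invf_div.
Qed.

(** Q(z) is the coordinate Z of the image of the axis point x = 0 on the leaf z. As Z ~ zeta x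
    there, Q(z) ~ l z^D h(z), with first coordinate h(z) ~ l' z^e. *)
Lemma Qf_asymp : Qf z / z ^+ (D + e) @[z --> cx_infty] --> l * l'.
Proof.
pose h z : C := (H (leaf phi (0, z))).1.
have powcv n : (leafY phi (0, z) / z) ^+ n @[z --> cx_infty] --> (1 : C).
  elim: n => [|n IH]; first exact: cvg_cst.
  under eq_fun do rewrite exprS.
  have K := cvgM leafY_axis_cvg IH; rewrite mulr1 in K; exact: K.
have c1 : h z / leafY phi (0, z) ^+ e @[z --> cx_infty] --> l'.
  exact: (cvg_comp _ _ leaf_axis_infty HPe).
have cA : l * h z / z ^+ e @[z --> cx_infty] --> l * l'.
  have c2 : l * (h z / leafY phi (0, z) ^+ e * (leafY phi (0, z) / z) ^+ e) @[z --> cx_infty] --> l * (l' * 1).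
    by apply: cvgM; [exact: cvg_cst|exact: (cvgM c1 (powcv e))].
  rewrite mulr1 in c2; apply: (@cx_infty_eq_cvg _ _ _ _ (2 * s) _ c2) => z zs.
  have zd := ld_axis zs; have y0 : leafY phi (0, z) != 0.
    by rewrite -nrm_gt0; apply: lt_trans (lnc zd).1.
  rewrite expr_div_n; have y1 := expf_neq0 e y0.
  by rewrite -[RHS]mulrA; congr (_ * _); rewrite mulrA divfK.
apply/cvg_nrmP => d d0; pose M := nrm (l * l') + 1.
have M0 : 0 < M by rewrite ltr_wpDl ?nrm_ge0.
have dM : 0 < d / 2 / M by rewrite !divr_gt0.
have [k kP] := Zasymp dM.
have [k1 k10 k1P] := near_cx_infty ((cvg_nrmP _ _ _).1 cA 1 ltr01).
have [k2 k20 k2P] := near_cx_infty ((cvg_nrmP _ _ _).1 cA _ (divr_gt0 d0 (ltr0n R 2))).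
pose kk := Num.max (k / nrm l) 1.
apply: (@cx_infty_near _ _ (Num.max (Num.max k1 k2) (Num.max (2 * s) kk))) => z.
rewrite !gt_max => /andP[/andP[zk1 zk2] /and3P[zs zk z1]].
have zd := ld_axis zs; have [hd _] := leaf_H r0 rs phi_diff phi_est phi_H H_step zd.
have lp : 0 < nrm l by rewrite nrm_gt0.
have z0 : z != 0 by rewrite -nrm_gt0; apply: lt_trans z1.
have kz : k < nrm (l * z ^+ D).
  rewrite nrmM nrmX; rewrite ltr_pdivrMr // in zk; apply: (lt_le_trans zk); rewrite mulrC ler_wpM2l ?nrm_ge0 //.
  by rewrite -{1}[nrm z]expr1; apply: ler_weXn2l; [exact: ltW|exact: ltnW].
have {kP} := kP _ hd kz; rewrite /= -/(h z) -/(Qf z) => KQ.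
have := nrm_triangle (l * h z / z ^+ e) (Qf z / z ^+ (D + e)) (l * l') => T.
apply: (le_lt_trans T).
have AM : nrm (l * h z / z ^+ e) <= M.
  by apply: (le_trans (nrm_subD _ (l * l'))); rewrite addrC /M lerD2l ltW // k1P.
have K1 : nrm (Qf z / z ^+ (D + e) - l * h z / z ^+ e) <= d / 2.
  have zD : z ^+ D != 0 by rewrite expf_neq0.
  have ze : z ^+ e != 0 by rewrite expf_neq0.
  have -> : Qf z / z ^+ (D + e) - l * h z / z ^+ e = (Qf z - l * z ^+ D * h z) / (z ^+ D * z ^+ e).
    by rewrite exprD; move: (z ^+ D) (z ^+ e) zD ze (h z) (Qf z) => u v u0 v0 x y; field; rewrite u0 v0.
  rewrite nrmM nrmV ler_pdivrMr ?nrm_gt0 ?mulf_neq0 //; apply: (le_trans KQ).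
  have -> : nrm (l * z ^+ D) * nrm (h z) = nrm (l * h z / z ^+ e) * nrm (z ^+ D * z ^+ e).
    rewrite -!nrmM; congr nrm; move: (z ^+ D) (z ^+ e) ze (h z) => u v v0 x; by field.
  rewrite mulrA ler_wpM2r ?nrm_ge0 //; apply: (le_trans (ler_wpM2l (ltW dM) AM)).
  by rewrite divfK ?gt_eqF.
by have := k2P z zk2; move: K1; rewrite /=; move: (nrm _) (nrm _) => u v; lra.
Qed.

End Chart.

(** * Normalisation and the abstract chart *)

Section HenonChart.
Context {R : realType}.
Local Notation C := (Cx R).
Local Notation C2 := (Cx2 R).

Definition wdom (rho : R) : set C2 := [set w | rho < nrm w.2 /\ nrm w.1 < nrm w.2 ^+ 2].

(* The only facts about H used below: Psi, with inverse Phi, conjugates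
   (z, zeta) |-> (al z + Q zeta, zeta^d) to H, and every point of U+ enters its
   image Dm. *)
Record henon_chart (H Hi : C2 -> C2) (Up : set C2) (G : C2 -> R) (d e : nat) (rho : R)
    (al q : C) (Q : C -> C) (Phi Psi : C2 -> C2) (Dm : set C2) : Prop := HenonChart {
  hc_H : forall p, differentiable H p;
  hc_Hi : forall p, differentiable Hi p;
  hc_HK : cancel H Hi;
  hc_HiK : cancel Hi H;
  hc_rho : 1 <= rho;
  hc_al : al != 0;
  hc_q : q != 0;
  hc_e : (0 < e < d)%N;
  hc_Q : Q z / z ^+ (d + e) @[z --> cx_infty] --> q;
  hc_open : open Dm;
  hc_Phi : forall p, Dm p -> [/\ wdom rho (Phi p), Psi (Phi p) = p & differentiable Phi p];
  hc_Psi : forall w, wdom rho w -> [/\ Dm (Psi w), Phi (Psi w) = w & differentiable Psi w];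
  hc_conj : forall w, wdom rho w -> wdom rho (al * w.1 + Q w.2, w.2 ^+ d) /\
    H (Psi w) = Psi (al * w.1 + Q w.2, w.2 ^+ d);
  hc_U : forall p, Up p <-> exists N, Dm (iter N H p);
  hc_G : forall p N, Dm (iter N H p) -> G p = ln (nrm (Phi (iter N H p)).2) / d%:R ^+ N }.

Lemma scaled_limit (u : nat -> R) (d N : nat) (L K : R) : (1 < d)%N ->
  (forall n, `|u (n + N)%N - d%:R ^+ n * L| <= K) ->
  (d%:R ^+ n)^-1 * u n @[n --> \oo] --> L / d%:R ^+ N.
Proof.
move=> d1 uK; rewrite -(cvg_shiftn N).
apply/cvgrPdist_lt => e e0.
have K0 : 0 <= K by apply: le_trans (uK 0%N); exact: normr_ge0.
have d0 : 0 < d%:R :> R by rewrite ltr0n (ltn_trans _ d1).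
have [M MP] := half_small (divr_gt0 e0 (ltr_wpDl K0 (@ltr01 R))).
exists M => // n /= Mn; rewrite distrC.
have -> : (d%:R ^+ (n + N))^-1 * u (n + N)%N - L / d%:R ^+ N =
    (d%:R ^+ (n + N))^-1 * (u (n + N)%N - d%:R ^+ n * L).
  rewrite mulrBr; congr (_ - _); rewrite exprD invfM mulrACA mulVf ?mul1r 1?mulrC //.
  by rewrite expf_neq0 // gt_eqF.
rewrite normrM ger0_norm ?invr_ge0 ?exprn_ge0 ?ltW //.
apply: (@le_lt_trans _ _ (2^-1 ^+ M * (K + 1))); last first.
  by rewrite -ltr_pdivlMr // ltr_wpDl.
apply: ler_pM; rewrite ?normr_ge0 ?invr_ge0 ?exprn_ge0 ?(ltW d0) //; last first.
  by apply: (le_trans (uK n)); rewrite lerDl.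
rewrite exprVn lef_pV2 ?posrE ?exprn_gt0 //.
apply: (@le_trans _ _ (2 ^+ (n + N))).
  by rewrite ler_weXn2l ?ler1n // (leq_trans Mn) // leq_addr.
by apply: lerXn2r; rewrite ?nnegrE ?ler_nat // ltW.
Qed.

Lemma nrm_bounded_fun (f : nat -> C2) : bounded_fun f <-> exists M, forall n, nrm (f n) <= M.
Proof.
split=> [[M [Mr MP]]|[M MP]].
  have ME : M = rc (Re M).
    by move: Mr; rewrite realE => /orP[]; rewrite lecE /= => /andP[/eqP i0 _];
       apply: cx_ext => //=; rewrite ?i0 // -i0.
  exists (Re M + 1) => n; rewrite -rc_le -nrmE.
  by apply: (MP (rc (Re M + 1)) _ n I); rewrite {1}ME rc_lt ltrDl.
exists (rc M); split; first by rewrite realE -!rc0 !rc_le le_total.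
move=> x Mx n _ /=; rewrite nrmE; apply: le_trans (ltW Mx); by rewrite rc_le.
Qed.

Lemma ln_close (y f c : R) : 0 < c -> 0 < f -> 0 < y -> y <= 2 * f -> f <= 2 * y ->
  `|ln y - ln (c * f)| <= ln 2 + `|ln c|.
Proof.
move=> c0 f0 y0 yf fy; rewrite [ln (c * f)]lnM ?posrE //.
have A1 : ln y <= ln 2 + ln f by rewrite -lnM ?posrE // ler_ln // posrE mulr_gt0.
have A2 : ln f <= ln 2 + ln y by rewrite -lnM ?posrE // ler_ln // posrE mulr_gt0.
have := ler_norm (ln c); have := ler_norm (- ln c); rewrite normrN ler_norml => B1 B2.
by apply/andP; split; lra.
Qed.

Lemma wdom_aux (u v c : R) : 0 < c -> (16 * c ^+ 2 * u < (c * v) ^+ 2) = (u < v ^+ 2 / 16).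
Proof.
move=> c0; have c2 : 0 < c ^+ 2 by rewrite exprn_gt0.
by rewrite exprMn [16 * _]mulrC -mulrA ltr_pM2l // ltr_pdivlMr // mulrC.
Qed.

Lemma pow_step (c l f F : C) (D n : nat) : c * l = c ^+ D -> c * f = F ^+ (D ^ n) ->
  c * (l * f ^+ D) = F ^+ (D ^ n.+1).
Proof. by move=> cD IH; rewrite mulrA cD -exprMn IH -exprM expnSr. Qed.

(** Multiplying phi by such a root c turns phi(H p) = l phi(p)^D into an exact D-th power law. *)
Lemma root_exists (l : C) (D : nat) : (1 < D)%N -> l != 0 ->
  exists2 c : C, c != 0 & c ^+ D.-1 = l.
Proof.
move=> D1 /cexp_surj[m mE]; exists (cexp (m / D.-1%:R)); first exact: cexp_neq0.
rewrite -cexpMn -mE; congr cexp; rewrite mulrC divfK // pnatr_eq0.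
by move: D1; case: (D) => [|[|]].
Qed.

Section Construction.
Variable hs : seq ({poly C} * C).
Hypothesis hsd : henon_data hs.
Local Notation H := (henon hs).
Local Notation D := (henon_degree hs).

Lemma henon_ok : factors_ok hs.
Proof. by case/andP: hsd. Qed.

Lemma iter_unbounded (s : R) (p : C2) N : 1 <= s ->
  (forall n, ncone (2 ^+ n * s) (iter n H (iter N H p))) -> Uplus hs p.
Proof.
move=> s1 nP /nrm_bounded_fun[M MP].
have M1 : 0 < M + 1.
  by apply: (@le_lt_trans _ _ M); [apply: le_trans (MP 0%N); exact: nrm_ge0|rewrite ltrDl].
have [n nM] : exists n, M + 1 < 2 ^+ n.
  have Mi : 0 < (M + 1)^-1 by rewrite invr_gt0.
  have [n] := half_small Mi; rewrite exprVn ltf_pV2 ?posrE ?exprn_gt0 // => nP'.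
  by exists n.
have := (nP n).1; rewrite -iterD => K.
have := le_trans (nrm_snd _) (MP (n + N)%N); apply/negP; rewrite -ltNge.
apply: lt_trans K; apply: (@lt_le_trans _ _ (2 ^+ n)); last by rewrite ler_peMr // exprn_ge0.
by apply: lt_trans nM; rewrite ltrDl.
Qed.

Lemma Uplus_enters_cone (r0 : R) (p : C2) : Uplus hs p -> exists2 r, r0 <= r &
  exists n, cone r (iter n H p).
Proof.
move=> pU; have [r1 r10 rP] := henon_cone henon_ok; pose r := Num.max r0 r1.
exists r; first by rewrite le_max lexx.
have [|_ rB] := rP r; first by rewrite le_max lexx orbT.
apply: contrapT => nex; apply: pU; apply/nrm_bounded_fun.
exists (Num.max r (nrm p)) => n.
suff : nrm (iter n H p).1 <= Num.max r (nrm p) /\ nrm (iter n H p).2 <= Num.max r (nrm p).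
  by case=> ? ?; exact: nrm_pair_le.
elim: n => [|n [IH1 IH2]].
  by split; rewrite le_max; apply/orP; right; [exact: nrm_fst|exact: nrm_snd].
rewrite iterS; apply: rB => //; last by rewrite le_max lexx.
by move=> cn; apply: nex; exists n.+1.
Qed.

Theorem henon_chart_exists : exists Hi e rho al q Q Phi Psi Dm,
  henon_chart H Hi (Uplus hs) (Gplus hs) D e rho al q Q Phi Psi Dm.
Proof.
have ok := henon_ok; have [a a0 jac] := henon_jacobian ok.
have [e [l [l' [/andP[e0 eD] [l0 l'0] HN HPe HP]]]] := henon_growth hsd.
have D1 : (1 < D)%N by apply: leq_ltn_trans eD.
have Hd := henon_differentiable hs.
have [r _ rP] := escape_radius_exists D1 l0 HN HP 1.
have r1 := rP.1; have r0 : 0 < r := lt_le_trans ltr01 r1.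
pose phi := bphi H D l.
have phi_diff p : cone r p -> differentiable phi p by exact: (bphi_differentiable D1 Hd rP).
have phi_H p : cone r p -> phi (H p) = l * phi p ^+ D by exact: (bphi_H D1 l0 rP).
have est (d : R) : 0 < d -> exists2 s, r <= s & forall p, ncone s p ->
  nrm (phi p - p.2) <= d * nrm p.2 /\ nrm (dif phi p ((0, 1) : C2) - 1) <= d.
  exact: (bphi_estimates D1 l0 Hd HN rP).
have [|s1 rs1 s1P] := est 20^-1; first by rewrite invr_gt0.
have [c c0 cE] := root_exists D1 l0.
(* The radius of the normalised chart is 2 s |c|; the second bound makes it at least 1. *)
pose s := Num.max s1 (nrm c)^-1.
have rs : r <= s by rewrite le_max rs1.
have s0 : 0 < s := lt_le_trans r0 rs.
have phi_est p : ncone s p -> nrm (phi p - p.2) <= 20^-1 * nrm p.2 /\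
    nrm (dif phi p ((0, 1) : C2) - 1) <= 20^-1.
  by move=> pn; apply: s1P; apply: ncone_sub pn; rewrite le_max lexx.
have phi_lim (d : R) : 0 < d -> exists2 s', s <= s' & forall p, ncone s' p ->
  nrm (phi p - p.2) <= d * nrm p.2 /\ nrm (dif phi p ((0, 1) : C2) - 1) <= d.
  move=> /est[s2 _ s2P]; exists (Num.max s s2); first by rewrite le_max lexx.
  by move=> p pn; apply: s2P; apply: ncone_sub pn; rewrite le_max lexx orbT.
have cstep s' p : r <= s' -> cone s' p -> ncone (2 * s') (H p) /\ nrm (H p).1 <= nrm (H p).2 / 100.
  move=> rs' pc; have [_ _ N2 P1] := rP.2 p (cone_sub rs' pc); split => //.
  have [c1 c2] := cone_step rP rs' pc; split => //.
  have y0 : 0 < nrm (H p).2 by apply: lt_trans c1; rewrite mulr_gt0 // (lt_le_trans r0).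
  by apply: (le_lt_trans P1); rewrite ltr_pM2l // ltf_pV2 ?posrE // ltr_nat.
have H_step s' p : s <= s' -> ncone s' p -> ncone (2 * s') (H p) /\ nrm (H p).1 <= nrm (H p).2 / 100.
  move=> ss' pn; apply: cstep; first exact: le_trans ss'.
  by apply: ncone_cone pn; apply: ltW; apply: lt_le_trans ss'.
pose Z := Zl H D l a phi.
pose Dm := chart_set H D l a phi s.
(* Scaling z by k and zeta by c turns |z| < |zeta|^2/16 into |z| < |zeta|^2. *)
pose k := 16 * c ^+ 2.
have k0 : k != 0 by rewrite mulf_neq0 ?expf_neq0 // pnatr_eq0.
pose Phi p : C2 := (k * (phi0 H D l a phi p).1, c * (phi0 H D l a phi p).2).
pose sc (w : C2) : C2 := (w.1 / k, w.2 / c).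
pose Psi w : C2 := psi0 H D l a phi (sc w).
pose Q z := k * Qf H D l a phi (z / c).
exists (henon_inv hs), e, (2 * s * nrm c), (a / D%:R), (k * (l * l') / c ^+ (D + e)), Q, Phi, Psi, Dm.
have nc0 : 0 < nrm c by rewrite nrm_gt0.
have scK w : (k * (sc w).1, c * (sc w).2) = w :> C2.
  by case: w => x y; rewrite /sc /= mulrC divfK // mulrC divfK.
have Ksc (z w : C) : sc (k * z, c * w) = (z, w) by rewrite /sc /= ![_ * z]mulrC ![_ * w]mulrC !mulfK.
have domE w : chart_dom s w <-> wdom (2 * s * nrm c) (k * w.1, c * w.2).
  have kE : nrm k = 16 * nrm c ^+ 2 by rewrite /k nrmM nrmX nrm_nat.
  rewrite /chart_dom /wdom /= [nrm (k * _)]nrmM [nrm (c * _)]nrmM kE wdom_aux //.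
  by rewrite [nrm c * _]mulrC ltr_pM2r.
have pK w : chart_dom s w -> Dm (psi0 H D l a phi w) /\ phi0 H D l a phi (psi0 H D l a phi w) = w.
  exact: (psi0K D1 l0 a0 r0 rs Hd jac phi_diff phi_est phi_lim phi_H H_step).
have fK p : Dm p -> psi0 H D l a phi (phi0 H D l a phi p) = p.
  exact: (phi0K D1 l0 a0 r0 rs Hd jac phi_diff phi_est phi_lim phi_H H_step).
have pd w : chart_dom s w -> differentiable (psi0 H D l a phi) w.
  exact: (psi0_differentiable D1 l0 a0 r0 rs Hd jac phi_diff phi_est phi_lim phi_H H_step).
have fd p : Dm p -> differentiable (phi0 H D l a phi) p.
  exact: (phi0_differentiable D1 l0 a0 r0 rs Hd jac phi_diff phi_est phi_lim phi_H H_step).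
have cj w : chart_dom s w -> chart_dom s (Ff H D l a phi w) /\
    H (psi0 H D l a phi w) = psi0 H D l a phi (Ff H D l a phi w).
  exact: (psi0_conj D1 l0 a0 r0 rs Hd jac phi_diff phi_est phi_lim phi_H H_step).
have cset p : ncone (3 * s) p -> nrm p.1 <= nrm p.2 / 100 -> Dm p.
  exact: (chart_set_of D1 l0 a0 r0 rs Hd jac phi_diff phi_est phi_lim phi_H H_step).
have Qa : Qf H D l a phi z / z ^+ (D + e) @[z --> cx_infty] --> l * l'.
  exact: (Qf_asymp D1 l0 a0 r0 rs Hd jac phi_diff phi_est phi_lim phi_H H_step HPe).
have Dmo : open Dm.
  exact: (chart_set_open D1 l0 a0 r0 rs Hd jac phi_diff phi_est phi_lim phi_H H_step).
have scd w : wdom (2 * s * nrm c) w -> chart_dom s (sc w).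
  by move=> wd; apply/domE; rewrite scK.
have scdiff w : differentiable sc w.
  apply: differentiable_pair; (apply: differentiableM; last exact: differentiable_cst).
    exact: fst_differentiable.
  exact: snd_differentiable.
have s1' : 1 <= s by apply: le_trans rs.
have cD : c * l = c ^+ D by rewrite -cE -exprS prednK // (ltn_trans _ D1).
constructor.
- exact: Hd.
- exact: henon_inv_differentiable.
- exact: henonK.
- exact: henon_invK.
- have : (nrm c)^-1 <= s by rewrite le_max lexx orbT.
  rewrite -[(nrm c)^-1]mul1r ler_pdivrMr // => H1; apply: (le_trans H1).
  by rewrite -mulrA ler_peMl ?ler1n // mulr_ge0 // ltW.
- by rewrite mulf_neq0 // invr_eq0 pnatr_eq0 -lt0n (ltn_trans _ D1).
- by rewrite !mulf_neq0 // invr_eq0 expf_neq0.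
- by rewrite e0.
- have cinf : (fun z : C => z / c) @ cx_infty --> cx_infty.
    move=> P /near_cx_infty[m m0 mP]; apply: (@cx_infty_near _ _ (m * nrm c)) => z zm.
    by apply: mP; rewrite nrmM nrmV ltr_pdivlMr.
  have K := cvg_comp _ _ cinf Qa.
  have K2 : k / c ^+ (D + e) * (Qf H D l a phi (z / c) / (z / c) ^+ (D + e)) @[z --> cx_infty]
      --> k / c ^+ (D + e) * (l * l').
    by apply: cvgM; [exact: cvg_cst|exact: K].
  rewrite [k * _ / _]mulrAC; apply: (@cx_infty_eq_cvg _ _ _ _ 0 _ K2) => z z0.
  rewrite /Q expr_div_n; have z1 : z ^+ (D + e) != 0 by rewrite expf_neq0 // -nrm_gt0.
  have c1 : c ^+ (D + e) != 0 by rewrite expf_neq0.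
  move: (z ^+ _) (c ^+ _) (Qf _ _ _ _ _ _) z1 c1 => u v x u0 v0.
  by field; rewrite u0 v0.
- exact: Dmo.
- move=> p pD; split; first by apply/domE; case: (pD).
    by rewrite /Psi /Phi Ksc; case: (phi0 _ _ _ _ _ p) (fK p pD).
  apply: differentiable_pair; (apply: differentiableM; first exact: differentiable_cst).
    apply: (@differentiable_comp _ _ _ _ (phi0 H D l a phi) (fun q : C2 => q.1)); first exact: fd.
    exact: fst_differentiable.
  apply: (@differentiable_comp _ _ _ _ (phi0 H D l a phi) (fun q : C2 => q.2)); first exact: fd.
  exact: snd_differentiable.
- move=> w /scd wd; have [w1 w2] := pK _ wd; split=> //; first by rewrite /Phi w2 scK.
  by apply: (@differentiable_comp _ _ _ _ sc (psi0 H D l a phi)); [exact: scdiff|exact: pd].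
- move=> w /scd wd; have [w1 w2] := cj _ wd.
  have E : (a / D%:R * w.1 + Q w.2, w.2 ^+ D) =
      (k * (Ff H D l a phi (sc w)).1, c * (Ff H D l a phi (sc w)).2) :> C2.
    congr (_, _); rewrite /Ff /sc /=.
      by rewrite mulrDr /Q; congr (_ + _); rewrite [k * _]mulrCA [k * _]mulrC divfK.
    by rewrite expr_div_n mulrA cD mulrC divfK // expf_neq0.
  rewrite E; split; first exact/domE.
  by rewrite /Psi Ksc w2; case: (Ff _ _ _ _ _ _).
- move=> p; split => [pU|[N pN]].
    have [r' rr' [n nP]] := Uplus_enters_cone (Num.max r (3 * s)) pU.
    move: rr'; rewrite ge_max => /andP[rr' sr'].
    exists n.+1; have [K1 K2] := cstep _ _ rr' nP; apply: cset => //.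
    apply: ncone_sub K1; apply: (le_trans sr'); rewrite ler_peMl ?ler1n //.
    exact: le_trans (ltW r0) rr'.
  apply: (@iter_unbounded s p N) => // n; have [pn _ _] := pN.
  exact: (iter_ncone (r := r) r0 rs H_step n (lexx s) pn).
move=> p N pN; have [pn _ _] := pN.
set q := iter N H p in pN pn *.
have qn n : ncone s (iter n H q).
  apply: ncone_sub (iter_ncone (r := r) r0 rs H_step n (lexx s) pn).
  by rewrite ler_peMl ?(ltW s0) // exprn_ege1 // ler1n.
have phq n : c * phi (iter n H q) = (c * phi q) ^+ (D ^ n).
  elim: n => [|n IH]; first by rewrite expn0 expr1.
  rewrite iterS phi_H; last exact: (ncone_r r0 rs (qn n)).
  exact: pow_step cD IH.
apply: cvg_lim; first exact: norm_hausdorff.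
(* The second coordinate of H^n q is within a factor 2 of phi(H^n q), so that its log-modulus
   differs from D^n log |c phi(q)| by a bounded amount, which disappears in the limit. *)
apply: (@scaled_limit _ D N _ (ln 2 + `|ln (nrm c)|)) => // n.
have -> : iter (n + N) H p = iter n H q by rewrite iterD.
have [y1 y2] := qn n; have [e1 _] := phi_est _ (qn n).
have ym1 : 1 <= nrm (iter n H q).2 by apply: (le_trans s1'); exact: ltW.
have y0 : 0 < nrm (iter n H q).2 := lt_le_trans ltr01 ym1.
have -> : norm2 (iter n H q) = nrm (iter n H q).2.
  have -> : norm2 (iter n H q) = nrm (iter n H q) by [].
  rewrite [iter n H q]surjective_pairing nrm_pair max_r // ltW // (lt_le_trans y2) //.
  by rewrite ler_pdivrMr // ler_peMr ?ler1n // ltW.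
rewrite /lnplus max_r ?ln_ge0 //.
have -> : D%:R ^+ n * ln (nrm (Phi q).2) = ln (nrm c * nrm (phi (iter n H q))).
  rewrite -nrmM phq nrmX lnXn; last by rewrite nrm_gt0 mulf_neq0 // (phi_neq0 r0 rs phi_est pn).
  by rewrite -[RHS]mulr_natl natrX.
have f1 := nrm_subD (iter n H q).2 (phi (iter n H q)); rewrite nrmBC in f1.
have f2 := nrm_subD (phi (iter n H q)) (iter n H q).2.
apply: ln_close => //; move: e1 f1 f2 y0; move: (nrm _) (nrm _) (nrm _) => u v w; lra.
Qed.

End Construction.

End HenonChart.

(** * Translations along the leaves *)

Section FlowChart.
Context {R : realType}.
Local Notation C := (Cx R).
Local Notation C2 := (Cx2 R).

Lemma half_recursion (u : nat -> R) : (forall n, u n.+1 <= u n / 2 + 4^-1) ->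
  exists n, u n < 1.
Proof.
move=> uS; have B n : u n <= 2^-1 + 2^-1 ^+ n * `|u 0%N|.
  elim: n => [|n IH].
    by rewrite expr0 mul1r; have := ler_norm (u 0%N); lra.
  by apply: (le_trans (uS n)); rewrite exprS -mulrA; move: IH; lra.
have h0 : 0 < 2^-1 / (`|u 0%N| + 1) by rewrite divr_gt0 ?invr_gt0 // ltr_wpDl.
have [n nP] := half_small h0.
exists n; apply: (le_lt_trans (B n)); have : 2^-1 ^+ n * (`|u 0%N| + 1) < 2^-1.
  by rewrite -ltr_pdivlMr // ltr_wpDl.
have : 0 <= (2^-1 : R) ^+ n by rewrite exprn_ge0.
by rewrite mulrDr; lra.
Qed.

Lemma exprn_large (b k : R) (d : nat) : 1 < b -> (1 < d)%N ->
  exists M, forall n, (M <= n)%N -> k < b ^+ (d ^ n).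
Proof.
move=> b1 d1.
have b0 : 0 < b - 1 by rewrite subr_gt0.
have bern n : n%:R * (b - 1) <= b ^+ n.
  suff : 1 + n%:R * (b - 1) <= b ^+ n by move=> ?; lra.
  elim: n => [|n IH]; first by rewrite mul0r addr0 expr0.
  rewrite exprS; apply: (@le_trans _ _ (b * (1 + n%:R * (b - 1)))); last first.
    by rewrite ler_pM2l //; lra.
  have n0 : 0 <= n%:R :> R by rewrite ler0n.
  have : 0 <= n%:R * (b - 1) ^+ 2 by rewrite mulr_ge0 // sqr_ge0.
  by rewrite -natr1; nra.
pose M := Num.trunc (`|k| / (b - 1)); exists M.+1 => n Mn.
have nn : (n <= d ^ n)%N by apply: ltnW; exact: ltn_expl.
apply: lt_le_trans (bern _); rewrite -ltr_pdivrMr //.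
apply: (@lt_le_trans _ _ M.+1%:R); last by rewrite ler_nat (leq_trans Mn).
apply: (@le_lt_trans _ _ (`|k| / (b - 1))).
  by rewrite ler_pM2r ?invr_gt0 // ler_norm.
exact: truncnS_gt.
Qed.

Section Completion.
Variables (H Hi : C2 -> C2) (Up : set C2) (G : C2 -> R) (d e : nat) (rho : R).
Variables (al q : C) (Q : C -> C) (Phi Psi : C2 -> C2) (Dm : set C2).
Hypothesis hc : henon_chart H Hi Up G d e rho al q Q Phi Psi Dm.

Definition Fmap (w : C2) : C2 := (al * w.1 + Q w.2, w.2 ^+ d).

Let rho1 : 1 <= rho := hc_rho hc.
Let rho0 : 0 < rho := lt_le_trans ltr01 rho1.
Let d1 : (1 < d)%N.
Proof. by have /andP[e0 ed] := hc_e hc; apply: leq_ltn_trans ed. Qed.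

Definition full_dom : set C2 := [set w | rho < nrm w.2].

Lemma wdom_full w : wdom rho w -> full_dom w.
Proof. by case. Qed.

Lemma rho_exp (x : R) n : (0 < n)%N -> rho < x -> rho < x ^+ n.
Proof.
move=> n0 rx; apply: (lt_le_trans rx); rewrite -{1}[x]expr1.
by apply: ler_weXn2l => //; apply: (le_trans rho1); exact: ltW.
Qed.

Lemma Fmap_full w : full_dom w -> full_dom (Fmap w).
Proof. by move=> wf; rewrite /full_dom /= nrmX; apply: rho_exp => //; rewrite (ltn_trans _ d1). Qed.

Lemma iter_Fmap_full n w : full_dom w -> full_dom (iter n Fmap w).
Proof. by move=> wf; elim: n => // n; exact: Fmap_full. Qed.

Lemma iter_Fmap_snd n w : (iter n Fmap w).2 = w.2 ^+ (d ^ n).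
Proof. by elim: n => [|n IH]; rewrite ?expr1 // iterS /= IH -exprM expnSr. Qed.

Lemma Q_differentiable z : rho < nrm z -> differentiable Q z.
Proof.
move=> rz; have /nbhs_nrmP[u u0 uP] : \forall w \near z, rho < nrm w.
  exact: (cvgr_gt _ (@nrm_continuous R _ z)).
have wd w : rho < nrm w -> wdom rho ((0, w) : C2).
  by move=> rw; split => //=; rewrite nrm0 exprn_gt0 // (lt_trans rho0).
apply: (@diff_near _ _ _ (fun w => (Phi (H (Psi (0, w)))).1)).
  apply/nbhs_nrmP; exists u => // w /uP rw.
  have [w1 w2] := hc_conj hc (wd w rw); rewrite w2 /= mulr0 add0r.
  by rewrite /= mulr0 add0r in w1; have [_ -> _] := hc_Psi hc w1.
have [w1 w2] := hc_conj hc (wd z rz); have [P1 _ P3] := hc_Psi hc w1.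
apply: (@differentiable_comp _ _ _ _ (fun w => Phi (H (Psi (0, w)))) (fun p : C2 => p.1)); last exact: fst_differentiable.
apply: (@differentiable_comp _ _ _ _ (fun w => H (Psi (0, w))) Phi); last first.
  by rewrite w2; have [] := hc_Phi hc P1.
apply: (@differentiable_comp _ _ _ _ (fun w => Psi (0, w)) H); last exact: hc_H hc _.
apply: (@differentiable_comp _ _ _ _ (fun w : C => (0, w) : C2) Psi); last by have [] := hc_Psi hc (wd z rz).
exact: is_derive_diff (vertical_is_derive 0 z).
Qed.

Lemma Fmap_differentiable w : full_dom w -> differentiable Fmap w.
Proof.
move=> wf; apply: differentiable_pair; last by apply: differentiable_pow; exact: snd_differentiable.
apply: differentiableD.
  by apply: differentiableM; [exact: differentiable_cst|exact: fst_differentiable].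
apply: (@differentiable_comp _ _ _ _ (fun w : C2 => w.2) Q); first exact: snd_differentiable.
exact: Q_differentiable.
Qed.

Lemma iter_Fmap_differentiable n w : full_dom w -> differentiable (iter n Fmap) w.
Proof.
move=> wf; elim: n => [|n IH]; first by have [] := @is_diff_id (Cx R) (Cx2 R) w.
rewrite (_ : iter n.+1 Fmap = Fmap \o iter n Fmap); last by [].
apply: differentiable_comp; first exact: IH.
by apply: Fmap_differentiable; exact: iter_Fmap_full.
Qed.

Lemma wdom_Fmap w : wdom rho w -> wdom rho (Fmap w).
Proof. by move=> /(hc_conj hc)[]. Qed.

Lemma wdom_iter n m w : (n <= m)%N -> wdom rho (iter n Fmap w) -> wdom rho (iter m Fmap w).
Proof.
move=> /subnK <- wd; elim: (m - n)%N => // k IH; rewrite addSn iterS; exact: wdom_Fmap.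
Qed.

(** Once |zeta| is large, the ratio u = |z| / |zeta|^2 becomes at most u/2 + 1/4 in each step:
    |zeta|^(2d) outweighs both |alpha z| and Q, the latter because e < d. *)
Lemma enters_wdom w : full_dom w -> exists n, wdom rho (iter n Fmap w).
Proof.
move=> wf; have w1 : 1 < nrm w.2 by apply: le_lt_trans wf.
have [k k0 kP] := near_cx_infty ((cvg_nrmP _ _ _).1 (hc_Q hc) 1 ltr01).
pose A := nrm al; pose B := nrm q + 1.
have B0 : 0 < B by rewrite ltr_wpDl ?nrm_ge0.
have [M MP] := exprn_large (Num.max k (Num.max (2 * A) (4 * B))) w1 d1.
pose x n := nrm (iter n Fmap w).2; pose y n := nrm (iter n Fmap w).1.
have xE n : x n = nrm w.2 ^+ (d ^ n) by rewrite /x iter_Fmap_snd nrmX.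
have x1 n : 1 < x n.
  by apply: (le_lt_trans rho1); exact: iter_Fmap_full.
have rec n : (M <= n)%N -> y n.+1 / x n.+1 ^+ 2 <= (y n / x n ^+ 2) / 2 + 4^-1.
  move=> /MP; rewrite -xE !gt_max => /and3P[xk xA xB].
  have x0 : 0 < x n by apply: lt_trans (x1 n).
  have QB : nrm (Q (iter n Fmap w).2) <= B * x n ^+ (d + e).
    have z0 : (iter n Fmap w).2 ^+ (d + e) != 0 by rewrite expf_neq0 // -nrm_gt0.
    have := kP _ xk; set z := (iter n Fmap w).2 in z0 *; rewrite /= => K.
    have : nrm (Q z / z ^+ (d + e)) <= B.
      by apply: (le_trans (nrm_subD _ q)); rewrite addrC /B lerD2l ltW.
    by rewrite nrmM nrmV nrmX ler_pdivrMr ?exprn_gt0.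
  have yS : y n.+1 <= A * y n + B * x n ^+ (d + e).
    apply: (le_trans (nrmD _ _)); rewrite nrmM; exact: lerD.
  have xS : x n.+1 = x n ^+ d by rewrite /x iterS /= nrmX.
  have [dk dE] : exists dk, d = dk.+2 by move: d1; case: (d) => [|[|k']] // _; exists k'.
  have xd : x n ^+ 2 * x n <= x n.+1 ^+ 2.
    rewrite xS -exprM -exprSr; apply: ler_weXn2l; [exact: ltW|].
    by rewrite dE muln2 doubleS.
  have xe : x n ^+ (d + e) * x n <= x n.+1 ^+ 2.
    rewrite xS -exprM -exprSr; apply: ler_weXn2l; [exact: ltW|].
    by rewrite muln2 -addnn -addnS leq_add2l; case/andP: (hc_e hc).
  have X0 : 0 < x n.+1 ^+ 2 by rewrite exprn_gt0 // (lt_trans _ (x1 _)).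
  rewrite ler_pdivrMr // mulrDl; apply: (le_trans yS); apply: lerD.
    apply: (@le_trans _ _ (y n / x n ^+ 2 / 2 * (x n ^+ 2 * x n))); last first.
      by rewrite ler_wpM2l // !mulr_ge0 ?invr_ge0 ?exprn_ge0 ?nrm_ge0.
    have -> : y n / x n ^+ 2 / 2 * (x n ^+ 2 * x n) = x n / 2 * y n.
      by move: (gt_eqF x0); move: (x n) (y n) => u v u0; field; rewrite u0.
    by rewrite ler_wpM2r ?nrm_ge0 // ler_pdivlMr // mulrC ltW.
  apply: (@le_trans _ _ (4^-1 * (x n ^+ (d + e) * x n))); last by rewrite ler_wpM2l ?invr_ge0.
  rewrite mulrCA mulrC ler_wpM2l ?exprn_ge0 ?(ltW x0) // mulrC ler_pdivlMr // mulrC; exact: ltW.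
have [n nP] := half_recursion (u := fun n => y (n + M)%N / x (n + M)%N ^+ 2) (fun n => rec _ (leq_addl n M)).
exists (n + M)%N; split; first exact: iter_Fmap_full.
by move: nP; rewrite ltr_pdivrMr ?mul1r // exprn_gt0 // (lt_trans _ (x1 _)).
Qed.

Definition enter (w : C2) : nat := xget 0%N [set n | wdom rho (iter n Fmap w)].

Lemma enterP w : full_dom w -> wdom rho (iter (enter w) Fmap w).
Proof. by move=> /enters_wdom[n nP]; exact: (@xgetPex _ 0%N [set n | wdom rho (iter n Fmap w)] (ex_intro _ n nP)). Qed.

Lemma iter_conj n w : wdom rho w -> iter n H (Psi w) = Psi (iter n Fmap w).
Proof.
move=> wd; elim: n => // n IH; rewrite !iterS IH.
have /(hc_conj hc)[_ //] : wdom rho (iter n Fmap w) by exact: (@wdom_iter 0).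
Qed.

Lemma iterK n p : iter n Hi (iter n H p) = p.
Proof. by elim: n p => // n IH p; rewrite iterSr iterS (hc_HK hc). Qed.

Lemma iterKi n p : iter n H (iter n Hi p) = p.
Proof. by elim: n p => // n IH p; rewrite iterSr iterS (hc_HiK hc). Qed.

(* Defined on all of |zeta| > rho by the conjugation, but only injective on each
   set zeta = const. *)
Definition fullPsi (w : C2) : C2 := iter (enter w) Hi (Psi (iter (enter w) Fmap w)).

Lemma fullPsiE n w : full_dom w -> wdom rho (iter n Fmap w) ->
  fullPsi w = iter n Hi (Psi (iter n Fmap w)).
Proof.
move=> wf; have := enterP wf; rewrite /fullPsi; move: (enter w) => m.
have key i j : (i <= j)%N -> wdom rho (iter i Fmap w) ->
    iter j Hi (Psi (iter j Fmap w)) = iter i Hi (Psi (iter i Fmap w)).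
  move=> /subnKC <- wd; rewrite iterD [(i + _)%N]addnC [in iter _ Fmap w]iterD.
  by rewrite -iter_conj // iterK.
case/orP: (leq_total m n) => [mn wm wn|nm wm wn]; first by rewrite (key m n).
by rewrite (key n m).
Qed.

Lemma fullPsi_H w : full_dom w -> H (fullPsi w) = fullPsi (Fmap w).
Proof.
move=> wf; have [n nP] := enters_wdom wf.
have nP1 : wdom rho (iter n.+1 Fmap w) by exact: (@wdom_iter n).
rewrite (fullPsiE wf nP1) (fullPsiE (n := n) (Fmap_full wf)); last by rewrite -iterSr.
by rewrite -iterSr iterS (hc_HiK hc).
Qed.

Lemma iter_fullPsi n w : full_dom w -> iter n H (fullPsi w) = fullPsi (iter n Fmap w).
Proof.
move=> wf; elim: n => // n IH; rewrite !iterS IH fullPsi_H //; exact: iter_Fmap_full.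
Qed.

Lemma fullPsi_wdom w : wdom rho w -> fullPsi w = Psi w.
Proof. by move=> wd; rewrite (@fullPsiE 0 w) //; exact: wdom_full. Qed.

Lemma Fmap_inj w w' : w.2 = w'.2 -> Fmap w = Fmap w' -> w = w'.
Proof.
case: w w' => [z x] [z' x'] /= -> [] /addIr/(mulfI (hc_al hc)) -> //.
Qed.

Lemma iter_Fmap_inj n w w' : w.2 = w'.2 -> iter n Fmap w = iter n Fmap w' -> w = w'.
Proof.
move=> ww'; elim: n => // n IH /Fmap_inj; rewrite !iter_Fmap_snd ww' => /(_ erefl); exact: IH.
Qed.

Lemma fullPsi_inj w w' : full_dom w -> w.2 = w'.2 -> fullPsi w = fullPsi w' -> w = w'.
Proof.
move=> wf ww'; have wf' : full_dom w' by rewrite /full_dom /= -ww'.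
have [n nP] := enters_wdom wf; have [n' nP'] := enters_wdom wf'.
have [m1 m2] : wdom rho (iter (n + n') Fmap w) /\ wdom rho (iter (n + n') Fmap w').
  by split; [apply: wdom_iter nP|apply: wdom_iter nP']; rewrite ?leq_addr ?leq_addl.
move=> E; have := congr1 (iter (n + n') H) E.
rewrite !iter_fullPsi // !fullPsi_wdom // => E2.
have [_ P1 _] := hc_Psi hc m1; have [_ P2 _] := hc_Psi hc m2.
by apply: (iter_Fmap_inj (n := (n + n')%N) ww'); rewrite -P1 -P2 E2.
Qed.

Lemma wdom_open w : wdom rho w -> \forall v \near w, wdom rho v.
Proof.
move=> [w2 w1].
have c1 : (fun v : C2 => nrm v.2) @ w --> nrm w.2.
  by apply: (@cvg_comp _ _ _ (fun v : C2 => v.2) (@nrm R C)); [exact: (diff_continuous_nrm (snd_differentiable w))|exact: nrm_continuous].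
have c2 : (fun v : C2 => nrm v.1) @ w --> nrm w.1.
  by apply: (@cvg_comp _ _ _ (fun v : C2 => v.1) (@nrm R C)); [exact: (diff_continuous_nrm (fst_differentiable w))|exact: nrm_continuous].
have c3 : (fun v : C2 => nrm v.2 ^+ 2 - nrm v.1) @ w --> nrm w.2 ^+ 2 - nrm w.1.
  by apply: cvgB; [exact: (cvgM c1 c1)|exact: c2].
have n1 : \forall v \near w, rho < nrm v.2 by exact: (cvgr_gt _ c1).
have n2 : \forall v \near w, 0 < nrm v.2 ^+ 2 - nrm v.1.
  by apply: (cvgr_gt _ c3); rewrite subr_gt0.
by near=> v; split; [near: v|rewrite -subr_gt0; near: v].
Unshelve. all: by end_near.
Qed.

Lemma full_dom_open w : full_dom w -> \forall v \near w, full_dom v.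
Proof.
move=> wf; have c1 : (fun v : C2 => nrm v.2) @ w --> nrm w.2.
  by apply: (@cvg_comp _ _ _ (fun v : C2 => v.2) (@nrm R C)); [exact: (diff_continuous_nrm (snd_differentiable w))|exact: nrm_continuous].
exact: (cvgr_gt _ c1).
Qed.

Lemma iter_diff (K : C2 -> C2) n p : (forall p, differentiable K p) -> differentiable (iter n K) p.
Proof.
move=> Kd; elim: n => [|n IH]; first by have [] := @is_diff_id (Cx R) (Cx2 R) p.
rewrite (_ : iter n.+1 K = K \o iter n K); last by [].
by apply: differentiable_comp; [exact: IH|exact: Kd].
Qed.

Lemma fullPsi_differentiable w : full_dom w -> differentiable fullPsi w.
Proof.
move=> wf; have [n nP] := enters_wdom wf.
have nd := iter_Fmap_differentiable n wf.
apply: (@diff_near _ _ _ (fun v => iter n Hi (Psi (iter n Fmap v)))).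
  have /nbhs_nrmP[u u0 uP] := diff_continuous_nrm nd (wdom_open nP).
  have /nbhs_nrmP[v v0 vP] := full_dom_open wf.
  apply/nbhs_nrmP; exists (Num.min u v) => [|x]; first by rewrite lt_min u0.
  by rewrite lt_min => /andP[/uP x1 /vP x2]; rewrite (fullPsiE x2 x1).
apply: (@differentiable_comp _ _ _ _ (fun v => Psi (iter n Fmap v)) (iter n Hi)); last first.
  exact: iter_diff (hc_Hi hc).
by apply: (@differentiable_comp _ _ _ _ (iter n Fmap) Psi); [exact: nd|have [] := hc_Psi hc nP].
Qed.

End Completion.
End FlowChart.

(** * Levels, logarithms and translations on U+ *)

Section Orbits.
Context {R : realType}.
Local Notation C := (Cx R).
Local Notation C2 := (Cx2 R).
Variables (H Hi : C2 -> C2) (Up : set C2) (G : C2 -> R) (d e : nat) (rho : R).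
Variables (al q : C) (Q : C -> C) (Phi Psi : C2 -> C2) (Dm : set C2).
Hypothesis hc : henon_chart H Hi Up G d e rho al q Q Phi Psi Dm.

Local Notation Fm := (Fmap d al Q).
Local Notation PsiF := (fullPsi Hi d rho al Q Psi).
Local Notation full := (full_dom (R := R) rho).

Let rho1 : 1 <= rho := hc_rho hc.
Let rho0 : 0 < rho := lt_le_trans ltr01 rho1.
Let d1 : (1 < d)%N.
Proof. by have /andP[e0 ed] := hc_e hc; apply: leq_ltn_trans ed. Qed.
Let dC n : (d%:R ^+ n : C) != 0.
Proof. by rewrite expf_neq0 // pnatr_eq0 -lt0n (ltn_trans _ d1). Qed.
Let dR n : 0 < (d%:R ^+ n : R).
Proof. by rewrite exprn_gt0 // ltr0n (ltn_trans _ d1). Qed.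

(* At level N, the point p is described by the chart coordinates (zN, phN) of H^N p. *)
Definition lvl (N : nat) (p : C2) : Prop := Dm (iter N H p).
Definition phN (N : nat) (p : C2) : C := (Phi (iter N H p)).2.
Definition zN (N : nat) (p : C2) : C := (Phi (iter N H p)).1.

Lemma lvl_full N p : lvl N p -> full (zN N p, phN N p).
Proof. by move=> /(hc_Phi hc)[[]]. Qed.

Lemma lvl_wdom N p : lvl N p -> wdom rho ((zN N p, phN N p) : C2).
Proof. by rewrite /zN /phN => /(hc_Phi hc)[]; case: (Phi _). Qed.

Lemma lvl_eq N p : lvl N p -> iter N H p = PsiF (zN N p, phN N p).
Proof.
move=> pN; rewrite (fullPsi_wdom hc (lvl_wdom pN)).
by have [_ + _] := hc_Phi hc pN; rewrite /zN /phN; case: (Phi _).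
Qed.

Lemma lvl_eqi N p : lvl N p -> p = iter N Hi (PsiF (zN N p, phN N p)).
Proof. by move=> pN; rewrite -lvl_eq // (iterK hc). Qed.

Lemma lvl_step N p : lvl N p -> lvl N.+1 p /\ Phi (iter N.+1 H p) = Fm (zN N p, phN N p).
Proof.
move=> pN; have pw := lvl_wdom pN; have [w1 w2] := hc_conj hc pw.
have E : iter N.+1 H p = Psi (Fm (zN N p, phN N p)).
  by rewrite iterS (lvl_eq pN) (fullPsi_wdom hc pw) w2.
have [P1 P2 _] := hc_Psi hc w1.
by rewrite /lvl E; split.
Qed.

Lemma lvlS N p : lvl N p -> lvl N.+1 p.
Proof. by case/lvl_step. Qed.

Lemma lvl_le N M p : (N <= M)%N -> lvl N p -> lvl M p.
Proof. by move=> /subnK <- pN; elim: (M - N)%N => // k IH; rewrite addSn; exact: lvlS. Qed.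

Lemma phNS N p : lvl N p -> phN N.+1 p = phN N p ^+ d.
Proof. by case/lvl_step=> _ E; rewrite {1}/phN E. Qed.

Lemma zNS N p : lvl N p -> zN N.+1 p = al * zN N p + Q (phN N p).
Proof. by case/lvl_step=> _ E; rewrite {1}/zN E. Qed.

Lemma phN_add N k p : lvl N p -> phN (N + k) p = phN N p ^+ (d ^ k).
Proof.
move=> pN; elim: k => [|k IH]; first by rewrite addn0 expr1.
by rewrite addnS phNS ?IH -?exprM ?expnSr //; apply: lvl_le pN; exact: leq_addr.
Qed.

Lemma phN_gt N p : lvl N p -> rho < nrm (phN N p).
Proof. exact: lvl_full. Qed.

Lemma phN_neq0 N p : lvl N p -> phN N p != 0.
Proof. by move=> /phN_gt pN; rewrite -nrm_gt0; apply: lt_trans pN. Qed.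

Lemma iterH_differentiable N p : differentiable (iter N H) p.
Proof. exact: iter_diff (hc_H hc). Qed.

Lemma iterHi_differentiable N p : differentiable (iter N Hi) p.
Proof. exact: iter_diff (hc_Hi hc). Qed.

Lemma lvl_open N p : lvl N p -> \forall r \near p, lvl N r.
Proof.
move=> pN; apply: (diff_continuous_nrm (iterH_differentiable N p)).
exact: open_nbhs_nbhs (conj (hc_open hc) pN).
Qed.

Lemma PhiN_differentiable N p : lvl N p -> differentiable (fun r => Phi (iter N H r)) p.
Proof.
move=> pN; apply: (@differentiable_comp _ _ _ _ (iter N H) Phi); first exact: iterH_differentiable.
by have [] := hc_Phi hc pN.
Qed.

Lemma phN_differentiable N p : lvl N p -> differentiable (phN N) p.
Proof.
move=> pN; apply: (@differentiable_comp _ _ _ _ (fun r => Phi (iter N H r)) (fun r : C2 => r.2)).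
  exact: PhiN_differentiable.
exact: snd_differentiable.
Qed.

Lemma zN_differentiable N p : lvl N p -> differentiable (zN N) p.
Proof.
move=> pN; apply: (@differentiable_comp _ _ _ _ (fun r => Phi (iter N H r)) (fun r : C2 => r.1)).
  exact: PhiN_differentiable.
exact: fst_differentiable.
Qed.

Lemma Up_lvl p : Up p <-> exists N, lvl N p.
Proof. exact: hc_U hc p. Qed.

(* s is a logarithm of the Boettcher coordinate of p; the set of these s is a coset
   of 2 pi i Z[1/d], and N can be replaced by any larger level, but not by every
   level of p. *)
Definition Sg (p : C2) (s : C) : Prop := exists2 N, lvl N p & cexp (d%:R ^+ N * s) = phN N p.

Lemma cexp_dS n (s : C) : cexp (d%:R ^+ n.+1 * s) = cexp (d%:R ^+ n * s) ^+ d.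
Proof. by rewrite exprS -mulrA cexpMn. Qed.

Lemma cexp_dD n k (s : C) : cexp (d%:R ^+ (n + k) * s) = cexp (d%:R ^+ n * s) ^+ (d ^ k).
Proof.
elim: k => [|k IH]; first by rewrite addn0 expr1.
by rewrite addnS cexp_dS IH -exprM expnSr.
Qed.

Lemma Sg_large p s : Sg p s ->
  exists N, forall M, (N <= M)%N -> lvl M p /\ cexp (d%:R ^+ M * s) = phN M p.
Proof.
move=> [N pN E]; exists N => M /subnKC <-; split; first by apply: lvl_le pN; exact: leq_addr.
by rewrite phN_add // -E cexp_dD.
Qed.

Lemma Sg_exists p N : lvl N p -> exists s, cexp (d%:R ^+ N * s) = phN N p.
Proof.
move=> pN; have [w wE] := cexp_surj (phN_neq0 pN); exists (w / d%:R ^+ N).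
by rewrite mulrC divfK.
Qed.

Lemma Sg_Up p s : Sg p s -> Up p.
Proof. by move=> [N pN _]; apply/Up_lvl; exists N. Qed.

Lemma Up_Sg p : Up p -> exists s, Sg p s.
Proof. by move=> /Up_lvl[N pN]; have [s sE] := Sg_exists pN; exists s; exists N. Qed.

Lemma Re_dM n (s : C) : Re (d%:R ^+ n * s) = d%:R ^+ n * Re s.
Proof. by rewrite -rc_nat -rcX ReM /= mul0r subr0. Qed.

Lemma G_lvl N p s : lvl N p -> cexp (d%:R ^+ N * s) = phN N p -> G p = Re s.
Proof.
move=> pN E; rewrite (hc_G hc pN) -/(phN N p) -E nrm_cexp expRK Re_dM.
by rewrite mulrC mulKf // gt_eqF.
Qed.

Lemma G_Sg p s : Sg p s -> G p = Re s.
Proof. by move=> [N pN E]; exact: G_lvl pN E. Qed.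

Lemma G_gt0 p : Up p -> 0 < G p.
Proof.
move=> /Up_lvl[N pN]; rewrite (hc_G hc pN) divr_gt0 //; apply: ln_gt0.
exact: le_lt_trans (phN_gt pN).
Qed.

Definition sdom (N : nat) (s : C) : Prop := rho < nrm (cexp (d%:R ^+ N * s)).
(* The parametrisation of U+ by its covering {Re s > 0} x C, read at level N. *)
Definition pt (N : nat) (z s : C) : C2 := iter N Hi (PsiF (z, cexp (d%:R ^+ N * s))).

Lemma sdomS N s : sdom N s -> sdom N.+1 s.
Proof. by move=> sN; rewrite /sdom cexp_dS nrmX; apply: (rho_exp hc) => //; rewrite (ltn_trans _ d1). Qed.

Lemma sdom_le N M s : (N <= M)%N -> sdom N s -> sdom M s.
Proof. by move=> /subnK <- pN; elim: (M - N)%N => // k IH; rewrite addSn; exact: sdomS. Qed.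

Lemma sdom_exists s : 0 < Re s -> exists N, sdom N s.
Proof.
move=> s0; have es1 : 1 < expR (Re s) by rewrite expR_gt1.
have [M MP] := exprn_large rho es1 d1.
exists M; rewrite /sdom nrm_cexp Re_dM -natrX.
by have := MP M (leqnn M); rewrite -expRM_natl.
Qed.

Lemma ptE N z s : pt N z s = iter N Hi (PsiF (z, cexp (d%:R ^+ N * s))).
Proof. by []. Qed.

Lemma pt_step N z s : sdom N s ->
  pt N z s = pt N.+1 (al * z + Q (cexp (d%:R ^+ N * s))) s.
Proof.
move=> sN; rewrite /pt iterSr cexp_dS.
have -> : ((al * z + Q (cexp (d%:R ^+ N * s)), cexp (d%:R ^+ N * s) ^+ d) : C2) =
  Fm (z, cexp (d%:R ^+ N * s)) by [].
by rewrite -(fullPsi_H hc) // (hc_HK hc).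
Qed.

(** The z-coordinate at level N + k of the point over s that has coordinate z at level N. *)
Definition zz (N k : nat) (z s : C) : C := (iter k Fm (z, cexp (d%:R ^+ N * s))).1.

Lemma iter_Fm N k z s : iter k Fm (z, cexp (d%:R ^+ N * s)) = (zz N k z s, cexp (d%:R ^+ (N + k) * s)).
Proof.
rewrite [LHS]surjective_pairing; congr (_, _).
by rewrite iter_Fmap_snd cexp_dD.
Qed.

Lemma zzS N k z s : zz N k.+1 z s = al * zz N k z s + Q (cexp (d%:R ^+ (N + k) * s)).
Proof. by rewrite {1}/zz iterS iter_Fm. Qed.

Lemma zzD N k z c s : zz N k (z + c) s = zz N k z s + al ^+ k * c.
Proof.
elim: k => [|k IH]; first by rewrite expr0 mul1r.
by rewrite !zzS IH mulrDr exprS -mulrA addrAC.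
Qed.

Lemma pt_shift N k z s : sdom N s -> pt N z s = pt (N + k) (zz N k z s) s.
Proof.
move=> sN; elim: k => [|k IH]; first by rewrite addn0.
by rewrite IH pt_step ?addnS ?zzS //; apply: sdom_le sN; exact: leq_addr.
Qed.

Lemma pt_lvl N z s : sdom N s -> exists K, forall k, (K <= k)%N ->
  [/\ lvl (N + k) (pt N z s), phN (N + k) (pt N z s) = cexp (d%:R ^+ (N + k) * s)
    & zN (N + k) (pt N z s) = zz N k z s].
Proof.
move=> sN; have wf : full (z, cexp (d%:R ^+ N * s)) by exact: sN.
have [K KP] := enters_wdom hc wf; exists K => k Kk.
have kP := wdom_iter hc Kk KP.
have E : iter (N + k) H (pt N z s) = Psi (zz N k z s, cexp (d%:R ^+ (N + k) * s)).
  rewrite addnC iterD /pt (iterKi hc) (iter_fullPsi hc) // (fullPsi_wdom hc kP).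
  by rewrite iter_Fm addnC.
rewrite iter_Fm in kP; have [P1 P2 _] := hc_Psi hc kP.
by rewrite /lvl /phN /zN E P2.
Qed.

Lemma pt_Sg N z s : sdom N s -> Sg (pt N z s) s.
Proof.
move=> /(pt_lvl z)[K KP]; have [k1 k2 _] := KP K (leqnn K).
by exists (N + K)%N.
Qed.

Lemma lvl_pt N p s : lvl N p -> cexp (d%:R ^+ N * s) = phN N p ->
  sdom N s /\ p = pt N (zN N p) s.
Proof.
move=> pN E; split; first by rewrite /sdom E; exact: phN_gt.
by rewrite /pt E -lvl_eqi.
Qed.

Lemma pt_inj N z z' s : sdom N s -> pt N z s = pt N z' s -> z = z'.
Proof.
move=> sN E; have := congr1 (iter N H) E; rewrite /pt !(iterKi hc) => E2.
have wf : full (z, cexp (d%:R ^+ N * s)) by exact: sN.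
by have [] := fullPsi_inj hc wf (erefl _ : _ = ((z', cexp (d%:R ^+ N * s)) : C2).2) E2.
Qed.

Definition lev (p : C2) : nat := xget 0%N [set N | lvl N p].

Lemma levP p : Up p -> lvl (lev p) p.
Proof. by move=> /Up_lvl[N pN]; exact: (@xgetPex _ 0%N [set N | lvl N p] (ex_intro _ N pN)). Qed.

(* Dividing the displacement by al^N makes the translation independent of N. *)
Definition Tr (b : C) (p : C2) : C2 :=
  iter (lev p) Hi (PsiF (zN (lev p) p + al ^+ lev p * b, phN (lev p) p)).

Lemma Tr_lvl N b p : lvl N p -> Tr b p = iter N Hi (PsiF (zN N p + al ^+ N * b, phN N p)).
Proof.
move=> pN; have pU : Up p by apply/Up_lvl; exists N.
have := levP pU; rewrite /Tr; move: (lev p) => M pM.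
have key i j : (i <= j)%N -> lvl i p ->
    iter j Hi (PsiF (zN j p + al ^+ j * b, phN j p)) =
    iter i Hi (PsiF (zN i p + al ^+ i * b, phN i p)).
  move=> /subnKC <- pi; elim: (j - i)%N => [|k IH]; first by rewrite addn0.
  rewrite -IH addnS iterSr; have pk : lvl (i + k) p by apply: lvl_le pi; exact: leq_addr.
  rewrite zNS // phNS // exprS.
  have -> : ((al * zN (i + k) p + Q (phN (i + k) p) + al * al ^+ (i + k) * b, phN (i + k) p ^+ d) : C2) =
    Fm (zN (i + k) p + al ^+ (i + k) * b, phN (i + k) p).
    by congr (_, _) => /=; rewrite mulrDr addrAC mulrA.
  by rewrite -(fullPsi_H hc) ?(hc_HK hc) //; exact: phN_gt.
case/orP: (leq_total M N) => [MN|NM]; first by rewrite (key M N).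
by rewrite (key N M).
Qed.

Lemma Tr_pt N b z s : sdom N s -> Tr b (pt N z s) = pt N (z + al ^+ N * b) s.
Proof.
move=> sN; have [K KP] := pt_lvl z sN; have [k1 k2 k3] := KP K (leqnn K).
rewrite (Tr_lvl b k1) k2 k3 (pt_shift K _ sN) zzD.
by rewrite mulrA -exprD [(K + N)%N]addnC.
Qed.

Lemma Sg_pt p s : Sg p s -> exists2 N, sdom N s & exists z, p = pt N z s.
Proof. by move=> [N pN E]; have [sN ->] := lvl_pt pN E; exists N => //; exists (zN N p). Qed.

Lemma Tr_Sg b p s : Sg p s -> Sg (Tr b p) s.
Proof. by move=> /Sg_pt[N sN [z ->]]; rewrite Tr_pt //; exact: pt_Sg. Qed.

Lemma Tr_Up b p : Up p -> Up (Tr b p).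
Proof. by move=> /Up_Sg[s /(Tr_Sg b)/Sg_Up]. Qed.

Lemma Tr_G b p : Up p -> G (Tr b p) = G p.
Proof. by move=> /Up_Sg[s ps]; rewrite (G_Sg (Tr_Sg b ps)) (G_Sg ps). Qed.

Lemma Tr0 p : Up p -> Tr 0 p = p.
Proof. by move=> /Up_Sg[s /Sg_pt[N sN [z ->]]]; rewrite Tr_pt // mulr0 addr0. Qed.

Lemma TrD b c p : Up p -> Tr b (Tr c p) = Tr (b + c) p.
Proof. by move=> /Up_Sg[s /Sg_pt[N sN [z ->]]]; rewrite !Tr_pt // -addrA -mulrDr [c + b]addrC. Qed.

Lemma Tr_inj b c p : Up p -> Tr b p = Tr c p -> b = c.
Proof.
move=> /Up_Sg[s /Sg_pt[N sN [z ->]]]; rewrite !Tr_pt // => /(pt_inj sN)/addrI/mulfI; apply.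
by rewrite expf_neq0 // (hc_al hc).
Qed.

Lemma Sg_common p p' s : Sg p s -> Sg p' s -> exists2 N, sdom N s &
  exists z z', p = pt N z s /\ p' = pt N z' s.
Proof.
move=> /Sg_large[N NP] /Sg_large[N' NP'].
have [p1 p2] := NP (N + N')%N (leq_addr _ _); have [p1' p2'] := NP' (N + N')%N (leq_addl _ _).
have [sN pE] := lvl_pt p1 p2; have [_ pE'] := lvl_pt p1' p2'.
by exists (N + N')%N => //; exists (zN (N + N') p), (zN (N + N') p').
Qed.

(** Together with [Tr_inj] this makes the points sharing a logarithm s, that is, a leaf, a torsor
    under C. *)
Lemma Tr_exists p p' s : Sg p s -> Sg p' s -> exists b, p' = Tr b p.
Proof.
move=> ps ps'; have [N sN [z [z' [-> ->]]]] := Sg_common ps ps'.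
exists ((z' - z) / al ^+ N); rewrite Tr_pt // mulrC divfK ?expf_neq0 ?(hc_al hc) //.
by rewrite addrC subrK.
Qed.

Lemma Sg_H p s : Sg p s <-> Sg (H p) (d%:R * s).
Proof.
split=> [/Sg_large[N NP]|[N pN E]].
  have [p1 p2] := NP N.+1 (leqnSn N); exists N.
    by rewrite /lvl -iterSr.
  by rewrite mulrA -exprSr p2 /phN -iterSr.
by exists N.+1; [rewrite /lvl iterSr|rewrite exprSr -mulrA E /phN iterSr].
Qed.

Lemma Up_H p : Up p <-> Up (H p).
Proof.
split=> [/Up_Sg[s /Sg_H/Sg_Up]//|/Up_lvl[N pN]].
by apply/Up_lvl; exists N.+1; rewrite /lvl iterSr.
Qed.

Lemma G_H p : Up p -> G (H p) = d%:R * G p.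
Proof.
move=> /Up_Sg[s ps]; rewrite (G_Sg ps) (G_Sg ((Sg_H p s).1 ps)).
by have := Re_dM 1 s; rewrite !expr1.
Qed.

Lemma Tr_differentiable b p : Up p -> differentiable (Tr b) p.
Proof.
move=> /Up_lvl[N pN]; have /nbhs_nrmP[u u0 uP] := lvl_open pN.
apply: (@diff_near _ _ _ (fun r => iter N Hi (PsiF (zN N r + al ^+ N * b, phN N r)))).
  by apply/nbhs_nrmP; exists u => // r /uP rN; rewrite (Tr_lvl _ rN).
apply: (@differentiable_comp _ _ _ _ (fun r => PsiF (zN N r + al ^+ N * b, phN N r)) (iter N Hi)); last first.
  exact: iterHi_differentiable.
apply: (@differentiable_comp _ _ _ _ (fun r => (zN N r + al ^+ N * b, phN N r) : C2) PsiF); last first.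
  by apply: (fullPsi_differentiable hc); exact: phN_gt.
apply: differentiable_pair; last exact: phN_differentiable.
by apply: differentiableD; [exact: zN_differentiable|exact: differentiable_cst].
Qed.

Lemma Tr_entire p b : Up p -> differentiable (fun b => Tr b p) b.
Proof.
move=> /Up_lvl[N pN].
rewrite (_ : (fun b => Tr b p) = (fun b => iter N Hi (PsiF (zN N p + al ^+ N * b, phN N p)))); last first.
  by apply/funext => c; rewrite (Tr_lvl _ pN).
apply: (@differentiable_comp _ _ _ _ (fun b => PsiF (zN N p + al ^+ N * b, phN N p)) (iter N Hi)); last first.
  exact: iterHi_differentiable.
apply: (@differentiable_comp _ _ _ _ (fun b => (zN N p + al ^+ N * b, phN N p) : C2) PsiF); last first.
  by apply: (fullPsi_differentiable hc); exact: phN_gt.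
apply: differentiable_pair; last exact: differentiable_cst.
apply: differentiableD; first exact: differentiable_cst.
by apply: differentiableM; [exact: differentiable_cst|exact: differentiable_idC].
Qed.

Lemma pt_differentiable N z s : sdom N s -> differentiable (pt N z) s.
Proof.
move=> sN; apply: (@differentiable_comp _ _ _ _ (fun s : C => PsiF (z, cexp (d%:R ^+ N * s))) (iter N Hi)); last first.
  exact: iterHi_differentiable.
apply: (@differentiable_comp _ _ _ _ (fun s : C => (z, cexp (d%:R ^+ N * s)) : C2) PsiF); last first.
  exact: (fullPsi_differentiable hc).
apply: differentiable_pair; first exact: differentiable_cst.
apply: (@differentiable_comp _ _ _ _ (fun s : C => d%:R ^+ N * s) (@cexp R)); last exact: cexp_differentiable.
by apply: differentiableM; [exact: differentiable_cst|exact: differentiable_idC].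
Qed.

End Orbits.

(** * Paths and the fundamental group *)

Section Pasting.
Context {R : realType}.
Local Notation C := (Cx R).

Definition cl (t : R) : R := clamp 0 1 t.

Lemma cl_continuous : continuous cl.
Proof. exact: clamp_continuous. Qed.

Lemma cl_id t : 0 <= t <= 1 -> cl t = t.
Proof. exact: clamp_id. Qed.

Lemma cl_in t : 0 <= cl t <= 1.
Proof. exact: clamp_in (@ler01 R). Qed.

Lemma within_cl {T : topologicalType} (g : R -> T) :
  {within `[0, 1], continuous g} <-> continuous (g \o cl).
Proof.
split=> [/subspace_continuousP gc t|gc].
  have tin : `[0, 1]%classic (cl t) by rewrite /= in_itv /=; exact: cl_in.
  move=> P /(gc _ tin); rewrite /= /within /= => W.
  have K := cl_continuous W; apply: (@filterS _ (nbhs t) _ _ _ _ K) => u; apply.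
  by rewrite /= in_itv /=; exact: cl_in.
apply/subspace_continuousP => t; rewrite /= in_itv /= => t01 P.
have := gc t P; rewrite /= (cl_id t01) => K /K W.
apply: (@filterS _ (nbhs t) _ _ _ _ W) => u; rewrite /= => K2 u01.
by move: u01 K2; rewrite in_itv /= => u01; rewrite /= cl_id.
Qed.

Lemma within_cl2 {T : topologicalType} (h : R * R -> T) :
  {within `[0, 1] `*` `[0, 1], continuous h} <-> continuous (fun q => h (cl q.1, cl q.2)).
Proof.
have clc (q : R * R) : (fun q : R * R => (cl q.1, cl q.2)) @ q --> (cl q.1, cl q.2).
  apply: (@pair_continuous _ _ _ (fun q : R * R => cl q.1) (fun q : R * R => cl q.2)).
    apply: (@continuous_comp _ _ _ fst cl); [exact: cvg_fst|exact: cl_continuous].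
  apply: (@continuous_comp _ _ _ snd cl); [exact: cvg_snd|exact: cl_continuous].
split=> [/subspace_continuousP gc q|gc].
  have tin : (`[0, 1] `*` `[0, 1])%classic (cl q.1, cl q.2).
    by split; rewrite /= in_itv /=; exact: cl_in.
  move=> P /(gc _ tin); rewrite /= /within /= => W.
  have K := clc q _ W; apply: (@filterS _ (nbhs q) _ _ _ _ K) => u; apply.
  by split; rewrite /= in_itv /=; exact: cl_in.
apply/subspace_continuousP => -[s t] [/=]; rewrite !in_itv /= => s01 t01 P.
have := gc (s, t) P; rewrite /= (cl_id s01) (cl_id t01) => K /K W.
apply: (@filterS _ (nbhs (s, t)) _ _ _ _ W) => -[u v] /= K2 [/=].
by rewrite !in_itv /= => u01 v01; move: K2; rewrite !cl_id.
Qed.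

Lemma paste_continuous {T : topologicalType} (f1 f2 : R -> T) (a : R) : continuous f1 ->
  continuous f2 -> f1 a = f2 a -> continuous (fun t => if t <= a then f1 t else f2 t).
Proof.
move=> c1 c2 E t; have [ta|ta|ta] := ltgtP t a.
- move=> P; rewrite (ltW ta) => PP; have N1 := c1 t P PP; have N2 : \forall u \near t, u < a by exact: lt_nbhsl.
  by apply: (@filterS2 _ (nbhs t) _ _ _ _ _ N2 N1) => u u1 u2; rewrite /= (ltW u1).
- move=> P; rewrite leNgt ta => PP; have N1 := c2 t P PP; have N2 : \forall u \near t, a < u by exact: lt_nbhsr.
  by apply: (@filterS2 _ (nbhs t) _ _ _ _ _ N2 N1) => u u1 u2; rewrite /= leNgt u1.
move=> P; rewrite ta lexx => PP; have N1 := c1 a P PP.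
have N2 : \forall u \near a, P (f2 u) by apply: c2; rewrite -E.
by apply: (@filterS2 _ (nbhs a) _ _ _ _ _ N1 N2) => u u1 u2 /=; case: (u <= a).
Qed.

Lemma half_in1 (t : R) : 0 < t -> t <= 2^-1 -> 0 <= 2 * t <= 1.
Proof. by move=> *; apply/andP; split; lra. Qed.

Lemma half_in2 (t : R) : t <= 1 -> 2^-1 < t -> 0 <= 2 * t - 1 <= 1.
Proof. by move=> *; apply/andP; split; lra. Qed.

Lemma sub_swap (x y x' y' : C) : x - x' = y - y' -> x - y = x' - y'.
Proof.
move=> E; have -> : x - y = (x - x') - (y - y') + (x' - y') by ring.
by rewrite E subrr add0r.
Qed.

Lemma disp_field (u v A : C) : u != 0 -> u * v * (A / u) = v * A.
Proof. by move=> u0; field. Qed.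

(** The values of Im D / (2 pi) are integers; if the two end values differed, the intermediate value
    theorem would produce a half-integer. *)
Lemma cexp_eq1_const (D : R -> C) : (forall t, 0 <= t <= 1 -> {for t, continuous D}) ->
  (forall t, 0 <= t <= 1 -> cexp (D t) = 1) -> D 1 = D 0.
Proof.
move=> Dc D1; have pi2 : 2 * pi != 0 :> R by rewrite mulf_neq0 // gt_eqF // pi_gt0.
pose v t := Im (D (cl t)) / (2 * pi).
have vint t : exists k : int, v t = k%:~R /\ D (cl t) = k%:~R * mkc 0 (2 * pi).
  have [k kE] := cexp_eq1 (D1 _ (cl_in t)); exists k; split=> //.
  by rewrite /v kE -rc_int ImM /= mul0r addr0 mulfK.
have vc : continuous v.
  move=> t; apply: cvgM; last exact: cvg_cst.
  apply: Im_comp_continuous; apply: (@continuous_comp _ _ _ cl D); first exact: cl_continuous.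
  by apply: Dc; exact: cl_in.
have [k0 [v0 e0]] := vint 0; have [k1 [v1 e1]] := vint 1.
have [l0 l1] : cl 0 = 0 /\ cl 1 = 1 by split; rewrite cl_id // ?lexx ?ler01.
rewrite l0 in e0; rewrite l1 in e1; rewrite e0 e1.
suff -> : k1 = k0 by [].
have vw : {within `[0, 1], continuous v} by exact: continuous_subspaceT.
have ki (k k' : int) : k < k' -> k%:~R + 1 <= k'%:~R :> R.
  by rewrite -lezD1 -(ler_int R) rmorphD.
have nohalf (k : int) t : v t = k%:~R + 2^-1 -> False.
  have [k' [-> _]] := vint t => E; have kk : k < k' by rewrite -(ltr_int R) E ltrDl invr_gt0.
  by have := ki _ _ kk; rewrite E lerD2l; apply/negP; rewrite -ltNge invf_lt1 // ltr1n.
have [k01|k10|//] := ltgtP k0 k1.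
  have := ki _ _ k01; rewrite -v0 -v1 => K.
  have [|c _ vE] := IVT (ler01) vw (v := v 0 + 2^-1).
    by rewrite ge_min le_max; apply/andP; split; apply/orP; [left|right]; move: K; lra.
  by case: (nohalf k0 c); rewrite vE v0.
have := ki _ _ k10; rewrite -v0 -v1 => K.
have [|c _ vE] := IVT (ler01) vw (v := v 1 + 2^-1).
  by rewrite ge_min le_max; apply/andP; split; apply/orP; [right|left]; move: K; lra.
by case: (nohalf k1 c); rewrite vE v1.
Qed.

End Pasting.

(** * Lifting paths and the increment of the logarithm *)

Section PathLifting.
Context {R : realType}.
Local Notation C := (Cx R).
Local Notation C2 := (Cx2 R).
Variables (H Hi : C2 -> C2) (Up : set C2) (G : C2 -> R) (d e : nat) (rho : R).
Variables (al q : C) (Q : C -> C) (Phi Psi : C2 -> C2) (Dm : set C2).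
Hypothesis hc : henon_chart H Hi Up G d e rho al q Q Phi Psi Dm.

Local Notation lvl := (lvl H Dm).
Local Notation phN := (phN H Phi).

Let d1 : (1 < d)%N.
Proof. by have /andP[e0 ed] := hc_e hc; apply: leq_ltn_trans ed. Qed.
Let dC n : (d%:R ^+ n : C) != 0.
Proof. by rewrite expf_neq0 // pnatr_eq0 -lt0n (ltn_trans _ d1). Qed.

Definition lift (g : R -> C2) (N : nat) (L : R -> C) : Prop := forall t, 0 <= t <= 1 ->
  [/\ lvl N (g t), {for t, continuous L} & cexp (L t) = phN N (g t)].

(* The increment of s along g. On loops it identifies pi_1 with 2 pi i Z[1/d]. *)
Definition disp (g : R -> C2) (D : C) : Prop :=
  exists N L, lift g N L /\ D = (L 1 - L 0) / d%:R ^+ N.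

Definition upath (g : R -> C2) : Prop := continuous (g \o cl) /\ forall t, 0 <= t <= 1 -> Up (g t).

Lemma lvl_compact {T : topologicalType} (K : set T) (g : T -> C2) : compact K ->
  (forall x, K x -> {for x, continuous g}) -> (forall x, K x -> Up (g x)) ->
  exists N, forall M, (N <= M)%N -> forall x, K x -> lvl M (g x).
Proof.
move=> Kc gc gU; apply: compact_nat => // x Kx.
have [N gN] := (Up_lvl hc _).1 (gU x Kx); exists N.
have K1 := gc x Kx _ (lvl_open hc gN).
by apply: (@filterS _ (nbhs x) _ _ _ _ K1) => y yN n Nn; exact: (lvl_le hc Nn yN).
Qed.

Lemma upath_lvl g : upath g -> exists N, forall M, (N <= M)%N -> forall t, 0 <= t <= 1 -> lvl M (g t).
Proof.
move=> [gc gU]; have [N NP] := @lvl_compact R `[0, 1]%classic (g \o cl) (@segment_compact R 0 1)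
  (fun x _ => gc x) (fun x _ => gU _ (cl_in x)).
exists N => M NM t t01; have := NP M NM t; rewrite /= (cl_id t01); apply.
by rewrite in_itv.
Qed.

Lemma phN_comp_continuous {T : topologicalType} (g : T -> C2) N x : {for x, continuous g} ->
  lvl N (g x) -> {for x, continuous (fun y => phN N (g y))}.
Proof.
move=> gc gN; apply: (@continuous_comp _ _ _ g (phN N)); first exact: gc.
exact: diff_continuous_nrm (phN_differentiable hc gN).
Qed.

Lemma lift_exists g N : continuous (g \o cl) -> (forall t, 0 <= t <= 1 -> lvl N (g t)) ->
  exists L, lift g N L.
Proof.
move=> gc gN; have [||L LP] := @log_lift_path R (fun t => phN N (g (cl t))).
- by move=> t; apply: (@phN_comp_continuous _ (g \o cl)); [exact: gc|apply: gN; exact: cl_in].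
- by move=> t t01; apply: (phN_neq0 hc); apply: gN; exact: cl_in.
by exists L => t t01; have [L1 L2] := LP t t01; split; rewrite ?L2 ?cl_id //; exact: gN.
Qed.

Lemma disp_exists g : upath g -> exists D, disp g D.
Proof.
move=> gp; have [N NP] := upath_lvl gp; have [L LP] := lift_exists gp.1 (NP N (leqnn N)).
by exists ((L 1 - L 0) / d%:R ^+ N); exists N, L.
Qed.

Lemma lift_raise g N L k : lift g N L -> lift g (N + k) (fun t => d%:R ^+ k * L t).
Proof.
move=> gL t t01; have [g1 g2 g3] := gL t t01; split.
- by apply: (lvl_le hc) g1; exact: leq_addr.
- by apply: cvgM; [exact: cvg_cst|exact: g2].
by rewrite (phN_add hc) // -g3 -cexpMn natrX.
Qed.

Lemma lift_uniq g N L L' : lift g N L -> lift g N L' -> L 1 - L 0 = L' 1 - L' 0.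
Proof.
move=> gL gL'; suff E : L 1 - L' 1 = L 0 - L' 0.
  exact: sub_swap.
apply: (@cexp_eq1_const _ (fun t => L t - L' t)) => t t01.
  by have [_ c1 _] := gL t t01; have [_ c2 _] := gL' t t01; exact: cvgB c1 c2.
have [gN _ c1] := gL t t01; have [_ _ c2] := gL' t t01.
by rewrite cexpB c1 c2 divff // (phN_neq0 hc gN).
Qed.

Lemma disp_uniq g D D' : disp g D -> disp g D' -> D = D'.
Proof.
move=> [N [L [gL ->]]] [M [L' [gL' ->]]].
have := lift_uniq (lift_raise M gL) (_ : lift g (N + M) (fun t => d%:R ^+ N * L' t)).
rewrite addnC; move=> /(_ (lift_raise N gL')); rewrite -!mulrBr => E.
apply: (mulfI (dC (N + M))).
have -> : d%:R ^+ (N + M) * ((L 1 - L 0) / d%:R ^+ N) = d%:R ^+ M * (L 1 - L 0).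
  by rewrite exprD; exact: disp_field.
by rewrite E addnC exprD; apply/esym; exact: disp_field.
Qed.

Lemma lift_uniq_const g N L : lift g N L -> (forall t, 0 <= t <= 1 -> phN N (g t) = phN N (g 0)) -> L 1 = L 0.
Proof.
move=> gL gc; apply/eqP; rewrite -subr_eq0; apply/eqP.
have -> : L 1 - L 0 = (fun t => L t - L 0) 1 by [].
have -> : 0 = (fun t => L t - L 0) 0 by rewrite subrr.
have z01 : 0 <= (0 : R) <= 1 by rewrite lexx ler01.
have [gN _ e0] := gL 0 z01.
apply: (@cexp_eq1_const _ (fun t => L t - L 0)) => t t01.
  by have [_ c1 _] := gL t t01; apply: cvgB; [exact: c1|exact: cvg_cst].
have [_ _ e1] := gL t t01.
by rewrite cexpB e1 e0 (gc t t01) divff //; exact: (phN_neq0 hc gN).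
Qed.

Lemma upath_cat g g' : upath g -> upath g' -> g 1 = g' 0 -> upath (path_cat g g').
Proof.
move=> [gc gU] [gc' gU'] E; split; last first.
  move=> t /andP[t0 t1]; rewrite /path_cat; case: (leP t 2^-1) => th; [apply: gU|apply: gU'].
    by rewrite mulr_ge0 //=; move: th; rewrite -(ler_pM2l (ltr0n R 2)) divff.
  by apply/andP; split; lra.
have -> : path_cat g g' \o cl = fun t => if t <= 2^-1 then (g \o cl) (2 * t) else (g' \o cl) (2 * t - 1).
  apply/funext => t /=; rewrite /path_cat.
  have [t0|t0] := leP t 0.
    have -> : cl t = 0 by rewrite /cl /clamp; move: t0; rewrite /Num.max /Num.min; do 2 case: ifP => /=; lra.
    rewrite mulr0 invr_ge0 ler0n (le_trans t0) ?invr_ge0 //.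
    have -> : cl (2 * t) = 0 by rewrite /cl /clamp; move: t0; rewrite /Num.max /Num.min; do 2 case: ifP => /=; lra.
    by [].
  have [t1|t1] := leP t 1.
    have -> : cl t = t by apply: cl_id; rewrite t1 ltW.
    case: (leP t 2^-1) => th.
      by have -> : cl (2 * t) = 2 * t by apply: cl_id; exact: half_in1.
    by have -> : cl (2 * t - 1) = 2 * t - 1 by apply: cl_id; exact: half_in2.
  have -> : cl t = 1 by rewrite /cl /clamp; move: t1; rewrite /Num.max /Num.min; do 2 case: ifP => /=; lra.
  have -> : cl (2 * t - 1) = 1 by rewrite /cl /clamp; move: t1; rewrite /Num.max /Num.min; do 2 case: ifP => /=; lra.
  have -> : (t <= 2^-1) = false by apply/negbTE; rewrite -ltNge; lra.
  have -> : ((1 : R) <= 2^-1) = false by apply/negbTE; rewrite -ltNge; lra.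
  by congr g'; lra.
apply: paste_continuous.
- move=> t; apply: (@continuous_comp _ _ _ (fun t : R => 2 * t) (g \o cl)); last exact: gc.
  by apply: cvgM; [exact: cvg_cst|exact: cvg_id].
- move=> t; apply: (@continuous_comp _ _ _ (fun t : R => 2 * t - 1) (g' \o cl)); last exact: gc'.
  by apply: cvgB; [apply: cvgM; [exact: cvg_cst|exact: cvg_id]|exact: cvg_cst].
rewrite divff // subrr /= !cl_id ?lexx ?ler01 //.
Qed.

Lemma upath_rev g : upath g -> upath (path_rev g).
Proof.
move=> [gc gU]; split=> [|t t01]; last by apply: gU; move: t01; lra.
have -> : path_rev g \o cl = (g \o cl) \o (fun t => 1 - t).
  apply/funext => t /=; rewrite /path_rev; congr g.
  by rewrite /cl /clamp /Num.max /Num.min; do 4 case: ifP => /=; lra.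
move=> t; apply: (@continuous_comp _ _ _ (fun t : R => 1 - t) (g \o cl)); last exact: gc.
by apply: cvgB; [exact: cvg_cst|exact: cvg_id].
Qed.

Lemma disp_rev g D : disp g D -> disp (path_rev g) (- D).
Proof.
move=> [N [L [gL ->]]]; exists N, (fun t => L (1 - t)); split; last first.
  by rewrite subrr subr0 -mulNr opprB.
move=> t t01; have t01' : 0 <= 1 - t <= 1 by move: t01; lra.
have [g1 g2 g3] := gL _ t01'; split; [exact: g1| |exact: g3].
apply: (@continuous_comp _ _ _ (fun t : R => 1 - t) L); last exact: g2.
by apply: cvgB; [exact: cvg_cst|exact: cvg_id].
Qed.

Lemma disp_cat g g' D D' : g 1 = g' 0 -> disp g D -> disp g' D' -> disp (path_cat g g') (D + D').
Proof.
move=> E [N [L [gL ->]]] [M [L' [gL' ->]]].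
have {gL} := lift_raise M gL; set L1 := (fun t => _) => gL.
have {gL'} := lift_raise N gL'; set L2 := (fun t => _) => gL'; rewrite addnC in gL'.
have -> : (L 1 - L 0) / d%:R ^+ N + (L' 1 - L' 0) / d%:R ^+ M =
  ((L2 1 - L2 0 + L1 1) - L1 0) / d%:R ^+ (N + M).
  rewrite /L1 /L2 exprD; move: (dC N) (dC M); move: (_ ^+ N) (_ ^+ M) => u v u0 v0.
  by field; rewrite u0 v0.
(* The second lift is moved by the constant L1 1 - L2 0, a period of exp, so that the two lifts meet
   at the junction. *)
pose L3 t := if t <= 2^-1 then L1 (cl (2 * t)) else L2 (cl (2 * t - 1)) - L2 0 + L1 1.
have zz01 : 0 <= (0 : R) <= 1 by rewrite lexx ler01.
have oo01 : 0 <= (1 : R) <= 1 by rewrite lexx ler01.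
have L3c : continuous L3.
  apply: paste_continuous.
  - move=> t; apply: (@continuous_comp _ _ _ (fun t : R => cl (2 * t)) L1).
      apply: (@continuous_comp _ _ _ (fun t : R => 2 * t) cl); last exact: cl_continuous.
      by apply: cvgM; [exact: cvg_cst|exact: cvg_id].
    by have [] := gL _ (cl_in (2 * t)).
  - move=> t; apply: cvgD; last exact: cvg_cst.
    apply: cvgB; last exact: cvg_cst.
    apply: (@continuous_comp _ _ _ (fun t : R => cl (2 * t - 1)) L2).
      apply: (@continuous_comp _ _ _ (fun t : R => 2 * t - 1) cl); last exact: cl_continuous.
      by apply: cvgB; [apply: cvgM; [exact: cvg_cst|exact: cvg_id]|exact: cvg_cst].
    by have [] := gL' _ (cl_in (2 * t - 1)).
  by rewrite divff // subrr !cl_id // subrr add0r.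
exists (N + M)%N, L3; split; last first.
  have E1 : L3 1 = L2 1 - L2 0 + L1 1.
    rewrite /L3 (_ : (1 <= 2^-1) = false); last by apply/negbTE; rewrite -ltNge; lra.
    by rewrite (_ : cl (2 * 1 - 1) = 1) // (_ : 2 * 1 - 1 = 1) ?cl_id //; lra.
  have E0 : L3 0 = L1 0 by rewrite /L3 invr_ge0 ler0n mulr0 cl_id.
  by rewrite E1 E0.
move=> t t01; have := t01 => /andP[t0 t1]; rewrite /path_cat; split; last 2 first.
- exact: L3c.
- rewrite /L3; case: (leP t 2^-1) => th.
    have ti : 0 <= 2 * t <= 1 by apply/andP; split; lra.
    by rewrite cl_id //; have [_ _ ->] := gL _ ti.
  have ti : 0 <= 2 * t - 1 <= 1 by apply/andP; split; lra.
  rewrite cl_id // cexpD cexpB; have [_ _ ->] := gL' _ ti.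
  have [P1 _ ->] := gL' _ zz01; have [_ _ ->] := gL _ oo01.
  by rewrite E divfK // (phN_neq0 hc P1).
case: (leP t 2^-1) => th.
  have ti : 0 <= 2 * t <= 1 by apply/andP; split; lra.
  by have [] := gL _ ti.
have ti : 0 <= 2 * t - 1 <= 1 by apply/andP; split; lra.
by have [] := gL' _ ti.
Qed.

End PathLifting.

(** * Increments classify paths up to homotopy *)

Section Loops.
Context {R : realType}.
Local Notation C := (Cx R).
Local Notation C2 := (Cx2 R).
Variables (H Hi : C2 -> C2) (Up : set C2) (G : C2 -> R) (d e : nat) (rho : R).
Variables (al q : C) (Q : C -> C) (Phi Psi : C2 -> C2) (Dm : set C2).
Hypothesis hc : henon_chart H Hi Up G d e rho al q Q Phi Psi Dm.

Local Notation PsiF := (fullPsi Hi d rho al Q Psi).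
Local Notation lvl := (lvl H Dm).
Local Notation phN := (phN H Phi).
Local Notation zN := (zN H Phi).
Local Notation Sg := (Sg H d Phi Dm).
Local Notation sdom := (sdom d rho).
Local Notation pt := (pt Hi d rho al Q Psi).
Local Notation lift := (lift H Phi Dm).
Local Notation disp := (disp H d Phi Dm).
Local Notation upath := (upath Up).

Let d1 : (1 < d)%N.
Proof. by have /andP[e0 ed] := hc_e hc; apply: leq_ltn_trans ed. Qed.
Let dC n : (d%:R ^+ n : C) != 0.
Proof. by rewrite expf_neq0 // pnatr_eq0 -lt0n (ltn_trans _ d1). Qed.
Let dR n : 0 < (d%:R ^+ n : R).
Proof. by rewrite exprn_gt0 // ltr0n (ltn_trans _ d1). Qed.
Let rho0 : 0 < rho := lt_le_trans ltr01 (hc_rho hc).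

(** The parametrisation [pt] in terms of L = d^N s, the logarithm of zeta at level N that lifts of
    paths supply. *)
Definition cpt (N : nat) (z L : C) : C2 := iter N Hi (PsiF (z, cexp L)).

Lemma cptE N z L : cpt N z L = pt N z (L / d%:R ^+ N).
Proof. by rewrite /cpt /pt mulrCA divff // mulr1. Qed.

Lemma cpt_Sg N z L : rho < nrm (cexp L) -> Sg (cpt N z L) (L / d%:R ^+ N).
Proof.
move=> Lr; rewrite cptE; apply: (pt_Sg hc).
by rewrite /sdom mulrCA divff // mulr1.
Qed.

Lemma cpt_G N z L : rho < nrm (cexp L) -> G (cpt N z L) = Re L / d%:R ^+ N.
Proof.
move=> /cpt_Sg K; rewrite (G_Sg hc (K N z)); apply: (mulfI (lt0r_neq0 (dR N))).
by rewrite -(Re_dM d N) mulrCA divff // mulr1 mulrCA divff ?mulr1 ?gt_eqF.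
Qed.

Lemma cpt_lvl N p L : lvl N p -> cexp L = phN N p -> cpt N (zN N p) L = p.
Proof. by move=> pN E; rewrite /cpt E -(lvl_eqi hc pN). Qed.

Lemma cpt_continuous {T : topologicalType} N (z L : T -> C) x : {for x, continuous z} ->
  {for x, continuous L} -> rho < nrm (cexp (L x)) -> {for x, continuous (fun y => cpt N (z y) (L y))}.
Proof.
move=> zc Lc Lr; apply: (@continuous_comp _ _ _ (fun y => PsiF (z y, cexp (L y))) (iter N Hi)); last first.
  exact: diff_continuous_nrm (iterHi_differentiable hc N _).
apply: (@continuous_comp _ _ _ (fun y => (z y, cexp (L y)) : C2) PsiF); last first.
  by apply: diff_continuous_nrm; apply: (fullPsi_differentiable hc).
apply: pair_continuous; first exact: zc.
by apply: (@continuous_comp _ _ _ L (@cexp R)); [exact: Lc|exact: cexp_continuous].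
Qed.

Lemma zN_comp_continuous {T : topologicalType} (g : T -> C2) N x : {for x, continuous g} ->
  lvl N (g x) -> {for x, continuous (fun y => zN N (g y))}.
Proof.
move=> gc gN; apply: (@continuous_comp _ _ _ g (zN N)); first exact: gc.
exact: diff_continuous_nrm (zN_differentiable hc gN).
Qed.

Lemma exp_log_convex (L0 L1 : C) (s : R) : 0 <= s <= 1 -> rho < nrm (cexp L0) -> rho < nrm (cexp L1) ->
  rho < nrm (cexp (rc (1 - s) * L0 + rc s * L1)).
Proof.
move=> /andP[s0 s1]; rewrite !nrm_cexp -{1 2 3}(lnK (_ : rho \is Num.pos)) ?posrE // !ltr_expR.
rewrite ReD !ReM /= !mul0r !subr0 => H0 H1.
have [->|s'] := eqVneq s 0; first by rewrite subr0 mul1r mul0r addr0.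
have {}s0 : 0 < s by rewrite lt_def s'.
have E : ln rho = (1 - s) * ln rho + s * ln rho by rewrite -mulrDl subrK mul1r.
rewrite E; apply: ler_ltD; first by rewrite ler_wpM2l ?subr_ge0 // ltW.
by rewrite ltr_pM2l.
Qed.

(* U+ and Omega'_c are the cases I = R and I = ]-oo, c[. *)
Definition XI (I : set R) : set C2 := [set p | Up p /\ I (G p)].

Variable I : set R.
Hypothesis Idn : forall x y, I y -> x <= y -> I x.

Lemma convex_I (a b s : R) : 0 <= s <= 1 -> I a -> I b -> I ((1 - s) * a + s * b).
Proof.
move=> /andP[s0 s1] Ia Ib; have M : I (Num.max a b) by rewrite /Num.max; case: ifP.
apply: Idn M _; have -> : Num.max a b = (1 - s) * Num.max a b + s * Num.max a b by rewrite -mulrDl subrK mul1r.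
by apply: lerD; rewrite ler_wpM2l ?subr_ge0 // le_max lexx ?orbT.
Qed.

Lemma cpt_convex N (z L0 L1 : C) (s : R) : 0 <= s <= 1 -> rho < nrm (cexp L0) -> rho < nrm (cexp L1) ->
  I (Re L0 / d%:R ^+ N) -> I (Re L1 / d%:R ^+ N) -> XI I (cpt N z (rc (1 - s) * L0 + rc s * L1)).
Proof.
move=> s01 r0 r1 I0 I1; have r := exp_log_convex s01 r0 r1.
split; first exact: (Sg_Up hc (cpt_Sg N z r)).
rewrite cpt_G // ReD !ReM /= !mul0r !subr0 mulrDl -!mulrA; exact: convex_I.
Qed.

Lemma is_path_upath x y g : is_path (R := R) (XI I) x y g -> upath g.
Proof. by move=> [/within_cl gc gX _ _]; split=> // t /gX[]. Qed.

Lemma XI_connected x y : XI I x -> XI I y -> exists g, is_path (R := R) (XI I) x y g.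
Proof.
move=> [xU xI] [yU yI]; have [n xn] := (Up_lvl hc _).1 xU; have [m ym] := (Up_lvl hc _).1 yU.
pose N := (n + m)%N; have {}xn := lvl_le hc (leq_addr m n) xn.
have {}ym := lvl_le hc (leq_addl n m) ym.
have [s0 E0] := Sg_exists hc xn; have [s1 E1] := Sg_exists hc ym.
set L0 := _ * s0 in E0; set L1 := _ * s1 in E1.
pose g t := cpt N (rc (1 - t) * zN N x + rc t * zN N y) (rc (1 - t) * L0 + rc t * L1).
have r0 : rho < nrm (cexp L0) by rewrite E0; exact: (phN_gt hc).
have r1 : rho < nrm (cexp L1) by rewrite E1; exact: (phN_gt hc).
have ReL0 : Re L0 / d%:R ^+ N = G x by rewrite (G_lvl hc xn E0) Re_dM mulrC mulKf // gt_eqF.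
have ReL1 : Re L1 / d%:R ^+ N = G y by rewrite (G_lvl hc ym E1) Re_dM mulrC mulKf // gt_eqF.
exists g; split.
- apply/within_cl => t.
  have c1 : {for t, continuous (fun t => rc (1 - cl t))}.
    apply: (@continuous_comp _ _ _ (fun t => 1 - cl t) (@rc R)); last exact: rc_continuous.
    by apply: cvgB; [exact: cvg_cst|exact: cl_continuous].
  have c2 : {for t, continuous (fun t => rc (cl t))}.
    by apply: (@continuous_comp _ _ _ cl (@rc R)); [exact: cl_continuous|exact: rc_continuous].
  apply: (@cpt_continuous R N (fun t => rc (1 - cl t) * zN N x + rc (cl t) * zN N y) (fun t => rc (1 - cl t) * L0 + rc (cl t) * L1)); last by apply: exp_log_convex => //; exact: cl_in.
    by apply: cvgD; (apply: cvgM; last exact: cvg_cst); [exact: c1|exact: c2].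
  by apply: cvgD; (apply: cvgM; last exact: cvg_cst); [exact: c1|exact: c2].
- by move=> t t01; apply: cpt_convex => //; rewrite ?ReL0 ?ReL1.
- by rewrite /g subr0 rc0 rc1 !mul0r !addr0 !mul1r cpt_lvl.
by rewrite /g subrr rc0 rc1 !mul0r !add0r !mul1r cpt_lvl.
Qed.

(** A logarithm exists on the whole square, at one level by compactness. It is constant on the two
    sides where the homotopy fixes the endpoints. *)
Lemma homotopic_disp (X : set C2) g0 g1 D : X `<=` Up -> path_homotopic X g0 g1 -> disp g0 D -> disp g1 D.
Proof.
move=> XU [h [/within_cl2 hcont hX h01 hs]] D0.
have cc : compact (`[0, 1] `*` `[0, 1] : set (R * R)).
  by apply: compact_setX; exact: segment_compact.
have [|w _|N NP] := lvl_compact hc (g := fun w : R * R => h (cl w.1, cl w.2)) cc.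
- by move=> w _; exact: hcont.
- by apply: XU; apply: hX; exact: cl_in.
have hN s t : 0 <= s <= 1 -> 0 <= t <= 1 -> lvl N (h (s, t)).
  move=> s01 t01; have := NP N (leqnn N) (s, t); rewrite /= !cl_id //; apply.
  by split; rewrite /= in_itv.
have [||L LP] := @log_lift_square R (fun w => phN N (h (cl w.1, cl w.2))).
- move=> w; apply: (@phN_comp_continuous R H Hi Up G d e rho al q Q Phi Psi Dm hc _ (fun w : R * R => h (cl w.1, cl w.2))).
    exact: hcont.
  by apply: hN; exact: cl_in.
- by move=> s t s01 t01; apply: (phN_neq0 hc); apply: hN; exact: cl_in.
have zz01 : 0 <= (0 : R) <= 1 by rewrite lexx ler01.
have oo01 : 0 <= (1 : R) <= 1 by rewrite lexx ler01.
have row s : 0 <= s <= 1 -> lift (fun t => h (s, t)) N (fun t => L (s, t)).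
  move=> s01 t t01; have [c1 c2] := LP s t s01 t01; split; first exact: hN.
    apply: (@continuous_comp _ _ _ (fun t : R => (s, t)) L); last exact: c1.
    by apply: pair_continuous; [exact: cvg_cst|exact: cvg_id].
  by rewrite c2 /= !cl_id.
have col t : 0 <= t <= 1 -> lift (fun s => h (s, t)) N (fun s => L (s, t)).
  move=> t01 s s01; have [c1 c2] := LP s t s01 t01; split; first exact: hN.
    apply: (@continuous_comp _ _ _ (fun s : R => (s, t)) L); last exact: c1.
    by apply: pair_continuous; [exact: cvg_id|exact: cvg_cst].
  by rewrite c2 /= !cl_id.
have e0 : L (1, 0) = L (0, 0).
  apply: (lift_uniq_const hc (col 0 zz01)) => s s01.
  by have [-> _] := hs s s01; have [-> _] := hs 0 zz01.
have e1 : L (1, 1) = L (0, 1).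
  apply: (lift_uniq_const hc (col 1 oo01)) => s s01.
  by have [_ ->] := hs s s01; have [_ ->] := hs 0 zz01.
have K0 : disp g0 ((L (0, 1) - L (0, 0)) / d%:R ^+ N).
  exists N, (fun t => L (0, t)); split; last by [].
  by move=> t t01; have [<- _] := h01 t t01; exact: row zz01 t t01.
rewrite (disp_uniq hc D0 K0); exists N, (fun t => L (1, t)); split; last by rewrite e0 e1.
by move=> t t01; have [_ <-] := h01 t t01; exact: row oo01 t t01.
Qed.

(** In the coordinates (z, L) of a common level the set is convex. Equal increments allow lifts with
    the same two endpoints, and the straight-line homotopy between them projects to one with fixed
    endpoints. *)
Lemma disp_homotopic x y g0 g1 D : is_path (XI I) x y g0 -> is_path (XI I) x y g1 ->
  disp g0 D -> disp g1 D -> path_homotopic (XI I) g0 g1.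
Proof.
move=> p0 p1 D0 D1; have u0 := is_path_upath p0; have u1 := is_path_upath p1.
have [n nP] := upath_lvl hc u0; have [m mP] := upath_lvl hc u1.
pose N := (n + m)%N; have {}nP := nP N (leq_addr _ _); have {}mP := mP N (leq_addl _ _).
have [L0 L0P] := lift_exists hc u0.1 nP; have [L1' L1P'] := lift_exists hc u1.1 mP.
have zz01 : 0 <= (0 : R) <= 1 by rewrite lexx ler01.
have oo01 : 0 <= (1 : R) <= 1 by rewrite lexx ler01.
case: p0 => c0 X0 x0 y0; case: p1 => c1 X1 x1 y1.
(* The lifts of a common starting point differ by a period, which is removed here. *)
pose L1 t := L1' t + (L0 0 - L1' 0).
have L1P : lift g1 N L1.
  move=> t t01; have [a1 a2 a3] := L1P' t t01; split; first exact: a1.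
    by apply: cvgD; [exact: a2|exact: cvg_cst].
  have [_ _ b1] := L0P 0 zz01; have [b2 _ b3] := L1P' 0 zz01.
  by rewrite cexpD cexpB b1 b3 x0 x1 divff ?mulr1 // -x1 (phN_neq0 hc b2).
have L10 : L1 0 = L0 0 by rewrite /L1 addrC subrK.
have L11 : L1 1 = L0 1.
  have E0 : D = (L0 1 - L0 0) / d%:R ^+ N by apply: (disp_uniq hc D0); exists N, L0.
  have E1 : D = (L1 1 - L1 0) / d%:R ^+ N by apply: (disp_uniq hc D1); exists N, L1.
  have := etrans (esym E1) E0 => /(mulIf (invr_neq0 (dC N))).
  by rewrite L10 => /addIr.
have r0 t : 0 <= t <= 1 -> rho < nrm (cexp (L0 t)) /\ I (Re (L0 t) / d%:R ^+ N).
  move=> t01; have [a1 _ a3] := L0P t t01; have [_ It] := X0 t t01.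
  split; first by rewrite a3; exact: (phN_gt hc).
  by rewrite -(cpt_G N (zN N (g0 t))) ?cpt_lvl // a3; exact: (phN_gt hc).
have r1 t : 0 <= t <= 1 -> rho < nrm (cexp (L1 t)) /\ I (Re (L1 t) / d%:R ^+ N).
  move=> t01; have [a1 _ a3] := L1P t t01; have [_ It] := X1 t t01.
  split; first by rewrite a3; exact: (phN_gt hc).
  by rewrite -(cpt_G N (zN N (g1 t))) ?cpt_lvl // a3; exact: (phN_gt hc).
exists (fun w => cpt N (rc (1 - w.1) * zN N (g0 w.2) + rc w.1 * zN N (g1 w.2))
  (rc (1 - w.1) * L0 w.2 + rc w.1 * L1 w.2)); split.
- apply/within_cl2 => w /=.
  have clf : {for w, continuous (fun w : R * R => cl w.1)}.
    by apply: (@continuous_comp _ _ _ fst cl); [exact: cvg_fst|exact: cl_continuous].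
  have cls : {for w, continuous (fun w : R * R => cl w.2)}.
    by apply: (@continuous_comp _ _ _ snd cl); [exact: cvg_snd|exact: cl_continuous].
  have k1 : {for w, continuous (fun w : R * R => rc (1 - cl w.1))}.
    apply: (@continuous_comp _ _ _ (fun w : R * R => 1 - cl w.1) (@rc R)); last exact: rc_continuous.
    by apply: cvgB; [exact: cvg_cst|exact: clf].
  have k2 : {for w, continuous (fun w : R * R => rc (cl w.1))}.
    by apply: (@continuous_comp _ _ _ (fun w : R * R => cl w.1) (@rc R)); [exact: clf|exact: rc_continuous].
  have [a1 a2 _] := L0P _ (cl_in w.2); have [b1 b2 _] := L1P _ (cl_in w.2).
  have [ra _] := r0 _ (cl_in w.2); have [rb _] := r1 _ (cl_in w.2).
  apply: (@cpt_continuous _ N (fun w : R * R => rc (1 - cl w.1) * zN N (g0 (cl w.2)) + rc (cl w.1) * zN N (g1 (cl w.2)))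
    (fun w : R * R => rc (1 - cl w.1) * L0 (cl w.2) + rc (cl w.1) * L1 (cl w.2))); last by apply: exp_log_convex => //; exact: cl_in.
    apply: cvgD; apply: cvgM; [exact: k1| |exact: k2|].
      apply: (@zN_comp_continuous _ (fun w : R * R => g0 (cl w.2))); last exact: a1.
      by apply: (@continuous_comp _ _ _ snd (g0 \o cl)); [exact: cvg_snd|exact: u0.1].
    apply: (@zN_comp_continuous _ (fun w : R * R => g1 (cl w.2))); last exact: b1.
    by apply: (@continuous_comp _ _ _ snd (g1 \o cl)); [exact: cvg_snd|exact: u1.1].
  apply: cvgD; apply: cvgM; [exact: k1| |exact: k2|].
    by apply: (@continuous_comp _ _ _ (fun w : R * R => cl w.2) L0); [exact: cls|exact: a2].
  by apply: (@continuous_comp _ _ _ (fun w : R * R => cl w.2) L1); [exact: cls|exact: b2].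
- move=> s t s01 t01 /=; have [ra Ia] := r0 _ t01; have [rb Ib] := r1 _ t01.
  exact: cpt_convex.
- move=> t t01 /=; have [a1 _ a3] := L0P t t01; have [b1 _ b3] := L1P t t01.
  by rewrite !subr0 subrr rc0 rc1 !mul0r !addr0 !add0r !mul1r !cpt_lvl.
move=> s s01 /=; have [a1 _ a3] := L0P 0 zz01; have [b1 _ b3] := L0P 1 oo01.
rewrite L10 L11 x1 y1 -x0 -y0 -!mulrDl -!rcD !subrK !rc1 !mul1r !cpt_lvl //.
Qed.

End Loops.

(** * Trivial action on the fundamental group in terms of increments *)

Section TrivialAction.
Context {R : realType}.
Local Notation C := (Cx R).
Local Notation C2 := (Cx2 R).
Variables (H Hi : C2 -> C2) (Up : set C2) (G : C2 -> R) (d e : nat) (rho : R).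
Variables (al q : C) (Q : C -> C) (Phi Psi : C2 -> C2) (Dm : set C2).
Hypothesis hc : henon_chart H Hi Up G d e rho al q Q Phi Psi Dm.

Local Notation disp := (disp H d Phi Dm).

Local Notation XI := (XI Up G).
Variable I : set R.
Hypothesis Idn : forall x y, I y -> x <= y -> I x.

(* Equivalent to acting trivially on pi_1. *)
Definition WP (f : C2 -> C2) : Prop := forall x g D,
  is_path (R := R) (XI I) x x g -> disp g D -> disp (f \o g) D.

Let XU : XI I `<=` Up.
Proof. by move=> p []. Qed.

Lemma is_path_disp x y g : is_path (R := R) (XI I) x y g -> exists D, disp g D.
Proof. by move=> /is_path_upath/(disp_exists hc). Qed.

Lemma homotopic_refl x y g : is_path (R := R) (XI I) x y g -> path_homotopic (XI I) g g.
Proof. by move=> gp; have [D gD] := is_path_disp gp; exact: (disp_homotopic hc Idn gp gp gD gD). Qed.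

Lemma homotopic_path x y g g' : is_path (R := R) (XI I) x y g -> path_homotopic (XI I) g g' ->
  is_path (R := R) (XI I) x y g'.
Proof.
move=> [gc gX g0 g1] [h [/within_cl2 hc' hX h01 hs]].
have zz01 : 0 <= (0 : R) <= 1 by rewrite lexx ler01.
have oo01 : 0 <= (1 : R) <= 1 by rewrite lexx ler01.
have E t : 0 <= t <= 1 -> g' t = h (1, t) by move=> /h01[].
split.
- apply/within_cl.
  have -> : g' \o cl = (fun w : R * R => h (cl w.1, cl w.2)) \o (fun t => (1, t)).
    by apply/funext => t /=; rewrite E ?cl_in // (cl_id oo01).
  move=> t; apply: (@continuous_comp _ _ _ (fun t : R => ((1 : R), t)) (fun w : R * R => h (cl w.1, cl w.2))); last exact: hc'.
  by apply: pair_continuous; [exact: cvg_cst|exact: cvg_id].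
- by move=> t t01; rewrite E //; exact: hX.
- by rewrite E //; have [-> _] := hs 1 oo01.
by rewrite E //; have [_ ->] := hs 1 oo01.
Qed.

Lemma is_path_cat x y z g g' : is_path (R := R) (XI I) x y g -> is_path (R := R) (XI I) y z g' ->
  is_path (R := R) (XI I) x z (path_cat g g').
Proof.
move=> gp gp'; have u := is_path_upath gp; have u' := is_path_upath gp'.
case: gp => gc gX g0 g1; case: gp' => gc' gX' g0' g1'.
have [cc _] := upath_cat u u' (etrans g1 (esym g0')).
split; first by apply/within_cl; exact: cc.
- move=> t /andP[t0 t1]; rewrite /path_cat; case: (leP t 2^-1) => th.
    by apply: gX; apply/andP; split; lra.
  by apply: gX'; apply/andP; split; lra.
- by rewrite /path_cat invr_ge0 ler0n mulr0.
rewrite /path_cat (_ : (1 <= 2^-1) = false); last by apply/negbTE; rewrite -ltNge; lra.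
by rewrite (_ : 2 * 1 - 1 = 1) //; lra.
Qed.

Lemma is_path_rev x y g : is_path (R := R) (XI I) x y g -> is_path (R := R) (XI I) y x (path_rev g).
Proof.
move=> gp; have [cc _] := upath_rev (is_path_upath gp); case: gp => gc gX g0 g1.
split; first by apply/within_cl; exact: cc.
- by move=> t /andP[t0 t1]; apply: gX; rewrite subr_ge0 t1 /= gerBl.
- by rewrite /path_rev subr0.
by rewrite /path_rev subrr.
Qed.

Variable f : C2 -> C2.
Hypotheses (fX : forall p, XI I p -> XI I (f p)) (fc : forall p, XI I p -> {for p, continuous f}).

Lemma is_path_image x y g : is_path (R := R) (XI I) x y g -> is_path (R := R) (XI I) (f x) (f y) (f \o g).
Proof.
move=> [/within_cl gc gX <- <-]; split; [|by move=> t /gX; exact: fX|by []|by []].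
apply/within_cl => t; apply: (@continuous_comp _ _ _ (g \o cl) f); first exact: gc.
by apply: fc; apply: gX; exact: cl_in.
Qed.

(** The increments along [dd] and its reverse cancel, so the change of base point is invisible to
    [disp]; both directions of the comparison with [WP] rest on this. *)
Lemma conj_path x g dd D d0 : is_path (R := R) (XI I) x (f x) dd -> disp dd d0 ->
  is_path (R := R) (XI I) (f x) (f x) g -> disp g D ->
  is_path (R := R) (XI I) x x (path_cat dd (path_cat g (path_rev dd))) /\
  disp (path_cat dd (path_cat g (path_rev dd))) D.
Proof.
move=> dp dd0 gp gD; have rp := is_path_rev dp; have rd := disp_rev dd0.
have gr := is_path_cat gp rp.
have E1 : g 1 = path_rev dd 0 by case: gp => _ _ _ ->; case: rp => _ _ -> _.
have E2 : dd 1 = path_cat g (path_rev dd) 0 by case: dp => _ _ _ ->; case: gr => _ _ -> _.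
split; first exact: is_path_cat gr.
have := disp_cat hc E2 dd0 (disp_cat hc E1 gD rd).
by rewrite addrCA subrr addr0.
Qed.

Lemma acts_trivially_WP : acts_trivially_on_pi1 (R := R) (XI I) f -> WP f.
Proof.
move=> act x g D gp gD; have xX : XI I x.
  by case: gp => _ gX <- _; apply: gX; rewrite lexx ler01.
have [dd dp] := XI_connected hc Idn xX (fX xX).
have [d0 dd0] := is_path_disp dp.
have gp' := is_path_image gp; have [D' gD'] := is_path_disp gp'.
have [kp kD] := conj_path dp dd0 gp' gD'.
have E := act x dd (path_class (XI I) g) dp (ex_intro2 _ _ g gp erefl).
have kin : pi1_transport (XI I) dd (pi1_map (XI I) f (path_class (XI I) g))
    (path_cat dd (path_cat (f \o g) (path_rev dd))).
  exists (f \o g); last exact: homotopic_refl kp.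
  by exists g; [exact: homotopic_refl gp|exact: homotopic_refl gp'].
rewrite E in kin; have kD2 := homotopic_disp hc XU kin gD.
by rewrite (disp_uniq hc kD2 kD).
Qed.

Lemma WP_acts_trivially : WP f -> acts_trivially_on_pi1 (R := R) (XI I) f.
Proof.
move=> wp x dd a dp [g gp <-]; have [d0 dd0] := is_path_disp dp.
have [D gD] := is_path_disp gp; have gp' := is_path_image gp; have gD' := wp x g D gp gD.
apply/seteqP; split=> [k [g' [g2 gg2 g2g'] kk]|k kk].
  have g2p := homotopic_path gp gg2; have g2D := homotopic_disp hc XU gg2 gD.
  have fg2p := is_path_image g2p; have fg2D := wp x g2 D g2p g2D.
  have g'p := homotopic_path fg2p g2g'; have g'D := homotopic_disp hc XU g2g' fg2D.
  have [cp cD] := conj_path dp dd0 g'p g'D.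
  have kp := homotopic_path cp kk; have kD := homotopic_disp hc XU kk cD.
  exact: (disp_homotopic hc Idn gp kp gD kD).
have kp := homotopic_path gp kk; have kD := homotopic_disp hc XU kk gD.
exists (f \o g); first by exists g; [exact: homotopic_refl gp|exact: homotopic_refl gp'].
have [cp cD] := conj_path dp dd0 gp' gD'.
exact: (disp_homotopic hc Idn cp kp cD kD).
Qed.

End TrivialAction.

(** * Automorphisms in logarithmic coordinates *)

Section EntireCurves.
Context {R : realType}.
Local Notation C := (Cx R).
Local Notation C2 := (Cx2 R).
Variables (H Hi : C2 -> C2) (Up : set C2) (G : C2 -> R) (d e : nat) (rho : R).
Variables (al q : C) (Q : C -> C) (Phi Psi : C2 -> C2) (Dm : set C2).
Hypothesis hc : henon_chart H Hi Up G d e rho al q Q Phi Psi Dm.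

Local Notation Fm := (Fmap d al Q).
Local Notation lvl := (lvl H Dm).
Local Notation phN := (phN H Phi).
Local Notation zN := (zN H Phi).
Local Notation Sg := (Sg H d Phi Dm).
Local Notation sdom := (sdom d rho).
Local Notation pt := (pt Hi d rho al Q Psi).
Local Notation disp := (disp H d Phi Dm).

Let d1 : (1 < d)%N.
Proof. by have /andP[e0 ed] := hc_e hc; apply: leq_ltn_trans ed. Qed.
Let dC n : (d%:R ^+ n : C) != 0.
Proof. by rewrite expf_neq0 // pnatr_eq0 -lt0n (ltn_trans _ d1). Qed.
Let rho0 : 0 < rho := lt_le_trans ltr01 (hc_rho hc).

Local Notation zz := (zz d al Q).

Lemma pt_wdom N k z (s : C) : wdom rho (iter k Fm (z, cexp (d%:R ^+ N * s))) -> sdom N s ->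
  [/\ lvl (N + k) (pt N z s), phN (N + k) (pt N z s) = cexp (d%:R ^+ (N + k) * s)
    & zN (N + k) (pt N z s) = zz N k z s].
Proof.
move=> kP sN; have wf : full_dom rho ((z, cexp (d%:R ^+ N * s)) : C2) by exact: sN.
have E : iter (N + k) H (pt N z s) = Psi (zz N k z s, cexp (d%:R ^+ (N + k) * s)).
  rewrite addnC iterD /pt (iterKi hc) (iter_fullPsi hc) // (fullPsi_wdom hc kP).
  by rewrite iter_Fm addnC.
rewrite iter_Fm in kP; have [P1 P2 _] := hc_Psi hc kP.
by rewrite /lvl /phN /zN E P2.
Qed.

Lemma pt0_lvl N (s : C) : sdom N s -> lvl N (pt N 0 s) /\ phN N (pt N 0 s) = cexp (d%:R ^+ N * s).
Proof.
move=> sN; have w0 : wdom rho (iter 0 Fm (0, cexp (d%:R ^+ N * s))).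
  by split=> //=; rewrite nrm0 exprn_gt0 // (lt_trans rho0).
by have [] := pt_wdom w0 sN; rewrite addn0.
Qed.

Lemma phN_eq_Sg M p p' s : lvl M p -> lvl M p' -> phN M p = phN M p' -> Sg p s -> Sg p' s.
Proof.
move=> pM pM' E /(Sg_large hc)[N NP]; have [n1 n2] := NP (M + N)%N (leq_addl _ _).
exists (M + N)%N; first by apply: (lvl_le hc) pM'; exact: leq_addr.
by rewrite n2 !(phN_add hc) // E.
Qed.

Lemma is_derive_pow (g : C -> C) (z l : C) n : is_derive z 1 g l ->
  is_derive z 1 (fun w => g w ^+ n) (n%:R * g z ^+ n.-1 * l).
Proof.
move=> gl; have := is_deriveX n gl.
by congr is_derive; apply/funext => w; rewrite exprfctE.
Qed.

Lemma logder_step (F : C -> C2) b N k l : differentiable F b -> lvl N (F b) ->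
  is_derive b 1 (fun y => phN N (F y)) l ->
  is_derive b 1 (fun y => phN (N + k) (F y)) ((d ^ k)%:R * phN N (F b) ^+ (d ^ k).-1 * l).
Proof.
move=> Fd FN Nl; apply: is_derive_near (is_derive_pow (d ^ k) Nl).
have K := diff_continuous_nrm Fd (lvl_open hc FN).
by apply: (@filterS _ (nbhs b) _ _ _ _ K) => y yN; rewrite (phN_add hc).
Qed.

Lemma field_aux4 (l x y u v : C) : x != 0 -> y != 0 -> u != 0 -> v != 0 ->
  u * x * l / (x * y * (v * u)) = l / (y * v).
Proof. by move=> x0 y0 u0 v0; field; rewrite x0 y0 u0 v0. Qed.

Lemma logder_add (F : C -> C2) b N k l m : differentiable F b -> lvl N (F b) ->
  is_derive b 1 (fun y => phN N (F y)) l -> is_derive b 1 (fun y => phN (N + k) (F y)) m ->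
  m / (phN (N + k) (F b) * d%:R ^+ (N + k)) = l / (phN N (F b) * d%:R ^+ N).
Proof.
move=> Fd FN Nl Nm; rewrite (is_derive_uniq Nm (logder_step k Fd FN Nl)) (phN_add hc) //.
have n0 := phN_neq0 hc FN; rewrite natrX exprD.
have -> : phN N (F b) ^+ (d ^ k) = phN N (F b) ^+ (d ^ k).-1 * phN N (F b).
  by rewrite -exprSr prednK // expn_gt0 (ltn_trans _ d1).
exact: (field_aux4 _ (expf_neq0 (d ^ k).-1 n0) n0 (dC k) (dC N)).
Qed.

(** Both sides are the derivative of the logarithm s along F, which does not depend on the level at
    which s is read. *)
Lemma logder (F : C -> C2) b N M l m : differentiable F b -> lvl N (F b) -> lvl M (F b) ->
  is_derive b 1 (fun y => phN N (F y)) l -> is_derive b 1 (fun y => phN M (F y)) m ->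
  m / (phN M (F b) * d%:R ^+ M) = l / (phN N (F b) * d%:R ^+ N).
Proof.
move=> Fd FN FM Nl Mm; have A := logder_add Fd FN Nl (logder_step M Fd FN Nl).
have L := logder_step M Fd FN Nl; rewrite addnC in L.
by rewrite -A addnC; apply/esym; exact: logder_add L.
Qed.

Lemma phN_is_derive (F : C -> C2) b N : differentiable F b -> lvl N (F b) ->
  exists l, is_derive b 1 (fun y => phN N (F y)) l.
Proof.
move=> Fd FN; exists ('d (fun y => phN N (F y)) b 1); apply: diff_is_derive.
apply: (@differentiable_comp _ _ _ _ F (phN N)); first exact: Fd.
exact: (phN_differentiable hc FN).
Qed.

Lemma le_inv_eq0 (a : R) : 0 <= a -> (forall r, 0 < r -> a <= 2 / r) -> a = 0.
Proof.
move=> a0 ar; apply/eqP; rewrite eq_le a0 andbT leNgt; apply/negP => ap.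
have := ar (4 / a); rewrite divr_gt0 // => /(_ isT); apply/negP; rewrite -ltNge invf_div.
by rewrite mulrA ltr_pdivrMr //; lra.
Qed.

Lemma ball_csquare (z : C) r : nrm z < r -> csquare r z.
Proof.
by move=> zr; split; [apply: le_trans (Re_le_nrm z) _|apply: le_trans (Im_le_nrm z) _]; exact: ltW.
Qed.

(* If s(y) lifts F y then |exp(-s(y))| = exp(-G (F y)) < 1: apply Liouville. *)
Lemma entire_curve_derive (F : C -> C2) b N : (forall y, differentiable F y) -> (forall y, Up (F y)) ->
  lvl N (F b) -> is_derive b 1 (fun y => phN N (F y)) 0.
Proof.
move=> Fd FU FN; have [l Nl] := phN_is_derive (Fd b) FN.
suff : l / (phN N (F b) * d%:R ^+ N) = 0.
  move/eqP; rewrite mulf_eq0 invr_eq0 mulf_eq0 (negPf (phN_neq0 hc FN)) (negPf (dC N)) !orbF.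
  by move=> /eqP <-.
set la := l / _; apply/eqP; rewrite -nrm_eq0; apply/eqP.
have e0 : 0 < expR (- G (F b)) by exact: expR_gt0.
suff : nrm la * expR (- G (F b)) = 0 by move/eqP; rewrite mulf_eq0 (gt_eqF e0) orbF => /eqP.
apply: le_inv_eq0; first by rewrite mulr_ge0 ?nrm_ge0 // ltW.
move=> r r0; pose F1 y := F (b + y).
have F1d y : differentiable F1 y.
  apply: (@differentiable_comp _ _ _ _ (fun y : C => b + y) F); last exact: Fd.
  by apply: differentiableD; [exact: differentiable_cst|exact: differentiable_idC].
have [||M MP] := lvl_compact hc (g := F1) (@csquare_compact R r).
- by move=> y _; exact: diff_continuous_nrm (F1d y).
- by move=> y _; exact: FU.
have {}MP := MP M (leqnn M).
have psic y : csquare r y -> {for y, continuous (fun y => phN M (F1 y))}.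
  move=> yr; apply: (phN_comp_continuous hc); last exact: MP.
  exact: diff_continuous_nrm (F1d y).
have [|L LP] := log_lift_csquare (ltW r0) psic; first by move=> y yr; exact: (phN_neq0 hc (MP y yr)).
have Lder (y m : C) : nrm y < r -> is_derive y 1 (fun y => phN M (F1 y)) m ->
    is_derive y 1 L (m / phN M (F1 y)).
  move=> yr; have [c1 c2] := LP y (ball_csquare yr).
  apply: lift_is_derive; first exact: c1.
  apply/nbhs_nrmP; exists (r - nrm y); first by rewrite subr_gt0.
  move=> w wy; have [] // := LP w _; apply: ball_csquare.
  apply: le_lt_trans (nrm_subD w y) _; by rewrite -ltrBrDr.
pose u y := cexp (- (L y / d%:R ^+ M)).
have uder (y m : C) : nrm y < r -> is_derive y 1 (fun y => phN M (F1 y)) m ->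
    is_derive y 1 u (- (m / phN M (F1 y) / d%:R ^+ M) * u y).
  move=> yr ym; have L1 := Lder y m yr ym.
  have L2 : is_derive y 1 (fun y => - (L y / d%:R ^+ M)) (- (m / phN M (F1 y) / d%:R ^+ M)).
    apply: is_deriveN; have := is_deriveZ (d%:R ^+ M)^-1 L1.
    have -> : (d%:R ^+ M)^-1 *: (m / phN M (F1 y)) = m / phN M (F1 y) / d%:R ^+ M by rewrite [_ *: _]mulrC.
    by congr is_derive; apply/funext => w; rewrite mulrC.
  exact: (is_derive_compC (is_derive_cexp _) L2).
have r00 : nrm (0 : C) < r by rewrite nrm0.
have z0 := MP 0 (ball_csquare r00).
have [m Mm] := phN_is_derive (F1d 0) z0.
have F1b : F1 0 = F b by rewrite /F1 addr0.
have Nl1 : is_derive (0 : C) 1 (fun y => phN N (F1 y)) l.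
  have K : is_derive (0 + b : C) 1 (fun y => phN N (F y)) l by rewrite add0r.
  by have := is_derive_shiftr K; congr is_derive; apply/funext => w; rewrite /F1 addrC.
have laE : m / phN M (F1 0) / d%:R ^+ M = la.
  have FN1 : lvl N (F1 0) by rewrite F1b.
  by have := logder (F1d 0) FN1 z0 Nl1 Mm; rewrite invfM mulrA F1b.
have nu y : csquare r y -> nrm (u y) = expR (- G (F1 y)).
  move=> yr; have [_ c2] := LP y yr; rewrite /u nrm_cexp ReN; congr (expR (- _)).
  have E : cexp (d%:R ^+ M * (L y / d%:R ^+ M)) = phN M (F1 y) by rewrite mulrC divfK.
  by rewrite (G_lvl hc (MP y yr) E).
have := @cauchy_estimate R u 0 r 1 _ r0 _ _ (uder 0 m r00 Mm).
rewrite laE nrmM nrmN nu; last exact: ball_csquare.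
rewrite F1b mulr1; apply.
- move=> z; rewrite subr0 => zr; have [m' m'P] := phN_is_derive (F1d z) (MP z (ball_csquare zr)).
  exact: is_derive_diff (uder z m' zr m'P).
move=> z; rewrite subr0 => zr; rewrite nu; last exact: ball_csquare.
by rewrite -expR0 ler_expR oppr_le0 ltW // (G_gt0 hc) //; exact: FU.
Qed.

Lemma entire_curve_const (F : C -> C2) r : (forall y, differentiable F y) -> (forall y, Up (F y)) ->
  0 < r -> exists N, forall M, (N <= M)%N ->
  forall b, nrm b < r -> lvl M (F b) /\ phN M (F b) = phN M (F 0).
Proof.
move=> Fd FU r0.
have [||N NP] := lvl_compact hc (g := F) (@csquare_compact R r).
- by move=> y _; exact: diff_continuous_nrm (Fd y).
- by move=> y _; exact: FU.
exists N => M NM b br; have {}NP := NP M NM.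
split; first by apply: NP; exact: ball_csquare.
apply: (@derive_eq0_const R (fun y => phN M (F y)) 0 b) => u /andP[u0 u1].
rewrite add0r subr0; apply: entire_curve_derive => //; apply: NP; apply: ball_csquare.
rewrite nrmM nrm_rc ger0_norm //; apply: le_lt_trans br.
by rewrite ler_piMl ?nrm_ge0.
Qed.

Lemma entire_curve_Sg (F : C -> C2) b s : (forall y, differentiable F y) -> (forall y, Up (F y)) ->
  Sg (F 0) s <-> Sg (F b) s.
Proof.
move=> Fd FU; have b0 : 0 < nrm b + 1 by rewrite ltr_wpDl ?nrm_ge0.
have [N NP] := entire_curve_const Fd FU b0; have {}NP := NP N (leqnn N).
have [p1 _] : lvl N (F 0) /\ phN N (F 0) = phN N (F 0) by apply: NP; rewrite nrm0.
have [p2 p3] : lvl N (F b) /\ phN N (F b) = phN N (F 0) by apply: NP; rewrite ltrDl.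
by split; [apply: (phN_eq_Sg p1 p2 (esym p3))|apply: (phN_eq_Sg p2 p1 p3)].
Qed.

Lemma entire_curve_disp (F : C -> C2) b : (forall y, differentiable F y) -> (forall y, Up (F y)) ->
  disp (fun t => F (rc t * b)) 0.
Proof.
move=> Fd FU; have b0 : 0 < nrm b + 1 by rewrite ltr_wpDl ?nrm_ge0.
have [N NP'] := entire_curve_const Fd FU b0; have {}NP' := NP' N (leqnn N).
have NP (t : R) : 0 <= t <= 1 -> lvl N (F (rc t * b)) /\ phN N (F (rc t * b)) = phN N (F 0).
  move=> /andP[t0 t1]; apply: NP'; rewrite nrmM nrm_rc ger0_norm //.
  by apply: (@le_lt_trans _ _ (nrm b)); [rewrite ler_piMl ?nrm_ge0|rewrite ltrDl].
have [||L LP] := lift_exists hc (g := fun t => F (rc t * b)) (N := N).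
- move=> t; apply: (@continuous_comp _ _ _ (fun t => rc (cl t) * b) F); last exact: diff_continuous_nrm.
  apply: cvgM; last exact: cvg_cst.
  by apply: (@continuous_comp _ _ _ cl (@rc R)); [exact: cl_continuous|exact: rc_continuous].
- by move=> t /NP[].
have E0 : F (rc 0 * b) = F 0 by rewrite rc0 mul0r.
have K t : 0 <= t <= 1 -> phN N (F (rc t * b)) = phN N (F (rc 0 * b)).
  by move=> /NP[_ ->]; rewrite E0.
exists N, L; split; first exact: LP.
by rewrite (lift_uniq_const hc LP K) subrr mul0r.
Qed.

End EntireCurves.

(** * Derivatives along a segment and density of fractions *)

Section RayDerivative.
Context {R : realType}.
Local Notation C := (Cx R).

(** A complex derivative is already determined by the values on one real segment; loops only give
    information in the vertical direction. *)
Lemma is_derive_ray (F1 F2 : C -> C) (s v l1 l2 : C) : v != 0 -> is_derive s 1 F1 l1 -> is_derive s 1 F2 l2 ->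
  (forall t : R, 0 <= t <= 1 -> F1 (s + rc t * v) = F2 (s + rc t * v)) -> l1 = l2.
Proof.
move=> v0 D1 D2 E; apply/eqP; rewrite -subr_eq0 -nrm_eq0 eq_le nrm_ge0 andbT leNgt; apply/negP => l0.
have D : is_derive s 1 (fun z => F1 z - F2 z) (l1 - l2) by exact: is_deriveB.
have e0 : 0 < nrm (l1 - l2) / 2 by rewrite divr_gt0.
have [u u0 uP] := is_derive_nrm D e0.
have vn : 0 < nrm v by rewrite nrm_gt0.
pose t := Num.min 1 (u / 2 / nrm v).
have t0 : 0 < t by rewrite lt_min ltr01 !divr_gt0.
have t1 : t <= 1 by rewrite ge_min lexx.
have tu : t * nrm v < u.
  apply: (@le_lt_trans _ _ (u / 2)); last by rewrite ltr_pdivrMr // ltr_pMr // ltr1n.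
  by rewrite -ler_pdivlMr // ge_min lexx orbT.
have hn : nrm (rc t * v) = t * nrm v by rewrite nrmM nrm_rc gtr0_norm.
have K : nrm (F1 (s + rc t * v) - F2 (s + rc t * v) - (F1 s - F2 s) - (rc t * v) *: (l1 - l2))
    <= nrm (l1 - l2) / 2 * nrm (rc t * v) by apply: uP; rewrite hn.
have Et : F1 (s + rc t * v) = F2 (s + rc t * v) by apply: E; rewrite (ltW t0).
have E0 : F1 s = F2 s by have := E 0; rewrite rc0 mul0r addr0 lexx ler01; apply.
move: K; rewrite Et E0 !subrr sub0r nrmN nrmZ hn.
have p0 : 0 < t * nrm v by rewrite mulr_gt0.
rewrite mulrC ler_pM2r //; move: l0; move: (nrm (l1 - l2)) => x; lra.
Qed.

Lemma continuous_eps (E : R -> C) (t e : R) : {for t, continuous E} -> 0 < e ->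
  exists2 r : R, 0 < r & forall u, `|t - u| < r -> nrm (E u - E t) < e.
Proof.
move=> Ec e0; have N := (cvg_nrmP _ E (E t)).1 Ec e e0.
have [r /= r0 rP] := (@nbhs_ballP R R t (fun u => nrm (E u - E t) < e)).1 (N _).
by exists r.
Qed.

(** Denominators are powers of d because shifting s by 2 pi i k/d^j leaves the leaf unchanged. *)
Lemma dyadic_approx (d : nat) (t e : R) : (1 < d)%N -> 0 <= t -> 0 < e ->
  exists k j : nat, k%:R / d%:R ^+ j <= t /\ t - k%:R / d%:R ^+ j < e.
Proof.
move=> d1 t0 e0; have [j jP] := half_small e0.
have dj : 0 < d%:R ^+ j :> R by rewrite exprn_gt0 // ltr0n (ltn_trans _ d1).
exists (Num.trunc (t * d%:R ^+ j)), j.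
have td : 0 <= t * d%:R ^+ j by rewrite mulr_ge0 // ltW.
have /andP[T1 T2] := truncn_itv td.
split; first by rewrite ler_pdivrMr.
have T3 : t < ((Num.trunc (t * d%:R ^+ j)).+1)%:R / d%:R ^+ j by rewrite ltr_pdivlMr.
have B : (d%:R ^+ j)^-1 <= 2^-1 ^+ j :> R.
  rewrite exprVn lef_pV2 ?posrE ?exprn_gt0 ?ltr0n ?(ltn_trans _ d1) //.
  by apply: lerXn2r; rewrite ?nnegrE ?ler_nat ?ler0n.
move: T3; rewrite -natr1 mulrDl mul1r; move: jP B; move: (_^-1) (_ ^+ j) (_ / _) => a b c; lra.
Qed.

End RayDerivative.

(** * The shift of the logarithm induced by an automorphism *)

Section Kappa.
Context {R : realType}.
Local Notation C := (Cx R).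
Local Notation C2 := (Cx2 R).
Variables (H Hi : C2 -> C2) (Up : set C2) (G : C2 -> R) (d e : nat) (rho : R).
Variables (al q : C) (Q : C -> C) (Phi Psi : C2 -> C2) (Dm : set C2).
Hypothesis hc : henon_chart H Hi Up G d e rho al q Q Phi Psi Dm.

Local Notation lvl := (lvl H Dm).
Local Notation phN := (phN H Phi).
Local Notation Sg := (Sg H d Phi Dm).
Local Notation sdom := (sdom d rho).
Local Notation pt := (pt Hi d rho al Q Psi).
Local Notation lift := (lift H Phi Dm).
Local Notation disp := (disp H d Phi Dm).
Local Notation upath := (upath Up).

Let d1 : (1 < d)%N.
Proof. by have /andP[e0 ed] := hc_e hc; apply: leq_ltn_trans ed. Qed.
Let dC n : (d%:R ^+ n : C) != 0.
Proof. by rewrite expf_neq0 // pnatr_eq0 -lt0n (ltn_trans _ d1). Qed.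
Let dR n : 0 < (d%:R ^+ n : R).
Proof. by rewrite exprn_gt0 // ltr0n (ltn_trans _ d1). Qed.

Local Notation XI := (XI Up G).
Local Notation Tr := (Tr H Hi d rho al Q Phi Psi Dm).
Local Notation tpi := (mkc 0 (2 * pi) : C).
Variable I : set R.
Hypothesis Idn : forall x y, I y -> x <= y -> I x.
Variable f : C2 -> C2.
Hypotheses (fX : forall p, XI I p -> XI I (f p)) (fd : forall p, XI I p -> differentiable f p).

Lemma Tr_XI b p : XI I p -> XI I (Tr b p).
Proof. by move=> [pU pI]; split; [exact: (Tr_Up hc)|rewrite (Tr_G hc)]. Qed.

Lemma image_Tr_diff p : XI I p -> forall b, differentiable (fun b => f (Tr b p)) b.
Proof.
move=> pX b; apply: (@differentiable_comp _ _ _ _ (fun b => Tr b p) f).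
  by apply: (Tr_entire hc); case: pX.
by apply: fd; exact: Tr_XI.
Qed.

Lemma Sg_image p p' s u : XI I p -> XI I p' -> Sg p s -> Sg p' s -> Sg (f p) u -> Sg (f p') u.
Proof.
move=> pX pX' ps ps' fu; have [b ->] := Tr_exists hc ps ps'.
have := entire_curve_Sg hc b u (image_Tr_diff pX) (fun b => proj1 (fX (Tr_XI b pX))).
by rewrite (Tr0 hc) //; [move=> [K _]; exact: K|case: pX].
Qed.

Lemma sdom_Re N (s s' : C) : Re s <= Re s' -> sdom N s -> sdom N s'.
Proof.
move=> ss; rewrite /sdom !nrm_cexp !Re_dM => K; apply: (lt_le_trans K).
by rewrite ler_expR ler_pM2l.
Qed.

Lemma Re_vert (s : C) (t : R) : Re (s + rc t * tpi) = Re s.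
Proof. by rewrite ReD ReM /= mulr0 mul0r subr0 addr0. Qed.

Lemma vert_frac n k j (s : C) : (j <= n)%N ->
  cexp (d%:R ^+ n * (s + rc (k%:R / d%:R ^+ j) * tpi)) = cexp (d%:R ^+ n * s).
Proof.
move=> jn; rewrite mulrDr cexpD -[RHS]mulr1; congr (_ * _).
have -> : d%:R ^+ n * (rc (k%:R / d%:R ^+ j) * tpi) = ((k * d ^ (n - j))%N : int)%:~R * tpi.
  rewrite mulrA; congr (_ * _); rewrite rcM rcV rcX !rc_nat -{1}(subnK jn) exprD.
  by rewrite -pmulrn natrM natrX mulrACA mulfV // mulr1 mulrC.
exact: cexp_2pi_int.
Qed.

Lemma pt0_XI N (s : C) : sdom N s -> I (Re s) -> XI I (pt N 0 s).
Proof.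
move=> sN sI; have ps := pt_Sg hc 0 sN.
by split; [exact: (Sg_Up hc ps)|rewrite (G_Sg hc ps)].
Qed.

Lemma vert_continuous N (s : C) (a : R) : sdom N s ->
  continuous ((fun t => pt N 0 (s + rc (a * t) * tpi)) \o cl).
Proof.
move=> sN t; apply: (@continuous_comp _ _ _ (fun t => s + rc (a * cl t) * tpi) (pt N 0)).
  apply: cvgD; first exact: cvg_cst.
  apply: cvgM; last exact: cvg_cst.
  apply: (@continuous_comp _ _ _ (fun t => a * cl t) (@rc R)); last exact: rc_continuous.
  by apply: cvgM; [exact: cvg_cst|exact: cl_continuous].
apply: diff_continuous_nrm; apply: (pt_differentiable hc).
by apply: sdom_Re sN; rewrite Re_vert.
Qed.

Hypothesis fWP : WP H Up G d Phi Dm I f.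

Lemma f_comp_continuous (g : R -> C2) : continuous (g \o cl) -> (forall t, 0 <= t <= 1 -> XI I (g t)) ->
  continuous ((f \o g) \o cl).
Proof.
move=> gc gX t; apply: (@continuous_comp _ _ _ (g \o cl) f); first exact: gc.
by apply: diff_continuous_nrm; apply: fd; apply: gX; exact: cl_in.
Qed.

(* The path from s to s + 2 pi i k/d^j projects to a path in a single leaf, closed up
   by a translation path of zero increment; WP determines the increment of its image. *)
Lemma vert_disp N M (s : C) L k j : sdom N s -> I (Re s) ->
  lift (f \o (fun t => pt N 0 (s + rc t * tpi))) M L -> k%:R / d%:R ^+ j <= 1 :> R ->
  L (k%:R / d%:R ^+ j) - L 0 = d%:R ^+ M * (rc (k%:R / d%:R ^+ j) * tpi).
Proof.
move=> sN sI fL r1; set r : R := k%:R / d%:R ^+ j in r1 *.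
have r0 : 0 <= r by rewrite divr_ge0 // ltW.
pose g t := pt N 0 (s + rc (r * t) * tpi).
have sv t : sdom N (s + rc t * tpi) by apply: sdom_Re sN; rewrite Re_vert.
have vX t : XI I (pt N 0 (s + rc t * tpi)) by apply: pt0_XI => //; rewrite Re_vert.
pose p1 := pt N 0 (s + rc r * tpi).
have p1X : XI I p1 by exact: vX.
have p1s : Sg p1 s.
  have [m mP] := Sg_large hc (pt_Sg hc 0 (sv r)).
  have [q1 q2] := mP (m + j)%N (leq_addr _ _); exists (m + j)%N => //.
  by rewrite -q2 vert_frac // leq_addl.
have [b bE] := Tr_exists hc p1s (pt_Sg hc 0 sN).
pose g' t := Tr (rc t * b) p1.
have gc : continuous (g \o cl) by exact: vert_continuous.
have gX t : 0 <= t <= 1 -> XI I (g t) by move=> _; exact: vX.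
have Td : forall y, differentiable (fun y => Tr y p1) y by move=> y; apply: (Tr_entire hc); case: p1X.
have bc : continuous (fun t => rc (cl t) * b).
  move=> t; apply: cvgM; last exact: cvg_cst.
  by apply: (@continuous_comp _ _ _ cl (@rc R)); [exact: cl_continuous|exact: rc_continuous].
have gc' : continuous (g' \o cl).
  move=> t; apply: (@continuous_comp _ _ _ (fun t => rc (cl t) * b) (fun y => Tr y p1)); first exact: bc.
  exact: diff_continuous_nrm.
have gX' t : 0 <= t <= 1 -> XI I (g' t) by move=> _; exact: Tr_XI.
have g1 : g 1 = g' 0 by rewrite /g /g' mulr1 rc0 mul0r (Tr0 hc) //; case: p1X.
have gg : g' 1 = g 0 by rewrite /g' /g rc1 mul1r -bE mulr0 rc0 mul0r addr0.
have gp : is_path (R := R) (XI I) (g 0) (g 1) g by split; [apply/within_cl; exact: gc|exact: gX|by []|by []].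
have gp' : is_path (R := R) (XI I) (g 1) (g 0) g'.
  by split; [apply/within_cl; exact: gc'|exact: gX'|by []|by []].
have gD : disp g (rc r * tpi).
  exists N, (fun t => d%:R ^+ N * (s + rc (r * t) * tpi)); split.
    move=> t t01; have [q1 q2] := pt0_lvl hc (sv (r * t)); split; [exact: q1| |by rewrite -q2].
    apply: cvgM; first exact: cvg_cst.
    apply: cvgD; first exact: cvg_cst.
    apply: cvgM; last exact: cvg_cst.
    apply: (@continuous_comp _ _ _ (fun t => r * t) (@rc R)); last exact: rc_continuous.
    by apply: cvgM; [exact: cvg_cst|exact: cvg_id].
  by rewrite mulr1 mulr0 rc0 mul0r addr0 -mulrBr addrAC subrr add0r [d%:R ^+ N * _]mulrC mulfK.
have gD' : disp g' 0.
  by apply: (entire_curve_disp hc b Td) => y; case: (Tr_XI y p1X).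
have catp := is_path_cat gp gp'.
have catD := disp_cat hc g1 gD gD'; rewrite addr0 in catD.
have fcat := fWP catp catD.
have E : f \o path_cat g g' = path_cat (f \o g) (f \o g').
  by apply/funext => t; rewrite /path_cat /=; case: ifP.
rewrite E in fcat.
have fgD : disp (f \o g) ((L r - L 0) / d%:R ^+ M).
  exists M, (fun t => L (r * t)); split; last by rewrite mulr1 mulr0.
  move=> t /andP[t0 t1]; have rt : 0 <= r * t <= 1.
    by rewrite mulr_ge0 //= mulr_ile1.
  have [q1 q2 q3] := fL _ rt; split; [exact: q1| |exact: q3].
  apply: (@continuous_comp _ _ _ (fun t => r * t) L); last exact: q2.
  by apply: cvgM; [exact: cvg_cst|exact: cvg_id].
have fgD' : disp (f \o g') 0.
  exact: (entire_curve_disp hc b (image_Tr_diff p1X) (fun y => proj1 (fX (Tr_XI y p1X)))).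
have fg1 : (f \o g) 1 = (f \o g') 0 by rewrite /= g1.
have := disp_uniq hc fcat (disp_cat hc fg1 fgD fgD'); rewrite addr0 => ->.
by rewrite mulrC divfK.
Qed.

(** By [vert_disp] the lift of the image of a vertical segment has the increment of the segment
    itself at all fractions k/d^j, hence everywhere by continuity. The derivative along this segment
    is the complex derivative: the logarithm of f moves at unit speed in s. *)
Lemma theta_derive N M (s : C) : sdom N s -> I (Re s) -> lvl M (f (pt N 0 s)) ->
  is_derive s 1 (fun s => phN M (f (pt N 0 s))) (d%:R ^+ M * phN M (f (pt N 0 s))).
Proof.
move=> sN sI sM.
have sv t : sdom N (s + rc t * tpi) by apply: sdom_Re sN; rewrite Re_vert.
have vX t : XI I (pt N 0 (s + rc t * tpi)) by apply: pt0_XI => //; rewrite Re_vert.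
pose g t := pt N 0 (s + rc t * tpi).
have gc : continuous (g \o cl).
  rewrite (_ : g \o cl = (fun t => pt N 0 (s + rc (1 * t) * tpi)) \o cl).
    exact: vert_continuous.
  by apply/funext => t; rewrite /g /= mul1r.
have gX t : 0 <= t <= 1 -> XI I (g t) by move=> _; exact: vX.
have fgc := f_comp_continuous gc gX.
have fgu : upath (f \o g) by split; [exact: fgc|move=> t /gX/fX[]].
have [K KP] := upath_lvl hc fgu; have [L LP] := lift_exists hc fgc (KP K (leqnn K)).
have zz01 : 0 <= (0 : R) <= 1 by rewrite lexx ler01.
have Lt t : 0 <= t <= 1 -> L t = L 0 + d%:R ^+ K * (rc t * tpi).
  move=> t01; have /andP[t0 t1] := t01.
  apply/eqP; rewrite -subr_eq0 -nrm_eq0 eq_le nrm_ge0 andbT leNgt; apply/negP => p0.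
  pose E u := L u - (L 0 + d%:R ^+ K * (rc u * tpi)).
  have Ec : {for t, continuous E}.
    apply: cvgB; first by have [] := LP t t01.
    apply: cvgD; first exact: cvg_cst.
    apply: cvgM; first exact: cvg_cst.
    by apply: cvgM; [exact: rc_continuous|exact: cvg_cst].
  have [r r0 rP] := continuous_eps Ec p0.
  have [k [j [k1 k2]]] := dyadic_approx d1 t0 r0.
  have := rP (k%:R / d%:R ^+ j); rewrite ger0_norm ?subr_ge0 // => /(_ k2).
  rewrite {1}/E; have := vert_disp sN sI LP (le_trans k1 t1) => /eqP; rewrite subr_eq addrC => /eqP ->.
  by rewrite subrr sub0r nrmN ltxx.
have Th t : 0 <= t <= 1 -> phN K (f (g t)) = phN K (f (pt N 0 s)) * cexp (d%:R ^+ K * (rc t * tpi)).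
  move=> t01; have [_ _ <-] := LP t t01; rewrite Lt // cexpD; congr (_ * _).
  by have [_ _ ->] := LP 0 zz01; rewrite /= /g rc0 mul0r addr0.
have ptd : differentiable (fun s => f (pt N 0 s)) s.
  apply: (@differentiable_comp _ _ _ _ (pt N 0) f); first exact: (pt_differentiable hc).
  by apply: fd; exact: pt0_XI.
have sK : lvl K (f (pt N 0 s)).
  by have := KP K (leqnn K) 0 zz01; rewrite /= /g rc0 mul0r addr0.
have [l lP] := phN_is_derive hc ptd sM; have [m mP] := phN_is_derive hc ptd sK.
have t0 : tpi != 0.
  by apply/eqP => /(congr1 (@complex.Im R)) /= /eqP; rewrite mulf_eq0 pnatr_eq0 /= gt_eqF // pi_gt0.
have mE : m = d%:R ^+ K * phN K (f (pt N 0 s)).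
  pose F2 z := phN K (f (pt N 0 s)) * cexp (d%:R ^+ K * (z - s)).
  have D2 : is_derive s 1 F2 (d%:R ^+ K * phN K (f (pt N 0 s))).
    have i1 : is_derive s 1 (fun z : C => d%:R ^+ K * (z - s)) (d%:R ^+ K).
      have := is_derive_lin (d%:R ^+ K) (s - s : C) => i0.
      have := is_derive_shiftr (a := s) (b := - s) i0.
      by congr is_derive; apply/funext => w; rewrite mulrC.
    have i2 : is_derive (d%:R ^+ K * (s - s)) 1 (@cexp R) 1.
      by rewrite subrr mulr0 -{2}(@cexp0 R); exact: is_derive_cexp.
    have i3 := is_deriveZ (phN K (f (pt N 0 s)))
      (@is_derive_compC R _ (@cexp R) (fun z : C => d%:R ^+ K * (z - s)) s _ _ i2 i1).
    move: i3; congr is_derive; by rewrite /GRing.scale /= mulr1 mulrC.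
  apply: (is_derive_ray t0 mP D2) => t t01.
  by rewrite -/(g t) Th // /F2 addrAC subrr add0r.
have := logder hc ptd sK sM mP lP; rewrite mE.
have nK := phN_neq0 hc sK; have nM := phN_neq0 hc sM.
rewrite [d%:R ^+ K * _]mulrC divff ?mulf_neq0 // => /eqP.
rewrite -(inj_eq (mulIf (mulf_neq0 nM (dC M)))) divfK ?mulf_neq0 // mul1r => /eqP lE.
by rewrite lE in lP; rewrite mulrC.
Qed.

Lemma theta_segment N M (s0 s1 : C) :
  (forall t : R, 0 <= t <= 1 -> [/\ sdom N (s0 + rc t * (s1 - s0)), I (Re (s0 + rc t * (s1 - s0))) &
     lvl M (f (pt N 0 (s0 + rc t * (s1 - s0))))]) ->
  phN M (f (pt N 0 s1)) = phN M (f (pt N 0 s0)) * cexp (d%:R ^+ M * (s1 - s0)).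
Proof.
move=> tP.
have : phN M (f (pt N 0 s1)) * cexp (- (d%:R ^+ M * s1)) = phN M (f (pt N 0 s0)) * cexp (- (d%:R ^+ M * s0)).
  apply: (@derive_eq0_const R (fun s => phN M (f (pt N 0 s)) * cexp (- (d%:R ^+ M * s))) s0 s1) => t t01.
  have [t1 t2 t3] := tP t t01; move: (s0 + _) t1 t2 t3 => w t1 t2 t3.
  have D1 := theta_derive t1 t2 t3.
  have i1 : is_derive w 1 (fun z : C => - (d%:R ^+ M * z)) (- d%:R ^+ M).
    apply: is_deriveN; have := is_derive_lin (d%:R ^+ M : C) w.
    by congr is_derive; apply/funext => u; rewrite mulrC.
  have i2 := @is_derive_compC R _ (@cexp R) (fun z : C => - (d%:R ^+ M * z)) w _ _ (is_derive_cexp _) i1.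
  have := is_deriveM D1 i2; congr is_derive; rewrite /GRing.scale /=; ring.
rewrite !cexpN mulrBr cexpB => E.
by rewrite mulrCA -E mulrC divfK ?cexp_neq0.
Qed.

(** Integrate the unit derivative along a segment from a reference s0. As f sends points with a
    common logarithm to points with a common logarithm ([Sg_image]), it suffices to follow the
    points with z = 0. *)
Lemma kappa_exists : (exists2 x, 0 < x & I x) -> exists k, forall p s, XI I p -> Sg p s -> Sg (f p) (s + k).
Proof.
move=> [x x0 xI]; pose s0 := rc x; have Rs0 : Re s0 = x by [].
have [n0 n0P] : exists n, sdom n s0 by apply: (sdom_exists hc).
have p0X : XI I (pt n0 0 s0) by apply: pt0_XI.
have [u0 u0P] := Up_Sg hc (fX p0X).1.
exists (u0 - s0) => p s pX ps.
have Gs := G_Sg hc ps; have Rs : 0 < Re s by rewrite -Gs; apply: (G_gt0 hc); case: pX.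
have sI : I (Re s) by rewrite -Gs; case: pX.
have [n1 n1P] := sdom_exists hc Rs.
pose N := (n0 + n1)%N; have sN0 : sdom N s0 := sdom_le hc (leq_addr _ _) n0P.
have sN1 : sdom N s := sdom_le hc (leq_addl _ _) n1P.
pose sg (t : R) : C := s0 + rc t * (s - s0).
have Resg t : Re (sg t) = (1 - t) * x + t * Re s.
  by rewrite /sg ReD ReM ReB /= mul0r subr0; ring.
have sgN t : 0 <= t <= 1 -> sdom N (sg t).
  move=> /andP[t0 t1]; have [xs|sx] := leP x (Re s).
    by apply: sdom_Re sN0; rewrite Resg Rs0; nra.
  by apply: sdom_Re sN1; rewrite Resg; nra.
have sgI t : 0 <= t <= 1 -> I (Re (sg t)) by move=> t01; rewrite Resg; exact: (convex_I Idn).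
pose g t := pt N 0 (sg t).
have gX t : 0 <= t <= 1 -> XI I (g t) by move=> t01; apply: pt0_XI; [exact: sgN|exact: sgI].
have gc : continuous (g \o cl).
  move=> t; apply: (@continuous_comp _ _ _ (sg \o cl) (pt N 0)); last first.
    by apply: diff_continuous_nrm; apply: (pt_differentiable hc); apply: sgN; exact: cl_in.
  apply: cvgD; first exact: cvg_cst.
  apply: cvgM; last exact: cvg_cst.
  by apply: (@continuous_comp _ _ _ cl (@rc R)); [exact: cl_continuous|exact: rc_continuous].
have fgc := f_comp_continuous gc gX.
have fgu : upath (f \o g) by split; [exact: fgc|move=> t /gX/fX[]].
have [m mP] := upath_lvl hc fgu.
have s0E : sg 0 = s0 by rewrite /sg rc0 mul0r addr0.
have s1E : sg 1 = s by rewrite /sg rc1 mul1r addrC subrK.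
have zz01 : 0 <= (0 : R) <= 1 by rewrite lexx ler01.
have oo01 : 0 <= (1 : R) <= 1 by rewrite lexx ler01.
have q0X := gX 0 zz01; rewrite /g s0E in q0X.
have q1X := gX 1 oo01; rewrite /g s1E in q1X.
have q0u : Sg (f (pt N 0 s0)) u0.
  exact: Sg_image p0X q0X (pt_Sg hc 0 n0P) (pt_Sg hc 0 sN0) u0P.
have [m' m'P] := Sg_large hc q0u.
pose M := (m + m')%N; have [_ E0] := m'P M (leq_addl _ _); have {}mP := mP M (leq_addr _ _).
suff : Sg (f (pt N 0 s)) (s + (u0 - s0)).
  exact: Sg_image q1X pX (pt_Sg hc 0 sN1) ps.
exists M; first by have := mP 1 oo01; rewrite /= /g s1E.
rewrite (theta_segment (s0 := s0) (s1 := s)) ?E0; last first.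
  by move=> t t01; split; [exact: sgN|exact: sgI|exact: mP].
by rewrite -E0 -cexpD; congr cexp; ring.
Qed.

End Kappa.

(** * Automorphisms preserve G and are affine on leaves *)

Section Rigidity.
Context {R : realType}.
Local Notation C := (Cx R).
Local Notation C2 := (Cx2 R).
Variables (H Hi : C2 -> C2) (Up : set C2) (G : C2 -> R) (d e : nat) (rho : R).
Variables (al q : C) (Q : C -> C) (Phi Psi : C2 -> C2) (Dm : set C2).
Hypothesis hc : henon_chart H Hi Up G d e rho al q Q Phi Psi Dm.

Local Notation lvl := (lvl H Dm).
Local Notation phN := (phN H Phi).
Local Notation zN := (zN H Phi).
Local Notation Sg := (Sg H d Phi Dm).
Local Notation sdom := (sdom d rho).
Local Notation pt := (pt Hi d rho al Q Psi).
Local Notation disp := (disp H d Phi Dm).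

Local Notation XI := (XI Up G).
Local Notation Tr := (Tr H Hi d rho al Q Phi Psi Dm).
Local Notation WP := (WP H Up G d Phi Dm).

Lemma disp_ext g g' D : (forall t, 0 <= t <= 1 -> g t = g' t) -> disp g D -> disp g' D.
Proof. by move=> E [N [L [LP ->]]]; exists N, L; split=> // t t01; rewrite -E //; exact: LP. Qed.

Lemma Tr_lvl_diff M p p' : lvl M p -> lvl M p' -> phN M p' = phN M p ->
  p' = Tr ((zN M p' - zN M p) / al ^+ M) p.
Proof.
move=> pM pM' E; rewrite (Tr_lvl hc _ pM) [_ * (_ / _)]mulrC divfK ?expf_neq0 ?(hc_al hc) //.
by rewrite addrC subrK -E -(lvl_eqi hc pM').
Qed.

(** An automorphism together with its inverse, so that every result on f can be applied to g; [WP]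
    for g follows from [WP] for f ([waut_sym]). *)
Record waut (I : set R) (f g : C2 -> C2) : Prop := Waut {
  wa_fX : forall p, XI I p -> XI I (f p);
  wa_gX : forall p, XI I p -> XI I (g p);
  wa_fd : forall p, XI I p -> differentiable f p;
  wa_gd : forall p, XI I p -> differentiable g p;
  wa_gf : forall p, XI I p -> g (f p) = p;
  wa_fg : forall p, XI I p -> f (g p) = p;
  wa_WP : WP I f }.

Section Maps.
Variable I : set R.
Hypothesis Idn : forall x y, I y -> x <= y -> I x.

Lemma waut_sym f g : waut I f g -> waut I g f.
Proof.
move=> w; split; [exact: wa_gX w|exact: wa_fX w|exact: wa_gd w|exact: wa_fd w|exact: wa_fg w|exact: wa_gf w|].
move=> x y D yp yD.
have gc p : XI I p -> {for p, continuous g} by move=> pX; apply: diff_continuous_nrm; exact: wa_gd w p pX.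
have gyp := is_path_image (wa_gX w) gc yp.
have [D' D'P] := is_path_disp hc gyp.
have D'P2 := wa_WP w gyp D'P.
suff -> : D = D' by exact: D'P.
apply: (disp_uniq hc yD); apply: disp_ext D'P2 => t t01 /=.
by apply: (wa_fg w); case: yp => _ K _ _; exact: K.
Qed.

Lemma pt0_small f k : (exists2 x, 0 < x & I x) ->
  (forall p, XI I p -> XI I (f p)) ->
  (forall p s, XI I p -> Sg p s -> Sg (f p) (s + k)) -> 0 <= Re k.
Proof.
move=> [x x0 xI] fX kP; rewrite leNgt; apply/negP => k0.
pose y := Num.min x (- Re k / 2).
have y0 : 0 < y by rewrite lt_min x0 divr_gt0 // oppr_gt0.
have [n nP] : exists n, sdom n (rc y) by apply: (sdom_exists hc).
have pX : XI I (pt n 0 (rc y)) by apply: (pt0_XI hc) => //; apply: (Idn xI); rewrite /= ge_min lexx.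
have S := kP _ _ pX (pt_Sg hc 0 nP).
have := G_gt0 hc (fX _ pX).1; rewrite (G_Sg hc S) ReD.
have : Re (rc y) <= - Re k / 2 by rewrite /= ge_min lexx orbT.
by move: k0; move: (Re k) (Re (rc y)) => a b; lra.
Qed.

(** [pt0_small] gives a nonnegative real part to the shifts of both f and g, and these real parts
    add up to 0 because g inverts f. *)
Lemma kappa_imag f g : (exists2 x, 0 < x & I x) -> waut I f g ->
  exists k, [/\ Re k = 0, forall p s, XI I p -> Sg p s -> Sg (f p) (s + k),
     forall p s, XI I p -> Sg p s -> Sg (g p) (s - k) & forall p, XI I p -> G (f p) = G p].
Proof.
move=> Ine w; have w' := waut_sym w.
have [k kP] := kappa_exists hc Idn (wa_fX w) (wa_fd w) (wa_WP w) Ine.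
have k0 := pt0_small Ine (wa_fX w) kP.
have [k' kP'] := kappa_exists hc Idn (wa_fX w') (wa_fd w') (wa_WP w') Ine.
have k0' := pt0_small Ine (wa_fX w') kP'.
have Gf p : XI I p -> G (f p) = G p + Re k.
  move=> pX; have [s ps] := Up_Sg hc pX.1.
  by rewrite (G_Sg hc ps) (G_Sg hc (kP _ _ pX ps)) ReD.
have Gg p : XI I p -> G (g p) = G p + Re k'.
  move=> pX; have [s ps] := Up_Sg hc pX.1.
  by rewrite (G_Sg hc ps) (G_Sg hc (kP' _ _ pX ps)) ReD.
have [x x0 xI] := Ine.
have [n nP] : exists n, sdom n (rc x) by apply: (sdom_exists hc).
have p0X : XI I (pt n 0 (rc x)) by apply: (pt0_XI hc).
have kk : Re k + Re k' = 0.
  have := Gg _ (wa_fX w p0X); rewrite (wa_gf w p0X) (Gf _ p0X).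
  by move: (G _) (Re k) (Re k') => a b c; lra.
have Rk : Re k = 0 by move: k0 k0' kk; move: (Re k) (Re k') => a b; lra.
exists k; split=> // [p s pX ps|p pX]; last by rewrite Gf // Rk addr0.
(* The shift k' obtained for g agrees with -k only modulo 2 pi i Z[1/d]; comparing the logarithms s
   and s + k' + k of p makes the difference disappear at a high level. *)
have S := kP' _ _ pX ps; have S2 := kP _ _ (wa_gX w pX) S.
rewrite (wa_fg w pX) in S2.
have [N1 N1P] := Sg_large hc S; have [N2 N2P] := Sg_large hc S2; have [N3 N3P] := Sg_large hc ps.
pose N := (N1 + N2 + N3)%N.
have [a1 a2] : lvl N (g p) /\ cexp (d%:R ^+ N * (s + k')) = phN N (g p).
  by apply: N1P; rewrite /N -addnA leq_addr.
have [_ b2] : lvl N p /\ cexp (d%:R ^+ N * (s + k' + k)) = phN N p.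
  by apply: N2P; rewrite /N addnAC leq_addl.
have [_ c2] : lvl N p /\ cexp (d%:R ^+ N * s) = phN N p by apply: N3P; rewrite /N leq_addl.
exists N; first exact: a1.
rewrite -a2 mulrBr cexpB c2 -b2 -cexpB; congr cexp; ring.
Qed.

End Maps.

(** An entire curve stays in one leaf, and its parameter is unique by [Tr_inj]. Near each point it
    is a difference of z-coordinates at a fixed level divided by [al ^+ N], hence holomorphic. *)
Lemma curve_tau (F : C -> C2) : (forall y, differentiable F y) -> (forall y, Up (F y)) ->
  exists tau : C -> C, (forall y, differentiable tau y) /\ forall y, F y = Tr (tau y) (F 0).
Proof.
move=> Fd FU.
have ex y : exists t, F y = Tr t (F 0).
  have [s S0] := Up_Sg hc (FU 0).
  exact: (Tr_exists hc S0 ((entire_curve_Sg hc y s Fd FU).1 S0)).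
have [tau tauP] := choice ex; exists tau; split=> // y.
have r0 : 0 < nrm y + 1 by rewrite ltr_wpDl ?nrm_ge0.
have [N NP'] := entire_curve_const hc Fd FU r0; have {}NP := NP' N (leqnn N).
have [l0 _] : lvl N (F 0) /\ phN N (F 0) = phN N (F 0) by apply: NP; rewrite nrm0.
have [ly _] : lvl N (F y) /\ phN N (F y) = phN N (F 0) by apply: NP; rewrite ltrDl.
apply: (@diff_near _ _ _ (fun y => (zN N (F y) - zN N (F 0)) / al ^+ N)).
  apply/nbhs_nrmP; exists 1 => // x xy.
  have [lx px] : lvl N (F x) /\ phN N (F x) = phN N (F 0).
    apply: NP; rewrite -(subrK y x); apply: le_lt_trans (nrmD _ _) _.
    by rewrite addrC ltrD2l.
  by apply: (Tr_inj hc (FU 0)); rewrite -tauP; apply: esym; apply: Tr_lvl_diff.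
apply: differentiableM; last exact: differentiable_cst.
apply: differentiableB; last exact: differentiable_cst.
apply: (@differentiable_comp _ _ _ _ F (zN N)); first exact: Fd.
exact: (zN_differentiable hc).
Qed.

(** On the translates of p the maps f and g induce entire functions [tau] and [k] with k(tau(z)) =
    z. By [entire_affine] tau is affine, and it fixes 0. *)
Lemma image_Tr (I : set R) f g p : waut I f g -> XI I p ->
  exists2 A, A != 0 & forall b, f (Tr b p) = Tr (A * b) (f p).
Proof.
move=> w pX; have fpX := wa_fX w pX.
have TX b p' : XI I p' -> XI I (Tr b p') by exact: (Tr_XI hc).
have [tau [td tP]] := curve_tau (image_Tr_diff hc (wa_fd w) pX) (fun y => (wa_fX w (TX y p pX)).1).
have [k [kd kP]] := curve_tau (image_Tr_diff hc (wa_gd w) fpX) (fun y => (wa_gX w (TX y (f p) fpX)).1).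
have tP' y : f (Tr y p) = Tr (tau y) (f p) by rewrite tP (Tr0 hc pX.1).
have kP' y : g (Tr y (f p)) = Tr (k y) p by rewrite kP (Tr0 hc fpX.1) (wa_gf w pX).
have kt z : k (tau z) = z.
  by apply: (Tr_inj hc pX.1); rewrite -kP' -tP' (wa_gf w) //; exact: TX.
have [A A0 AP] := entire_affine td kd kt; exists A => // b.
have t0 : tau 0 = 0 by apply: (Tr_inj hc fpX.1); rewrite -tP' !(Tr0 hc) //; [exact: fpX.1|exact: pX.1].
by rewrite tP' AP t0 addr0.
Qed.

End Rigidity.

(** * The multiplier along a leaf *)

Section PowerSequences.
Context {R : realType}.
Local Notation C := (Cx R).

Lemma nrm_expr_sub1 (v : C) i : nrm v = 1 -> nrm (v ^+ i - 1) <= i%:R * nrm (v - 1).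
Proof.
move=> v1; elim: i => [|i IH]; first by rewrite expr0 subrr nrm0 mul0r.
have -> : v ^+ i.+1 - 1 = v * (v ^+ i - 1) + (v - 1) by rewrite exprS; ring.
apply: le_trans (nrmD _ _) _; rewrite nrmM v1 mul1r -natr1 mulrDl mul1r; exact: lerD.
Qed.

Lemma nrm_sum_ord n (F : 'I_n -> C) : nrm (\sum_i F i) <= \sum_i nrm (F i).
Proof.
elim/big_ind2: _ => [|x1 x2 y1 y2 h1 h2|//]; first by rewrite nrm0.
by apply: le_trans (nrmD _ _) _; exact: lerD.
Qed.

(** The quotient (v^d - 1) / (v - 1) is a sum of d powers of v, together within 1 of d; its modulus
    is at least d - 1 >= 1. *)
Lemma nrm_expr_expand (v : C) d : (1 < d)%N -> nrm v = 1 -> nrm (v - 1) * d%:R ^+ 2 <= 1 ->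
  nrm (v - 1) <= nrm (v ^+ d - 1).
Proof.
move=> d1 v1 vs; rewrite subrX1 nrmM ler_peMr ?nrm_ge0 //.
have E : (d%:R : C) = \sum_(i < d) v ^+ i - \sum_(i < d) (v ^+ i - 1).
  by rewrite -sumrB (eq_bigr (fun=> 1)) ?sumr_const ?card_ord // => i _; rewrite opprB addrC subrK.
have K1 : d%:R <= nrm (\sum_(i < d) v ^+ i) + nrm (\sum_(i < d) (v ^+ i - 1)).
  by rewrite -(nrm_nat d) E nrmB.
have K2 : nrm (\sum_(i < d) (v ^+ i - 1)) <= 1.
  apply: le_trans (nrm_sum_ord _) _; apply: le_trans vs.
  rewrite (_ : nrm (v - 1) * d%:R ^+ 2 = \sum_(i < d) d%:R * nrm (v - 1)); last first.
    by rewrite sumr_const card_ord -mulr_natl; ring.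
  apply: ler_sum => i _; apply: le_trans (nrm_expr_sub1 i v1) _.
  by rewrite ler_wpM2r ?nrm_ge0 // ler_nat ltnW.
have d2 : 2 <= d%:R :> R by rewrite ler_nat.
by move: K1 K2 d2; move: (nrm _) (nrm _) (d%:R) => a b c; lra.
Qed.

(** Within 1/d^2 of 1 the distance to 1 never decreases under the d-th power, so it tends to 0 only
    if it vanishes. *)
Lemma power_seq_to1 (w : nat -> C) d : (1 < d)%N -> (forall l, w l.+1 = w l ^+ d) ->
  (forall l, nrm (w l) = 1) ->
  (forall eps : R, 0 < eps -> exists K, forall l, (K <= l)%N -> nrm (w l - 1) < eps) -> exists L, w L = 1.
Proof.
move=> d1 wS w1 wc; have d0 : 0 < d%:R :> R by rewrite ltr0n (ltn_trans _ d1).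
have [|K KP] := wc (d%:R ^+ 2)^-1; first by rewrite invr_gt0 exprn_gt0.
exists K; apply/eqP; rewrite -subr_eq0 -nrm_eq0 eq_le nrm_ge0 andbT leNgt; apply/negP => a0.
have mono j : nrm (w K - 1) <= nrm (w (K + j)%N - 1).
  elim: j => [|j IH]; first by rewrite addn0.
  apply: le_trans IH _; rewrite addnS wS; apply: nrm_expr_expand => //.
  rewrite -ler_pdivlMr ?exprn_gt0 // mul1r; apply/ltW/KP; exact: leq_addr.
have [M MP] := wc _ a0.
by have := MP (K + M)%N (leq_addl _ _); rewrite ltNge mono.
Qed.

Lemma growth_seq (x : nat -> R) (m : R) d : (1 < d)%N -> (forall k, x k.+1 = x k ^+ d) ->
  1 <= m -> m <= x 0%N -> forall k, m ^+ k.+1 <= x k /\ x 0%N <= x k.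
Proof.
move=> d1 xS m1 mx; elim=> [|k [I1 I2]]; first by rewrite expr1.
have x1 : 1 <= x k by apply: le_trans I2; exact: le_trans mx.
have x2 : x k * x k <= x k.+1.
  by rewrite xS -expr2; apply: ler_weXn2l.
split.
  apply: le_trans x2; rewrite exprS; apply: ler_pM => //.
  - by apply: le_trans m1.
  - by rewrite exprn_ge0 // (le_trans _ m1).
  - exact: le_trans I2.
apply: le_trans I2 (le_trans _ x2); rewrite ler_peMl //; exact: le_trans x1.
Qed.

Lemma inv_aux (u v w : C) : u != 0 -> v != 0 -> u * ((v * u)^-1 * w) = w / v.
Proof. by move=> u0 v0; field; rewrite u0 v0. Qed.

Lemma four_quarters (a b x eps q1 q2 z1 z2 : R) : a <= z2 + z1 -> b <= q2 + q1 ->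
  q1 <= eps / 4 * x -> q2 <= eps / 4 * x -> z1 <= eps / 4 * x -> z2 <= eps / 4 * x -> a + b <= eps * x.
Proof. by lra. Qed.

End PowerSequences.

(** * Displacement between points over s and s + 2 pi i/d^(l+1) *)

Section ShiftAsymptotics.
Context {R : realType}.
Local Notation C := (Cx R).
Local Notation C2 := (Cx2 R).
Variables (H Hi : C2 -> C2) (Up : set C2) (G : C2 -> R) (d e : nat) (rho : R).
Variables (al q : C) (Q : C -> C) (Phi Psi : C2 -> C2) (Dm : set C2).
Hypothesis hc : henon_chart H Hi Up G d e rho al q Q Phi Psi Dm.

Let d1 : (1 < d)%N.
Proof. by have /andP[e0 ed] := hc_e hc; apply: leq_ltn_trans ed. Qed.
Let dC n : (d%:R ^+ n : C) != 0.
Proof. by rewrite expf_neq0 // pnatr_eq0 -lt0n (ltn_trans _ d1). Qed.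

Local Notation tpi := (mkc 0 (2 * pi) : C).
Local Notation zz := (zz d al Q).

Lemma Q_asym (eps : R) : 0 < eps -> exists2 r, 0 < r & forall z, r < nrm z ->
  nrm (Q z - q * z ^+ (d + e)) <= eps * nrm z ^+ (d + e).
Proof.
move=> e0; have [r r0 rP] := near_cx_infty ((cvg_nrmP _ (fun z => Q z / z ^+ (d + e)) q).1 (hc_Q hc) eps e0).
exists r => // z zr; have z0 : z != 0 by rewrite -nrm_gt0 (lt_trans r0).
have zn : z ^+ (d + e) != 0 by rewrite expf_neq0.
have -> : Q z - q * z ^+ (d + e) = (Q z / z ^+ (d + e) - q) * z ^+ (d + e) by rewrite mulrBl divfK.
by rewrite nrmM nrmX ler_wpM2r ?exprn_ge0 ?nrm_ge0 // ltW // rP.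
Qed.

Lemma Q_bound : exists k B : R, [/\ 0 < k, 0 < B & forall z, k < nrm z -> nrm (Q z) <= B * nrm z ^+ (d + e)].
Proof.
have [r r0 rP] := Q_asym ltr01; exists r, (1 + nrm q); split=> //; first by rewrite ltr_wpDr ?nrm_ge0.
move=> z zr; rewrite -(subrK (q * z ^+ (d + e)) (Q z)); apply: le_trans (nrmD _ _) _.
by rewrite mulrDl lerD // ?rP // nrmM nrmX.
Qed.

(** Otherwise d would divide d + e, although 0 < e < d. This is where the exact range of e matters:
    the leading coefficient of the displacement does not vanish. *)
Lemma shift_root_neq1 : cexp ((d + e)%:R * (tpi / d%:R)) != 1.
Proof.
apply/eqP => /cexp_eq1[n nE]; have /andP[e0 ed] := hc_e hc.
have t0 : tpi != 0.
  by rewrite -nrm_eq0 nrm_def /= expr0n add0r sqrtr_sqr normr_eq0 mulf_neq0 ?pnatr_eq0 // gt_eqF // pi_gt0.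
have dn0 : (d%:R : C) != 0 by have := dC 1; rewrite expr1.
have E : ((d + e)%:R : C) = n%:~R * d%:R.
  apply: (mulIf t0); rewrite mulrAC -nE; field; exact: dn0.
have {}E : ((d + e)%N%:Z : int) = n * d%:Z.
  apply: (@intr_inj C); rewrite intrM; exact: E.
have dd : (d %| d + e)%N by apply/dvdnP; exists `|n|%N; rewrite -[RHS]/(`|n| * `|d%:Z|)%N -abszM -E.
by move: dd; rewrite dvdn_addr // => /(dvdn_leq e0); rewrite leqNgt ed.
Qed.

(* Since s and s + 2 pi i/d^(N+k+1) have the same exponential at level N+k+1, the points
   over them differ by a translation: see pt_gap. *)
Definition gapE (N k : nat) (s : C) : C :=
  zz N k.+1 0 (s + rc (d%:R ^+ (N + k).+1)^-1 * tpi) - zz N k.+1 0 s.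

Section Growth.
Variables (k0 B : R) (N : nat) (s : C).
Hypotheses (B0 : 0 < B) (QB : forall z, k0 < nrm z -> nrm (Q z) <= B * nrm z ^+ (d + e)).
Let x k := nrm (cexp (d%:R ^+ (N + k) * s)).
Hypotheses (xk : k0 < x 0%N) (xa : 2 * (nrm al + 1) <= x 0%N).

Let m1 : 2 <= 2 * (nrm al + 1).
Proof. by rewrite ler_peMr // ler_wpDl ?nrm_ge0. Qed.

Lemma xS k : x k.+1 = x k ^+ d.
Proof. by rewrite /x addnS cexp_dS nrmX. Qed.

(** The factor |al| + 1 outweighs the powers of [al], and the factor 2 leaves a geometric decay for
    the error terms. *)
Lemma x_growth k : (2 * (nrm al + 1)) ^+ k.+1 <= x k /\ x 0%N <= x k.
Proof. by apply: growth_seq d1 xS _ xa k; apply: le_trans m1; rewrite ler1n. Qed.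

Lemma x_growth2 k : 2 ^+ k.+1 <= x k.
Proof.
apply: le_trans (x_growth k).1; apply: lerXn2r => //; rewrite nnegrE //.
exact: le_trans m1.
Qed.

(** Stated for every a of the same modulus as s, to cover both points compared in [gapE]. The
    additional factor x k in the last bound shows that z is of lower order than |zeta|^(d+e). *)
Lemma zz_bound1 (a : C) k : nrm (cexp (d%:R ^+ N * a)) = x 0%N ->
  (forall j, nrm (cexp (d%:R ^+ (N + j) * a)) = x j) /\
  (nrm (zz N k 0 a) <= B * x k ^+ (d + e) /\ nrm (zz N k.+1 0 a) * x k <= (nrm al + 1) * B * x k.+1 ^+ (d + e)).
Proof.
move=> ax; have xj j : nrm (cexp (d%:R ^+ (N + j) * a)) = x j.
  by rewrite /x !cexp_dD !nrmX ax /x addn0.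
split=> //.
have xp j : 1 <= x j.
  by apply: le_trans (x_growth2 j); rewrite exprn_ege1 // ler1n.
have step j : nrm (zz N j 0 a) <= B * x j ^+ (d + e) ->
    nrm (zz N j.+1 0 a) * x j <= (nrm al + 1) * B * x j.+1 ^+ (d + e).
  move=> IH; rewrite zzS.
  have K1 : nrm (al * zz N j 0 a + Q (cexp (d%:R ^+ (N + j) * a))) <= (nrm al + 1) * B * x j ^+ (d + e).
    apply: le_trans (nrmD _ _) _; rewrite -mulrA mulrDl mul1r; apply: lerD.
      by rewrite nrmM ler_wpM2l ?nrm_ge0.
    by rewrite -xj; apply: QB; rewrite xj; apply: lt_le_trans xk (x_growth j).2.
  have c0 : 0 <= (nrm al + 1) * B by rewrite mulr_ge0 ?addr_ge0 ?nrm_ge0 // ltW.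
  have xj0 : 0 <= x j by apply: nrm_ge0.
  apply: le_trans (ler_wpM2r xj0 K1) _; rewrite -[leLHS]mulrA; apply: ler_wpM2l => //.
  rewrite xS -exprM -exprSr; apply: ler_weXn2l => //.
  apply: (@leq_trans ((d + e) * 2)%N); last by rewrite [leqRHS]mulnC leq_pmul2l // ltn_addr // (ltn_trans _ d1).
  by rewrite muln2 -addnn -addn1 leq_add2l addn_gt0 (ltn_trans _ d1).
have main j : nrm (zz N j 0 a) <= B * x j ^+ (d + e).
  elim: j => [|j IH].
    by rewrite /zz /= nrm0 mulr_ge0 ?exprn_ge0 ?nrm_ge0 // ltW.
  have K := step _ IH; have xa2 : nrm al + 1 <= x j.
    apply: le_trans (x_growth j).2; apply: le_trans xa; have := nrm_ge0 al; move: (nrm al) => u; lra.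
  have a1 : 0 < nrm al + 1 by rewrite ltr_wpDl ?nrm_ge0.
  rewrite -(ler_pM2r a1); apply: le_trans (_ : nrm (zz N j.+1 0 a) * x j <= _).
    by rewrite ler_wpM2l ?nrm_ge0.
  by apply: le_trans K _; rewrite [leRHS]mulrC mulrA.
by split; [exact: main|exact: step (main k)].
Qed.

Lemma zz_bound2 (a : C) k : nrm (cexp (d%:R ^+ N * a)) = x 0%N ->
  nrm (zz N k 0 a) * 2 ^+ k <= (nrm al + 1) * B * x k ^+ (d + e).
Proof.
move=> ax; have c0 : 0 <= (nrm al + 1) * B by rewrite mulr_ge0 ?addr_ge0 ?nrm_ge0 // ltW.
case: k => [|k].
  by rewrite /zz /= nrm0 mul0r mulr_ge0 // exprn_ge0 // nrm_ge0.
have [_ [_ K]] := zz_bound1 k ax; apply: le_trans K.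
by rewrite ler_wpM2l ?nrm_ge0 // x_growth2.
Qed.

(** At level N + k + 1 both z-coordinates are dominated by their last summand q zeta^(d+e), and the
    shift multiplies zeta by exp(2 pi i/d). The four error terms, two from Q and two from the
    earlier summands, take eps/4 each. *)
Lemma gapE_asym (eps : R) : 0 < eps -> exists K, forall k, (K <= k)%N ->
  nrm (gapE N k s - q * (cexp ((d + e)%:R * (tpi / d%:R)) - 1) * cexp (d%:R ^+ (N + k) * s) ^+ (d + e))
    <= eps * x k ^+ (d + e).
Proof.
move=> e0; have [r r0 rP] := Q_asym (divr_gt0 e0 (ltr0n _ 4)).
have c0 : 0 < nrm al * ((nrm al + 1) * B) + 1.
  by rewrite ltr_wpDl // mulr_ge0 ?nrm_ge0 // mulr_ge0 ?addr_ge0 ?nrm_ge0 // ltW.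
have [n1 n1P] := half_small (divr_gt0 (divr_gt0 e0 (ltr0n _ 4)) c0).
have r1 : 0 < r^-1 by rewrite invr_gt0.
have [n2 n2P] := half_small r1.
exists (n1 + n2)%N => k Kk; rewrite /gapE; set s' := s + _.
have Rs' : cexp (d%:R ^+ N * s') = cexp (d%:R ^+ N * s) * cexp (rc (d%:R ^+ N / d%:R ^+ (N + k).+1) * tpi).
  by rewrite -cexpD /s' mulrDr mulrA rcM rcX rc_nat.
have s'x : nrm (cexp (d%:R ^+ N * s')) = x 0%N.
  rewrite Rs' nrmM [nrm (cexp (rc _ * _))]nrm_cexp ReM /= mul0r mulr0 subr0 expR0 mulr1.
  by rewrite /x addn0.
have X' : cexp (d%:R ^+ (N + k) * s') = cexp (d%:R ^+ (N + k) * s) * cexp (tpi / d%:R).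
  rewrite -cexpD /s' mulrDr; congr (cexp (_ + _)).
  rewrite rcV rcX rc_nat exprS; have a0 := dC (N + k)%N; have b0 := dC 1; rewrite expr1 in b0.
  exact: inv_aux.
have s0x : nrm (cexp (d%:R ^+ N * s)) = x 0%N by rewrite /x addn0.
have [xj' _] := zz_bound1 0 s'x.
rewrite !zzS; set X := cexp (d%:R ^+ (N + k) * s) in X' *.
have xX : nrm X = x k by [].
have xX' : nrm (cexp (d%:R ^+ (N + k) * s')) = x k by apply: xj'.
have xr : r < x k.
  apply: lt_le_trans (x_growth2 k).
  have : (2^-1 : R) ^+ k.+1 < r^-1.
    by apply: le_lt_trans n2P; apply: ler_wiXn2l => //; rewrite ?invf_le1 ?ler1n //; apply: leq_trans (leqW Kk); exact: leq_addl.
  by rewrite exprVn ltf_pV2 ?posrE ?exprn_gt0.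
have Q1 : nrm (Q X - q * X ^+ (d + e)) <= eps / 4 * x k ^+ (d + e) by rewrite -xX; apply: rP; rewrite xX.
have Q2 : nrm (Q (cexp (d%:R ^+ (N + k) * s')) - q * (cexp (d%:R ^+ (N + k) * s')) ^+ (d + e))
    <= eps / 4 * x k ^+ (d + e) by rewrite -xX'; apply: rP; rewrite xX'.
have zb (a : C) : nrm (cexp (d%:R ^+ N * a)) = x 0%N ->
    nrm (al * zz N k 0 a) <= eps / 4 * x k ^+ (d + e).
  move=> ax; have Z := zz_bound2 k ax.
  have p2 : 0 < (2 ^+ k : R) by rewrite exprn_gt0.
  have xk0 : 0 <= x k ^+ (d + e) by rewrite exprn_ge0 // nrm_ge0.
  have h2 : (nrm al * ((nrm al + 1) * B) + 1) <= eps / 4 * 2 ^+ k.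
    rewrite [leRHS]mulrC -ler_pdivrMr; last by rewrite divr_gt0.
    have : (2^-1 : R) ^+ k < eps / 4 / (nrm al * ((nrm al + 1) * B) + 1).
      by apply: le_lt_trans n1P; apply: ler_wiXn2l => //; rewrite ?invf_le1 ?ler1n //; apply: leq_trans Kk; exact: leq_addr.
    move=> /ltW; rewrite exprVn; rewrite -[leRHS]invf_div lef_pV2 ?posrE ?divr_gt0 //.
  rewrite nrmM -(ler_pM2r p2) -[leLHS]mulrA.
  apply: le_trans (ler_wpM2l (nrm_ge0 _) Z) _; rewrite mulrA [leRHS]mulrAC.
  by apply: ler_wpM2r => //; apply: le_trans h2; rewrite lerDl.
have Z1 := zb _ s0x; have Z2 := zb _ s'x.
have -> : al * zz N k 0 s' + Q (cexp (d%:R ^+ (N + k) * s')) - (al * zz N k 0 s + Q X) -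
    q * (cexp ((d + e)%:R * (tpi / d%:R)) - 1) * X ^+ (d + e) =
  al * zz N k 0 s' - al * zz N k 0 s + ((Q (cexp (d%:R ^+ (N + k) * s')) - q * (cexp (d%:R ^+ (N + k) * s')) ^+ (d + e))
   - (Q X - q * X ^+ (d + e))).
  rewrite X' exprMn cexpMn; ring.
apply: le_trans (nrmD _ _) _.
exact: (four_quarters (nrmB _ _) (nrmB _ _) Q1 Q2 Z1 Z2).
Qed.

End Growth.
End ShiftAsymptotics.

(** * Comparison of f with the vertical shift *)

Section Multiplier.
Context {R : realType}.
Local Notation C := (Cx R).
Local Notation C2 := (Cx2 R).
Variables (H Hi : C2 -> C2) (Up : set C2) (G : C2 -> R) (d e : nat) (rho : R).
Variables (al q : C) (Q : C -> C) (Phi Psi : C2 -> C2) (Dm : set C2).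
Hypothesis hc : henon_chart H Hi Up G d e rho al q Q Phi Psi Dm.

Local Notation PsiF := (fullPsi Hi d rho al Q Psi).
Local Notation lvl := (lvl H Dm).
Local Notation phN := (phN H Phi).
Local Notation zN := (zN H Phi).
Local Notation Sg := (Sg H d Phi Dm).
Local Notation sdom := (sdom d rho).
Local Notation pt := (pt Hi d rho al Q Psi).
Local Notation upath := (upath Up).

Let d1 : (1 < d)%N.
Proof. by have /andP[e0 ed] := hc_e hc; apply: leq_ltn_trans ed. Qed.

Local Notation XI := (XI Up G).
Local Notation Tr := (Tr H Hi d rho al Q Phi Psi Dm).
Local Notation tpi := (mkc 0 (2 * pi) : C).
Local Notation zz := (zz d al Q).
Local Notation gapE := (gapE d al Q).
Local Notation waut := (waut H Up G d Phi Dm).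

Lemma pt_gap N k (s : C) : sdom N s ->
  pt N 0 (s + rc (d%:R ^+ (N + k).+1)^-1 * tpi) = Tr (gapE N k s / al ^+ (N + k).+1) (pt N 0 s).
Proof.
move=> sN; have a0 : al ^+ (N + k).+1 != 0 by rewrite expf_neq0 // (hc_al hc).
have sN' : sdom N (s + rc (d%:R ^+ (N + k).+1)^-1 * tpi).
  by apply: (sdom_Re hc _ sN); rewrite Re_vert.
have sNk : sdom (N + k.+1) s by apply: (sdom_le hc) sN; exact: leq_addr.
rewrite (pt_shift hc k.+1 _ sN) (pt_shift hc k.+1 _ sN') (Tr_pt hc) // addnS.
rewrite [_ * (_ / _)]mulrC divfK // /gapE [zz _ _ _ s + _]addrC subrK !ptE; congr (iter _ Hi (PsiF (_, _))).
have := vert_frac hc 1 s (leqnn (N + k).+1); rewrite mul1r; exact.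
Qed.

Section Automorphism.
Variable I : set R.
Hypothesis Idn : forall x y, I y -> x <= y -> I x.
Variables (f g : C2 -> C2) (k : C).
Hypotheses (w : waut I f g) (k0 : Re k = 0).
Hypothesis kP : forall p s, XI I p -> Sg p s -> Sg (f p) (s + k).

(** Both points have the logarithm s + k + 2 pi i t, hence differ by a translation. A continuous
    choice of it at one level is bounded over the compact segment, uniformly for all the shifts
    1/d^l used later. *)
Lemma vertical_offset N (s : C) : sdom N s -> I (Re s) -> exists (B : R -> C) (K : R),
  forall t : R, 0 <= t <= 1 ->
    f (pt N 0 (s + rc t * tpi)) = Tr (B t) (pt N 0 (s + k + rc t * tpi)) /\ nrm (B t) <= K.
Proof.
move=> sN sI.
have skN : sdom N (s + k) by apply: (sdom_Re hc _ sN); rewrite ReD k0 addr0.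
have sNt (t : R) : sdom N (s + rc t * tpi) by apply: (sdom_Re hc _ sN); rewrite Re_vert.
have skNt (t : R) : sdom N (s + k + rc t * tpi) by apply: (sdom_Re hc _ skN); rewrite Re_vert.
have pX (t : R) : XI I (pt N 0 (s + rc t * tpi)) by apply: (pt0_XI hc) => //; rewrite Re_vert.
have vc (a : C) : sdom N a -> continuous ((fun t => pt N 0 (a + rc t * tpi)) \o cl).
  move=> aN; rewrite (_ : (fun t => _) = (fun t => pt N 0 (a + rc (1 * t) * tpi))).
    by move=> t; exact: (vert_continuous hc aN).
  by apply/funext => t; rewrite mul1r.
pose gA (t : R) := f (pt N 0 (s + rc t * tpi)); pose gB (t : R) := pt N 0 (s + k + rc t * tpi).
have gAc : continuous (gA \o cl).
  apply: (f_comp_continuous (wa_fd w) (g := fun t => pt N 0 (s + rc t * tpi))) => //.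
  exact: vc sN.
have gBc : continuous (gB \o cl) by exact: vc skN.
have gAu : upath gA by split; [exact: gAc|move=> t _; exact: (wa_fX w (pX t)).1].
have [m mP] := upath_lvl hc gAu.
have pE0 : s + rc 0 * tpi = s by rewrite rc0 mul0r addr0.
have p0X := pX 0; rewrite pE0 in p0X.
have S0 := kP p0X (pt_Sg hc 0 sN).
have [m' m'P] := Sg_large hc S0.
pose M := (N + (m + m'))%N.
have gAl (t : R) : 0 <= t <= 1 -> lvl M (gA t).
  by apply: mP; rewrite /M addnCA leq_addr.
have [_ M0] : lvl M (f (pt N 0 s)) /\ cexp (d%:R ^+ M * (s + k)) = phN M (f (pt N 0 s)).
  by apply: m'P; rewrite /M addnA leq_addl.
have gAp (t : R) : 0 <= t <= 1 -> phN M (gA t) = cexp (d%:R ^+ M * (s + k + rc t * tpi)).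
  move=> /andP[t0 t1]; rewrite /gA (theta_segment hc (wa_fX w) (wa_fd w) (wa_WP w) (N := N) (s0 := s)).
    by rewrite -M0 -cexpD; congr cexp; rewrite -mulrDr addrA addrAC [in RHS]addrAC; congr (_ * _); ring.
  move=> u /andP[u0 u1]; have -> : s + rc u * (s + rc t * tpi - s) = s + rc (u * t) * tpi.
    by rewrite rcM -mulrA; congr (s + rc u * _); rewrite addrAC subrr add0r.
  split; [exact: sNt|by rewrite Re_vert|].
  by apply: gAl; rewrite mulr_ge0 //= mulr_ile1.
have gBl (t : R) : lvl M (gB t) /\ phN M (gB t) = cexp (d%:R ^+ M * (s + k + rc t * tpi)).
  have [l1 l2] := pt0_lvl hc (skNt t); split; first by apply: (lvl_le hc) l1; exact: leq_addr.
  by rewrite /M (phN_add hc _ l1) l2 cexp_dD.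
pose B (t : R) := (zN M (gA t) - zN M (gB t)) / al ^+ M.
have Bc : continuous (fun t => nrm (B (cl t)) : R).
  move=> t; apply: (@continuous_comp _ _ _ (fun t => B (cl t)) (nrm : C -> R)); last exact: nrm_continuous.
  apply: cvgM; last exact: cvg_cst.
  apply: cvgB.
    apply: (zN_comp_continuous hc (g := gA \o cl)); first exact: gAc.
    by apply: gAl; exact: cl_in.
  by apply: (zN_comp_continuous hc (g := gB \o cl)); [exact: gBc|exact: (gBl _).1].
have [c _ cP] : exists2 c : R, c \in `[0, 1]%R & forall t, t \in `[0, 1]%R -> nrm (B (cl t)) <= nrm (B (cl c)).
  by apply: EVT_max => //; apply: continuous_subspaceT; exact: Bc.
exists B, (nrm (B (cl c))) => t t01; split.
  apply: (Tr_lvl_diff hc); [exact: (gBl t).1|exact: gAl|].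
  by rewrite (gAp t t01) (gBl t).2.
by have := cP t; rewrite in_itv /= cl_id //; apply.
Qed.

End Automorphism.
End Multiplier.

(** * Identities and bounds for the multiplier *)

Section MultiplierAlgebra.
Context {R : realType}.
Local Notation C := (Cx R).

Lemma offset_identity (A g1 g2 a B0 B1 : C) : a != 0 -> A * (g1 / a) + B0 = B1 + g2 / a ->
  g2 - A * g1 = a * (B0 - B1).
Proof.
move=> a0 E; have -> : B0 = B1 + g2 / a - A * (g1 / a) by rewrite -E addrC addKr.
by field.
Qed.

Lemma multiplier_identity (c X u A g1 g2 a B0 B1 : C) : g2 - A * g1 = a * (B0 - B1) ->
  c * X * (u - A) = (A * (g1 - c * X) - (g2 - c * (X * u))) + a * (B0 - B1).
Proof. by move=> <-; ring. Qed.

Lemma multiplier_bound (x c v a K eps A : R) : 0 < x -> 0 < c -> 0 < eps -> 0 <= A ->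
  c * x * v <= A * (eps * c / (2 * (A + 2)) * x) + eps * c / (2 * (A + 2)) * x + eps * c / (2 * (A + 2)) * x ->
  v < eps.
Proof.
move=> x0 c0 e0 A0; have -> : A * (eps * c / (2 * (A + 2)) * x) + eps * c / (2 * (A + 2)) * x +
   eps * c / (2 * (A + 2)) * x = c * x * (eps / 2).
  field; rewrite gt_eqF //; lra.
rewrite ler_pM2l ?mulr_gt0 //; move: e0; lra.
Qed.

Lemma geometric_bound (a K eps x y : R) (N j : nat) : 0 <= a -> 0 <= K -> 1 <= x ->
  (2 * (a + 1)) ^+ j.+1 <= x -> x <= y -> 2^-1 ^+ j.+1 < eps / (2 * K * a ^+ N + 1) -> 0 < eps ->
  a ^+ (N + j).+1 * (2 * K) <= eps * y.
Proof.
move=> a0 K0 x1 xj xy h e0.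
have c0 : 0 <= 2 * K * a ^+ N by rewrite mulr_ge0 ?exprn_ge0 // mulr_ge0.
have c1 : 0 < 2 * K * a ^+ N + 1 by rewrite ltr_wpDl.
have p2 : 0 < (2 ^+ j.+1 : R) by rewrite exprn_gt0.
have h1 : 2 * K * a ^+ N <= eps * 2 ^+ j.+1.
  move: h; rewrite exprVn ltr_pdivlMr // mulrC ltr_pdivrMr // => /ltW; apply: le_trans.
  by rewrite lerDl.
have h2 : a ^+ j.+1 * 2 ^+ j.+1 <= y.
  apply: le_trans xy; apply: le_trans xj; rewrite -exprMn; apply: lerXn2r; rewrite ?nnegrE; lra.
rewrite -(ler_pM2r p2); have -> : a ^+ (N + j).+1 * (2 * K) * 2 ^+ j.+1 = 2 * K * a ^+ N * (a ^+ j.+1 * 2 ^+ j.+1).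
  by rewrite -addnS exprD; ring.
have y0 : 0 <= y by apply: le_trans xy; apply: le_trans x1.
apply: le_trans (ler_wpM2l c0 h2) _.
by rewrite [leRHS]mulrAC; apply: ler_wpM2r.
Qed.

End MultiplierAlgebra.

(** * The limit of exp((d+e) d^l kappa) and torsion of kappa *)

Section MultiplierLimit.
Context {R : realType}.
Local Notation C := (Cx R).
Local Notation C2 := (Cx2 R).
Variables (H Hi : C2 -> C2) (Up : set C2) (G : C2 -> R) (d e : nat) (rho : R).
Variables (al q : C) (Q : C -> C) (Phi Psi : C2 -> C2) (Dm : set C2).
Hypothesis hc : henon_chart H Hi Up G d e rho al q Q Phi Psi Dm.

Local Notation Sg := (Sg H d Phi Dm).
Local Notation sdom := (sdom d rho).
Local Notation pt := (pt Hi d rho al Q Psi).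

Let d1 : (1 < d)%N.
Proof. by have /andP[e0 ed] := hc_e hc; apply: leq_ltn_trans ed. Qed.
Let dR n : 0 < (d%:R ^+ n : R).
Proof. by rewrite exprn_gt0 // ltr0n (ltn_trans _ d1). Qed.

Local Notation XI := (XI Up G).
Local Notation Tr := (Tr H Hi d rho al Q Phi Psi Dm).
Local Notation tpi := (mkc 0 (2 * pi) : C).
Local Notation gapE := (gapE d al Q).
Local Notation waut := (waut H Up G d Phi Dm).
Variable I : set R.
Hypothesis Idn : forall x y, I y -> x <= y -> I x.
Variables (f g : C2 -> C2) (k : C).
Hypotheses (w : waut I f g) (k0 : Re k = 0).
Hypothesis kP : forall p s, XI I p -> Sg p s -> Sg (f p) (s + k).

(** Evaluate f over s + 2 pi i/d^(N+j+1) in two ways: as the image of a translate of the point over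
    s, which brings in A, and through the vertical offset B of the shifted point. *)
Lemma gap_relation N j (s A : C) (B : R -> C) : sdom N s -> I (Re s) ->
  (forall b, f (Tr b (pt N 0 s)) = Tr (A * b) (f (pt N 0 s))) ->
  (forall t : R, 0 <= t <= 1 -> f (pt N 0 (s + rc t * tpi)) = Tr (B t) (pt N 0 (s + k + rc t * tpi))) ->
  gapE N j (s + k) - A * gapE N j s = al ^+ (N + j).+1 * (B 0 - B (d%:R ^+ (N + j).+1)^-1).
Proof.
move=> sN sI AP BP; have a0 : al ^+ (N + j).+1 != 0 by rewrite expf_neq0 // (hc_al hc).
have skN : sdom N (s + k) by apply: (sdom_Re hc _ sN); rewrite ReD k0 addr0.
have PU : Up (pt N 0 (s + k)) := Sg_Up hc (pt_Sg hc 0 skN).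
have r01 : 0 <= ((d%:R ^+ (N + j).+1)^-1 : R) <= 1.
  rewrite invr_ge0 (ltW (dR _)) invf_le1 ?dR //=.
  by rewrite exprn_ege1 // ler1n (ltn_trans _ d1).
apply: offset_identity a0 _; apply: (Tr_inj hc PU).
rewrite -[LHS](TrD hc _ _ PU) -[RHS](TrD hc _ _ PU) -(pt_gap hc) // -BP // (pt_gap hc) // AP; congr (Tr _ _).
have := BP 0; rewrite rc0 mul0r !addr0 lexx ler01 => -> //.
Qed.

(** Divide [gap_relation] by the leading term of the gap at s. The gap at s + k has the same leading
    term multiplied by exp((d+e) d^l k), and the bounded offset times a power of [al] is negligible
    against |zeta|^(d+e). *)
Lemma multiplier_limit p s A : XI I p -> Sg p s -> (forall b, f (Tr b p) = Tr (A * b) (f p)) ->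
  forall eps : R, 0 < eps -> exists K, forall l, (K <= l)%N ->
    nrm (cexp ((d + e)%:R * (d%:R ^+ l * k)) - A) < eps.
Proof.
move=> pX ps AP eps e0.
have [r [B [r0 B0 QB]]] := Q_bound hc.
have Gs := G_Sg hc ps; have Rs : 0 < Re s by rewrite -Gs; apply: (G_gt0 hc); case: pX.
have sI : I (Re s) by rewrite -Gs; case: pX.
have es1 : 1 < expR (Re s) by rewrite expR_gt1.
have [N NP] := exprn_large (Num.max rho (Num.max r (2 * (nrm al + 1)))) es1 d1.
have x0E : nrm (cexp (d%:R ^+ N * s)) = expR (Re s) ^+ (d ^ N).
  by rewrite nrm_cexp Re_dM -natrX expRM_natl.
have := NP N (leqnn N); rewrite -x0E !gt_max => /and3P[sN xr xa].
pose c := q * (cexp ((d + e)%:R * (tpi / d%:R)) - 1).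
have c0 : 0 < nrm c by rewrite nrm_gt0 mulf_neq0 ?(hc_q hc) // subr_eq0 (shift_root_neq1 hc).
have pX0 : XI I (pt N 0 s) by apply: (pt0_XI hc).
have AP0 b : f (Tr b (pt N 0 s)) = Tr (A * b) (f (pt N 0 s)).
  have [b0 ->] := Tr_exists hc ps (pt_Sg hc 0 sN).
  by rewrite (TrD hc _ _ pX.1) !AP (TrD hc _ _ (wa_fX w pX).1) mulrDr.
have [Bf [K BP]] := vertical_offset hc w k0 kP sN sI.
have K0 : 0 <= K.
  have [_ L] : f (pt N 0 (s + rc 0 * tpi)) = Tr (Bf 0) (pt N 0 (s + k + rc 0 * tpi)) /\ nrm (Bf 0) <= K.
    by apply: BP; rewrite lexx ler01.
  by apply: le_trans L; exact: nrm_ge0.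
have skE l : nrm (cexp (d%:R ^+ l * (s + k))) = nrm (cexp (d%:R ^+ l * s)).
  by rewrite !nrm_cexp !Re_dM ReD k0 addr0.
(* The three errors carry the weights |A|, 1 and 1; the factor 2 gives the strict inequality. *)
pose ep := eps * nrm c / (2 * (nrm A + 2)).
have ep0 : 0 < ep.
  by apply: divr_gt0; [exact: mulr_gt0|rewrite mulr_gt0 // ltr_wpDl ?nrm_ge0].
have xr' : r < nrm (cexp (d%:R ^+ (N + 0) * s)) by rewrite addn0.
have xa' : 2 * (nrm al + 1) <= nrm (cexp (d%:R ^+ (N + 0) * s)) by rewrite addn0 ltW.
have [K1 K1P] := gapE_asym hc B0 QB xr' xa' ep0.
have [K2 K2P] : exists K, forall j, (K <= j)%N ->
  nrm (gapE N j (s + k) - c * cexp (d%:R ^+ (N + j) * (s + k)) ^+ (d + e)) <= ep * nrm (cexp (d%:R ^+ (N + j) * (s + k))) ^+ (d + e).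
  by apply: (gapE_asym hc B0 QB _ _ ep0); rewrite skE.
have c1 : 0 < 2 * K * nrm al ^+ N + 1 by rewrite ltr_wpDl // mulr_ge0 ?exprn_ge0 ?nrm_ge0 // mulr_ge0.
have [K3 K3P] := half_small (divr_gt0 ep0 c1).
exists (N + (K1 + K2 + K3))%N => l Kl; pose j := (l - N)%N.
have lE : l = (N + j)%N by rewrite subnKC // (leq_trans (leq_addr _ _) Kl).
have Kj : (K1 + K2 + K3 <= j)%N by rewrite -(leq_add2l N) -lE.
have := K1P j (leq_trans (leq_trans (leq_addr _ _) (leq_addr _ _)) Kj).
have := K2P j (leq_trans (leq_trans (leq_addl _ _) (leq_addr _ _)) Kj).
have [xg _] := x_growth hc xa' j.
have xj1 : 1 <= nrm (cexp (d%:R ^+ (N + j) * s)).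
  by apply: le_trans (x_growth2 hc xa' j); rewrite exprn_ege1 // ler1n.
rewrite skE; have -> : cexp (d%:R ^+ (N + j) * (s + k)) ^+ (d + e) =
  cexp (d%:R ^+ (N + j) * s) ^+ (d + e) * cexp ((d + e)%:R * (d%:R ^+ l * k)).
  by rewrite mulrDr cexpD exprMn lE [in RHS]cexpMn.
set x := nrm (cexp (d%:R ^+ (N + j) * s)) in xg xj1 *.
have xD : x <= x ^+ (d + e).
  by apply: ler_eXnr => //; apply: ltn_addr; exact: ltn_trans d1.
set X := cexp _ ^+ _; set u := cexp _; rewrite -/c => G2 G1.
have E := gap_relation j sN sI AP0 (fun t t01 => (BP t t01).1).
have F := multiplier_identity c X u E.
have Xn : nrm X = x ^+ (d + e) by rewrite nrmX.
have xp : 0 < x ^+ (d + e) by rewrite exprn_gt0 // (lt_le_trans ltr01).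
apply: (@multiplier_bound R (x ^+ (d + e)) (nrm c) _ 0 0 eps (nrm A)) => //; first exact: nrm_ge0.
rewrite -/ep -Xn -!nrmM F Xn.
apply: le_trans (nrmD _ _) _; apply: lerD.
  apply: le_trans (nrmB _ _) _; apply: lerD; last exact: G2.
  by rewrite nrmM ler_wpM2l ?nrm_ge0.
rewrite nrmM nrmX.
apply: le_trans (_ : nrm al ^+ (N + j).+1 * (2 * K) <= _).
  rewrite ler_wpM2l ?exprn_ge0 ?nrm_ge0 //; apply: le_trans (nrmB _ _) _.
  rewrite mulr_natl mulr2n; apply: lerD; apply: (BP _ _).2; rewrite ?lexx ?ler01 //.
  rewrite invr_ge0 (ltW (dR _)) invf_le1 ?dR //=.
  by rewrite exprn_ege1 // ler1n (ltn_trans _ d1).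
apply: (geometric_bound (nrm_ge0 _) K0 xj1 xg xD) => //.
apply: le_lt_trans K3P; apply: ler_wiXn2l; rewrite ?invr_ge0 ?invf_le1 ?ler1n //.
by apply: leqW; apply: leq_trans Kj; exact: leq_addl.
Qed.

Lemma multiplier_one p s A L : XI I p -> Sg p s -> (forall b, f (Tr b p) = Tr (A * b) (f p)) ->
  cexp (d%:R ^+ L * k) = 1 -> A = 1.
Proof.
move=> pX ps AP kL; apply/eqP; rewrite eq_sym -subr_eq0 -nrm_eq0 eq_le nrm_ge0 andbT leNgt; apply/negP => a0.
have [K KP] := multiplier_limit pX ps AP a0.
have := KP (L + K)%N (leq_addl _ _).
by rewrite cexpMn cexp_dD kL !expr1n ltxx.
Qed.

(* u_l = exp((d+e) d^l kappa) converges and u_(l+1) = u_l^d, hence u_l^(d-1) tends to 1,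
   which is a repelling fixed point of w |-> w^d on the unit circle. *)
Lemma kappa_torsion : (exists2 x, 0 < x & I x) ->
  exists (m L : nat) (n : int), (0 < m)%N /\ m%:R * (d%:R ^+ L * k) = n%:~R * tpi.
Proof.
move=> [x x0 xI].
have [n nP] : exists n, sdom n (rc x) by apply: (sdom_exists hc).
have pX : XI I (pt n 0 (rc x)) by apply: (pt0_XI hc).
have [A _ AP] := image_Tr hc w pX.
have AL := multiplier_limit pX (pt_Sg hc 0 nP) AP.
pose u l := cexp ((d + e)%:R * (d%:R ^+ l * k)).
have u1 l : nrm (u l) = 1 by rewrite nrm_cexp -rc_nat ReM /= mul0r subr0 Re_dM k0 !mulr0 expR0.
have uS l : u l.+1 = u l ^+ d by rewrite /u !cexpMn cexp_dS -!exprM mulnC.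
have [||eps e0|L LP] := @power_seq_to1 R (fun l => u l ^+ d.-1) d d1.
- by move=> l; rewrite uS -!exprM mulnC.
- by move=> l; rewrite nrmX u1 expr1n.
- have [K KP] := AL _ (divr_gt0 e0 (ltr0n _ 2)).
  exists K => l Kl; have := KP l Kl; have := KP l.+1 (leqW Kl); rewrite -/(u l) -/(u l.+1).
  have -> : nrm (u l ^+ d.-1 - 1) = nrm (u l.+1 - u l).
    have E : u l.+1 = u l ^+ d.-1 * u l by rewrite uS -exprSr prednK // (ltn_trans _ d1).
    by rewrite E -{4}(mul1r (u l)) -mulrBl nrmM u1 mulr1.
  have := nrm_triangle A (u l.+1) (u l); rewrite (nrmBC A).
  move: (nrm (u l.+1 - u l)) (nrm (u l.+1 - A)) (nrm (u l - A)) => a b c; lra.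
have {}LP : cexp ((d.-1 * (d + e))%N%:R * (d%:R ^+ L * k)) = 1.
  by rewrite natrM -mulrA cexpMn; exact: LP.
have [n' nE] := cexp_eq1 LP; exists (d.-1 * (d + e))%N, L, n'; split=> //.
by rewrite muln_gt0 addn_gt0 (ltn_trans _ d1) // andbT -ltnS prednK // (ltn_trans _ d1).
Qed.

End MultiplierLimit.

(** * Translations and extension *)

Section Translations.
Context {R : realType}.
Local Notation C := (Cx R).
Local Notation C2 := (Cx2 R).
Variables (H Hi : C2 -> C2) (Up : set C2) (G : C2 -> R) (d e : nat) (rho : R).
Variables (al q : C) (Q : C -> C) (Phi Psi : C2 -> C2) (Dm : set C2).
Hypothesis hc : henon_chart H Hi Up G d e rho al q Q Phi Psi Dm.

Local Notation lvl := (lvl H Dm).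
Local Notation zN := (zN H Phi).
Local Notation Sg := (Sg H d Phi Dm).
Local Notation sdom := (sdom d rho).
Local Notation pt := (pt Hi d rho al Q Psi).

Let d1 : (1 < d)%N.
Proof. by have /andP[e0 ed] := hc_e hc; apply: leq_ltn_trans ed. Qed.

Local Notation XI := (XI Up G).
Local Notation Tr := (Tr H Hi d rho al Q Phi Psi Dm).
Local Notation tpi := (mkc 0 (2 * pi) : C).
Local Notation waut := (waut H Up G d Phi Dm).

Lemma sdom_open N (s : C) : sdom N s -> exists2 u, 0 < u & forall s' : C, nrm (s' - s) < u -> sdom N s'.
Proof.
move=> sN; have wf : full_dom rho ((0, cexp (d%:R ^+ N * s)) : C2) by exact: sN.
have c : {for s, continuous (fun s : C => (0, cexp (d%:R ^+ N * s)) : C2)}.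
  apply: diff_continuous_nrm; apply: differentiable_pair; first exact: differentiable_cst.
  apply: (@differentiable_comp _ _ _ _ (fun s : C => d%:R ^+ N * s) (@cexp R)); last exact: cexp_differentiable.
  by apply: differentiableM; [exact: differentiable_cst|exact: differentiable_idC].
have /nbhs_nrmP[u u0 uP] := c _ (full_dom_open wf).
by exists u => // s' /uP.
Qed.

Lemma Sg_vert p (s : C) n j : Sg p s -> Sg p (s + rc (n%:R / d%:R ^+ j) * tpi).
Proof.
move=> /(Sg_large hc)[N NP]; have [l E] := NP (N + j)%N (leq_addr _ _).
by exists (N + j)%N => //; rewrite (vert_frac hc _ _ (leq_addl _ _)).
Qed.

Lemma Sg_tors p (s k : C) L : cexp (d%:R ^+ L * k) = 1 -> Sg p (s + k) -> Sg p s.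
Proof.
move=> kL /(Sg_large hc)[N NP]; have [l E] := NP (N + L)%N (leq_addr _ _).
exists (N + L)%N => //; rewrite -E mulrDr cexpD [(N + L)%N]addnC [cexp (_ * k)]cexp_dD kL expr1n mulr1 //.
Qed.

Variable I : set R.
Hypothesis Idn : forall x y, I y -> x <= y -> I x.
Hypothesis Iop : forall x, I x -> exists2 u, 0 < u & I (x + u).
Variables (h hi : C2 -> C2).
Hypotheses (w : waut I h hi) (hS : forall p s, XI I p -> Sg p s -> Sg (h p) s).
Hypothesis h1 : forall p b, XI I p -> h (Tr b p) = Tr b (h p).

(** As h preserves logarithms and commutes with translations, it acts on each leaf as a translation;
    this is its amount as a function of s. The default 0 occurs only outside the range of
    [shiftNP]. *)
Definition shiftN N (s : C) : C := xget 0 [set b | h (pt N 0 s) = Tr b (pt N 0 s)].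

Lemma shiftNP N (s : C) : sdom N s -> I (Re s) -> h (pt N 0 s) = Tr (shiftN N s) (pt N 0 s).
Proof.
move=> sN sI; have ps := pt_Sg hc 0 sN; have [b bP] := Tr_exists hc ps (hS (pt0_XI hc sN sI) ps).
exact: (@xgetPex _ 0 [set b | h (pt N 0 s) = Tr b (pt N 0 s)] (ex_intro _ b bP)).
Qed.

Lemma shiftN_uniq N (s b : C) : sdom N s -> I (Re s) -> h (pt N 0 s) = Tr b (pt N 0 s) -> shiftN N s = b.
Proof.
move=> sN sI hb; apply: (Tr_inj hc (Sg_Up hc (pt_Sg hc 0 sN))).
by rewrite -hb -shiftNP.
Qed.

Lemma shiftN_frac N (s : C) n j : sdom N s -> I (Re s) ->
  shiftN N (s + rc (n%:R / d%:R ^+ j) * tpi) = shiftN N s.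
Proof.
move=> sN sI; set s' := s + _.
have sN' : sdom N s' by apply: (sdom_Re hc _ sN); rewrite Re_vert.
have pX := pt0_XI hc sN sI.
apply: shiftN_uniq => //; first by rewrite Re_vert.
have [b ->] := Tr_exists hc (Sg_vert n j (pt_Sg hc 0 sN)) (pt_Sg hc 0 sN').
by rewrite h1 // shiftNP // !(TrD hc) ?pX.1 //; [rewrite addrC|case: pX|case: pX].
Qed.

(** Near s the amount is a difference of z-coordinates at one level. [theta_segment] supplies the
    equality of the zeta-coordinates that identifies the two. *)
Lemma shiftN_differentiable N (s : C) : sdom N s -> I (Re s) -> differentiable (shiftN N) s.
Proof.
move=> sN sI; have pX := pt0_XI hc sN sI.
have hpd : differentiable (fun s => h (pt N 0 s)) s.
  apply: (@differentiable_comp _ _ _ _ (pt N 0) h); first exact: (pt_differentiable hc).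
  exact: (wa_fd w).
have [m mP] := Sg_large hc (hS pX (pt_Sg hc 0 sN)).
pose M := (N + m)%N; have [lM EM] := mP M (leq_addl _ _).
have hpc : {for s, continuous (fun s => h (pt N 0 s))} by exact: diff_continuous_nrm hpd.
have /nbhs_nrmP[u1 u10 u1P] := hpc _ (lvl_open hc lM).
have [u2 u20 u2P] := sdom_open sN.
have [u3 u30 u3P] := Iop sI.
pose u := Num.min u1 (Num.min u2 u3).
have u0 : 0 < u by rewrite !lt_min u10 u20.
have near_s (s' : C) : nrm (s' - s) < u -> [/\ sdom N s', I (Re s') & lvl M (h (pt N 0 s'))].
  rewrite !lt_min => /and3P[/u1P h1' /u2P h2' h3']; split=> //.
  apply: Idn u3P _; rewrite -lerBlDl -ReB; apply: le_trans (ltW h3').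
  exact: le_trans (ler_norm _) (Re_le_nrm _).
apply: (@diff_near _ _ _ (fun s => (zN M (h (pt N 0 s)) - zN M (pt N 0 s)) / al ^+ M)).
  apply/nbhs_nrmP; exists u => // s' s'u; have [a1 a2 a3] := near_s s' s'u.
  apply: esym; apply: shiftN_uniq => //.
  have [b1 b2] := pt0_lvl hc a1.
  apply: (Tr_lvl_diff hc) => //; first by apply: (lvl_le hc) b1; exact: leq_addr.
  rewrite /M (phN_add hc _ b1) b2 -cexp_dD -/M.
  rewrite (theta_segment hc (wa_fX w) (wa_fd w) (wa_WP w) (N := N) (s0 := s)).
    by rewrite -EM -cexpD -mulrDr addrC subrK.
  move=> t /andP[t0 t1]; apply: near_s; rewrite addrAC subrr add0r nrmM nrm_rc ger0_norm //.
  by apply: le_lt_trans s'u; rewrite ler_piMl ?nrm_ge0.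
apply: differentiableM; last exact: differentiable_cst.
have lMp : lvl M (pt N 0 s) by apply: (lvl_le hc) (pt0_lvl hc sN).1; exact: leq_addr.
apply: differentiableB.
  by apply: (@differentiable_comp _ _ _ _ (fun s => h (pt N 0 s)) (zN M)); [exact: hpd|exact: (zN_differentiable hc)].
apply: (@differentiable_comp _ _ _ _ (pt N 0) (zN M)); first exact: (pt_differentiable hc).
exact: (zN_differentiable hc).
Qed.

(* shiftN is invariant under 2 pi i Z[1/d], which is dense in the imaginary axis. *)
Lemma shiftN_vert N (s : C) (t : R) : sdom N s -> I (Re s) -> 0 <= t ->
  shiftN N (s + rc t * tpi) = shiftN N s.
Proof.
move=> sN sI t0; apply/eqP; rewrite -subr_eq0 -nrm_eq0 eq_le nrm_ge0 andbT leNgt; apply/negP => p0.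
pose E (u : R) := shiftN N (s + rc u * tpi).
have Ec : {for t, continuous E}.
  apply: (@continuous_comp _ _ _ (fun u : R => s + rc u * tpi) (shiftN N)).
    apply: cvgD; first exact: cvg_cst.
    by apply: cvgM; [exact: rc_continuous|exact: cvg_cst].
  apply: diff_continuous_nrm; apply: shiftN_differentiable; last by rewrite Re_vert.
  by apply: (sdom_Re hc _ sN); rewrite Re_vert.
have [r r0 rP] := continuous_eps Ec p0.
have [k [j [k1 k2]]] := dyadic_approx d1 t0 r0.
have := rP (k%:R / d%:R ^+ j); rewrite ger0_norm ?subr_ge0 // => /(_ k2).
by rewrite {1}/E shiftN_frac // nrmBC ltxx.
Qed.

Lemma shiftN_derive N (s : C) : sdom N s -> I (Re s) -> is_derive s 1 (shiftN N) 0.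
Proof.
move=> sN sI; have D := diff_is_derive (shiftN_differentiable sN sI).
have t0 : tpi != 0.
  by apply/eqP => /(congr1 (@complex.Im R)) /= /eqP; rewrite mulf_eq0 pnatr_eq0 /= gt_eqF // pi_gt0.
suff E : 'd (shiftN N) s 1 = 0 by rewrite E in D.
apply: (is_derive_ray t0 D (is_derive_cst (shiftN N s) s 1)) => t /andP[t0' _].
exact: shiftN_vert.
Qed.

Lemma shiftN_const N (s0 s1 : C) : sdom N s0 -> sdom N s1 -> I (Re s0) -> I (Re s1) ->
  shiftN N s1 = shiftN N s0.
Proof.
move=> n0 n1 i0 i1; apply: derive_eq0_const => t t01; have /andP[t0 t1] := t01.
have E : Re (s0 + rc t * (s1 - s0)) = (1 - t) * Re s0 + t * Re s1.
  by rewrite ReD ReM ReB /= mul0r subr0; ring.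
apply: shiftN_derive; last by rewrite E; exact: (convex_I Idn).
have [xs|sx] := leP (Re s0) (Re s1).
  by apply: (sdom_Re hc _ n0); rewrite E; nra.
by apply: (sdom_Re hc _ n1); rewrite E; nra.
Qed.

(** The amount is holomorphic in s and constant on vertical lines, hence constant; it remains to see
    that it does not depend on the level. *)
Lemma translation_exists : exists b, forall p, XI I p -> h p = Tr b p.
Proof.
have [[p0 p0X]|E] := pselect (exists p, XI I p); last first.
  by exists 0 => p pX; exfalso; apply: E; exists p.
have [s0 s0P] := Up_Sg hc p0X.1.
have I0 : I (Re s0) by rewrite -(G_Sg hc s0P); exact: p0X.2.
have R0 : 0 < Re s0 by rewrite -(G_Sg hc s0P); exact: (G_gt0 hc p0X.1).
have [N0 N0P] := sdom_exists hc R0.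
exists (shiftN N0 s0) => p pX; have [s ps] := Up_Sg hc pX.1.
have Ip : I (Re s) by rewrite -(G_Sg hc ps); exact: pX.2.
have Rp : 0 < Re s by rewrite -(G_Sg hc ps); exact: (G_gt0 hc pX.1).
have [N1 N1P] := sdom_exists hc Rp.
have a0 : sdom (N0 + N1) s0 by apply: (sdom_le hc) N0P; exact: leq_addr.
have a1 : sdom (N0 + N1) s by apply: (sdom_le hc) N1P; exact: leq_addl.
(* Different levels take different base points [pt N 0 s'] of the same leaf, but the amount is the
   same for all of its points because h commutes with translations. *)
have tr N s' p' b : sdom N s' -> I (Re s') -> XI I p' -> Sg p' s' ->
    h (pt N 0 s') = Tr b (pt N 0 s') -> h p' = Tr b p'.
  move=> b0 b2 b3 b4 b5; have [c ->] := Tr_exists hc (pt_Sg hc 0 b0) b4.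
  have qX := pt0_XI hc b0 b2.
  by rewrite (h1 _ qX) b5 (TrD hc _ _ qX.1) (TrD hc _ _ qX.1) addrC.
have -> : shiftN N0 s0 = shiftN (N0 + N1) s0.
  apply: shiftN_uniq => //; apply: (tr _ _ _ _ a0 I0 (pt0_XI hc N0P I0) (pt_Sg hc 0 N0P)).
  exact: (shiftNP a0 I0).
rewrite -(shiftN_const a0 a1 I0 Ip); apply: (tr _ _ _ _ a1 Ip pX ps).
exact: (shiftNP a1 Ip).
Qed.

End Translations.

(** * Composition, conjugation by H and restriction of automorphisms *)

Section AutomorphismOperations.
Context {R : realType}.
Local Notation C := (Cx R).
Local Notation C2 := (Cx2 R).
Variables (H Hi : C2 -> C2) (Up : set C2) (G : C2 -> R) (d e : nat) (rho : R).
Variables (al q : C) (Q : C -> C) (Phi Psi : C2 -> C2) (Dm : set C2).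
Hypothesis hc : henon_chart H Hi Up G d e rho al q Q Phi Psi Dm.

Local Notation Fm := (Fmap d al Q).
Local Notation lvl := (lvl H Dm).
Local Notation phN := (phN H Phi).
Local Notation zN := (zN H Phi).
Local Notation Sg := (Sg H d Phi Dm).
Local Notation pt := (pt Hi d rho al Q Psi).
Local Notation disp := (disp H d Phi Dm).
Local Notation upath := (upath Up).

Let d1 : (1 < d)%N.
Proof. by have /andP[e0 ed] := hc_e hc; apply: leq_ltn_trans ed. Qed.
Let dC n : (d%:R ^+ n : C) != 0.
Proof. by rewrite expf_neq0 // pnatr_eq0 -lt0n (ltn_trans _ d1). Qed.
Let dR n : 0 < (d%:R ^+ n : R).
Proof. by rewrite exprn_gt0 // ltr0n (ltn_trans _ d1). Qed.
Let rho0 : 0 < rho := lt_le_trans ltr01 (hc_rho hc).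

Local Notation XI := (XI Up G).
Local Notation Tr := (Tr H Hi d rho al Q Phi Psi Dm).
Local Notation waut := (waut H Up G d Phi Dm).

Lemma is_path_comp {T : topologicalType} (X Y : set T) (f : T -> T) x y (g : R -> T) :
  (forall p, X p -> Y (f p)) -> (forall p, X p -> {for p, continuous f}) ->
  is_path (R := R) X x y g -> is_path (R := R) Y (f x) (f y) (f \o g).
Proof.
move=> fX fc [/within_cl gc gX <- <-]; split; [|by move=> t /gX; exact: fX|by []|by []].
apply/within_cl => t; apply: (@continuous_comp _ _ _ (g \o cl) f); first exact: gc.
by apply: fc; apply: gX; exact: cl_in.
Qed.

Lemma is_path_sub {T : topologicalType} (X Y : set T) x y (g : R -> T) : X `<=` Y ->
  is_path (R := R) X x y g -> is_path (R := R) Y x y g.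
Proof. by move=> XY [gc gX g0 g1]; split; [exact: gc|move=> t /gX/XY|exact: g0|exact: g1]. Qed.

(** Since G(H p) = d G(p), this is the condition on G after applying H: for I = ]-oo, c[ it is ]-oo,
    d c[. *)
Definition Isc (I : set R) : set R := [set x | I (x / d%:R)].

Lemma iter_Isc K I x : iter K Isc I x <-> I (x / d%:R ^+ K).
Proof.
elim: K x => [|K IH] x; first by rewrite divr1.
by rewrite exprS invfM mulrA; exact: IH.
Qed.

Lemma XI_H I p : XI (Isc I) (H p) <-> XI I p.
Proof.
have dn0 : d%:R != 0 :> R by have := dR 1; rewrite expr1 => /gt_eqF ->.
split=> [[pU]|[pU pI]].
  have pU' := (Up_H hc p).2 pU.
  by rewrite /Isc /= (G_H hc pU') mulrC mulKf.
by split; [exact: ((Up_H hc p).1 pU)|rewrite /Isc /= (G_H hc pU) mulrC mulKf].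
Qed.

Lemma XI_Hi I p : XI (Isc I) p <-> XI I (Hi p).
Proof. by rewrite -{1}(hc_HiK hc p) XI_H. Qed.

Definition cnj (f : C2 -> C2) (p : C2) : C2 := H (f (Hi p)).

Lemma disp_H g D : disp g D -> disp (H \o g) (d%:R * D).
Proof.
move=> [N [L [LP ->]]]; have LP1 := lift_raise hc 1 LP; rewrite addn1 expr1 in LP1.
exists N, (fun t => d%:R * L t); split; last by rewrite -mulrBr mulrA.
by move=> t t01; have [l1 l2 l3] := LP1 t t01; split; [rewrite /lvl /= -iterSr|exact: l2|rewrite l3 /phN -iterSr].
Qed.

Lemma disp_Hi g D : disp g D -> disp (Hi \o g) (D / d%:R).
Proof.
move=> [N [L [LP ->]]]; exists N.+1, L; split; last by rewrite exprSr invfM mulrA mulrAC.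
move=> t t01; have [l1 l2 l3] := LP t t01.
by split; [rewrite /lvl iterSr /= (hc_HiK hc)|exact: l2|rewrite l3 /phN iterSr /= (hc_HiK hc)].
Qed.

Lemma waut_cnj I f g : waut I f g -> waut (Isc I) (cnj f) (cnj g).
Proof.
have X1 f' : (forall p, XI I p -> XI I (f' p)) -> forall p, XI (Isc I) p -> XI (Isc I) (cnj f' p).
  by move=> fX p /XI_Hi/fX K; apply/XI_H.
have D1 f' : (forall p, XI I p -> differentiable f' p) -> forall p, XI (Isc I) p -> differentiable (cnj f') p.
  move=> fd p /XI_Hi/fd K; apply: (@differentiable_comp _ _ _ _ (f' \o Hi) H); last exact: (hc_H hc).
  by apply: (@differentiable_comp _ _ _ _ Hi f'); [exact: (hc_Hi hc)|exact: K].
have dn0 : d%:R != 0 :> C by have := dC 1; rewrite expr1.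
move=> w; split; [exact: X1 (wa_fX w)|exact: X1 (wa_gX w)|exact: D1 (wa_fd w)|exact: D1 (wa_gd w)|..].
- by move=> p /XI_Hi pX; rewrite /cnj (hc_HK hc) (wa_gf w pX) (hc_HiK hc).
- by move=> p /XI_Hi pX; rewrite /cnj (hc_HK hc) (wa_fg w pX) (hc_HiK hc).
move=> x g0 D gp gD.
have gp' : is_path (R := R) (XI I) (Hi x) (Hi x) (Hi \o g0).
  apply: is_path_comp gp; first by move=> p /XI_Hi.
  by move=> p _; apply: diff_continuous_nrm; exact: (hc_Hi hc).
have := disp_H (wa_WP w gp' (disp_Hi gD)).
by rewrite mulrC divfK //; exact.
Qed.

Lemma waut_comp I f g f' g' : waut I f g -> waut I f' g' -> waut I (f \o f') (g' \o g).
Proof.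
move=> w w'; split.
- by move=> p /(wa_fX w')/(wa_fX w).
- by move=> p /(wa_gX w)/(wa_gX w').
- move=> p pX; apply: (@differentiable_comp _ _ _ _ f' f); first exact: (wa_fd w').
  by apply: (wa_fd w); exact: (wa_fX w').
- move=> p pX; apply: (@differentiable_comp _ _ _ _ g g'); first exact: (wa_gd w).
  by apply: (wa_gd w'); exact: (wa_gX w).
- by move=> p pX; rewrite /= (wa_gf w) ?(wa_gf w') //; exact: (wa_fX w').
- by move=> p pX; rewrite /= (wa_fg w') ?(wa_fg w) //; exact: (wa_gX w).
move=> x y D yp yD; have yD' := wa_WP w' yp yD.
have yp' : is_path (R := R) (XI I) (f' x) (f' x) (f' \o y).
  apply: is_path_comp yp; first exact: (wa_fX w').
  by move=> p pX; apply: diff_continuous_nrm; exact: (wa_fd w').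
exact: (wa_WP w yp' yD').
Qed.

Lemma waut_sub (I I' : set R) f g : (forall x, I' x -> I x) -> (forall p, XI I p -> G (f p) = G p) ->
  waut I f g -> waut I' f g.
Proof.
move=> II fG w; have XX : XI I' `<=` XI I by move=> p [pU /II].
have gG p : XI I p -> G (g p) = G p by move=> pX; rewrite -(fG _ (wa_gX w pX)) (wa_fg w pX).
split.
- by move=> p pX; split; [exact: (wa_fX w (XX _ pX)).1|rewrite fG; [case: pX|exact: XX]].
- by move=> p pX; split; [exact: (wa_gX w (XX _ pX)).1|rewrite gG; [case: pX|exact: XX]].
- by move=> p /XX; exact: (wa_fd w).
- by move=> p /XX; exact: (wa_gd w).
- by move=> p /XX; exact: (wa_gf w).
- by move=> p /XX; exact: (wa_fg w).
by move=> x y D yp; apply: (wa_WP w (is_path_sub XX yp)).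
Qed.

Lemma Tr_lvl_phN N k b p : lvl N p -> wdom rho (iter k Fm (zN N p + al ^+ N * b, phN N p)) ->
  lvl (N + k) (Tr b p) /\ phN (N + k) (Tr b p) = phN (N + k) p.
Proof.
move=> pN; have [s sE] := Sg_exists hc pN; have [sN pE] := lvl_pt hc pN sE.
rewrite -{1}sE => /(pt_wdom hc)/(_ sN)[l1 l2 _].
have -> : Tr b p = pt N (zN N p + al ^+ N * b) s by rewrite {1}pE (Tr_pt hc).
by rewrite l2 (phN_add hc _ pN) -sE cexp_dD.
Qed.

(** A translation leaves zeta unchanged, but the translated point may reach the chart only at a
    higher level. By compactness one level serves the whole path, and there the same lift works. *)
Lemma disp_Tr b g D : upath g -> disp g D -> disp (Tr b \o g) D.
Proof.
move=> gu gD; have [gc gU] := gu.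
have [N0 N0P] := upath_lvl hc gu; have {}N0P := N0P N0 (leqnn N0).
pose P n t := lvl n (Tr b (g (cl t))) /\ phN n (Tr b (g (cl t))) = phN n (g (cl t)).
have [N1 N1P] : exists N, forall n, (N <= n)%N -> forall t, `[0, 1]%classic t -> P n t.
  apply: compact_nat; first exact: segment_compact.
  move=> t _; pose W t := (zN N0 (g (cl t)) + al ^+ N0 * b, phN N0 (g (cl t))) : C2.
  have lt : lvl N0 (g (cl t)) by apply: N0P; exact: cl_in.
  have Wf : full_dom rho (W t) by exact: (phN_gt hc lt).
  have [k kP] := enters_wdom hc Wf; exists (N0 + k)%N.
  have Wc : {for t, continuous (fun t => iter k Fm (W t))}.
    apply: (@continuous_comp _ _ _ W (iter k Fm)).
      apply: pair_continuous.
        apply: cvgD; last exact: cvg_cst.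
        by apply: (zN_comp_continuous hc (g := g \o cl)); [exact: gc|exact: lt].
      by apply: (phN_comp_continuous hc (g := g \o cl)); [exact: gc|exact: lt].
    by apply: diff_continuous_nrm; exact: (iter_Fmap_differentiable hc).
  have K := Wc _ (wdom_open kP).
  apply: (@filterS _ (nbhs t) _ _ _ _ K) => t' t'P n nk.
  have lt' : lvl N0 (g (cl t')) by apply: N0P; exact: cl_in.
  have [l1 l2] := Tr_lvl_phN lt' t'P.
  have lt2 : lvl (N0 + k) (g (cl t')) by apply: (lvl_le hc) lt'; exact: leq_addr.
  split; first exact: (lvl_le hc nk l1).
  by rewrite -(subnKC nk) (phN_add hc _ l1) (phN_add hc _ lt2) l2.
pose M := (N0 + N1)%N; have ML t : 0 <= t <= 1 -> lvl M (g t).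
  by move=> /N0P; apply: (lvl_le hc); exact: leq_addr.
have [L LP] := lift_exists hc gc ML.
have D' : disp g ((L 1 - L 0) / d%:R ^+ M) by exists M, L.
rewrite (disp_uniq hc gD D'); exists M, L; split=> // t t01.
have [l1 l2 l3] := LP t t01.
have [m1 m2] : P M t by apply: N1P; [exact: leq_addl|rewrite /= in_itv].
by rewrite /= cl_id // in m1 m2; split; [exact: m1|exact: l2|rewrite l3 -m2].
Qed.

Lemma waut_Tr I b : waut I (Tr b) (Tr (- b)).
Proof.
have X1 b' p : XI I p -> XI I (Tr b' p) by exact: (Tr_XI hc).
split; [exact: X1|exact: X1|..].
- by move=> p [pU _]; exact: (Tr_differentiable hc).
- by move=> p [pU _]; exact: (Tr_differentiable hc).
- by move=> p [pU _]; rewrite (TrD hc) // addNr (Tr0 hc).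
- by move=> p [pU _]; rewrite (TrD hc) // subrr (Tr0 hc).
by move=> x y D /is_path_upath; exact: disp_Tr.
Qed.

Lemma waut_iter_cnj I f g K : waut I f g -> waut (iter K Isc I) (iter K cnj f) (iter K cnj g).
Proof. by move=> w; elim: K => // K IH; exact: waut_cnj IH. Qed.

Lemma cnj_ext I f f' K : (forall p, XI I p -> f p = f' p) ->
  forall p, XI (iter K Isc I) p -> iter K cnj f p = iter K cnj f' p.
Proof.
move=> ff; elim: K => // K IH p pX; rewrite !iterS /cnj IH //.
by apply/XI_Hi.
Qed.

Lemma cnj_shift I f k K : (forall p s, XI I p -> Sg p s -> Sg (f p) (s + k)) ->
  forall p s, XI (iter K Isc I) p -> Sg p s -> Sg (iter K cnj f p) (s + d%:R ^+ K * k).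
Proof.
move=> fS; have dn0 : d%:R != 0 :> C by have := dC 1; rewrite expr1.
elim: K => [|K IH] p s pX ps; first by rewrite mul1r; exact: fS.
have ps' : Sg (Hi p) (s / d%:R).
  by apply/(Sg_H hc); rewrite (hc_HiK hc) mulrC divfK.
have := IH _ _ ((XI_Hi _ _).1 pX) ps' => /(Sg_H hc).
by rewrite mulrDr [_ * (_ / _)]mulrC divfK // exprS -mulrA.
Qed.

Lemma shift_G I f k : Re k = 0 -> (forall p s, XI I p -> Sg p s -> Sg (f p) (s + k)) ->
  forall p, XI I p -> G (f p) = G p.
Proof.
move=> k0 fS p pX; have [s ps] := Up_Sg hc pX.1.
by rewrite (G_Sg hc ps) (G_Sg hc (fS _ _ pX ps)) ReD k0 addr0.
Qed.

Lemma XI_open I p : (forall x y, I y -> x <= y -> I x) -> (forall x, I x -> exists2 u, 0 < u & I (x + u)) ->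
  XI I p -> \forall r \near p, XI I r.
Proof.
move=> Idn Iop [pU pI]; have [N pN] := (Up_lvl hc p).1 pU; have [u u0 uI] := Iop _ pI.
have a1 : 0 < nrm (phN N p) by apply: lt_trans (phN_gt hc pN).
have b1 : 1 < expR (u * d%:R ^+ N) by rewrite expR_gt1 mulr_gt0.
have e0 : 0 < nrm (phN N p) * (expR (u * d%:R ^+ N) - 1) by rewrite mulr_gt0 // subr_gt0.
have pc : {for p, continuous (phN N)} := diff_continuous_nrm (phN_differentiable hc pN).
have [v v0 vP] := (nbhs_nrmP _ _).1 ((cvg_nrmP _ (phN N) (phN N p)).1 pc _ e0).
have /nbhs_nrmP[v' v0' vP'] := lvl_open hc pN.
apply/nbhs_nrmP; exists (Num.min v v'); first by rewrite lt_min v0.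
move=> r; rewrite lt_min => /andP[/vP r1 /vP' r2]; split; first by apply/(Up_lvl hc); exists N.
apply: Idn uI _; have a2 : 0 < nrm (phN N r) by apply: lt_trans (phN_gt hc r2).
rewrite (hc_G hc r2) (hc_G hc pN) -/(phN N r) -/(phN N p) ler_pdivrMr // mulrDl divfK ?gt_eqF //.
rewrite -(expRK (u * _)) -lnM ?posrE ?expR_gt0 // ler_ln ?posrE ?mulr_gt0 ?expR_gt0 //.
have := nrm_subD (phN N r) (phN N p); move: r1; rewrite /= mulrBr mulr1.
move: (nrm _) (nrm _) (nrm _) (_ * expR _) => x1 x2 x3 x4; lra.
Qed.

End AutomorphismOperations.

Lemma pow_mod_periodic (d m : nat) : (0 < m)%N ->
  exists i K, (0 < K)%N /\ (d ^ (i + K) = d ^ i %[mod m])%N.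
Proof.
move=> m0; pose F (i : 'I_m.+1) : 'I_m := Ordinal (ltn_pmod (d ^ i) m0).
have /injectivePn[x [y xy E]] : ~~ injectiveb F.
  by apply/negP => /injectiveP/leq_card; rewrite !card_ord ltnn.
have {}E : (d ^ x = d ^ y %[mod m])%N by exact: (congr1 (@nat_of_ord m) E).
have {}xy : (x != y :> nat)%N := xy.
case: (ltngtP x y) xy => // xy _.
  by exists x, (y - x)%N; rewrite subn_gt0 xy subnKC // ltnW.
by exists y, (x - y)%N; rewrite subn_gt0 xy subnKC // ltnW.
Qed.

(** * Extension from a sublevel set of G to U+ *)

Section Extension.
Context {R : realType}.
Local Notation C := (Cx R).
Local Notation C2 := (Cx2 R).
Variables (H Hi : C2 -> C2) (Up : set C2) (G : C2 -> R) (d e : nat) (rho : R).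
Variables (al q : C) (Q : C -> C) (Phi Psi : C2 -> C2) (Dm : set C2).
Hypothesis hc : henon_chart H Hi Up G d e rho al q Q Phi Psi Dm.

Local Notation phN := (phN H Phi).
Local Notation Sg := (Sg H d Phi Dm).

Let d1 : (1 < d)%N.
Proof. by have /andP[e0 ed] := hc_e hc; apply: leq_ltn_trans ed. Qed.
Let dR n : 0 < (d%:R ^+ n : R).
Proof. by rewrite exprn_gt0 // ltr0n (ltn_trans _ d1). Qed.

Local Notation XI := (XI Up G).
Local Notation Tr := (Tr H Hi d rho al Q Phi Psi Dm).
Local Notation tpi := (mkc 0 (2 * pi) : C).
Local Notation waut := (waut H Up G d Phi Dm).
Local Notation Isc := (Isc (R := R) d).
Local Notation cnj := (cnj H Hi).

(** The number exp(d^L k) is an m-th root of unity, and the powers of d are eventually periodic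
    modulo m. *)
Lemma torsion_periodic (k : C) (m L : nat) (n : int) : (0 < m)%N ->
  m%:R * (d%:R ^+ L * k) = n%:~R * tpi ->
  exists K L', (0 < K)%N /\ cexp (d%:R ^+ L' * (d%:R ^+ K * k - k)) = 1.
Proof.
move=> m0 E; have [i [K [K0 KE]]] := pow_mod_periodic d m0.
have Um : cexp (d%:R ^+ L * k) ^+ m = 1 by rewrite -cexpMn E cexp_2pi_int.
exists K, (L + i)%N; split=> //.
rewrite mulrBr cexpB mulrA -exprD -addnA !cexp_dD.
have -> : cexp (d%:R ^+ L * k) ^+ (d ^ (i + K)) = cexp (d%:R ^+ L * k) ^+ (d ^ i).
  by rewrite -(expr_mod _ Um) KE (expr_mod _ Um).
by rewrite divff // expf_neq0 // cexp_neq0.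
Qed.

Lemma Isc_sub (I : set R) K : (forall x y, I y -> x <= y -> I x) -> (exists2 x, 0 < x & I x) ->
  forall x, I x -> iter K Isc I x.
Proof.
move=> Idn [y y0 yI] x xI; apply/iter_Isc; have [x0|x0] := leP 0 x.
  apply: Idn xI _; rewrite ler_pdivrMr ?dR // ler_peMr // exprn_ege1 // ler1n.
  exact: ltn_trans d1.
apply: Idn yI _; apply: le_trans (ltW y0); rewrite ler_pdivrMr ?dR // mul0r; exact: ltW.
Qed.

(** Conjugation by H^K multiplies the shift k by d^K, so g composed after the conjugate of f has
    shift (d^K - 1) k, which lies in 2 pi i Z[1/d]. By [multiplier_one] it has multiplier 1 and is
    therefore a translation. *)
Lemma conj_relation (I : set R) f g : (forall x y, I y -> x <= y -> I x) ->
  (forall x, I x -> exists2 u, 0 < u & I (x + u)) -> (exists2 x, 0 < x & I x) -> waut I f g ->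
  exists K b, (0 < K)%N /\ forall p, XI I p -> iter K cnj f p = f (Tr b p).
Proof.
move=> Idn Iop Ine w; have [k [k0 kP kP' Gf]] := kappa_imag hc Idn Ine w.
have [m [L [n [m0 E]]]] := kappa_torsion hc w k0 kP Ine.
have [K [L' [K0 KE]]] := torsion_periodic m0 E.
have kS := cnj_shift hc (K := K) kP.
have kr : Re (d%:R ^+ K * k) = 0 by rewrite Re_dM k0 mulr0.
have sub := Isc_sub K Idn Ine.
(* The conjugate lives on the larger set given by [iter K Isc I]; having an imaginary shift it
   preserves G and restricts to I. *)
have wK : waut I (iter K cnj f) (iter K cnj g).
  by apply: (waut_sub sub (shift_G hc kr kS)); exact: (waut_iter_cnj hc K w).
have wh := waut_comp (waut_sym hc w) wK.
have XX p : XI I p -> XI (iter K Isc I) p by move=> [pU /sub].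
pose h := g \o iter K cnj f.
have hk p s : XI I p -> Sg p s -> Sg (h p) (s + (d%:R ^+ K * k - k)).
  move=> pX ps; have := kP' _ _ (wa_fX wK pX) (kS _ _ (XX p pX) ps).
  by rewrite addrA.
have hr : Re (d%:R ^+ K * k - k) = 0 by rewrite ReB kr k0 subrr.
have hS p s : XI I p -> Sg p s -> Sg (h p) s.
  by move=> pX ps; apply: (Sg_tors hc KE); exact: hk.
have h1 p b : XI I p -> h (Tr b p) = Tr b (h p).
  move=> pX; have [A _ AP] := image_Tr hc wh pX; have [s ps] := Up_Sg hc pX.1.
  have A1 := multiplier_one hc wh hr hk pX ps AP KE.
  by rewrite -/h A1 in AP; rewrite AP mul1r.
have [b bP] := translation_exists hc Idn Iop wh hS h1.
exists K, b; split=> // p pX; rewrite -(bP p pX) /h /= (wa_fg w) //.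
exact: (wa_fX wK pX).
Qed.

Section Limit.
Variables (J : nat -> set R) (F F' : nat -> C2 -> C2).
Hypotheses (w : forall j, waut (J j) (F j) (F' j)) (JS : forall j x, J j x -> J j.+1 x).
Hypotheses (Jdn : forall j x y, J j y -> x <= y -> J j x)
  (Jop : forall j x, J j x -> exists2 u, 0 < u & J j (x + u)) (Jall : forall x, exists j, J j x).
Hypothesis FS : forall j p, XI (J j) p -> F j.+1 p = F j p.

Let XS j n p : XI (J j) p -> XI (J (j + n)) p.
Proof. by move=> [pU pJ]; split=> //; elim: n => [|n IH]; rewrite ?addn0 // addnS; exact: JS. Qed.

Lemma F'S j p : XI (J j) p -> F' j.+1 p = F' j p.
Proof.
move=> pX; have qX := wa_gX (w j) pX.
rewrite -{1}(wa_fg (w j) pX) -(FS qX) (wa_gf (w j.+1)) //.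
by have := XS 1 qX; rewrite addn1.
Qed.

Definition glue (E : nat -> C2 -> C2) (p : C2) : C2 := E (xget 0%N [set j | XI (J j) p]) p.

Lemma glueE (E : nat -> C2 -> C2) j p : (forall j p, XI (J j) p -> E j.+1 p = E j p) ->
  XI (J j) p -> glue E p = E j p.
Proof.
move=> ES pX; rewrite /glue.
have : XI (J (xget 0%N [set j | XI (J j) p])) p by exact: (@xgetPex _ 0%N [set j | XI (J j) p] (ex_intro _ j pX)).
move: (xget _ _) => i iX.
have up a n : XI (J a) p -> E (a + n)%N p = E a p.
  move=> aX; elim: n => [|n IH]; first by rewrite addn0.
  by rewrite addnS ES //; exact: XS.
by rewrite -(up i j iX) -(up j i pX) addnC.
Qed.

Lemma XI_exists p : XI setT p -> exists j, XI (J j) p.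
Proof. by move=> [pU _]; have [j jP] := Jall (G p); exists j. Qed.

(** G is bounded along a path, being the real part of a lift up to a factor. Hence each loop in U+
    already lies in one stage, and [WP] for the limit map is inherited from that stage. *)
Lemma path_bounded x y g : is_path (R := R) (XI setT) x y g -> exists j, is_path (R := R) (XI (J j)) x y g.
Proof.
move=> gp; have gu := is_path_upath gp; have [N NP] := upath_lvl hc gu; have {}NP := NP N (leqnn N).
have [L LP] := lift_exists hc gu.1 NP.
have [c _ cP] : exists2 c : R, c \in `[0, 1]%R & forall t, t \in `[0, 1]%R -> Re (L t) <= Re (L c).
  apply: EVT_max => //; apply: continuous_in_subspaceT => t; rewrite inE /= in_itv /= => t01.
  apply: (@continuous_comp _ _ _ L (@complex.Re R : C -> R)); last exact: Re_continuous.
  by have [] := LP t t01.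
have [j jP] := Jall (Re (L c) / d%:R ^+ N); exists j.
case: gp => gc gX g0 g1; split; [exact: gc| |exact: g0|exact: g1].
move=> t t01; have [l1 _ l3] := LP t t01; split; first exact: (gX t t01).1.
have gE : G (g t) = Re (L t) / d%:R ^+ N.
  rewrite (hc_G hc l1) -/(phN N (g t)) -l3 nrm_cexp expRK //.
rewrite gE; apply: Jdn jP _; rewrite ler_pM2r ?invr_gt0 //.
by apply: cP; rewrite in_itv.
Qed.

Lemma waut_limit : exists f g, waut setT f g /\ forall j p, XI (J j) p -> f p = F j p.
Proof.
have fE j p : XI (J j) p -> glue F p = F j p by exact: glueE.
have gE j p : XI (J j) p -> glue F' p = F' j p by apply: glueE; exact: F'S.
have near_eq (E : nat -> C2 -> C2) j p : (forall p, XI (J j) p -> glue E p = E j p) -> XI (J j) p ->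
    \forall r \near p, E j r = glue E r.
  move=> EE pX; have K := XI_open hc (@Jdn j) (@Jop j) pX.
  by apply: (@filterS _ (nbhs p) _ _ _ _ K) => r rX; rewrite EE.
exists (glue F), (glue F'); split=> //; split.
- by move=> p /XI_exists[j pX]; rewrite (fE j) //; split=> //; exact: (wa_fX (w j) pX).1.
- by move=> p /XI_exists[j pX]; rewrite (gE j) //; split=> //; exact: (wa_gX (w j) pX).1.
- move=> p /XI_exists[j pX]; apply: (@diff_near _ _ _ (F j)); last exact: (wa_fd (w j)).
  exact: near_eq (fE j) pX.
- move=> p /XI_exists[j pX]; apply: (@diff_near _ _ _ (F' j)); last exact: (wa_gd (w j)).
  exact: near_eq (gE j) pX.
- move=> p /XI_exists[j pX]; rewrite (fE j) // (gE j) ?(wa_gf (w j)) //; exact: (wa_fX (w j) pX).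
- move=> p /XI_exists[j pX]; rewrite (gE j) // (fE j) ?(wa_fg (w j)) //; exact: (wa_gX (w j) pX).
move=> x g D /path_bounded[j gp] gD; have := wa_WP (w j) gp gD.
by apply: disp_ext => t t01; rewrite /= (fE j) //; case: gp => _ K _ _; exact: K.
Qed.

End Limit.

Lemma Isc_dn (I : set R) j : (forall x y, I y -> x <= y -> I x) ->
  forall x y, iter j Isc I y -> x <= y -> iter j Isc I x.
Proof.
move=> Idn x y /iter_Isc yI xy; apply/iter_Isc; apply: Idn yI _.
by rewrite ler_pM2r ?invr_gt0.
Qed.

Lemma Isc_op (I : set R) j : (forall x, I x -> exists2 u, 0 < u & I (x + u)) ->
  forall x, iter j Isc I x -> exists2 u, 0 < u & iter j Isc I (x + u).
Proof.
move=> Iop x /iter_Isc/Iop[u u0 uI]; exists (u * d%:R ^+ j); first by rewrite mulr_gt0.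
by apply/iter_Isc; rewrite mulrDl mulfK // gt_eqF.
Qed.

Lemma Isc_all (I : set R) K : (0 < K)%N -> (forall x y, I y -> x <= y -> I x) -> (exists2 x, 0 < x & I x) ->
  forall x, exists j, iter (K * j) Isc I x.
Proof.
move=> K0 Idn [y y0 yI] x; have [n nP] := half_small (divr_gt0 y0 (ltr_wpDl (normr_ge0 x) (@ltr01 R))).
exists n; apply/iter_Isc; apply: Idn yI _; rewrite ler_pdivrMr //.
have h1 : (2 ^+ n : R) <= d%:R ^+ (K * n).
  apply: le_trans (_ : d%:R ^+ n <= _); first by apply: lerXn2r; rewrite ?nnegrE ?ler_nat ?ler0n.
  by apply: ler_weXn2l; [rewrite ler1n (ltn_trans _ d1)|apply: leq_pmull].
have p2 : 0 < (2 ^+ n : R) by rewrite exprn_gt0.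
have x1 : 0 < `|x| + 1 by rewrite ltr_wpDl.
have h2 : `|x| + 1 <= y * 2 ^+ n.
  by move: nP; rewrite exprVn ltr_pdivlMr // mulrC ltr_pdivrMr // => /ltW.
apply: le_trans (_ : y * 2 ^+ n <= _); last by rewrite ler_pM2l.
by apply: le_trans h2; apply: le_trans (ler_norm x) _; rewrite lerDl.
Qed.

Theorem waut_extends (I : set R) f g : (forall x y, I y -> x <= y -> I x) ->
  (forall x, I x -> exists2 u, 0 < u & I (x + u)) -> (exists2 x, 0 < x & I x) -> waut I f g ->
  exists f' g', waut setT f' g' /\ forall p, XI I p -> f' p = f p.
Proof.
move=> Idn Iop Ine w; have [K [b [K0 bP]]] := conj_relation Idn Iop Ine w.
pose J j := iter (K * j) Isc I.
(* Each stage is [bP] solved for f and read one stage higher, where the right side is already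
   defined. [F'] inverts [F], whence its reverse order and the opposite sign of b. *)
pose F := fix F j := if j is j'.+1 then iter K cnj (F j') \o Tr (- b) else f.
pose F' := fix F' j := if j is j'.+1 then Tr b \o iter K cnj (F' j') else g.
have JSE j : J j.+1 = iter K Isc (J j) by rewrite /J mulnS iterD.
have Jne j : exists2 x, 0 < x & J j x.
  by have [y y0 yI] := Ine; exists y => //; apply: Isc_sub => //; exists y.
have wF j : waut (J j) (F j) (F' j).
  elim: j => [|j IH]; first by rewrite /J muln0.
  rewrite JSE; have := waut_comp (waut_iter_cnj hc K IH) (waut_Tr hc (iter K Isc (J j)) (- b)).
  by rewrite opprK.
(* At j = 0 this is [bP] at the point [Tr (- b) p]; conjugation by H^K carries the agreement to the
   next stage. *)
have FS j p : XI (J j) p -> F j.+1 p = F j p.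
  elim: j p => [|j IH] p pX.
    rewrite /J muln0 in pX; have pX' := Tr_XI hc (- b) pX.
    by rewrite /= (bP _ pX') (TrD hc) ?subrr ?(Tr0 hc) //; case: pX.
  rewrite JSE in pX; have pX' := Tr_XI hc (- b) pX.
  exact: (cnj_ext hc IH pX').
have [f' [g' [w' E]]] := waut_limit wF (fun j x xJ => eq_ind_r (fun S : set R => S x)
   (Isc_sub K (fun x y => @Isc_dn I _ Idn x y) (Jne j) xJ) (JSE j))
  (fun j x y => @Isc_dn I _ Idn x y) (fun j => @Isc_op I _ Iop) (Isc_all K0 Idn Ine) FS.
exists f', g'; split=> // p pX; rewrite (E 0%N) //.
by rewrite /J muln0.
Qed.

End Extension.

(** * Automorphism groups in terms of pairs of inverse maps *)

Section Aut1.
Context {R : realType}.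
Local Notation C := (Cx R).
Local Notation C2 := (Cx2 R).
Variables (H Hi : C2 -> C2) (Up : set C2) (G : C2 -> R) (d e : nat) (rho : R).
Variables (al q : C) (Q : C -> C) (Phi Psi : C2 -> C2) (Dm : set C2).
Hypothesis hc : henon_chart H Hi Up G d e rho al q Q Phi Psi Dm.

Local Notation XI := (XI Up G).
Local Notation waut := (waut H Up G d Phi Dm).

Lemma Aut1_waut (I : set R) f : (forall x y, I y -> x <= y -> I x) ->
  Aut1 (R := R) (XI I) f <-> exists g, waut I f g.
Proof.
move=> Idn; split=> [[[[fX fI fS] fh [g [gh gX gf]]] act]|[g w]].
  have fc p : XI I p -> {for p, continuous f} by move=> /fh; exact: diff_continuous_nrm.
  exists g; split.
  - exact: fX.
  - exact: gX.
  - exact: fh.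
  - exact: gh.
  - exact: gf.
  - by move=> p /fS[p2 p2X <-]; rewrite gf.
  exact: (acts_trivially_WP hc Idn fX fc act).
have fc p : XI I p -> {for p, continuous f} by move=> /(wa_fd w); exact: diff_continuous_nrm.
split; last exact: (WP_acts_trivially hc Idn (wa_fX w) fc (wa_WP w)).
split.
- split; first exact: (wa_fX w).
    by move=> x y /set_mem xX /set_mem yX E; rewrite -(wa_gf w xX) E (wa_gf w yX).
  by move=> p pX; exists (g p); [exact: (wa_gX w)|exact: (wa_fg w)].
- exact: (wa_fd w).
exists g; split; [exact: (wa_gd w)|exact: (wa_gX w)|exact: (wa_gf w)].
Qed.

Lemma waut_image (I : set R) f g : waut I f g -> f @` XI I = XI I.
Proof.
move=> w; apply/seteqP; split=> [p [p2 p2X <-]|p pX]; first exact: (wa_fX w).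
by exists (g p); [exact: (wa_gX w)|exact: (wa_fg w)].
Qed.

End Aut1.

Theorem theorem1p2 (R : realType) (hs : seq ({poly Cx R} * Cx R))
  (Hhs : henon_data hs) (c : R) (c_gt0 : 0 < c) :
  (forall f : Cx2 R -> Cx2 R, Aut1 (Uplus hs) f ->
     f @` Omega' hs c = Omega' hs c /\ Aut1 (Omega' hs c) f)
  /\
  (forall f : Cx2 R -> Cx2 R, Aut1 (Omega' hs c) f ->
     exists g : Cx2 R -> Cx2 R,
       Aut1 (Uplus hs) g /\ (forall z, Omega' hs c z -> g z = f z)).
Proof.
have [Hi [e [rho [al [q [Q [Phi [Psi [Dm hc]]]]]]]]] := henon_chart_exists Hhs.
pose Ic : set R := [set x | x < c].
have UE : Uplus hs = XI (Uplus hs) (Gplus hs) setT.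
  by apply/seteqP; split=> [p pU|p []].
have OE : Omega' hs c = XI (Uplus hs) (Gplus hs) Ic.
  by apply/seteqP; split=> p [].
have Tdn (x y : R) : [set: R] y -> x <= y -> [set: R] x by [].
have Cdn (x y : R) : Ic y -> x <= y -> Ic x by move=> yc xy; exact: le_lt_trans xy yc.
have Cop (x : R) : Ic x -> exists2 u, 0 < u & Ic (x + u).
  by rewrite /Ic /= => xc; exists ((c - x) / 2); [rewrite divr_gt0 ?subr_gt0|move: xc; lra].
have Cne : exists2 x, 0 < x & Ic x by exists (c / 2); [rewrite divr_gt0|rewrite /Ic /=; move: c_gt0; lra].
have Tne : exists2 x : R, 0 < x & [set: R] x by exists 1.
rewrite OE; split=> f.
  rewrite {1}UE => /(Aut1_waut hc _ Tdn)[g w].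
  (* Preservation of G on U+ is what makes the sublevel set invariant, so that f restricts to it. *)
  have [_ [_ _ _ Gf]] := kappa_imag hc Tdn Tne w.
  have wc := waut_sub (I' := Ic) (fun x _ => Logic.I) Gf w.
  by split; [exact: waut_image wc|apply/(Aut1_waut hc _ Cdn); exists g].
move=> /(Aut1_waut hc _ Cdn)[g w].
have [f' [g' [w' E]]] := waut_extends hc Cdn Cop Cne w.
exists f'; split; last exact: E.
by rewrite {1}UE; apply/(Aut1_waut hc _ Tdn); exists g'.
Qed.
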